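(* Let $m_1,m_2\in\mathbb{N}$, $m=m_1+m_2$. (Direct part.) Suppose $v\in\big[C^1([0,\infty))\big]^{m_1\times m_2}$, and let $\mathcal{A}(x,\ell)$, $(x,\ell)\in\mathbb{R}^2_{+,+}:=\{(x,\ell)\in\mathbb{R}^2 : x\ge 0,\ \ell\ge 0\}$, be the $\mathcal{A}$-function of the Dirac-type system with potential $v$ (see context). Then $\mathcal{A}(\cdot,\cdot)\in\big[C^1(\mathbb{R}^2_{+,+})\big]^{m_2\times m_1}$ and for all $(x,\ell)\in\mathbb{R}^2_{+,+}$ \[ \frac{\partial}{\partial \ell}\mathcal{A}(x,\ell)=\frac{\partial}{\partial x}\mathcal{A}(x,\ell)+\int_0^x \mathcal{A}(x-t,\ell)\,\mathcal{A}(0,\ell)^*\,\mathcal{A}(t,\ell)\,dt. \tag{$*$} \] (Inverse part.) Conversely, let $\mathcal{A}_0\in\big[C^1([0,\infty))\big]^{m_2\times m_1}$ be such that for every $T\in(0,\infty)$ the operator $S_T$ on $\big[L^2((0,T))\big]^{m_2}$, \[ (S_Tf)(x)=f(x)-\int_0^T s(x,t)f(t)\,dt,\qquad s(x,t)=\int_0^{\min(x,t)}\mathcal{A}_0(x-\xi)\mathcal{A}_0(t-\xi)^*\,d\xi, \] is strictly positive definite (i.e., $S_T\ge \varepsilon I$ for some $\varepsilon>0$). Then the integro-differential equation $( * )$ with initial condition $\mathcal{A}(x,0)=\mathcal{A}_0(x)$, $x\ge 0$, has a unique solution $\mathcal{A}(\cdot,\cdot)\in\big[C^1(\mathbb{R}^2_{+,+})\big]^{m_2\times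 m_1}$; moreover there exists a potential $v\in\big[C^1([0,\infty))\big]^{m_1\times m_2}$ whose $\mathcal{A}$-function is this solution, and this potential is given by $v(\ell)=-i\,\mathcal{A}(0,\ell)^*$ for $\ell\ge 0$.
   Context: Dirac-type system: $y'(x,z)=i\big(zJ+JV(x)\big)y(x,z)$, $x\ge 0$, with $J=\begin{bmatrix}I_{m_1}&0\\0&-I_{m_2}\end{bmatrix}$, $V=\begin{bmatrix}0_{m_1}&v\\ v^*&0_{m_2}\end{bmatrix}$, where $v$ is an $m_1\times m_2$ matrix function with locally integrable entries. For $\ell\ge0$, $u_\ell(x,z)$ denotes the $m\times m$ fundamental solution with $u_\ell(\ell,z)=I_m$. The Weyl–Titchmarsh function $\varphi_\ell(z)$ on $[\ell,\infty)$ is the (unique, existing) $m_2\times m_1$ matrix function holomorphic in $\mathbb{C}_+=\{\Im z>0\}$ such that $u_\ell(\cdot,z)\begin{bmatrix}I_{m_1}\\ \varphi_\ell(z)\end{bmatrix}$ has entries in $L^2((\ell,\infty))$. For $v\in C^1$, for each $\ell\ge 0$ there is a unique function $\Phi(\cdot,\ell)\in\big[C^2([0,\infty))\big]^{m_2\times m_1}$ with $\varphi_\ell(z)=2iz\int_0^\infty e^{2ixz}\Phi(x,\ell)\,dx$ for $\Im z>0$; the $\mathcal{A}$-function is $\mathcal{A}(x,\ell):=\frac{\partial}{\partial x}\Phi(x,\ell)$, and $\mathcal{A}(x):=\mathcal{A}(x,0)$. *)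

(* Defs.v *)
From Stdlib Require Import Reals.
From Coquelicot Require Import Coquelicot.
Open Scope R_scope.

Definition CRInt (f : R -> C) (a b : R) : C :=
  @RInt C_R_CompleteNormedModule f a b.

Definition is_CRInt_pinfty (f : R -> C) (a : R) (l : C) : Prop :=
  @is_RInt_gen C_R_NormedModule f (at_point a) (Rbar_locally p_infty) l.

Definition cexp (z : C) : C :=
  (exp (Re z) * cos (Im z), exp (Re z) * sin (Im z)).

(* ---------- matrices: entries indexed by nat, sizes given separately ---------- *)
Definition Mat := nat -> nat -> C.

Fixpoint csum (k : nat) (f : nat -> C) : C :=
  match k with O => 0%C | S k' => (csum k' f + f k')%C end.

Definition mmul (k : nat) (A B : Mat) : Mat :=
  fun i j => csum k (fun l => (A i l * B l j)%C).

Definition madj (A : Mat) : Mat := fun i j => Cconj (A j i).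

Definition cont_half (g : R -> C) : Prop :=
  forall x, 0 <= x ->
    filterlim g (within (fun t => 0 <= t) (locally x)) (locally (g x)).

Definition has_C1_deriv_half (f f' : R -> C) : Prop :=
  cont_half f' /\ forall x, 0 <= x -> f x = (f 0 + CRInt f' 0 x)%C.

Definition C1_half (f : R -> C) : Prop := exists f', has_C1_deriv_half f f'.

Definition C1_half_mat (n1 n2 : nat) (F : R -> Mat) : Prop :=
  forall i j, (i < n1)%nat -> (j < n2)%nat -> C1_half (fun x => F x i j).

(* Coefficient  i (z J + J V(x))  of the system, m = m1 + m2, with
   J = diag(I_m1, -I_m2), V = [[0, v],[v^*, 0]].  Indices < m1 form the
   first block, indices m1 .. m1+m2-1 the second block. *)
Definition dirac_coef (m1 : nat) (v : R -> Mat) (z : C) (x : R) : Mat :=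
  fun i j =>
    (Ci *
     (if (i <? m1)%nat then
        (if (j <? m1)%nat then (if Nat.eqb i j then z else 0%C)
         else v x i (j - m1)%nat)
      else
        (if (j <? m1)%nat then (- Cconj (v x j (i - m1)%nat))%C
         else (if Nat.eqb i j then (- z)%C else 0%C))))%C.

Definition idm : Mat := fun i j => if Nat.eqb i j then 1%C else 0%C.

(* u is the fundamental solution u_l(., z), i.e. the (m x m) solution of
   y' = i (z J + J V) y on x >= 0 with u(l) = I_m (written in the
   equivalent integral (Volterra) form, which is the standard meaning
   of solution for locally integrable potentials). *)
Definition fund_sol (m1 m2 : nat) (v : R -> Mat) (l : R) (z : C)
    (u : R -> Mat) : Prop :=
  forall i j, (i < m1 + m2)%nat -> (j < m1 + m2)%nat ->
    cont_half (fun x => u x i j) /\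
    forall x, 0 <= x ->
      u x i j = (idm i j +
        CRInt (fun t => mmul (m1 + m2) (dirac_coef m1 v z t) (u t) i j) l x)%C.

Definition L2_from (l : R) (g : R -> C) : Prop :=
  exists M, forall T, l <= T -> RInt (fun x => (Cmod (g x)) ^ 2) l T <= M.

Definition stack_I (m1 : nat) (phi : Mat) : Mat :=
  fun i j => if (i <? m1)%nat then idm i j else phi (i - m1)%nat j.

Definition weyl_fun (m1 m2 : nat) (v : R -> Mat) (l : R) (phi : C -> Mat) : Prop :=
  (forall i j, (i < m2)%nat -> (j < m1)%nat ->
     forall z : C, 0 < Im z ->
       exists d : C, @is_derive C_AbsRing C_NormedModule
                        (fun w => phi w i j) z d) /\
  forall z : C, 0 < Im z ->
    forall u, fund_sol m1 m2 v l z u ->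
      forall i j, (i < m1 + m2)%nat -> (j < m1)%nat ->
        L2_from l (fun x => mmul (m1 + m2) (u x) (stack_I m1 (phi z)) i j).

Definition is_A_function (m1 m2 : nat) (v : R -> Mat) (A : R -> R -> Mat) : Prop :=
  forall l, 0 <= l ->
    exists (Phi : R -> Mat) (phi : C -> Mat),
      weyl_fun m1 m2 v l phi /\
      (forall i j, (i < m2)%nat -> (j < m1)%nat ->
         has_C1_deriv_half (fun x => Phi x i j) (fun x => A x l i j) /\
         C1_half (fun x => A x l i j)) /\
      (forall z : C, 0 < Im z ->
         forall i j, (i < m2)%nat -> (j < m1)%nat ->
           exists I : C,
             is_CRInt_pinfty
               (fun x => (cexp (2 * Ci * RtoC x * z) * Phi x i j)%C) 0 I /\
             phi z i j = (2 * Ci * z * I)%C).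

Definition quad (p : R * R) : Prop := 0 <= fst p /\ 0 <= snd p.

Definition cont_quad (g : R -> R -> C) : Prop :=
  forall x l, 0 <= x -> 0 <= l ->
    filterlim (fun p : R * R => g (fst p) (snd p))
      (within quad (locally (x, l))) (locally (g x l)).

Definition C1_quad_partials (m1 m2 : nat) (A Ax Al : R -> R -> Mat) : Prop :=
  forall i j, (i < m2)%nat -> (j < m1)%nat ->
    cont_quad (fun x l => A x l i j) /\
    cont_quad (fun x l => Ax x l i j) /\
    cont_quad (fun x l => Al x l i j) /\
    (forall x l, 0 <= x -> 0 <= l ->
       A x l i j = (A 0 l i j + CRInt (fun t => Ax t l i j) 0 x)%C /\
       A x l i j = (A x 0 i j + CRInt (fun s => Al x s i j) 0 l)%C).

Definition solves_star (m1 m2 : nat) (A : R -> R -> Mat) : Prop :=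
  exists Ax Al : R -> R -> Mat,
    C1_quad_partials m1 m2 A Ax Al /\
    forall x l, 0 <= x -> 0 <= l ->
      forall i j, (i < m2)%nat -> (j < m1)%nat ->
        Al x l i j =
          (Ax x l i j +
           CRInt (fun t =>
             mmul m2 (mmul m1 (A (x - t)%R l) (madj (A 0 l))) (A t l) i j) 0 x)%C.

Definition s_kernel (m1 : nat) (A0 : R -> Mat) (x t : R) : Mat :=
  fun i j => CRInt (fun xi => mmul m1 (A0 (x - xi)%R) (madj (A0 (t - xi)%R)) i j)
                   0 (Rmin x t).

Definition S_op (m1 m2 : nat) (A0 : R -> Mat) (T : R) (f : R -> nat -> C)
    (x : R) : nat -> C :=
  fun i => (f x i -
    CRInt (fun t => csum m2 (fun k => (s_kernel m1 A0 x t i k * f t k)%C)) 0 T)%C.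

Definition inner (m2 : nat) (T : R) (g f : R -> nat -> C) : C :=
  CRInt (fun x => csum m2 (fun k => (g x k * Cconj (f x k))%C)) 0 T.

(* S_T >= eps I, tested on continuous f (a dense subspace of L^2, S_T is
   bounded and self-adjoint, so this is equivalent). *)
Definition S_strictly_pos (m1 m2 : nat) (A0 : R -> Mat) : Prop :=
  forall T, 0 < T ->
    exists eps, 0 < eps /\
      forall f : R -> nat -> C,
        (forall k, (k < m2)%nat -> forall x, 0 <= x <= T ->
            continuity_pt (fun y => Re (f y k)) x /\
            continuity_pt (fun y => Im (f y k)) x) ->
        Re (inner m2 T (S_op m1 m2 A0 T f) f) >= eps * Re (inner m2 T f f).

(* Main.v *)
Require Import Defs.
From Stdlib Require Import Reals ZArith Lra Lia.
From Stdlib Require Import ClassicalEpsilon FunctionalExtensionality PropExtensionality ProofIrrelevance.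
From Coquelicot Require Import Coquelicot.
From Corelib Require Import ssreflect ssrfun.
Open Scope R_scope.

(* Put a(l) = A(0, l) = - i v(l)^*, and let [*] be the convolution in the first variable. The wave system
   P_x = - a^* E, E_x = E_t - a P conserves |P|^2 - |E|^2, and the integro-differential equation for A is the
   condition under which E = c A + A * P solves its second equation whenever P solves the first.

   Direct part. For given a the equation is a Goursat problem with boundary values A(0, .) = a, solved by a
   fixed point. The energy identity makes the convolution with A(., l) a contraction. Hence
   phi(z) = 2 i z int e^(2 i x z) Phi(x) dx exists, is contractive, and as a function of l satisfies the Riccati
   equation that makes the columns of u [I; phi] square integrable: phi is the Weyl function and A is an
   A-function. Weyl functions are unique by the growth of solutions with vanishing upper part, and Laplace
   transforms determine Phi by Lerch's theorem, so every A-function of v is this A.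

   Inverse part. S_T = I - K K^* with K the convolution with A_0, so its strict positivity says, after time
   reversal, that the convolution with A_0^* is a strict contraction. Start the wave system at l = 0 from
   P = 0, E = A_0^*, with coefficient a(l) = E(l, 0) truncated in norm. The energy identity and the strict
   contraction bound a a priori, so the truncation is inactive. The solution of the Goursat problem for a then
   has initial values A_0^*, by the energy identity for the difference of two solutions, and its adjoint solves
   the problem for A_0. Uniqueness of A for given initial values follows by integrating along characteristics. *)

(** * Calculus in complete normed spaces *)

(** The Dirac system is m x m while A is m2 x m1, and triple products of A, a and A mix the two
    shapes. All objects therefore live in one star-algebra, with A as the lower left block, and
    blocks are handled through a projection [Pi]. Functions are total and continuous on the whole
    line or plane; data given for nonnegative arguments are extended, so that derivatives are
    two-sided and oriented integrals obey their rules without side conditions.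

    The energy identity controls convolutions with A in mean square only and gives no pointwise
    bound on A, hence no direct convergence of transforms of A. The transform is therefore written
    with the second primitive of A, which grows linearly. The derivative in l is never exchanged
    with the improper integral: the Riccati equation is derived for integrals truncated at X, with
    an error decaying exponentially in X.

    Existence for all l also needs a global mechanism, because the equations are nonlinear. For
    given boundary values it is the stability of exponential bounds under convolution; in the
    inverse problem it is a bound that keeps the norm truncation from being reached. *)

Definition cont {U V : UniformSpace} (f : U -> V) : Prop := forall u, continuous f u.

Lemma continuous_ballP {U V : UniformSpace} (f : U -> V) u :
  continuous f u <-> forall eps : posreal, locally u (fun y => ball (f u) eps (f y)).
Proof. exact (filterlim_locally f (f u)). Qed.

Lemma locally_and {U : UniformSpace} (u : U) (P Q : U -> Prop) :
  locally u P -> locally u Q -> locally u (fun y => P y /\ Q y).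
Proof. exact (filter_and P Q). Qed.

Lemma locally_imp {U : UniformSpace} (u : U) (P Q : U -> Prop) :
  (forall y, P y -> Q y) -> locally u P -> locally u Q.
Proof. exact (filter_imp P Q). Qed.

Section Continuity.
Context {U V W X : UniformSpace}.

Lemma cont_id : cont (fun u : U => u).
Proof. move=> u; exact: continuous_id. Qed.

Lemma cont_const (c : V) : cont (fun _ : U => c).
Proof. move=> u; exact: continuous_const. Qed.

Lemma cont_comp (f : U -> V) (g : V -> W) : cont f -> cont g -> cont (fun u => g (f u)).
Proof. move=> hf hg u; exact: continuous_comp. Qed.

Lemma cont_comp2 (f : U -> V) (g : U -> W) (h : V -> W -> X) :
  cont f -> cont g -> cont (fun p : V * W => h (fst p) (snd p)) ->
  cont (fun u => h (f u) (g u)).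
Proof. move=> hf hg hh u; exact: continuous_comp_2. Qed.

Lemma cont_fst (f : U -> V * W) : cont f -> cont (fun u => fst (f u)).
Proof. move=> hf u; apply: continuous_comp => //; exact: continuous_fst. Qed.

Lemma cont_snd (f : U -> V * W) : cont f -> cont (fun u => snd (f u)).
Proof. move=> hf u; apply: continuous_comp => //; exact: continuous_snd. Qed.

Lemma cont_pair (f : U -> V) (g : U -> W) : cont f -> cont g -> cont (fun u => (f u, g u)).
Proof.
move=> hf hg u; apply/continuous_ballP => eps.
have Hf := proj1 (continuous_ballP _ _) (hf u) eps.
have Hg := proj1 (continuous_ballP _ _) (hg u) eps.
by apply: locally_imp (locally_and _ _ _ Hf Hg) => y [a b]; split.
Qed.

Lemma cont_ext (f g : U -> V) : (forall u, f u = g u) -> cont f -> cont g.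
Proof. by move=> e hf u; apply: (continuous_ext f). Qed.

End Continuity.

Section ContinuityAlg.
Context {U : UniformSpace} {V : NormedModule R_AbsRing}.

Lemma cont_plus (f g : U -> V) : cont f -> cont g -> cont (fun u => plus (f u) (g u)).
Proof. move=> hf hg u; exact: continuous_plus. Qed.
Lemma cont_opp (f : U -> V) : cont f -> cont (fun u => opp (f u)).
Proof. move=> hf u; exact: continuous_opp. Qed.
Lemma cont_minus (f g : U -> V) : cont f -> cont g -> cont (fun u => minus (f u) (g u)).
Proof. move=> hf hg u; exact: continuous_minus. Qed.
Lemma cont_scal (k : U -> R) (f : U -> V) : cont k -> cont f -> cont (fun u => scal (k u) (f u)).
Proof. move=> hf hg u; exact: (continuous_scal k). Qed.
Lemma cont_norm (f : U -> V) : cont f -> cont (fun u => norm (f u)).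
Proof. move=> hf u; apply: continuous_comp => //; exact: filterlim_norm. Qed.
Lemma cont_Rplus (f g : U -> R) : cont f -> cont g -> cont (fun u => f u + g u).
Proof. move=> hf hg u; exact: (continuous_plus f g). Qed.
Lemma cont_Ropp (f : U -> R) : cont f -> cont (fun u => - f u).
Proof. move=> hf u; exact: (continuous_opp f). Qed.
Lemma cont_Rminus (f g : U -> R) : cont f -> cont g -> cont (fun u => f u - g u).
Proof. move=> hf hg u; exact: (continuous_minus f g). Qed.
Lemma cont_Rmult (f g : U -> R) : cont f -> cont g -> cont (fun u => f u * g u).
Proof. move=> hf hg u; exact: (continuous_mult f g). Qed.
Lemma cont_pow (f : U -> R) n : cont f -> cont (fun u => f u ^ n).
Proof.
move=> hf; elim: n => [|n IH] /=; [exact: cont_const | exact: cont_Rmult].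
Qed.
Lemma cont_exp (f : U -> R) : cont f -> cont (fun u => exp (f u)).
Proof.
move=> hf u; apply: continuous_comp => //; apply: ex_derive_continuous; eexists; exact: is_derive_exp.
Qed.

Lemma continuous_normP (f : U -> V) u :
  continuous f u <-> forall eps, 0 < eps -> locally u (fun y => norm (minus (f y) (f u)) < eps).
Proof.
split=> [h eps he | h].
  have nf := @norm_factor_gt_0 _ V.
  have he' : 0 < eps / @norm_factor _ V by apply: Rdiv_lt_0_compat.
  apply: locally_imp (proj1 (continuous_ballP _ _) h (mkposreal _ he')) => y hy.
  apply: Rlt_le_trans (norm_compat2 _ _ _ hy) _ => /=.
  by apply: Req_le; field; apply: Rgt_not_eq.
apply/continuous_ballP => eps.
apply: locally_imp (h eps (cond_pos eps)) => y; exact: norm_compat1.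
Qed.

End ContinuityAlg.

Lemma cont_clamp : cont (fun x : R => Rmax 0 x).
Proof.
have e : forall x, (x + Rabs x) / 2 = Rmax 0 x.
  by move=> x; rewrite /Rmax /Rabs; destruct (Rcase_abs x), (Rle_dec 0 x); lra.
apply: (cont_ext _ _ e); apply: cont_Rmult; last exact: cont_const.
apply: cont_Rplus; [exact: cont_id | exact: (cont_norm (fun x : R => x) cont_id)].
Qed.

(** Compactness of the interval, by a supremum argument. The filter is arbitrary, so that one lemma
    yields both uniformity in a parameter ([unif_near]) and, with the filter of all sufficiently
    large constants, boundedness ([bound_rect]). *)
Lemma tube {T : Type} (F : (T -> Prop) -> Prop) {FF : Filter F} (P : T -> R -> Prop) a b :
  (forall t, a <= t <= b -> exists d, 0 < d /\ F (fun u => forall s, Rabs (s - t) < d -> P u s)) ->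
  F (fun u => forall s, a <= s <= b -> P u s).
Proof.
move=> H.
case: (Rle_lt_dec a b) => hab; last first.
  by apply: filter_forall => u s hs; lra.
pose E c := a <= c <= b /\ F (fun u => forall s, a <= s <= c -> P u s).
have Ea : E a.
  split; first lra.
  have [d [d0 hd]] := H a ltac:(lra).
  apply: filter_imp hd => u hu s hs; apply: hu.
  by have -> : s - a = 0; [lra | rewrite Rabs_R0].
have [c [ub lb]] := completeness E (ex_intro _ b (fun x (h : E x) => proj2 (proj1 h))) (ex_intro _ a Ea).
have hac : a <= c by apply: ub.
have hcb : c <= b by apply: lb => x [[]].
have [d [d0 hd]] := H c (conj hac hcb).
have [e [Ee hec]] : exists e, E e /\ c - d < e.
  apply: NNPP => hn.
  have : c <= c - d; last lra.
  apply: lb => x Ex; case: (Rle_lt_dec x (c - d)) => // hx.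
  by case: hn; exists x.
have Em : E (Rmin b (c + d / 2)).
  have h1 : c <= Rmin b (c + d/2) by apply: Rmin_glb; lra.
  split; first by split; [lra | exact: Rmin_l].
  apply: filter_imp (filter_and _ _ (proj2 Ee) hd) => u [h2 h3] s hs.
  have := Rmin_r b (c + d/2).
  case: (Rle_lt_dec s e) => hse hm; first by apply: h2; lra.
  apply: h3; apply: Rabs_def1; lra.
have := ub _ Em => hle.
have hb : Rmin b (c + d/2) = b.
  by apply: Rmin_left; move: hle; rewrite /Rmin; case: Rle_dec; lra.
by case: Em => _; rewrite hb.
Qed.

Section RIntBasics.
Context {V : CompleteNormedModule R_AbsRing}.
Implicit Types f g : R -> V.

Lemma exR f a b : cont f -> ex_RInt f a b.
Proof. move=> hf; apply: ex_RInt_continuous => z _; exact: hf. Qed.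

Lemma isR f a b : cont f -> is_RInt f a b (RInt f a b).
Proof. move=> hf; apply: RInt_correct; exact: exR. Qed.

Lemma deriv_RInt f a x : cont f -> is_derive (fun y => RInt f a y) x (f x).
Proof.
move=> hf; apply: is_derive_RInt (hf x).
apply: filter_forall => y; exact: isR.
Qed.

Lemma FTC f df a b : (forall x, is_derive f x (df x)) -> cont df ->
  RInt df a b = minus (f b) (f a).
Proof. move=> h1 h2; apply: is_RInt_unique; apply: is_RInt_derive => x _; [exact: h1 | exact: h2]. Qed.

Lemma FTC' f df a b : (forall x, is_derive f x (df x)) -> cont df ->
  f b = plus (f a) (RInt df a b).
Proof.
move=> h1 h2; rewrite (FTC f) //.
by rewrite plus_comm /minus -plus_assoc plus_opp_l plus_zero_r.
Qed.

Lemma zero_deriv_const f a b :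
  (forall x, Rmin a b <= x <= Rmax a b -> is_derive f x zero) -> f b = f a.
Proof.
move=> h.
have := is_RInt_derive f (fun _ => zero) a b h (fun x _ => continuous_const (zero : V) x).
move/is_RInt_unique; rewrite RInt_const scal_zero_r => e.
apply: (plus_reg_r (opp (f a))); by rewrite plus_opp_r -[plus _ _]/(minus _ _) -e.
Qed.

Lemma eq_of_deriv f g h a b :
  (forall x, Rmin a b <= x <= Rmax a b -> is_derive f x (h x)) ->
  (forall x, Rmin a b <= x <= Rmax a b -> is_derive g x (h x)) ->
  f a = g a -> f b = g b.
Proof.
move=> hf hg e.
have := zero_deriv_const (fun x => minus (f x) (g x)) a b.
rewrite e minus_eq_zero => H.
have {}H : minus (f b) (g b) = zero.
  apply: H => x hx; rewrite -(minus_eq_zero (h x)); apply: is_derive_minus; auto.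
by apply: (plus_reg_r (opp (g b))); rewrite plus_opp_r.
Qed.

Lemma norm_RInt_const f a b M : cont f ->
  (forall x, Rmin a b <= x <= Rmax a b -> norm (f x) <= M) ->
  norm (RInt f a b) <= Rabs (b - a) * M.
Proof.
move=> hf H.
case: (Rle_dec a b) => hab.
  rewrite Rabs_pos_eq; last lra.
  apply: (norm_RInt_le_const f a b) => [//| x hx | ]; last exact: isR.
  by apply: H; rewrite Rmin_left // Rmax_right.
rewrite Rabs_left; last lra.
rewrite -opp_RInt_swap; last exact: exR.
rewrite norm_opp.
have -> : - (b - a) = a - b by ring.
apply: (norm_RInt_le_const f b a) => [| x hx | ]; [lra | | exact: isR].
apply: H; rewrite Rmin_right ?Rmax_left; lra.
Qed.

End RIntBasics.

Section Param.
Context {U : UniformSpace} {V : CompleteNormedModule R_AbsRing}.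

Lemma unif_near (G : U -> R -> V) u0 a b eps :
  cont (fun p : U * R => G (fst p) (snd p)) -> 0 < eps ->
  locally u0 (fun u => forall s, a <= s <= b -> norm (minus (G u s) (G u0 s)) < eps).
Proof.
move=> hG he; apply: tube => t _.
have he2 : 0 < eps / 2 by lra.
have [d hd] := proj1 (continuous_normP _ _) (hG (u0, t)) _ he2.
exists d; split; first exact: cond_pos.
exists d => u hu s hs.
have h1 : norm (minus (G u s) (G u0 t)) < eps / 2 by apply: (hd (u, s)); split.
have h2 : norm (minus (G u0 s) (G u0 t)) < eps / 2.
  by apply: (hd (u0, s)); split => //; exact: ball_center.
rewrite (minus_trans (G u0 t)) -(opp_minus (G u0 s)).
apply: Rle_lt_trans (norm_triangle _ _) _; rewrite norm_opp; lra.
Qed.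

Lemma cont_slice (G : U -> R -> V) u :
  cont (fun p : U * R => G (fst p) (snd p)) -> cont (G u).
Proof.
move=> hG; apply: (cont_comp2 (fun _ => u) (fun x => x) G) => //; [exact: cont_const | exact: cont_id].
Qed.

Lemma cont_RInt_fix (G : U -> R -> V) a b :
  cont (fun p : U * R => G (fst p) (snd p)) -> cont (fun u => RInt (G u) a b).
Proof.
move=> hG u0; apply/continuous_normP => eps he.
have hl := Rabs_pos (b - a).
have he' : 0 < eps / (Rabs (b - a) + 1) by apply: Rdiv_lt_0_compat; lra.
have hs u : cont (G u) by exact: cont_slice.
apply: locally_imp (unif_near G u0 (Rmin a b) (Rmax a b) _ hG he') => u hu.
rewrite -RInt_minus; try exact: exR.
apply: Rle_lt_trans (norm_RInt_const _ _ _ _ _ (fun x hx => Rlt_le _ _ (hu x hx))) _.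
  by apply: cont_minus.
have -> : Rabs (b - a) * (eps / (Rabs (b - a) + 1)) = eps - eps / (Rabs (b - a) + 1) by field; lra.
lra.
Qed.

(** Moves the limits of integration into the integrand, so that [cont_RInt] only needs continuity of
    integrals over a fixed interval. *)
Lemma RInt_unit (f : R -> V) a b : cont f ->
  RInt f a b = scal (b - a) (RInt (fun s => f (a + s * (b - a))) 0 1).
Proof.
move=> hf.
have := RInt_comp_lin f (b - a) a 0 1.
have -> : (b - a) * 0 + a = a by ring.
have -> : (b - a) * 1 + a = b by ring.
move=> <-; last exact: exR.
rewrite RInt_scal.
  by congr scal; apply: RInt_ext => x _; congr f; ring.
apply: (exR (fun y => f ((b - a) * y + a))).
apply: (cont_comp _ f) => //; apply: cont_Rplus; last exact: cont_const.
apply: cont_Rmult; [exact: cont_const | exact: cont_id].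
Qed.

Lemma cont_RInt (G : U -> R -> V) (al be : U -> R) :
  cont (fun p : U * R => G (fst p) (snd p)) -> cont al -> cont be ->
  cont (fun u => RInt (G u) (al u) (be u)).
Proof.
move=> hG ha hb.
have e u : scal (be u - al u) (RInt (fun s => G u (al u + s * (be u - al u))) 0 1)
        = RInt (G u) (al u) (be u).
  by rewrite -RInt_unit //; apply: cont_slice.
apply: (cont_ext _ _ e); apply: cont_scal; first by apply: cont_Rminus.
apply: (cont_RInt_fix (fun u s => G u (al u + s * (be u - al u)))).
apply: (cont_comp2 (fun p : U * R => fst p) _ G) => //; first by apply: cont_fst; exact: cont_id.
have c1 : cont (fun p : U * R => al (fst p)) by apply: (cont_comp _ al) => //; apply: cont_fst; exact: cont_id.
have c2 : cont (fun p : U * R => be (fst p)) by apply: (cont_comp _ be) => //; apply: cont_fst; exact: cont_id.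
apply: cont_Rplus => //; apply: cont_Rmult; last by apply: cont_Rminus.
by apply: cont_snd; exact: cont_id.
Qed.

End Param.

Definition c2 {V : UniformSpace} (F : R -> R -> V) : Prop :=
  cont (fun p : R * R => F (fst p) (snd p)).

Lemma is_derive_normP {V : NormedModule R_AbsRing} (f : R -> V) x l :
  (forall eps, 0 < eps -> exists d, 0 < d /\ forall h, Rabs h < d ->
     norm (minus (minus (f (x + h)) (f x)) (scal h l)) <= eps * Rabs h) ->
  is_derive f x l.
Proof.
move=> H; split; first exact: is_linear_scal_l.
move=> y /is_filter_lim_locally_unique <- eps.
have [d [d0 hd]] := H eps (cond_pos eps).
exists (mkposreal d d0) => z hz.
have := hd (z - x) hz.
by have -> : x + (z - x) = z by ring.
Qed.

Lemma is_derive_normP' {V : NormedModule R_AbsRing} (f : R -> V) x l : is_derive f x l ->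
  forall eps, 0 < eps -> exists d, 0 < d /\ forall h, Rabs h < d ->
     norm (minus (minus (f (x + h)) (f x)) (scal h l)) <= eps * Rabs h.
Proof.
move=> [_ H] eps he.
have [d hd] := H x (fun P h => h) (mkposreal _ he).
exists d; split; first exact: cond_pos.
move=> h hh; have hb : ball x d (x + h).
  rewrite /ball /= /AbsRing_ball /abs /minus /plus /opp /=.
  by have -> : x + h + - x = h by ring.
have := hd _ hb; rewrite /=.
have -> : (minus (x + h) x : R) = h by rewrite /minus /plus /opp /=; ring.
by [].
Qed.

Lemma scal_Rminus {V : ModuleSpace R_Ring} (a b : R) (v : V) :
  scal (a - b) v = minus (scal a v) (scal b v).
Proof. exact: (scal_minus_distr_r a b v). Qed.

Section Leibniz.
Context {V : CompleteNormedModule R_AbsRing}.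
Implicit Types F : R -> R -> V.

Lemma c2_1 F y : c2 F -> cont (fun x => F x y).
Proof. move=> h; apply: (cont_comp2 (fun x => x) (fun _ => y) F) => //; [exact: cont_id | exact: cont_const]. Qed.
Lemma c2_2 F x : c2 F -> cont (F x).
Proof. move=> h; exact: (cont_slice F). Qed.

(** The increment in the first argument is an integral of [Gx], so joint continuity is required of
    [Gx] only; in the second argument a derivative at the single point [be x] suffices. This matters
    where the second partial derivative is known on part of the plane only. *)
Lemma chain2 (G : R -> R -> V) (Gx : R -> R -> V) (gy : V) (al be : R -> R) x (da db : R) :
  (forall s y, is_derive (fun x => G x y) s (Gx s y)) -> c2 Gx ->
  is_derive (G (al x)) (be x) gy ->
  is_derive al x da -> is_derive be x db ->
  is_derive (fun x => G (al x) (be x)) x (plus (scal da (Gx (al x) (be x))) (scal db gy)).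
Proof.
move=> hx cx hy ha hb.
have cb : continuous be x by apply: ex_derive_continuous; eexists; exact: hb.
have ca : continuous al x by apply: ex_derive_continuous; eexists; exact: ha.
have key : is_derive (fun t => minus (G (al t) (be t)) (G (al x) (be t))) x (scal da (Gx (al x) (be x))).
  have e t : minus (G (al t) (be t)) (G (al x) (be t)) = RInt (fun s => Gx s (be t)) (al x) (al t).
    by rewrite (FTC (fun s => G s (be t))) //; apply: (c2_1 Gx).
  apply: (is_derive_ext (fun t => RInt (fun s => Gx s (be t)) (al x) (al t))) => [t|]; first by rewrite e.
  apply: is_derive_normP => eps he.
  set g := Gx (al x) (be x).
  have ng := norm_ge_0 g.
  have [d1 [p1 h1]] := is_derive_normP' al x da ha 1 Rlt_0_1.
  have e2 : 0 < eps / (2 * (Rabs da + 1)) by apply: Rdiv_lt_0_compat => //; have := Rabs_pos da; lra.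
  have e3 : 0 < eps / (2 * (norm g + 1)) by apply: Rdiv_lt_0_compat => //; lra.
  have [d2 hd2] := proj1 (continuous_normP _ _) (cx (al x, be x)) _ e2.
  have [d3 hd3] := proj1 (continuous_ballP _ _) cb d2.
  have [d4 hd4] := proj1 (continuous_ballP _ _) ca d2.
  have [d5 [p5 h5]] := is_derive_normP' al x da ha _ e3.
  exists (Rmin (Rmin d1 d5) (Rmin d3 d4)); split.
    by repeat apply: Rmin_pos; try exact: cond_pos.
  move=> h hh.
  have l1 : Rabs h < d1 by apply: Rlt_le_trans hh _; apply: Rle_trans (Rmin_l _ _) (Rmin_l _ _).
  have l5 : Rabs h < d5 by apply: Rlt_le_trans hh _; apply: Rle_trans (Rmin_l _ _) (Rmin_r _ _).
  have l3 : Rabs h < d3 by apply: Rlt_le_trans hh _; apply: Rle_trans (Rmin_r _ _) (Rmin_l _ _).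
  have l4 : Rabs h < d4 by apply: Rlt_le_trans hh _; apply: Rle_trans (Rmin_r _ _) (Rmin_r _ _).
  have bx d : Rabs h < d -> ball x d (x + h).
    rewrite /ball /= /AbsRing_ball /abs /minus /plus /opp /=.
    by have -> : x + h + - x = h by ring.
  rewrite RInt_point /minus opp_zero plus_zero_r -[plus _ (opp _)]/(minus _ _).
  set I := RInt _ _ _.
  have -> : minus I (scal h (scal da g)) = plus (minus I (scal (al (x + h) - al x) g))
     (scal (al (x+h) - al x - h * da) g).
    rewrite (minus_trans (scal (al (x + h) - al x) g)) scal_assoc; congr plus.
    by rewrite (scal_Rminus _ (h * da)).
  apply: Rle_trans (norm_triangle _ _) _.
  have b1 : Rabs (al (x + h) - al x) <= (Rabs da + 1) * Rabs h.
    have := h1 h l1; rewrite /minus /norm /= /abs /= /plus /opp /scal /= /mult /= => q.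
    have -> : al (x+h) - al x = (al (x + h) + - al x + - (h * da)) + h * da by ring.
    apply: Rle_trans (Rabs_triang _ _) _; rewrite (Rabs_mult h); lra.
  have b2 : norm (minus I (scal (al (x + h) - al x) g)) <= Rabs (al (x+h) - al x) * (eps / (2 * (Rabs da + 1))).
    rewrite /I -(RInt_const (al x) (al (x + h)) g) -RInt_minus;
      [| apply: exR; exact: (c2_1 Gx) | apply: exR; exact: cont_const].
    apply: norm_RInt_const; first by apply: cont_minus; [exact: (c2_1 Gx) | exact: cont_const].
    move=> s hs; apply: Rlt_le; apply: (hd2 (s, be (x + h))); split => /=; last first.
      by apply: hd3; apply: bx.
    have := hd4 _ (bx _ l4).
    rewrite /ball /= /AbsRing_ball /abs /minus /plus /opp /=.
    move: hs; rewrite /Rmin /Rmax; case: Rle_dec => ? hs /Rabs_def2 q; apply: Rabs_def1; lra.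
  have b3 : norm (scal (al (x+h) - al x - h * da) g) <= eps / (2 * (norm g + 1)) * Rabs h * norm g.
    apply: Rle_trans (norm_scal _ _) _; apply: Rmult_le_compat_r => //.
    exact: h5.
  have c1 : Rabs (al (x+h) - al x) * (eps / (2 * (Rabs da + 1))) <= eps / 2 * Rabs h.
    apply: Rle_trans (Rmult_le_compat_r _ _ _ (Rlt_le _ _ e2) b1) _.
    by apply: Req_le; field; have := Rabs_pos da; lra.
  have c3 : eps / (2 * (norm g + 1)) * Rabs h * norm g <= eps / 2 * Rabs h.
    have -> : eps / 2 * Rabs h = eps / (2 * (norm g + 1)) * Rabs h * (norm g + 1) by field; lra.
    apply: Rmult_le_compat_l; last lra.
    apply: Rmult_le_pos; [lra | exact: Rabs_pos].
  lra.
apply: (is_derive_ext (fun t => plus (minus (G (al t) (be t)) (G (al x) (be t))) (G (al x) (be t)))).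
  by move=> t; rewrite /minus -plus_assoc plus_opp_l plus_zero_r.
apply: is_derive_plus => //; exact: (is_derive_comp (G (al x)) be).
Qed.

Lemma deriv_param F Fx a b x :
  (forall s t, is_derive (fun x => F x t) s (Fx s t)) -> c2 F -> c2 Fx ->
  is_derive (fun x => RInt (F x) a b) x (RInt (Fx x) a b).
Proof.
move=> hF cF cFx; apply: is_derive_normP => eps he.
have hl := Rabs_pos (b - a).
have he' : 0 < eps / (Rabs (b - a) + 1) by apply: Rdiv_lt_0_compat; lra.
have [d hd] := unif_near Fx x (Rmin a b) (Rmax a b) _ cFx he'.
exists d; split; first exact: cond_pos.
move=> h hh.
have cc y : cont (F y) by exact: c2_2.
have ccx y : cont (Fx y) by exact: c2_2.
rewrite -RInt_minus; try exact: exR.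
rewrite -RInt_scal; last exact: exR.
have c1 : cont (fun t => minus (F (x + h) t) (F x t)) by apply: cont_minus.
have c3 : cont (fun t => scal h (Fx x t)) by apply: cont_scal => //; exact: cont_const.
rewrite -RInt_minus; try exact: exR.
apply: Rle_trans (norm_RInt_const _ _ _ (Rabs h * (eps / (Rabs (b - a) + 1))) _ _) _.
- by apply: cont_minus.
- move=> t ht.
  rewrite -(FTC (fun s => F s t) (fun s => Fx s t) x (x + h)) //; last exact: (c2_1 Fx).
  have -> : scal h (Fx x t) = RInt (fun _ => Fx x t) x (x + h) by rewrite RInt_const; have -> : x + h - x = h by ring.
  rewrite -RInt_minus; [| apply: exR; exact: (c2_1 Fx) | apply: exR; exact: cont_const].
  have {2}-> : h = x + h - x by ring.
  apply: norm_RInt_const; first by apply: cont_minus; [exact: (c2_1 Fx) | exact: cont_const].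
  move=> s hs; apply: Rlt_le; apply: hd => //.
  rewrite /ball /= /AbsRing_ball /abs /minus /plus /opp /=.
  move: hs; rewrite /Rmin /Rmax; case: Rle_dec => ? hs; move: hh => /Rabs_def2 hh; apply: Rabs_def1; lra.
- have -> : Rabs (b - a) * (Rabs h * (eps / (Rabs (b - a) + 1))) =
     eps * Rabs h - eps / (Rabs (b - a) + 1) * Rabs h by field; lra.
  have : 0 <= eps / (Rabs (b - a) + 1) * Rabs h by apply: Rmult_le_pos; [lra | exact: Rabs_pos].
  lra.
Qed.

Lemma Leibniz F Fx (al be : R -> R) x (da db : R) :
  (forall s t, is_derive (fun x => F x t) s (Fx s t)) -> c2 F -> c2 Fx ->
  is_derive al x da -> is_derive be x db ->
  is_derive (fun x => RInt (F x) (al x) (be x)) x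
    (plus (RInt (Fx x) (al x) (be x)) (minus (scal db (F x (be x))) (scal da (F x (al x))))).
Proof.
move=> hF cF cFx ha hb.
(* With lower limit 0 the integral is a function of the parameter and of the upper limit, to which
   [chain2] applies; the general case is a difference of two such integrals. *)
have half ga dg : is_derive ga x dg ->
  is_derive (fun x => RInt (F x) 0 (ga x)) x (plus (RInt (Fx x) 0 (ga x)) (scal dg (F x (ga x)))).
  move=> hg.
  have := chain2 (fun x y => RInt (F x) 0 y) (fun x y => RInt (Fx x) 0 y) (F x (ga x)) (fun x => x) ga x 1 dg.
  rewrite scal_one; apply => //.
  - move=> s y; exact: deriv_param.
  - apply: (cont_RInt (fun p : R * R => Fx (fst p)) (fun _ => 0) (fun p => snd p)); last 2 first.
    + exact: cont_const.
    + apply: cont_snd; exact: cont_id.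
    apply: (cont_comp2 (fun p : R * R * R => fst (fst p)) (fun p => snd p) Fx) => //;
      [apply: cont_fst; apply: cont_fst | apply: cont_snd]; exact: cont_id.
  - apply: deriv_RInt; exact: c2_2.
  - exact: is_derive_id.
apply: (is_derive_ext (fun x => minus (RInt (F x) 0 (be x)) (RInt (F x) 0 (al x)))).
  move=> t; have cc : cont (F t) by exact: c2_2.
  rewrite -(RInt_Chasles (F t) 0 (al t) (be t)); try exact: exR.
  by rewrite plus_comm /minus -plus_assoc plus_opp_r plus_zero_r.
have cc : cont (Fx x) by exact: c2_2.
have -> : plus (RInt (Fx x) (al x) (be x)) (minus (scal db (F x (be x))) (scal da (F x (al x)))) =
  minus (plus (RInt (Fx x) 0 (be x)) (scal db (F x (be x))))
        (plus (RInt (Fx x) 0 (al x)) (scal da (F x (al x)))).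
  rewrite -(RInt_Chasles (Fx x) 0 (al x) (be x)); try exact: exR.
  set u := RInt _ _ _; set v := RInt _ _ _; set w := scal _ _; set w' := scal _ _.
  rewrite /minus opp_plus (plus_comm v u) -!plus_assoc; congr plus.
  by rewrite (plus_comm w (plus _ _)) !plus_assoc plus_opp_r plus_zero_l plus_comm.
apply: is_derive_minus; exact: half.
Qed.

(** Both sides have the same derivative in the upper limit [b] and vanish for [b = a]; the
    triangular version below is obtained in the same way from the derivative in [X]. *)
Lemma Fubini_rect F a b c d : c2 F ->
  RInt (fun x => RInt (F x) c d) a b = RInt (fun y => RInt (fun x => F x y) a b) c d.
Proof.
move=> cF.
have ci : cont (fun x => RInt (F x) c d) by apply: cont_RInt_fix.
apply: (eq_of_deriv (fun b => RInt (fun x => RInt (F x) c d) a b)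
   (fun b => RInt (fun y => RInt (fun x => F x y) a b) c d) (fun x => RInt (F x) c d) a b).
- move=> x _; exact: deriv_RInt.
- move=> x _; apply: (deriv_param (fun b y => RInt (fun x => F x y) a b) F) => //.
    by move=> s t; apply: (deriv_RInt (fun x => F x t)); exact: c2_1.
  apply: (cont_RInt (fun p : R * R => fun x => F x (snd p)) (fun _ => a) (fun p => fst p)).
  + apply: (cont_comp2 (fun p : R * R * R => snd p) (fun p => snd (fst p)) F) => //;
      [apply: cont_snd | apply: cont_snd; apply: cont_fst]; exact: cont_id.
  + exact: cont_const.
  + apply: cont_fst; exact: cont_id.
- rewrite RInt_point (RInt_ext _ (fun _ => zero)) ?RInt_const ?scal_zero_r // => y _.
  by rewrite RInt_point.
Qed.

Lemma Fubini_tri F a X : c2 F ->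
  RInt (fun x => RInt (F x) a x) a X = RInt (fun y => RInt (fun x => F x y) y X) a X.
Proof.
move=> cF.
have ci : cont (fun x => RInt (F x) a x).
  apply: (cont_RInt F) => //; [exact: cont_const | exact: cont_id].
apply: (eq_of_deriv (fun X => RInt (fun x => RInt (F x) a x) a X)
   (fun X => RInt (fun y => RInt (fun x => F x y) y X) a X) (fun x => RInt (F x) a x) a X).
- move=> x _; exact: deriv_RInt.
- move=> x _.
  have := Leibniz (fun X y => RInt (fun x => F x y) y X) F (fun _ => a) (fun x => x) x 0 1.
  rewrite RInt_point scal_zero_l scal_zero_r minus_eq_zero plus_zero_r; apply => //.
  + by move=> s t; apply: (deriv_RInt (fun x => F x t)); exact: c2_1.
  + apply: (cont_RInt (fun p : R * R => fun x => F x (snd p)) (fun p => snd p) (fun p => fst p)).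
    * apply: (cont_comp2 (fun p : R * R * R => snd p) (fun p => snd (fst p)) F) => //;
        [apply: cont_snd | apply: cont_snd; apply: cont_fst]; exact: cont_id.
    * apply: cont_snd; exact: cont_id.
    * apply: cont_fst; exact: cont_id.
  + exact: is_derive_const.
  + exact: is_derive_id.
- by rewrite !RInt_point.
Qed.

End Leibniz.

(** * Fixed points of Volterra operators *)

Lemma exp_mono x y : x <= y -> exp x <= exp y.
Proof. by case=> [h | ->]; [apply/Rlt_le/exp_increasing | exact: Rle_refl]. Qed.

Lemma small_half_pow c eps : 0 < eps -> exists n : nat, c / 2 ^ n < eps.
Proof.
move=> he.
have [n hn] : exists n : nat, Rmax c 0 / eps < 2 ^ n.
  have [n hn] := Pow_x_infinity 2 ltac:(rewrite Rabs_pos_eq; lra) (Rmax c 0 / eps + 1).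
  exists n; have := hn n (Nat.le_refl _); rewrite Rabs_pos_eq; last by apply: pow_le; lra.
  by lra.
exists n; have h2 : 0 < 2 ^ n by apply: pow_lt; lra.
apply: Rle_lt_trans (_ : Rmax c 0 / 2 ^ n < eps).
  apply: Rmult_le_compat_r; [apply: Rlt_le; exact: Rinv_0_lt_compat | exact: Rmax_l].
apply: (Rmult_lt_reg_r (2 ^ n)) => //.
have -> : Rmax c 0 / 2 ^ n * 2 ^ n = Rmax c 0 / eps * eps by field; split; lra.
by rewrite (Rmult_comm eps); apply: Rmult_lt_compat_r.
Qed.

(** The uniqueness half of a contraction argument: a bound that can always be improved by a factor 2
    cannot be positive. Restricting to [Reg] admits estimates that hold only in a domain of
    dependence. *)
Lemma halving_zero {T : Type} (Reg : T -> Prop) (w D : T -> R) c0 :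
  (forall p, Reg p -> D p <= c0 * w p) -> 0 <= c0 ->
  (forall c, 0 <= c -> (forall p, Reg p -> D p <= c * w p) -> forall p, Reg p -> D p <= c / 2 * w p) ->
  forall p, Reg p -> D p <= 0.
Proof.
move=> h0 hc H p hp.
have Hn n : forall p, Reg p -> D p <= c0 / 2 ^ n * w p.
  elim: n => [|n IH] q hq /=; first by have := h0 q hq; rewrite Rdiv_1_r.
  have := H _ _ IH q hq.
  have p2 : 0 < 2 ^ n by apply: pow_lt; lra.
  have -> : c0 / (2 * 2 ^ n) = c0 / 2 ^ n / 2 by field; lra.
  apply; apply: Rmult_le_pos => //; apply: Rlt_le; exact: Rinv_0_lt_compat.
case: (Rle_lt_dec (D p) 0) => // hD.
have [n hn] := small_half_pow (c0 * w p) (D p) hD.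
have := Hn n p hp.
have -> : c0 / 2 ^ n * w p = c0 * w p / 2 ^ n by rewrite /Rdiv; ring.
lra.
Qed.

Section Fix.
Context {V : CompleteNormedModule R_AbsRing}.

Lemma norm_minus_tri (x y z : V) : norm (minus x z) <= norm (minus x y) + norm (minus y z).
Proof. rewrite (minus_trans y); exact: norm_triangle. Qed.

Lemma norm_le_minus (x y : V) : norm x <= norm (minus x y) + norm y.
Proof.
have := norm_triangle (minus x y) y.
by rewrite /minus -plus_assoc plus_opp_l plus_zero_r.
Qed.

Lemma cnP {U : UniformSpace} (f : U -> V) u :
  continuous f u <-> forall eps, 0 < eps -> locally u (fun y => norm (minus (f y) (f u)) < eps).
Proof. exact: continuous_normP. Qed.

Lemma norm_minus_sym (x y : V) : norm (minus x y) = norm (minus y x).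
Proof. by rewrite -opp_minus norm_opp. Qed.

Lemma norm_minus_eq0 (x y : V) : norm (minus x y) <= 0 -> x = y.
Proof.
move=> h; have e : minus x y = zero by apply: norm_eq_zero; have := norm_ge_0 (minus x y); lra.
by apply: (plus_reg_r (opp y)); rewrite plus_opp_r.
Qed.

(** The increments are dominated by a geometric series whose tail is [2 r / 2^n]. The explicit rate
    is kept because [banach_fix] needs it to place the limit in the closed class. *)
Lemma cauchy_limit (u : nat -> V) (r : R) :
  (forall n, norm (minus (u (S n)) (u n)) <= r / 2 ^ n) ->
  exists l, forall n, norm (minus (u n) l) <= 2 * r / 2 ^ n.
Proof.
move=> H.
have r0 : 0 <= r by have := H 0%nat; have := norm_ge_0 (minus (u 1%nat) (u 0%nat)); rewrite /= Rdiv_1_r; lra.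
have p2 n : 0 < 2 ^ n by apply: pow_lt; lra.
have ip2 n : 0 < / 2 ^ n by apply: Rinv_0_lt_compat.
have Hk n k : norm (minus (u (n + k)%nat) (u n)) <= 2 * r / 2 ^ n - 2 * r / 2 ^ (n + k).
  elim: k => [|k IH].
    by rewrite Nat.add_0_r minus_eq_zero norm_zero; lra.
  apply: Rle_trans (norm_minus_tri _ (u (n + k)%nat) _) _.
  rewrite Nat.add_succ_r.
  have := H (n + k)%nat; rewrite /=.
  have -> : 2 * r / (2 * 2 ^ (n + k)) = r / 2 ^ (n + k) by field; apply: Rgt_not_eq; apply: p2.
  have -> : r / 2 ^ (n+k) = 2 * r / 2 ^ (n+k) - r / 2 ^ (n+k) by field; apply: Rgt_not_eq; apply: p2.
  lra.
have Hm n m : (n <= m)%nat -> norm (minus (u m) (u n)) <= 2 * r / 2 ^ n.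
  move=> hnm; have := Hk n (m - n)%nat.
  have -> : (n + (m - n))%nat = m by lia.
  have : 0 <= 2 * r / 2 ^ m by apply: Rmult_le_pos; [lra | exact: Rlt_le].
  lra.
have [l hl] : exists l, filterlim u eventually (locally l).
  apply/filterlim_locally_cauchy => eps.
  have [N hN] := small_half_pow (4 * r) eps (cond_pos eps).
  exists (fun n => (N <= n)%nat); split; first by exists N.
  move=> n m hn hm; apply: norm_compat1.
  apply: Rle_lt_trans (norm_minus_tri _ (u N) _) _.
  rewrite (norm_minus_sym (u N)).
  have := Hm N n hn; have := Hm N m hm.
  have e : 4 * r / 2 ^ N = 2 * r / 2 ^ N + 2 * r / 2 ^ N by field; apply: Rgt_not_eq; apply: p2.
  lra.
exists l => n; apply: le_epsilon => eps he.
have nf := @norm_factor_gt_0 _ V.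
have he' : 0 < eps / @norm_factor _ V by apply: Rdiv_lt_0_compat.
have [N hN] := proj1 (filterlim_locally u l) hl (mkposreal _ he').
have h1 := hN (Nat.max N n) (Nat.le_max_l _ _).
have {}h1 := norm_compat2 _ _ _ h1.
have e : @norm_factor _ V * (eps / @norm_factor _ V) = eps by field; apply: Rgt_not_eq.
rewrite /= e in h1. apply: Rle_trans (norm_minus_tri _ (u (Nat.max N n)) _) _.
rewrite (norm_minus_sym (u n)).
by apply: Rplus_le_compat; [exact: Hm (Nat.le_max_r _ _) | exact: Rlt_le].
Qed.

(** The contraction principle for the distance sup |B - B'| / w. This distance may be infinite on
    [Cl], so only the first step from [B0] is required to be finite. Limits are taken pointwise, and
    [Cl] has to be closed only under geometric convergence. *)
Lemma banach_fix {T : Type} (w : T -> R) (Cl : (T -> V) -> Prop) (Th : (T -> V) -> T -> V) B0 c0 :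
  (forall t, 0 < w t) -> Cl B0 -> 0 <= c0 ->
  (forall t, norm (minus (Th B0 t) (B0 t)) <= c0 * w t) ->
  (forall B, Cl B -> Cl (Th B)) ->
  (forall B B' c, Cl B -> Cl B' -> 0 <= c -> (forall t, norm (minus (B t) (B' t)) <= c * w t) ->
     forall t, norm (minus (Th B t) (Th B' t)) <= c / 2 * w t) ->
  (forall (Bn : nat -> T -> V) B c, (forall n, Cl (Bn n)) -> 0 <= c ->
     (forall n t, norm (minus (Bn n t) (B t)) <= c / 2 ^ n * w t) -> Cl B) ->
  exists B, Cl B /\ forall t, Th B t = B t.
Proof.
move=> hw h0 hc hi hCl hctr hlim.
pose Bn := fix Bn n := match n with O => B0 | S n => Th (Bn n) end.
have hBn n : Cl (Bn n) by elim: n => [//|n IH] /=; apply: hCl.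
have p2 n : 0 < 2 ^ n by apply: pow_lt; lra.
have ip2 n : 0 < / 2 ^ n by apply: Rinv_0_lt_compat.
have hstep n t : norm (minus (Bn (S n) t) (Bn n t)) <= c0 / 2 ^ n * w t.
  elim: n t => [|n IH] t; first by rewrite /= Rdiv_1_r.
  have -> : c0 / 2 ^ S n = c0 / 2 ^ n / 2 by rewrite /=; field; apply: Rgt_not_eq; apply: p2.
  apply: (hctr (Bn (S n)) (Bn n)) => //; apply: Rmult_le_pos => //; exact: Rlt_le.
have hex t : exists l, forall n, norm (minus (Bn n t) l) <= 2 * (c0 * w t) / 2 ^ n.
  apply: cauchy_limit => n; have := hstep n t; rewrite /Rdiv; lra.
pose B t := proj1_sig (constructive_indefinite_description _ (hex t)).
have hB n t : norm (minus (Bn n t) (B t)) <= 2 * c0 / 2 ^ n * w t.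
  have := proj2_sig (constructive_indefinite_description _ (hex t)) n; rewrite -/(B t) /Rdiv; lra.
have c20 : 0 <= 2 * c0 by lra.
have ClB : Cl B := hlim Bn B _ hBn c20 hB.
exists B; split => // t; apply: norm_minus_eq0.
apply: le_epsilon => eps he; rewrite Rplus_0_l.
have [n hn] := small_half_pow (2 * (c0 * w t)) eps he.
apply: Rle_trans (norm_minus_tri _ (Bn (S n) t) _) _.
have cn : 0 <= 2 * c0 / 2 ^ n by apply: Rmult_le_pos => //; exact: Rlt_le.
have h1 := hctr (Bn n) B _ (hBn n) ClB cn (hB n) t.
rewrite norm_minus_sym in h1.
have h2 := hB (S n) t.
have e1 : 2 * c0 / 2 ^ S n * w t = c0 * w t / 2 ^ n by rewrite /=; field; apply: Rgt_not_eq; apply: p2.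
have e2 : 2 * c0 / 2 ^ n / 2 * w t = c0 * w t / 2 ^ n by field; apply: Rgt_not_eq; apply: p2.
have e3 : 2 * (c0 * w t) / 2 ^ n = c0 * w t / 2 ^ n + c0 * w t / 2 ^ n by field; apply: Rgt_not_eq; apply: p2.
rewrite norm_minus_sym in h1; rewrite norm_minus_sym in h1; rewrite /= in h2 h1 *; rewrite /= in e1; lra.
Qed.

(* [tau] is the causal variable, [L] the size of the domain of
   dependence, and the weight [K (L p) * exp (2 C (L p) tau p)] turns the operator into a contraction. *)
Lemma volterra_fix {T : UniformSpace} (tau L : T -> R) (K C : R -> R) (S : T -> V -> Prop)
    (Th : (T -> V) -> T -> V) (B0 : T -> V) :
  (forall p, 0 <= tau p <= L p) ->
  (forall p, locally p (fun q => L q <= L p + 1)) ->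
  (forall x y, x <= y -> K x <= K y) -> (forall x, 0 < K x) ->
  (forall x y, x <= y -> C x <= C y) -> (forall x, 0 < C x) ->
  (forall p v, (forall eps, 0 < eps -> exists u, S p u /\ norm (minus u v) < eps) -> S p v) ->
  cont B0 -> (forall p, S p (B0 p)) ->
  (forall p, norm (minus (Th B0 p) (B0 p)) <= K (L p)) ->
  (forall B, cont B -> (forall p, S p (B p)) -> cont (Th B) /\ forall p, S p (Th B p)) ->
  (forall B B' p k c, cont B -> cont B' -> (forall p, S p (B p)) -> (forall p, S p (B' p)) ->
     0 < k -> 0 <= c ->
     (forall q, tau q <= tau p -> L q <= L p -> norm (minus (B q) (B' q)) <= c * exp (k * tau q)) ->
     norm (minus (Th B p) (Th B' p)) <= C (L p) / k * (c * exp (k * tau p))) ->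
  exists B, cont B /\ (forall p, S p (B p)) /\ forall p, Th B p = B p.
Proof.
move=> htau hloc Kmon Kpos Cmon Cpos Scl c0 S0 hinit hCl hctr.
pose w p := K (L p) * exp (2 * C (L p) * tau p).
have wpos p : 0 < w p by apply: Rmult_lt_0_compat; [exact: Kpos | exact: exp_pos].
suff [B [[cB sB] fB]] : exists B, (cont B /\ forall p, S p (B p)) /\ forall p, Th B p = B p by exists B.
apply: (banach_fix w _ Th B0 1 wpos) => //; first exact: Rle_0_1.
- move=> p; rewrite Rmult_1_l; apply: Rle_trans (hinit p) _.
  rewrite -{1}(Rmult_1_r (K (L p))); apply: Rmult_le_compat_l; first by apply: Rlt_le.
  rewrite -exp_0; apply: exp_mono; have := htau p; have := Cpos (L p); nra.
- move=> B [cB sB]; exact: hCl.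
- move=> B B' c [cB sB] [cB' sB'] hc hBB p.
  (* With [k = 2 C (L p)] the gain [C / k] is 1/2. On the domain of dependence of [p] the weight is
     at most [K (L p) * exp (k tau)], by monotonicity of [K] and [C]. *)
  have e : c / 2 * w p = C (L p) / (2 * C (L p)) * (c * K (L p) * exp (2 * C (L p) * tau p)).
    by rewrite /w; field; have := Cpos (L p); lra.
  rewrite e; apply: hctr => //.
  + have := Cpos (L p); lra.
  + by apply: Rmult_le_pos => //; apply: Rlt_le.
  + move=> q hq1 hq2; apply: Rle_trans (hBB q) _; rewrite /w (Rmult_assoc c (K (L p))).
    apply: Rmult_le_compat_l => //; apply: Rmult_le_compat.
    * exact: Rlt_le.
    * apply: Rlt_le; exact: exp_pos.
    * exact: Kmon.
    * apply: exp_mono; apply: Rmult_le_compat_r; first by case: (htau q).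
      have := Cmon _ _ hq2; lra.
- move=> Bn B c hBn hc hlim; split; last first.
    move=> p; apply: Scl => eps he.
    have [n hn] := small_half_pow (c * w p) eps he.
    exists (Bn n p); split; first exact: (proj2 (hBn n)).
    apply: Rle_lt_trans (hlim n p) _; move: hn; rewrite /Rdiv; lra.
  move=> p; apply/continuous_normP => eps he.
  (* Near [p] the sizes [L q] are at most [L p + 1]; [W] bounds the weight there, so the iterates
     converge uniformly and the limit is continuous. *)
  pose W := K (L p + 1) * exp (2 * C (L p + 1) * (L p + 1)).
  have hW q : L q <= L p + 1 -> w q <= W.
    move=> hq; have := htau q => -[t0 t1]; rewrite /w /W; apply: Rmult_le_compat.
    + exact: Rlt_le.
    + apply: Rlt_le; exact: exp_pos.
    + exact: Kmon.
    + apply: exp_mono; apply: Rmult_le_compat => //; first by have := Cpos (L q); lra.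
      * have := Cmon _ _ hq; lra.
      * lra.
  have he3 : 0 < eps / 3 by lra.
  have [n hn] := small_half_pow (c * W) (eps / 3) he3.
  have p2 : 0 < / 2 ^ n by apply: Rinv_0_lt_compat; apply: pow_lt; lra.
  have hq q : L q <= L p + 1 -> norm (minus (Bn n q) (B q)) < eps / 3.
    move=> hq; apply: Rle_lt_trans (hlim n q) _.
    apply: Rle_lt_trans (_ : c / 2 ^ n * W < _); last by move: hn; rewrite /Rdiv; lra.
    apply: Rmult_le_compat_l; last exact: hW.
    apply: Rmult_le_pos => //; exact: Rlt_le.
  have cn := proj1 (cnP _ _) (proj1 (hBn n) p) _ he3.
  apply: locally_imp (locally_and _ _ _ (hloc p) cn) => q [q1 q2].
  apply: Rle_lt_trans (norm_minus_tri _ (Bn n q) _) _.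
  apply: Rle_lt_trans (Rplus_le_compat_l _ _ _ (norm_minus_tri _ (Bn n p) _)) _.
  have h1 := hq q q1; rewrite norm_minus_sym in h1.
  have h2 := hq p ltac:(lra).
  have -> : eps = eps / 3 + (eps / 3 + eps / 3) by field.
  by apply: Rplus_lt_compat => //; apply: Rplus_lt_compat.
Qed.

Lemma bound_rect (f : R * R -> V) n : cont f ->
  exists M, forall x y, -n <= x <= n -> -n <= y <= n -> norm (f (x, y)) <= M.
Proof.
move=> cf.
pose F := fun P : R -> Prop => exists M0, forall M, M0 <= M -> P M.
have FF : Filter F.
  split.
  - by exists 0.
  - move=> P Q [m1 h1] [m2 h2]; exists (Rmax m1 m2) => M hM; split; [apply: h1 | apply: h2];
      apply: Rle_trans hM; [exact: Rmax_l | exact: Rmax_r].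
  - by move=> P Q h [m hm]; exists m => M hM; apply/h/hm.
pose G x y := f (x, y).
have cG : cont (fun p : R * R => G (fst p) (snd p)) by apply: (cont_ext f) => // -[].
have H1 x : F (fun M => forall y, -n <= y <= n -> norm (G x y) <= M).
  apply: (tube F) => t _.
  have cx : cont (G x) by exact: (cont_slice G).
  have [d hd] := proj1 (cnP _ _) (cx t) _ Rlt_0_1.
  exists d; split; first exact: cond_pos.
  exists (norm (G x t) + 1) => M hM s hs.
  have := norm_le_minus (G x s) (G x t); have := hd s hs; lra.
have [M hM] : F (fun M => forall x, -n <= x <= n -> forall y, -n <= y <= n -> norm (G x y) <= M).
  apply: (tube F) => t _.
  have [d hd] := unif_near G t (-n) n _ cG Rlt_0_1.
  exists d; split; first exact: cond_pos.
  have [M0 hM0] := H1 t.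
  exists (M0 + 1) => M hM s hs y hy.
  have := hd s hs y hy; have := hM0 M0 (Rle_refl _) y hy.
  have := norm_le_minus (G s y) (G t y); lra.
by exists M => x y hx hy; apply: (hM M (Rle_refl _)).
Qed.

(** The bound is the supremum over |x| + |y| <= L plus 1, with 0 adjoined to the set so that it is
    nonempty for negative L. Monotone positive functions of L are the form in which [volterra_fix]
    expects its constants. *)
Lemma bound_fun (f : R * R -> V) : cont f ->
  exists k : R -> R, (forall x y, x <= y -> k x <= k y) /\ (forall x, 1 <= k x) /\
    forall p, norm (f p) <= k (Rabs (fst p) + Rabs (snd p)).
Proof.
move=> cf.
pose E L v := v = 0 \/ exists x y, Rabs x + Rabs y <= L /\ v = norm (f (x, y)).
have hE L : {k | is_lub (E L) k}.
  apply: completeness; last by exists 0; left.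
  have [M hM] := bound_rect f L cf.
  exists (Rmax M 0) => v [-> | [x [y [hxy ->]]]]; first exact: Rmax_r.
  apply: Rle_trans (Rmax_l _ _); apply: hM; have := Rabs_pos x; have := Rabs_pos y => a b;
    apply/Rabs_le_between; lra.
exists (fun L => proj1_sig (hE L) + 1); split; [|split].
- move=> x y hxy; apply: Rplus_le_compat_r.
  case: (hE x) => kx [ux lx] /=; case: (hE y) => ky [uy ly] /=.
  apply: lx => v [-> | [a [b [hab ->]]]]; first by apply: uy; left.
  by apply: uy; right; exists a, b; split => //; lra.
- move=> x; case: (hE x) => k [u l] /=; have : 0 <= k by apply: u; left.
  lra.
- move=> [x y] /=; case: (hE _) => k [u l] /=.
  suff : norm (f (x, y)) <= k by lra.
  by apply: u; right; exists x, y; split => //; lra.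
Qed.

(** Integrating [exp (k |s - a|)] gains the factor 1/k; this is the source of the contraction in the
    applications of [volterra_fix]. *)
Lemma RInt_exp_bound (f : R -> V) a b C k : cont f -> 0 < k ->
  (forall s, Rmin a b <= s <= Rmax a b -> norm (f s) <= C * exp (k * Rabs (s - a))) ->
  norm (RInt f a b) <= C / k * exp (k * Rabs (b - a)).
Proof.
move=> cf hk H.
have C0 : 0 <= C.
  have := H a (conj (Rmin_l _ _) (Rmax_l _ _)).
  rewrite Rminus_diag Rabs_R0 Rmult_0_r exp_0 Rmult_1_r; have := norm_ge_0 (f a); lra.
have Ck : 0 <= C / k by apply: Rmult_le_pos => //; apply: Rlt_le; exact: Rinv_0_lt_compat.
case: (Rle_lt_dec a b) => hab.
- rewrite Rmin_left // Rmax_right // in H; rewrite Rabs_pos_eq; last lra.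
  have hd (s : R) : is_derive (fun s => C / k * exp (k * (s - a))) s (C * exp (k * (s - a))).
    auto_derive => //; rewrite /Rminus; field; lra.
  have cg : cont (fun s => C * exp (k * (s - a))).
    apply: cont_Rmult; first exact: cont_const.
    apply: cont_exp; apply: cont_Rmult; first exact: cont_const.
    apply: cont_Rminus; [exact: cont_id | exact: cont_const].
  have hI := is_RInt_derive _ _ a b (fun x _ => hd x) (fun x _ => cg x).
  apply: Rle_trans (norm_RInt_le f _ a b _ _ hab _ (isR _ _ _ cf) hI) _.
    by move=> s hs; have := H s hs; rewrite Rabs_pos_eq //; lra.
  rewrite /minus /plus /opp /= Rminus_diag Rmult_0_r exp_0; lra.
- rewrite Rmin_right in H; last lra.
  rewrite Rmax_left in H; last lra.
  rewrite Rabs_left; last lra.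
  rewrite -opp_RInt_swap; last exact: exR.
  rewrite norm_opp.
  have hd (s : R) : is_derive (fun s => - (C / k) * exp (k * (a - s))) s (C * exp (k * (a - s))).
    auto_derive => //; rewrite /Rminus; field; lra.
  have cg : cont (fun s => C * exp (k * (a - s))).
    apply: cont_Rmult; first exact: cont_const.
    apply: cont_exp; apply: cont_Rmult; first exact: cont_const.
    apply: cont_Rminus; [exact: cont_const | exact: cont_id].
  have hI := is_RInt_derive _ _ b a (fun x _ => hd x) (fun x _ => cg x).
  apply: Rle_trans (norm_RInt_le f _ b a _ _ (Rlt_le _ _ hab) _ (isR _ _ _ cf) hI) _.
    move=> s hs; have := H s hs; rewrite -Rabs_Ropp Rabs_pos_eq ?Ropp_minus_distr //; lra.
  rewrite /minus /plus /opp /= Rminus_diag Rmult_0_r exp_0 Ropp_minus_distr; lra.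
Qed.

Lemma norm_RInt_swap (f : R -> V) a b : cont f -> norm (RInt f a b) = norm (RInt f b a).
Proof. move=> cf; rewrite -opp_RInt_swap ?norm_opp //; exact: exR. Qed.

End Fix.

(** * Hilbert star-algebras *)

(* The model is the algebra of N x N complex matrices with the Frobenius norm, [inner a b] = Re tr (a^* b), and
   [cs z] the scalar matrix z. *)
Record star_alg := {
  car :> CompleteNormedModule R_AbsRing;
  mul : car -> car -> car;
  one : car;
  adj : car -> car;
  inner : car -> car -> R;
  cs : C -> car;
  mul_plus_l : forall a b c, mul (plus a b) c = plus (mul a c) (mul b c);
  mul_plus_r : forall a b c, mul a (plus b c) = plus (mul a b) (mul a c);
  mul_scal_l : forall (r : R) a b, mul (scal r a) b = scal r (mul a b);
  mul_scal_r : forall (r : R) a b, mul a (scal r b) = scal r (mul a b);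
  mulA : forall a b c, mul (mul a b) c = mul a (mul b c);
  mul1l : forall a, mul one a = a;
  mul1r : forall a, mul a one = a;
  norm_mul : forall a b, norm (mul a b) <= norm a * norm b;
  adj_plus : forall a b, adj (plus a b) = plus (adj a) (adj b);
  adj_scal : forall (r : R) a, adj (scal r a) = scal r (adj a);
  adj_mul : forall a b, adj (mul a b) = mul (adj b) (adj a);
  adjK : forall a, adj (adj a) = a;
  norm_adj : forall a, norm (adj a) = norm a;
  inner_plus : forall a b c, inner a (plus b c) = inner a b + inner a c;
  inner_scal : forall (r : R) a b, inner a (scal r b) = r * inner a b;
  inner_sym : forall a b, inner a b = inner b a;
  inner_norm : forall a, inner a a = norm a ^ 2;
  inner_mul : forall a b c, inner (mul a b) c = inner b (mul (adj a) c);
  cs_plus : forall z w : C, cs (z + w)%C = plus (cs z) (cs w);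
  cs_mul : forall z w : C, cs (z * w)%C = mul (cs z) (cs w);
  cs_RtoC : forall r : R, cs (RtoC r) = scal r one;
  cs_comm : forall z a, mul (cs z) a = mul a (cs z);
  norm_cs : forall z a, norm (mul (cs z) a) = Cmod z * norm a;
  inner_cs : forall z a, inner a (mul (cs z) a) = Re z * norm a ^ 2
}.

Arguments mul {_}. Arguments one {_}. Arguments adj {_}. Arguments inner {_}. Arguments cs {_}.

(* Copies of the module operations with a fixed canonical-structure path, so that rewriting never has to
   compare two convertible structures. *)
Definition add {M : star_alg} (x y : M) : M := plus x y.
Definition sub {M : star_alg} (x y : M) : M := minus x y.
Definition neg {M : star_alg} (x : M) : M := opp x.
Definition rs {M : star_alg} (r : R) (x : M) : M := scal r x.
Definition nul {M : star_alg} : M := zero.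
Definition nm {M : star_alg} (x : M) : R := norm x.

Section Alg.
Context {M : star_alg}.
Implicit Types x y a b c : M.

Lemma inner_add a b c : inner a (add b c) = inner a b + inner a c.
Proof. exact: inner_plus. Qed.
Lemma inner_rs a r b : inner a (rs r b) = r * inner a b.
Proof. exact: inner_scal. Qed.
Lemma inner_neg a b : inner a (neg b) = - inner a b.
Proof.
have -> : neg b = rs (-1) b by rewrite /neg /rs; symmetry; exact: (scal_opp_one (b : M)).
rewrite inner_rs; ring.
Qed.
Lemma inner_sub a b c : inner a (sub b c) = inner a b - inner a c.
Proof. by rewrite -[sub b c]/(add b (neg c)) inner_add inner_neg. Qed.
Lemma inner_nul a : inner a nul = 0.
Proof.
have -> : (nul : M) = rs 0 a by rewrite /nul /rs; symmetry; exact: (scal_zero_l (a : M)).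
rewrite inner_rs; ring.
Qed.
Lemma inner_addl a b c : inner (add b c) a = inner b a + inner c a.
Proof. by rewrite inner_sym inner_add !(inner_sym _ a). Qed.
Lemma inner_subl a b c : inner (sub b c) a = inner b a - inner c a.
Proof. by rewrite inner_sym inner_sub !(inner_sym _ a). Qed.
Lemma inner_rsl a r b : inner (rs r b) a = r * inner b a.
Proof. by rewrite inner_sym inner_rs !(inner_sym _ a). Qed.
Lemma inner_null a : inner nul a = 0.
Proof. by rewrite inner_sym inner_nul. Qed.
Lemma inner_nm a : inner a a = nm a ^ 2.
Proof. exact: inner_norm. Qed.

Lemma nm_ge0 x : 0 <= nm x.
Proof. exact: norm_ge_0. Qed.
Lemma nm_add x y : nm (add x y) <= nm x + nm y.
Proof. exact: norm_triangle. Qed.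
Lemma nm_neg x : nm (neg x) = nm x.
Proof. exact: norm_opp. Qed.
Lemma nm_sub x y : nm (sub x y) <= nm x + nm y.
Proof. by rewrite -(nm_neg y); exact: nm_add. Qed.
Lemma nm_mul x y : nm (mul x y) <= nm x * nm y.
Proof. exact: norm_mul. Qed.
Lemma nm_nul : nm (nul : M) = 0.
Proof. exact: norm_zero. Qed.
Lemma nm_eq0 x : nm x = 0 -> x = nul.
Proof. exact: norm_eq_zero. Qed.

(** Nondegeneracy of the real inner product. It turns linear identities in the algebra into
    identities between the real numbers [inner w x], which [ring] decides; the tactic [vec] is built
    on it. *)
Lemma inner_ext x y : (forall w, inner w x = inner w y) -> x = y.
Proof.
move=> h.
have e : nm (sub x y) ^ 2 = 0 by rewrite -inner_nm inner_sub h; ring.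
apply: norm_minus_eq0; apply: Req_le; have := nm_ge0 (sub x y); rewrite /= in e.
move=> h0; have : nm (sub x y) = 0 by nra.
by [].
Qed.

End Alg.

Ltac vec := apply: inner_ext => ?;
  rewrite ?(inner_add, inner_sub, inner_neg, inner_rs, inner_nul); try (ring || (field; lra)).

Section Alg2.
Context {M : star_alg}.
Implicit Types x y a b c : M.

Lemma nm_rs r x : nm (rs r x) = Rabs r * nm x.
Proof.
have h2 : nm (rs r x) ^ 2 = (Rabs r * nm x) ^ 2.
  by rewrite -inner_nm inner_rs inner_rsl inner_nm Rpow_mult_distr pow2_abs; ring.
have p1 := nm_ge0 (rs r x); have p2 : 0 <= Rabs r * nm x.
  by apply: Rmult_le_pos; [exact: Rabs_pos | exact: nm_ge0].
by apply: Rsqr_inj => //; rewrite !Rsqr_pow2.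
Qed.

Lemma CS a b : inner a b <= nm a * nm b.
Proof.
have pa := nm_ge0 a; have pb := nm_ge0 b.
case: (Req_dec (nm a) 0) => ha.
  by rewrite (nm_eq0 _ ha) inner_null nm_nul; lra.
have h : 0 <= nm (sub (rs (nm a) b) (rs (inner a b / nm a) a)) ^ 2 by apply: pow2_ge_0.
move: h; rewrite -inner_nm !(inner_sub, inner_subl, inner_rs, inner_rsl) !inner_nm (inner_sym _ b a).
set i := inner a b; set na := nm a; set nb := nm b => h.
have e : na * (na * nb ^ 2) - na * (i / na * i) - (i / na * (na * i) - i / na * (i / na * na ^ 2))
   = (na * nb) ^ 2 - i ^ 2 by field.
have h2 : i ^ 2 <= (na * nb) ^ 2 by move: h e; rewrite /i /na /nb; lra.
have : 0 <= na * nb by apply: Rmult_le_pos.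
nra.
Qed.

Lemma CS' a b : Rabs (inner a b) <= nm a * nm b.
Proof.
apply: Rabs_le; split; last exact: CS.
have := CS a (neg b); rewrite inner_neg nm_neg; lra.
Qed.

Lemma mul_add_l a b c : mul (add a b) c = add (mul a c) (mul b c).
Proof. exact: mul_plus_l. Qed.
Lemma mul_add_r a b c : mul a (add b c) = add (mul a b) (mul a c).
Proof. exact: mul_plus_r. Qed.
Lemma mul_rs_l r a b : mul (rs r a) b = rs r (mul a b).
Proof. exact: mul_scal_l. Qed.
Lemma mul_rs_r r a b : mul a (rs r b) = rs r (mul a b).
Proof. exact: mul_scal_r. Qed.
Lemma neg_rs a : neg a = rs (-1) a.
Proof. by vec. Qed.
Lemma nul_rs a : nul = rs 0 a.
Proof. by vec. Qed.
Lemma sub_rs a b : sub a b = add a (rs (-1) b).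
Proof. by vec. Qed.
Lemma mul_neg_l a b : mul (neg a) b = neg (mul a b).
Proof. by rewrite !neg_rs mul_rs_l. Qed.
Lemma mul_neg_r a b : mul a (neg b) = neg (mul a b).
Proof. by rewrite !neg_rs mul_rs_r. Qed.
Lemma mul_sub_l a b c : mul (sub a b) c = sub (mul a c) (mul b c).
Proof. by rewrite !sub_rs mul_add_l mul_rs_l. Qed.
Lemma mul_sub_r a b c : mul a (sub b c) = sub (mul a b) (mul a c).
Proof. by rewrite !sub_rs mul_add_r mul_rs_r. Qed.
Lemma mul_nul_l a : mul nul a = nul.
Proof. rewrite (nul_rs one) mul_rs_l; by vec. Qed.
Lemma mul_nul_r a : mul a nul = nul.
Proof. rewrite (nul_rs one) mul_rs_r; by vec. Qed.
Lemma adj_add a b : adj (add a b) = add (adj a) (adj b).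
Proof. exact: adj_plus. Qed.
Lemma adj_rs r a : adj (rs r a) = rs r (adj a).
Proof. exact: adj_scal. Qed.
Lemma adj_sub a b : adj (sub a b) = sub (adj a) (adj b).
Proof. by rewrite !sub_rs adj_add adj_rs. Qed.
Lemma adj_nul : adj (nul : M) = nul.
Proof. by rewrite (nul_rs one) adj_rs; vec. Qed.
Lemma nm_adj a : nm (adj a) = nm a.
Proof. exact: norm_adj. Qed.
Lemma nm_cs z a : nm (mul (cs z) a) = Cmod z * nm a.
Proof. exact: norm_cs. Qed.
Lemma nm_sub_sym a b : nm (sub a b) = nm (sub b a).
Proof. by rewrite -nm_neg; congr nm; vec. Qed.
Lemma nm_sub_tri b a c : nm (sub a c) <= nm (sub a b) + nm (sub b c).
Proof. have -> : sub a c = add (sub a b) (sub b c) by vec. exact: nm_add. Qed.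

End Alg2.

Ltac dist := rewrite ?(mul_add_l, mul_add_r, mul_sub_l, mul_sub_r, mul_rs_l, mul_rs_r, mul_neg_l, mul_neg_r,
  mul_nul_l, mul_nul_r, mulA).

Section Calc.
Context {M : star_alg} {U : UniformSpace}.
Implicit Types f g : U -> M.

Lemma cont_add f g : cont f -> cont g -> cont (fun u => add (f u) (g u)).
Proof. exact: cont_plus. Qed.
Lemma cont_sub f g : cont f -> cont g -> cont (fun u => sub (f u) (g u)).
Proof. exact: cont_minus. Qed.
Lemma cont_neg f : cont f -> cont (fun u => neg (f u)).
Proof. exact: cont_opp. Qed.
Lemma cont_rs (k : U -> R) f : cont k -> cont f -> cont (fun u => rs (k u) (f u)).
Proof. exact: cont_scal. Qed.
Lemma cont_nm f : cont f -> cont (fun u => nm (f u)).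
Proof. exact: cont_norm. Qed.

Lemma contP (f : U -> M) u :
  continuous f u <-> forall eps, 0 < eps -> locally u (fun y => nm (sub (f y) (f u)) < eps).
Proof. exact: continuous_normP. Qed.

Lemma contRP (f : U -> R) u :
  continuous f u <-> forall eps, 0 < eps -> locally u (fun y => Rabs (f y - f u) < eps).
Proof. exact: (continuous_normP (V := R_NormedModule)). Qed.

Lemma cont_Lip {M' : star_alg} (h : M -> M') f K :
  (forall x y, nm (sub (h x) (h y)) <= K * nm (sub x y)) -> cont f -> cont (fun u => h (f u)).
Proof.
move=> hL cf u; apply: (proj2 (continuous_normP (V := car M') (fun u => h (f u)) u)) => eps he.
have hK : 0 < eps / (Rabs K + 1) by apply: Rdiv_lt_0_compat => //; have := Rabs_pos K; lra.
apply: locally_imp (proj1 (contP _ _) (cf u) _ hK) => y hy.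
apply: Rle_lt_trans (hL _ _) _.
apply: Rle_lt_trans (_ : (Rabs K + 1) * nm (sub (f y) (f u)) < _).
  apply: Rmult_le_compat_r; [exact: nm_ge0 | have := Rle_abs K; lra].
have -> : eps = (Rabs K + 1) * (eps / (Rabs K + 1)) by field; have := Rabs_pos K; lra.
apply: Rmult_lt_compat_l => //; have := Rabs_pos K; lra.
Qed.

Lemma cont_adj f : cont f -> cont (fun u => adj (f u)).
Proof.
move=> cf; apply: (cont_Lip adj f 1) => // x y; rewrite -adj_sub nm_adj; lra.
Qed.

Lemma cont_mul f g : cont f -> cont g -> cont (fun u => mul (f u) (g u)).
Proof.
move=> cf cg u; apply/contP => eps he.
set nf := nm (f u); set ng := nm (g u).
have pf := nm_ge0 (f u); have pg := nm_ge0 (g u); rewrite -/nf -/ng in pf pg.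
pose d := Rmin 1 (eps / (nf + ng + 2)).
have q : 0 < eps / (nf + ng + 2) by apply: Rdiv_lt_0_compat; lra.
have hd : 0 < d by apply: Rmin_pos; lra.
have d1 : d <= 1 by apply: Rmin_l.
have d2 : d * (nf + ng + 1) < eps.
  apply: Rle_lt_trans (Rmult_le_compat_r _ _ _ _ (Rmin_r _ _)) _; first lra.
  have -> : eps / (nf + ng + 2) * (nf + ng + 1) = eps - eps / (nf + ng + 2) by field; lra.
  lra.
apply: locally_imp (locally_and _ _ _ (proj1 (contP _ _) (cf u) _ hd) (proj1 (contP _ _) (cg u) _ hd)) => y [h1 h2].
have -> : sub (mul (f y) (g y)) (mul (f u) (g u)) =
  add (mul (sub (f y) (f u)) (sub (g y) (g u))) (add (mul (sub (f y) (f u)) (g u)) (mul (f u) (sub (g y) (g u)))).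
  by dist; vec.
have p1 := nm_ge0 (sub (f y) (f u)); have p2 := nm_ge0 (sub (g y) (g u)).
apply: Rle_lt_trans (nm_add _ _) _.
apply: Rle_lt_trans (Rplus_le_compat _ _ _ _ (nm_mul _ _) (nm_add _ _)) _.
apply: Rle_lt_trans (Rplus_le_compat_l _ _ _ (Rplus_le_compat _ _ _ _ (nm_mul _ _) (nm_mul _ _))) _.
rewrite -/nf -/ng; nra.
Qed.

(** Polarization reduces this to continuity of the norm. *)
Lemma cont_inner f g : cont f -> cont g -> cont (fun u => inner (f u) (g u)).
Proof.
move=> cf cg.
have e u : ((nm (add (f u) (g u))) ^ 2 - nm (sub (f u) (g u)) ^ 2) / 4 = inner (f u) (g u) :> R.
  rewrite -!inner_nm !(inner_add, inner_sub, inner_addl, inner_subl) (inner_sym _ (g u) (f u)); field.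
apply: (cont_ext _ _ e).
apply: cont_Rmult; last exact: cont_const.
apply: cont_Rminus; apply: cont_pow; apply: cont_nm; [exact: cont_add | exact: cont_sub].
Qed.

End Calc.

Lemma cont_app1 {U V W : UniformSpace} (a : V -> W) (f : U -> V) : cont a -> cont f -> cont (fun u => a (f u)).
Proof. move=> ha hf; exact: cont_comp. Qed.
Lemma cont_app2 {U : UniformSpace} {V : UniformSpace} (F : R -> R -> V) (f g : U -> R) :
  c2 F -> cont f -> cont g -> cont (fun u => F (f u) (g u)).
Proof. move=> hF hf hg; exact: (cont_comp2 f g F). Qed.

Ltac cts_step :=
  match goal with
  | |- c2 _ => unfold c2; cbv beta
  | |- cont (fun _ => ?c) => apply cont_const
  | |- cont (fun u => u) => apply cont_id
  | |- cont (fun u => fst (@?f u)) => apply (cont_fst f); cbv beta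
  | |- cont (fun u => snd (@?f u)) => apply (cont_snd f); cbv beta
  | |- cont (fun u => add (@?f u) (@?g u)) => apply (cont_add f g); cbv beta
  | |- cont (fun u => sub (@?f u) (@?g u)) => apply (cont_sub f g); cbv beta
  | |- cont (fun u => neg (@?f u)) => apply (cont_neg f); cbv beta
  | |- cont (fun u => rs (@?f u) (@?g u)) => apply (cont_rs f g); cbv beta
  | |- cont (fun u => mul (@?f u) (@?g u)) => apply (cont_mul f g); cbv beta
  | |- cont (fun u => adj (@?f u)) => apply (cont_adj f); cbv beta
  | |- cont (fun u => inner (@?f u) (@?g u)) => apply (cont_inner f g); cbv beta
  | |- cont (fun u => nm (@?f u)) => apply (cont_nm f); cbv beta
  | |- cont (fun u => RInt (@?G u) (@?al u) (@?be u)) => apply (cont_RInt G al be); cbv beta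
  | |- cont (fun u => Rplus (@?f u) (@?g u)) => apply (cont_Rplus f g); cbv beta
  | |- cont (fun u => Rminus (@?f u) (@?g u)) => apply (cont_Rminus f g); cbv beta
  | |- cont (fun u => Rdiv (@?f u) ?g) => apply (cont_Rmult f (fun _ => Rinv g)); cbv beta
  | |- cont (fun u => Rmult (@?f u) (@?g u)) => apply (cont_Rmult f g); cbv beta
  | |- cont (fun u => Ropp (@?f u)) => apply (cont_Ropp f); cbv beta
  | |- cont (fun u => pow (@?f u) ?n) => apply (cont_pow f n); cbv beta
  | |- cont (fun u => exp (@?f u)) => apply (cont_exp f); cbv beta
  | |- cont (fun u => Rmax 0 (@?f u)) => apply (cont_app1 (fun x => Rmax 0 x) f cont_clamp); cbv beta
  | H : c2 ?F |- cont (fun u => ?F (@?f u) (@?g u)) => apply (cont_app2 F f g H); cbv beta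
  | H : cont ?a |- cont (fun u => ?a (@?f u)) => apply (cont_app1 a f H); cbv beta
  | H : c2 ?F |- cont (?F ?x) => apply (c2_2 F x H)
  | H : cont ?a |- cont ?a => exact H
  | H : forall x, c2 (?F x) |- cont (fun u => ?F ?x (@?f u) (@?g u)) => apply (cont_app2 (F x) f g (H x)); cbv beta
  end.
Ltac cts := repeat cts_step.

Section Deriv.
Context {M : star_alg}.
Implicit Types f g : R -> M.

Lemma D_add f g x a b : is_derive f x a -> is_derive g x b -> is_derive (fun x => add (f x) (g x)) x (add a b).
Proof. exact: (is_derive_plus f g). Qed.
Lemma D_sub f g x a b : is_derive f x a -> is_derive g x b -> is_derive (fun x => sub (f x) (g x)) x (sub a b).
Proof. exact: (is_derive_minus f g). Qed.
Lemma D_neg f x a : is_derive f x a -> is_derive (fun x => neg (f x)) x (neg a).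
Proof. exact: (is_derive_opp f). Qed.
Lemma D_const c x : is_derive (fun _ : R => c : M) x nul.
Proof. exact: (is_derive_const c). Qed.
Lemma D_comp f (g : R -> R) (x : R) (a : M) (dg : R) : is_derive f (g x) a -> is_derive g x dg ->
  is_derive (fun x => f (g x)) x (rs dg a).
Proof. exact: (is_derive_comp f g). Qed.

Lemma DP f x l : is_derive f x l <->
  (forall eps, 0 < eps -> exists d, 0 < d /\ forall h, Rabs h < d ->
     nm (sub (sub (f (x + h)) (f x)) (rs h l)) <= eps * Rabs h).
Proof. split; [exact: is_derive_normP' | exact: is_derive_normP]. Qed.

Lemma D_cont f x l : is_derive f x l -> continuous f x.
Proof. move=> h; apply: ex_derive_continuous; by exists l. Qed.

End Deriv.

Lemma D_lin {M M' : star_alg} (h : M -> M') K (f : R -> M) x l : (forall a b, h (add a b) = add (h a) (h b)) ->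
  (forall r a, h (rs r a) = rs r (h a)) -> (forall a, nm (h a) <= K * nm a) ->
  is_derive f x l -> is_derive (fun x => h (f x)) x (h l).
Proof.
move=> ha hs hK /DP H; apply/DP => eps he.
have hK' : 0 < eps / (Rabs K + 1) by apply: Rdiv_lt_0_compat => //; have := Rabs_pos K; lra.
have [d [d0 hd]] := H _ hK'; exists d; split => // k hk.
have -> : sub (sub (h (f (x + k))) (h (f x))) (rs k (h l)) = h (sub (sub (f (x + k)) (f x)) (rs k l)).
  by rewrite !sub_rs !ha !hs.
apply: Rle_trans (hK _) _; have {hd} := hd k hk; set n := nm _ => hn.
have n0 : 0 <= n by exact: nm_ge0.
have pk := Rabs_pos K; have := Rle_abs K => hK2.
apply: Rle_trans (_ : (Rabs K + 1) * n <= _); first nra.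
have -> : eps * Rabs k = (Rabs K + 1) * (eps / (Rabs K + 1) * Rabs k) by field; lra.
apply: Rmult_le_compat_l => //; lra.
Qed.

Section Deriv2.
Context {M : star_alg}.
Implicit Types f g : R -> M.

Lemma D_adj f x l : is_derive f x l -> is_derive (fun x => adj (f x)) x (adj l).
Proof.
apply: (D_lin adj 1) => [a b|r a|a]; [exact: adj_add | exact: adj_rs | rewrite nm_adj; lra].
Qed.

Lemma D_mulc c f x l : is_derive f x l -> is_derive (fun x => mul c (f x)) x (mul c l).
Proof.
apply: (D_lin (mul c) (nm c)) => [a b|r a|a]; [exact: mul_add_r | exact: mul_rs_r | exact: nm_mul].
Qed.

Lemma D_cmul c f x l : is_derive f x l -> is_derive (fun x => mul (f x) c) x (mul l c).
Proof.
apply: (D_lin (fun y => mul y c) (nm c)) => [a b|r a|a]; [exact: mul_add_l | exact: mul_rs_l |].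
rewrite Rmult_comm; exact: nm_mul.
Qed.

Lemma D_mul f g x a b : is_derive f x a -> is_derive g x b ->
  is_derive (fun x => mul (f x) (g x)) x (add (mul a (g x)) (mul (f x) b)).
Proof.
move=> hf hg.
(* Apart from terms in which one factor is frozen at [x], only the product of the two increments
   remains, and its derivative at [x] is zero. *)
apply: (is_derive_ext (fun t => add (mul (sub (f t) (f x)) (sub (g t) (g x)))
   (sub (add (mul (f t) (g x)) (mul (f x) (g t))) (mul (f x) (g x))))).
  by move=> t; dist; vec.
have -> : add (mul a (g x)) (mul (f x) b) =
  add nul (sub (add (mul a (g x)) (mul (f x) b)) nul) by vec.
apply: D_add; last first.
  apply: D_sub; last exact: D_const.
  by apply: D_add; [apply: D_cmul | apply: D_mulc].
apply/DP => eps he.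
have pa := nm_ge0 a; have pb := nm_ge0 b.
have [d1 [p1 h1]] := proj1 (DP f x a) hf 1 Rlt_0_1.
have q : 0 < eps / (nm a + 1) by apply: Rdiv_lt_0_compat; lra.
have cg := proj1 (contP _ _) (D_cont _ _ _ hg) _ q.
have [d2 hd2] := cg.
exists (Rmin d1 d2); split; first by apply: Rmin_pos => //; exact: cond_pos.
move=> k hk.
have k1 : Rabs k < d1 by apply: Rlt_le_trans hk (Rmin_l _ _).
have k2 : Rabs k < d2 by apply: Rlt_le_trans hk (Rmin_r _ _).
have b1 : nm (sub (f (x + k)) (f x)) <= (nm a + 1) * Rabs k.
  have -> : sub (f (x + k)) (f x) = add (sub (sub (f (x + k)) (f x)) (rs k a)) (rs k a) by vec.
  apply: Rle_trans (nm_add _ _) _; rewrite nm_rs; have := h1 k k1; lra.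
have b2 : nm (sub (g (x + k)) (g x)) < eps / (nm a + 1).
  apply: hd2; rewrite /ball /= /AbsRing_ball /abs /minus /plus /opp /=.
  by have -> : x + k + - x = k by ring.
have -> : sub (sub (mul (sub (f (x + k)) (f x)) (sub (g (x + k)) (g x)))
   (mul (sub (f x) (f x)) (sub (g x) (g x)))) (rs k nul)
  = mul (sub (f (x + k)) (f x)) (sub (g (x + k)) (g x)) by dist; vec.
apply: Rle_trans (nm_mul _ _) _.
apply: Rle_trans (Rmult_le_compat _ _ _ _ (nm_ge0 _) (nm_ge0 _) b1 (Rlt_le _ _ b2)) _.
apply: Req_le; field; lra.
Qed.

Lemma D_innerc c f x l : is_derive f x l -> is_derive (fun x => inner c (f x)) x (inner c l).
Proof.
move=> /DP H.
apply: (is_derive_normP (V := R_NormedModule)) => eps he.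
have q : 0 < eps / (nm c + 1) by apply: Rdiv_lt_0_compat => //; have := nm_ge0 c; lra.
have [d [d0 hd]] := H _ q; exists d; split => // h hh.
have -> : minus (minus (inner c (f (x + h))) (inner c (f x))) (scal h (inner c l)) =
   inner c (sub (sub (f (x + h)) (f x)) (rs h l)).
  by rewrite !(inner_sub, inner_rs).
apply: Rle_trans (CS' _ _) _.
apply: Rle_trans (Rmult_le_compat_l _ _ _ (nm_ge0 _) (hd h hh)) _.
have -> : eps * Rabs h = (nm c + 1) * (eps / (nm c + 1) * Rabs h) by field; have := nm_ge0 c; lra.
apply: Rmult_le_compat_r; last lra.
by apply: Rmult_le_pos; [apply: Rlt_le | exact: Rabs_pos].
Qed.

Lemma nmsq_polar (u v : M) : nm u ^ 2 = nm v ^ 2 + 2 * inner v (sub u v) + nm (sub u v) ^ 2.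
Proof. rewrite -!inner_nm !(inner_sub, inner_subl) (inner_sym _ u v); ring. Qed.

Lemma D_nmsq f x l : is_derive f x l -> is_derive (fun x => nm (f x) ^ 2) x (2 * inner (f x) l).
Proof.
move=> hf.
apply: (is_derive_ext (fun t => nm (f x) ^ 2 + 2 * inner (f x) (sub (f t) (f x)) + nm (sub (f t) (f x)) ^ 2)).
  by move=> t; rewrite -nmsq_polar.
have -> : 2 * inner (f x) l = 0 + 2 * inner (f x) (sub l nul) + 0 by rewrite inner_sub inner_nul; ring.
apply: (is_derive_plus (V := R_NormedModule)).
  apply: (is_derive_plus (V := R_NormedModule)); first exact: (is_derive_const (V := R_NormedModule)).
  apply: (is_derive_scal (fun t => inner (f x) (sub (f t) (f x))) x 2).
  apply: D_innerc; apply: D_sub => //; exact: D_const.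
apply: (is_derive_normP (V := R_NormedModule)) => eps he.
have [d1 [p1 h1]] := proj1 (DP f x l) hf 1 Rlt_0_1.
have pl := nm_ge0 l.
have q : 0 < eps / (nm l + 1) by apply: Rdiv_lt_0_compat; lra.
have [d2 hd2] := proj1 (contP _ _) (D_cont _ _ _ hf) _ q.
exists (Rmin d1 d2); split; first by apply: Rmin_pos => //; exact: cond_pos.
move=> k hk.
have k1 : Rabs k < d1 by apply: Rlt_le_trans hk (Rmin_l _ _).
have k2 : Rabs k < d2 by apply: Rlt_le_trans hk (Rmin_r _ _).
have b1 : nm (sub (f (x + k)) (f x)) <= (nm l + 1) * Rabs k.
  have -> : sub (f (x + k)) (f x) = add (sub (sub (f (x + k)) (f x)) (rs k l)) (rs k l) by vec.
  apply: Rle_trans (nm_add _ _) _; rewrite nm_rs; have := h1 k k1; lra.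
have b2 : nm (sub (f (x + k)) (f x)) < eps / (nm l + 1).
  apply: hd2; rewrite /ball /= /AbsRing_ball /abs /minus /plus /opp /=.
  by have -> : x + k + - x = k by ring.
have e0 : nm (sub (f x) (f x)) = 0 by have -> : sub (f x) (f x) = nul; [vec | exact: nm_nul].
rewrite e0 /norm /minus /plus /opp /scal /= /abs /mult /=.
have -> : nm (sub (f (x + k)) (f x)) * (nm (sub (f (x + k)) (f x)) * 1) + - (0 * (0 * 1)) + - (k * 0) =
   nm (sub (f (x + k)) (f x)) * nm (sub (f (x + k)) (f x)) by ring.
rewrite Rabs_pos_eq; last by apply: Rmult_le_pos; exact: nm_ge0.
apply: Rle_trans (Rmult_le_compat _ _ _ _ (nm_ge0 _) (nm_ge0 _) b1 (Rlt_le _ _ b2)) _.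
apply: Req_le; field; lra.
Qed.

Lemma RInt_add f g a b : cont f -> cont g -> RInt (fun t => add (f t) (g t)) a b = add (RInt f a b) (RInt g a b).
Proof. move=> cf cg; apply: RInt_plus; exact: exR. Qed.
Lemma RInt_sub f g a b : cont f -> cont g -> RInt (fun t => sub (f t) (g t)) a b = sub (RInt f a b) (RInt g a b).
Proof. move=> cf cg; apply: RInt_minus; exact: exR. Qed.
Lemma RInt_rs f r a b : cont f -> RInt (fun t => rs r (f t)) a b = rs r (RInt f a b).
Proof. move=> cf; apply: RInt_scal; exact: exR. Qed.
Lemma RInt_neg f a b : cont f -> RInt (fun t => neg (f t)) a b = neg (RInt f a b).
Proof. move=> cf; apply: RInt_opp; exact: exR. Qed.
Lemma RInt_nul f a : RInt f a a = nul.
Proof. exact: RInt_point. Qed.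
Lemma RInt_cat f a b c : cont f -> add (RInt f a b) (RInt f b c) = RInt f a c.
Proof. move=> cf; apply: RInt_Chasles; exact: exR. Qed.
Lemma RInt_rev f a b : cont f -> RInt f b a = neg (RInt f a b).
Proof. move=> cf; symmetry; apply: opp_RInt_swap; exact: exR. Qed.
Lemma RInt_cst (c : M) a b : RInt (fun _ => c) a b = rs (b - a) c.
Proof. exact: RInt_const. Qed.

Lemma RInt_mulc c f a b : cont f -> RInt (fun t => mul c (f t)) a b = mul c (RInt f a b).
Proof.
move=> cf; apply: (eq_of_deriv (fun b => RInt (fun t => mul c (f t)) a b) (fun b => mul c (RInt f a b)) (fun t => mul c (f t)) a).
- move=> x _; apply: (deriv_RInt (fun t => mul c (f t))); cts.
- move=> x _; apply: D_mulc; exact: deriv_RInt.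
- by rewrite !RInt_nul mul_nul_r.
Qed.

Lemma RInt_cmul c f a b : cont f -> RInt (fun t => mul (f t) c) a b = mul (RInt f a b) c.
Proof.
move=> cf; apply: (eq_of_deriv (fun b => RInt (fun t => mul (f t) c) a b) (fun b => mul (RInt f a b) c) (fun t => mul (f t) c) a).
- move=> x _; apply: (deriv_RInt (fun t => mul (f t) c)); cts.
- move=> x _; apply: D_cmul; exact: deriv_RInt.
- by rewrite !RInt_nul mul_nul_l.
Qed.

Lemma RInt_adj f a b : cont f -> RInt (fun t => adj (f t)) a b = adj (RInt f a b).
Proof.
move=> cf; apply: (eq_of_deriv (fun b => RInt (fun t => adj (f t)) a b) (fun b => adj (RInt f a b)) (fun t => adj (f t)) a).
- move=> x _; apply: (deriv_RInt (fun t => adj (f t))); cts.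
- move=> x _; apply: D_adj; exact: deriv_RInt.
- by rewrite !RInt_nul adj_nul.
Qed.

Lemma RInt_inner c f a b : cont f -> RInt (fun t => inner c (f t)) a b = inner c (RInt f a b).
Proof.
move=> cf; apply: (eq_of_deriv (fun b => RInt (fun t => inner c (f t)) a b) (fun b => inner c (RInt f a b)) (fun t => inner c (f t)) a).
- move=> x _; apply: (deriv_RInt (fun t => inner c (f t))); cts.
- move=> x _; apply: D_innerc; exact: deriv_RInt.
- by rewrite RInt_nul inner_nul; exact: RInt_point.
Qed.

Lemma RInt_sum_minus f c (X : R) : cont f -> RInt (fun t => f (c - t)) 0 X = RInt f (c - X) c.
Proof.
move=> cf.
have e := RInt_comp_lin f (-1) c 0 X.
have : RInt (fun y => scal (-1) (f (-1 * y + c))) 0 X = RInt f (-1 * 0 + c) (-1 * X + c).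
  apply: e; exact: exR.
have -> : -1 * 0 + c = c by ring.
have -> : -1 * X + c = c - X by ring.
rewrite (RInt_ext _ (fun t => rs (-1) (f (c - t)))); last first.
  by move=> t _; rewrite /rs; congr (scal _ (f _)); ring.
rewrite RInt_rs; last by cts.
rewrite (RInt_rev f (c - X) c) // => h.
apply: inner_ext => w; have := f_equal (inner w) h; rewrite !(inner_rs, inner_neg); lra.
Qed.

Lemma RInt_shift f c a b : cont f -> RInt (fun t => f (t + c)) a b = RInt f (a + c) (b + c).
Proof.
move=> cf.
have := RInt_comp_lin f 1 c a b.
rewrite !Rmult_1_l => <-; last exact: exR.
by apply: RInt_ext => t _; rewrite scal_one Rmult_1_l.
Qed.

Lemma nm_RInt_le f (g : R -> R) a b : a <= b -> cont f -> cont g ->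
  (forall t, a <= t <= b -> nm (f t) <= g t) -> nm (RInt f a b) <= RInt g a b.
Proof.
move=> hab cf cg H; exact: (norm_RInt_le f g a b _ _ hab H (isR f a b cf) (isR g a b cg)).
Qed.

Lemma nm_RInt_const f a b K : cont f ->
  (forall x, Rmin a b <= x <= Rmax a b -> nm (f x) <= K) -> nm (RInt f a b) <= Rabs (b - a) * K.
Proof. exact: norm_RInt_const. Qed.

End Deriv2.

(** * Convolution and the Goursat problem *)

(** For negative x the integral is oriented, so that the rules for convolutions, associativity
    included, hold on the whole line. *)
Definition cv {M : star_alg} (f g : R -> M) (x : R) : M := RInt (fun t => mul (f (x - t)) (g t)) 0 x.

Lemma cont_cv {M : star_alg} {U : UniformSpace} (F G : U -> R -> M) (X : U -> R) :
  cont (fun p : U * R => F (fst p) (snd p)) -> cont (fun p : U * R => G (fst p) (snd p)) -> cont X ->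
  cont (fun u => cv (F u) (G u) (X u)).
Proof.
move=> cF cG cX; rewrite /cv.
apply: (cont_RInt (fun u t => mul (F u (X u - t)) (G u t))) => //; last exact: cont_const.
apply: cont_mul => //.
apply: (cont_comp2 (fun p : U * R => fst p) (fun p => X (fst p) - snd p) F) => //; cts.
Qed.

Lemma cv_cont {M : star_alg} (f g : R -> M) : cont f -> cont g -> cont (cv f g).
Proof. move=> cf cg; apply: (cont_cv (fun _ => f) (fun _ => g) (fun x => x)); cts. Qed.

Ltac cts_step2 :=
  match goal with
  | |- cont (fun u => cv (@?F u) (@?G u) (@?X u)) => apply (cont_cv F G X); cbv beta
  | |- cont (cv ?f ?g) => apply (cv_cont f g)
  | |- cont (fun u => (@?f u, @?g u)) => apply (cont_pair f g); cbv beta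
  | _ => cts_step
  end.
Ltac cts ::= repeat cts_step2.

Section Conv.
Context {M : star_alg}.
Implicit Types f g h : R -> M.

Lemma cv_0 f g : cv f g 0 = nul.
Proof. exact: RInt_nul. Qed.

Lemma cv_ext f f' g g' x :
  (forall t, Rmin 0 x <= t <= Rmax 0 x -> f t = f' t) -> (forall t, Rmin 0 x <= t <= Rmax 0 x -> g t = g' t) ->
  cv f g x = cv f' g' x.
Proof.
move=> hf hg; apply: RInt_ext => t ht.
have -> : g t = g' t by apply: hg; lra.
have -> : f (x - t) = f' (x - t); last by [].
by apply: hf; move: ht; rewrite /Rmin /Rmax; case: Rle_dec; lra.
Qed.

Lemma cv_flip f g x : cont f -> cont g -> cv f g x = RInt (fun t => mul (f t) (g (x - t))) 0 x.
Proof.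
move=> cf cg.
have := RInt_sum_minus (fun t => mul (f t) (g (x - t))) x x ltac:(cts).
rewrite Rminus_diag => <-; apply: RInt_ext => t _; congr (mul _ (g _)); ring.
Qed.

Lemma cv_one_r f x : cont f -> cv f (fun _ => one) x = RInt f 0 x.
Proof.
by move=> cf; rewrite cv_flip //; [apply: RInt_ext => t _; rewrite mul1r | cts].
Qed.

Lemma cv_one_l f x : cont f -> cv (fun _ => one) f x = RInt f 0 x.
Proof. by move=> cf; apply: RInt_ext => t _; rewrite mul1l. Qed.

Lemma cv_assoc f g h x : cont f -> cont g -> cont h -> cv (cv f g) h x = cv f (cv g h) x.
Proof.
move=> cf cg ch; have cfg := cv_cont f g cf cg; have cgh := cv_cont g h cg ch.
have -> : cv f (cv g h) x = RInt (fun r => RInt (fun t => mul (f (x - r)) (mul (g (r - t)) (h t))) 0 r) 0 x.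
  apply: RInt_ext => r _; rewrite -RInt_mulc //; cts.
rewrite (Fubini_tri (fun r t => mul (f (x - r)) (mul (g (r - t)) (h t)))); last by cts.
apply: RInt_ext => t _; rewrite /cv -RInt_cmul; last by cts.
have := RInt_shift (fun r => mul (f (x - r)) (mul (g (r - t)) (h t))) t 0 (x - t) ltac:(cts).
have -> : 0 + t = t by ring.
have -> : x - t + t = x by ring.
move=> <-; apply: RInt_ext => s _; rewrite mulA; congr (mul (f _) (mul (g _) _)); ring.
Qed.

Lemma cv_add_l f f' g x : cont f -> cont f' -> cont g ->
  cv (fun t => add (f t) (f' t)) g x = add (cv f g x) (cv f' g x).
Proof. move=> a b c; rewrite /cv -RInt_add; try by cts. by apply: RInt_ext => t _; dist. Qed.
Lemma cv_add_r f g g' x : cont f -> cont g -> cont g' ->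
  cv f (fun t => add (g t) (g' t)) x = add (cv f g x) (cv f g' x).
Proof. move=> a b c; rewrite /cv -RInt_add; try by cts. by apply: RInt_ext => t _; dist. Qed.
Lemma cv_sub_l f f' g x : cont f -> cont f' -> cont g ->
  cv (fun t => sub (f t) (f' t)) g x = sub (cv f g x) (cv f' g x).
Proof. move=> a b c; rewrite /cv -RInt_sub; try by cts. by apply: RInt_ext => t _; dist. Qed.
Lemma cv_sub_r f g g' x : cont f -> cont g -> cont g' ->
  cv f (fun t => sub (g t) (g' t)) x = sub (cv f g x) (cv f g' x).
Proof. move=> a b c; rewrite /cv -RInt_sub; try by cts. by apply: RInt_ext => t _; dist. Qed.
Lemma cv_neg_r f g x : cont f -> cont g -> cv f (fun t => neg (g t)) x = neg (cv f g x).
Proof. move=> a b; rewrite /cv -RInt_neg; last by cts. by apply: RInt_ext => t _; dist. Qed.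
Lemma cv_neg_l f g x : cont f -> cont g -> cv (fun t => neg (f t)) g x = neg (cv f g x).
Proof. move=> a b; rewrite /cv -RInt_neg; last by cts. by apply: RInt_ext => t _; dist. Qed.
Lemma cv_mul_l c f g x : cont f -> cont g -> cv (fun t => mul c (f t)) g x = mul c (cv f g x).
Proof. move=> a b; rewrite /cv -RInt_mulc; last by cts. by apply: RInt_ext => t _; dist. Qed.
Lemma cv_mul_r c f g x : cont f -> cont g -> cv f (fun t => mul (g t) c) x = mul (cv f g x) c.
Proof. move=> a b; rewrite /cv -RInt_cmul; last by cts. by apply: RInt_ext => t _; dist. Qed.

Lemma cv_D f f' g x : (forall x, is_derive f x (f' x)) -> cont f' -> cont g ->
  is_derive (cv f g) x (add (mul (f 0) (g x)) (cv f' g x)).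
Proof.
move=> hf cf' cg.
have cf : cont f by move=> y; exact: D_cont (hf y).
have := Leibniz (fun x t => mul (f (x - t)) (g t)) (fun x t => mul (f' (x - t)) (g t)) (fun _ => 0) (fun x => x) x 0 1.
rewrite Rminus_diag scal_zero_l scal_one => H.
have -> : add (mul (f 0) (g x)) (cv f' g x) = add (cv f' g x) (sub (mul (f 0) (g x)) nul) by vec.
apply: H.
- move=> s t; apply: D_cmul.
  have -> : f' (s - t) = rs 1 (f' (s - t)) by vec.
  apply: (D_comp f (fun s => s - t)) => //.
  by auto_derive.
- cts.
- cts.
- exact: (is_derive_const (V := R_NormedModule)).
- exact: is_derive_id.
Qed.

Lemma cv_Dparam (F Fs G Gs : R -> R -> M) x s :
  (forall s t, is_derive (fun s => F s t) s (Fs s t)) -> (forall s t, is_derive (fun s => G s t) s (Gs s t)) ->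
  c2 F -> c2 Fs -> c2 G -> c2 Gs ->
  is_derive (fun s => cv (F s) (G s) x) s (add (cv (Fs s) (G s) x) (cv (F s) (Gs s) x)).
Proof.
move=> hF hG cF cFs cG cGs.
rewrite /cv -RInt_add; try by cts.
apply: (deriv_param (fun s t => mul (F s (x - t)) (G s t))
  (fun s t => add (mul (Fs s (x - t)) (G s t)) (mul (F s (x - t)) (Gs s t)))).
- by move=> s' t; apply: D_mul.
- cts.
- cts.
Qed.

Lemma cv_bound f g x K : cont f -> cont g ->
  (forall t, Rmin 0 x <= t <= Rmax 0 x -> nm (f (x - t)) * nm (g t) <= K) -> nm (cv f g x) <= Rabs x * K.
Proof.
move=> cf cg H; have -> : Rabs x = Rabs (x - 0) by rewrite Rminus_0_r.
apply: nm_RInt_const; first by cts.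
move=> t ht; apply: Rle_trans (nm_mul _ _) (H t ht).
Qed.

End Conv.

(** The integral term of the equation, with [a s] in place of [A 0 s]. The two agree in a [flow];
    keeping [a] separate makes it the datum of a Goursat problem. *)
Definition Qf {M : star_alg} (a : R -> M) (A : R -> R -> M) (y s : R) : M :=
  cv (fun t => A t s) (fun t => mul (adj (a s)) (A t s)) y.

(* [A] solves the integro-differential equation with boundary values [a]; [B] stands for A_x. *)
Record flow {M : star_alg} (a : R -> M) (A B : R -> R -> M) : Prop := {
  fl_a : cont a;
  fl_A : c2 A;
  fl_B : c2 B;
  fl_0 : forall l, A 0 l = a l;
  fl_x : forall x l, is_derive (fun x => A x l) x (B x l);
  fl_l : forall x l, is_derive (A x) l (add (B x l) (Qf a A x l))
}.

Lemma locally_size (p : R * R) :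
  locally p (fun q => Rabs (fst q) + Rabs (snd q) <= Rabs (fst p) + Rabs (snd p) + 1).
Proof.
have h : 0 < 1 / 2 by lra.
exists (mkposreal _ h) => q [h1 h2].
have e (x y : R) : ball x (1 / 2) y -> Rabs y <= Rabs x + 1 / 2.
  rewrite /ball /= /AbsRing_ball /abs /minus /plus /opp /= => h3.
  have -> : y = x + (y + - x) by ring.
  apply: Rle_trans (Rabs_triang _ _) _; lra.
have a1 : Rabs (fst q) <= Rabs (fst p) + 1 / 2 by apply: e.
have a2 : Rabs (snd q) <= Rabs (snd p) + 1 / 2 by apply: e.
lra.
Qed.

Section Goursat.
Context {M : star_alg} (a a' : R -> M).
Hypothesis ca : cont a.
Hypothesis ca' : cont a'.
Hypothesis Da : forall x, is_derive a x (a' x).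

(* Integrating the equation along the characteristics x + l = const and differentiating in x gives B = [goursat_map B] for
   B = A_x; [goursat_A B] is then A, and [goursat_R B] the x-derivative of the quadratic term. *)
Definition goursat_A (B : R * R -> M) (x l : R) : M := add (a l) (RInt (fun t => B (t, l)) 0 x).
Definition goursat_R (B : R * R -> M) (y s : R) : M :=
  add (mul (a s) (mul (adj (a s)) (goursat_A B y s)))
      (cv (fun t => B (t, s)) (fun t => mul (adj (a s)) (goursat_A B t s)) y).
Definition goursat_map (B : R * R -> M) (p : R * R) : M :=
  sub (a' (fst p + snd p)) (RInt (fun s => goursat_R B (fst p + snd p - s) s) (snd p) (fst p + snd p)).

Lemma c2_pair (B : R * R -> M) : cont B -> c2 (fun x l => B (x, l)).
Proof. by move=> cB; apply: (cont_ext B) => // -[]. Qed.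

Lemma c2_Aof B : cont B -> c2 (goursat_A B).
Proof. move=> /c2_pair cB; rewrite /goursat_A; set b := fun x l => B (x, l) in cB *; change (c2 (fun x l => add (a l) (RInt (fun t => b t l) 0 x))); cts. Qed.

Lemma c2_Rof B : cont B -> c2 (goursat_R B).
Proof.
move=> cB; have cA := c2_Aof B cB; move: cB => /c2_pair cB.
set b := fun x l => B (x, l) in cB *.
change (c2 (fun y s => add (mul (a s) (mul (adj (a s)) (goursat_A B y s)))
   (cv (fun t => b t s) (fun t => mul (adj (a s)) (goursat_A B t s)) y))).
cts.
Qed.

Lemma c2_Gth B : cont B -> cont (goursat_map B).
Proof. move=> cB; have cR := c2_Rof B cB; rewrite /goursat_map; cts. Qed.

(** The piece of the characteristic between (y, l) and the axis x = 0 stays in the domain of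
    dependence: on it neither |x| nor |x| + |l| exceeds its value at (y, l). *)
Lemma absdiff_sum y s l : Rmin l (y + l) <= s <= Rmax l (y + l) ->
  Rabs (y + l - s) <= Rabs y /\ Rabs (y + l - s) + Rabs s <= Rabs y + Rabs l.
Proof.
rewrite /Rmin /Rmax; case: Rle_dec => h; rewrite /Rabs; repeat case: Rcase_abs; lra.
Qed.

Lemma abs_between t y : Rmin 0 y <= t <= Rmax 0 y ->
  Rabs t <= Rabs y /\ Rabs (y - t) + Rabs t = Rabs y.
Proof.
rewrite /Rmin /Rmax; case: Rle_dec => h; rewrite /Rabs; repeat case: Rcase_abs; lra.
Qed.

Section Est.
Variables (k Lp : R).
Hypothesis hk : 1 <= k.
Hypothesis ha : forall s, Rabs s <= Lp -> nm (a s) <= k.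

Lemma Aof_bound B kap X x l : cont B -> 0 < kap -> Rabs x <= X -> X + Rabs l <= Lp -> 0 <= X ->
  (forall t, Rabs t <= X -> nm (B (t, l)) <= 2 * k * exp (kap * Rabs t)) -> 1 <= kap ->
  nm (goursat_A B x l) <= 3 * k * exp (kap * Rabs x).
Proof.
move=> /c2_pair cB hkap hx hXl hX hB h1; apply: Rle_trans (nm_add _ _) _.
have e1 : nm (a l) <= k by apply: ha; lra.
have cb : cont (fun t => B (t, l)) by exact: (c2_1 (fun x l => B (x, l))).
have e2 : nm (RInt (fun t => B (t, l)) 0 x) <= 2 * k / kap * exp (kap * Rabs (x - 0)).
  apply: RInt_exp_bound => // s hs; rewrite Rminus_0_r.
  by apply: hB; have := abs_between s x hs; lra.
rewrite Rminus_0_r in e2.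
have e3 : 2 * k / kap <= 2 * k.
  apply: (Rmult_le_reg_r kap) => //; rewrite /Rdiv Rmult_assoc Rinv_l; [nra | lra].
have e4 : 1 <= exp (kap * Rabs x).
  rewrite -exp_0; apply: exp_mono; apply: Rmult_le_pos; [lra | exact: Rabs_pos].
have e5 := Rmult_le_compat_r (exp (kap * Rabs x)) _ _ ltac:(lra) e3.
nra.
Qed.

(** Convolution respects exponential bounds: since |y - t| + |t| = |y|, two bounds with the same
    rate multiply to [exp (kap |y|)], and integration costs only a factor |y| <= [Lp]. Hence the
    quadratic term stays in the same exponential class as B. *)
Lemma Rof_bound B kap X y s : cont B -> 0 < kap -> Rabs y <= X -> X + Rabs s <= Lp -> 0 <= X ->
  (forall t, Rabs t <= X -> nm (B (t, s)) <= 2 * k * exp (kap * Rabs t)) -> 1 <= kap ->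
  nm (goursat_R B y s) <= 3 * k ^ 3 * (1 + 2 * Lp) * exp (kap * Rabs y).
Proof.
move=> cB hkap hy hXs hX hB h1; apply: Rle_trans (nm_add _ _) _.
have as_ : nm (a s) <= k by apply: ha; have := Rabs_pos s; lra.
have pas := nm_ge0 (a s).
have E0 := exp_pos (kap * Rabs y).
have e1 : nm (mul (a s) (mul (adj (a s)) (goursat_A B y s))) <= k * (k * (3 * k * exp (kap * Rabs y))).
  apply: Rle_trans (nm_mul _ _) _; apply: Rmult_le_compat => //; try exact: nm_ge0.
  apply: Rle_trans (nm_mul _ _) _; rewrite nm_adj; apply: Rmult_le_compat => //; try exact: nm_ge0.
  exact: (Aof_bound B kap X).
have cA := c2_Aof B cB; have cB2 := c2_pair B cB.
have e2 : nm (cv (fun t => B (t, s)) (fun t => mul (adj (a s)) (goursat_A B t s)) y) <=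
   Rabs y * (6 * k ^ 3 * exp (kap * Rabs y)).
  apply: cv_bound.
  - exact: (c2_1 (fun x l => B (x, l))).
  - cts.
  - move=> t ht; have [h2 h3] := abs_between t y ht.
    have -> : 6 * k ^ 3 * exp (kap * Rabs y) = (2 * k * exp (kap * Rabs (y - t))) * (k * (3 * k * exp (kap * Rabs t))).
      by rewrite -h3 Rmult_plus_distr_l exp_plus; ring.
    apply: Rmult_le_compat; try exact: nm_ge0.
      by apply: hB; have := Rabs_pos t; lra.
    apply: Rle_trans (nm_mul _ _) _; rewrite nm_adj; apply: Rmult_le_compat => //; try exact: nm_ge0.
    by apply: (Aof_bound B kap X) => //; lra.
have e3 : Rabs y * (6 * k ^ 3 * exp (kap * Rabs y)) <= Lp * (6 * k ^ 3 * exp (kap * Rabs y)).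
  apply: Rmult_le_compat_r; last by have := Rabs_pos s; lra.
  have : 0 <= k ^ 3 by apply: pow_le; lra.
  nra.
lra.
Qed.

Lemma Aof_diff B B' c kap X W x l : cont B -> cont B' -> 0 < kap -> 0 <= c -> Rabs x <= X -> 0 <= X ->
  X + Rabs l <= Lp ->
  (forall t, Rabs t <= X -> nm (B (t, l)) <= W) ->
  (forall t, Rabs t <= X -> nm (sub (B (t, l)) (B' (t, l))) <= c * exp (kap * Rabs t)) ->
  nm (goursat_A B x l) <= k + Lp * W /\ nm (sub (goursat_A B x l) (goursat_A B' x l)) <= Lp * (c * exp (kap * Rabs x)).
Proof.
move=> /c2_pair cB /c2_pair cB' hkap hc hx hX hXl hB hd.
have pl := Rabs_pos l; have px := Rabs_pos x.
have cb : cont (fun t => B (t, l)) by exact: (c2_1 (fun x l => B (x, l))).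
have cb' : cont (fun t => B' (t, l)) by exact: (c2_1 (fun x l => B' (x, l))).
have W0 : 0 <= W by have := hB x hx; have := nm_ge0 (B (x, l)); lra.
split.
  apply: Rle_trans (nm_add _ _) _; apply: Rplus_le_compat; first by apply: ha; lra.
  apply: Rle_trans (_ : Rabs (x - 0) * W <= _).
    apply: nm_RInt_const => // t ht; apply: hB; have := abs_between t x ht; lra.
  rewrite Rminus_0_r; apply: Rmult_le_compat_r => //; lra.
have -> : sub (goursat_A B x l) (goursat_A B' x l) = RInt (fun t => sub (B (t, l)) (B' (t, l))) 0 x.
  by rewrite RInt_sub // /goursat_A; vec.
apply: Rle_trans (_ : Rabs (x - 0) * (c * exp (kap * Rabs x)) <= _).
  apply: nm_RInt_const; first by cts.
  move=> t ht; have [h1 h2] := abs_between t x ht.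
  apply: Rle_trans (hd t _) _; first lra.
  apply: Rmult_le_compat_l => //; apply: exp_mono; apply: Rmult_le_compat_l => //; lra.
rewrite Rminus_0_r; apply: Rmult_le_compat_r; last lra.
apply: Rmult_le_pos => //; apply: Rlt_le; exact: exp_pos.
Qed.

(** Each term of the expansion contains exactly one difference; the constant is a Lipschitz constant
    of the quadratic expression on the ball of radius [W]. *)
Lemma Rof_diff B B' c kap X W y s : cont B -> cont B' -> 0 < kap -> 0 <= c -> Rabs y <= X -> 0 <= X ->
  X + Rabs s <= Lp -> 0 <= W ->
  (forall t, Rabs t <= X -> nm (B (t, s)) <= W) ->
  (forall t, Rabs t <= X -> nm (B' (t, s)) <= W) ->
  (forall t, Rabs t <= X -> nm (sub (B (t, s)) (B' (t, s))) <= c * exp (kap * Rabs t)) ->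
  nm (sub (goursat_R B y s) (goursat_R B' y s)) <= (k * (k * Lp) + Lp * k * (k + 2 * Lp * W)) * (c * exp (kap * Rabs y)).
Proof.
move=> cB cB' hkap hc hy hX hXs W0 hB hB' hd.
have ps := Rabs_pos s; have py := Rabs_pos y.
have cA := c2_Aof B cB; have cA' := c2_Aof B' cB'.
have cb2 := c2_pair B cB; have cb2' := c2_pair B' cB'.
have cb : cont (fun t => B (t, s)) by exact: (c2_1 (fun x l => B (x, l))).
have cb' : cont (fun t => B' (t, s)) by exact: (c2_1 (fun x l => B' (x, l))).
have as_ : nm (a s) <= k by apply: ha; lra.
have pas := nm_ge0 (a s).
have hA t : Rabs t <= X -> nm (goursat_A B t s) <= k + Lp * W /\
    nm (sub (goursat_A B t s) (goursat_A B' t s)) <= Lp * (c * exp (kap * Rabs t)).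
  by move=> ht; apply: (Aof_diff B B' c kap X).
have -> : sub (goursat_R B y s) (goursat_R B' y s) =
  add (mul (a s) (mul (adj (a s)) (sub (goursat_A B y s) (goursat_A B' y s))))
    (add (cv (fun t => sub (B (t, s)) (B' (t, s))) (fun t => mul (adj (a s)) (goursat_A B t s)) y)
         (cv (fun t => B' (t, s)) (fun t => mul (adj (a s)) (sub (goursat_A B t s) (goursat_A B' t s))) y)).
  have -> : cv (fun t => B' (t, s)) (fun t => mul (adj (a s)) (sub (goursat_A B t s) (goursat_A B' t s))) y =
    cv (fun t => B' (t, s)) (fun t => sub (mul (adj (a s)) (goursat_A B t s)) (mul (adj (a s)) (goursat_A B' t s))) y.
    by apply: cv_ext => // t _; dist.
  rewrite cv_sub_l // ?cv_sub_r //; try by cts.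
  by rewrite /goursat_R; dist; vec.
set E := c * exp (kap * Rabs y).
have E0 : 0 <= E by apply: Rmult_le_pos => //; apply: Rlt_le; exact: exp_pos.
have hE t : Rabs t <= Rabs y -> c * exp (kap * Rabs t) <= E.
  move=> h; apply: Rmult_le_compat_l => //; apply: exp_mono; apply: Rmult_le_compat_l => //; lra.
have e1 : nm (mul (a s) (mul (adj (a s)) (sub (goursat_A B y s) (goursat_A B' y s)))) <= k * (k * (Lp * E)).
  apply: Rle_trans (nm_mul _ _) _; apply: Rmult_le_compat => //; try exact: nm_ge0.
  apply: Rle_trans (nm_mul _ _) _; rewrite nm_adj; apply: Rmult_le_compat => //; try exact: nm_ge0.
  by apply: (proj2 (hA y hy)).
have e2 : nm (cv (fun t => sub (B (t, s)) (B' (t, s))) (fun t => mul (adj (a s)) (goursat_A B t s)) y) <=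
   Rabs y * (E * (k * (k + Lp * W))).
  apply: cv_bound; try by cts.
  move=> t ht; have [h2 h3] := abs_between t y ht; have pt := Rabs_pos t.
  apply: Rmult_le_compat; try exact: nm_ge0.
    apply: Rle_trans (hd (y - t) _) _; first lra.
    apply: hE; lra.
  apply: Rle_trans (nm_mul _ _) _; rewrite nm_adj; apply: Rmult_le_compat => //; try exact: nm_ge0.
  by apply: (proj1 (hA t _)); lra.
have e3 : nm (cv (fun t => B' (t, s)) (fun t => mul (adj (a s)) (sub (goursat_A B t s) (goursat_A B' t s))) y) <=
   Rabs y * (W * (k * (Lp * E))).
  apply: cv_bound; try by cts.
  move=> t ht; have [h2 h3] := abs_between t y ht; have pt := Rabs_pos t.
  have := Rabs_pos (y - t) => pyt.
  apply: Rmult_le_compat; try exact: nm_ge0.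
    by apply: hB'; lra.
  apply: Rle_trans (nm_mul _ _) _; rewrite nm_adj; apply: Rmult_le_compat => //; try exact: nm_ge0.
  apply: Rle_trans (proj2 (hA t _)) _; first lra.
  by apply: Rmult_le_compat_l; [lra | apply: hE].
apply: Rle_trans (nm_add _ _) _.
apply: Rle_trans (Rplus_le_compat_l _ _ _ (nm_add _ _)) _.
have p1 : 0 <= E * (k * (k + Lp * W)).
  apply: Rmult_le_pos => //; apply: Rmult_le_pos; first lra.
  have : 0 <= Lp * W by apply: Rmult_le_pos; lra.
  lra.
have p2 : 0 <= W * (k * (Lp * E)).
  apply: Rmult_le_pos => //; apply: Rmult_le_pos; first lra.
  by apply: Rmult_le_pos; lra.
have q1 := Rmult_le_compat_r _ (Rabs y) Lp p1 ltac:(lra).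
have q2 := Rmult_le_compat_r _ (Rabs y) Lp p2 ltac:(lra).
have -> : (k * (k * Lp) + Lp * k * (k + 2 * Lp * W)) * E = k * (k * (Lp * E)) +
   (Lp * (E * (k * (k + Lp * W))) + Lp * (W * (k * (Lp * E)))) by ring.
lra.
Qed.

End Est.
End Goursat.

(** * Global existence for the Goursat problem *)

Definition mono_nonneg (f : R -> R) : Prop := (forall x y, x <= y -> f x <= f y) /\ forall x, 0 <= f x.

Lemma mp_const c : 0 <= c -> mono_nonneg (fun _ => c).
Proof. by move=> hc; split => // *; apply: Rle_refl. Qed.
Lemma mp_max : mono_nonneg (Rmax 0).
Proof. split => [x y h | x]; last exact: Rmax_l. by apply: Rle_max_compat_l. Qed.
Lemma mp_plus f g : mono_nonneg f -> mono_nonneg g -> mono_nonneg (fun x => f x + g x).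
Proof.
move=> [f1 f2] [g1 g2]; split => [x y h | x].
  by apply: Rplus_le_compat; auto.
by have := f2 x; have := g2 x; lra.
Qed.
Lemma mp_mult f g : mono_nonneg f -> mono_nonneg g -> mono_nonneg (fun x => f x * g x).
Proof.
move=> [f1 f2] [g1 g2]; split => [x y h | x].
  by apply: Rmult_le_compat; auto.
exact: Rmult_le_pos.
Qed.
Lemma mp_exp f : mono_nonneg f -> mono_nonneg (fun x => exp (f x)).
Proof.
move=> [f1 f2]; split => [x y h | x]; first by apply: exp_mono; auto.
apply: Rlt_le; exact: exp_pos.
Qed.
Lemma mp_pow f n : mono_nonneg f -> mono_nonneg (fun x => f x ^ n).
Proof. move=> hf; elim: n => [|n IH] /=; [apply: mp_const; lra | exact: mp_mult]. Qed.

Ltac mono_tac := repeat match goal with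
  | |- mono_nonneg (fun x => (@?f x) + (@?g x)) => apply (mp_plus f g); cbv beta
  | |- mono_nonneg (fun x => (@?f x) * (@?g x)) => apply (mp_mult f g); cbv beta
  | |- mono_nonneg (fun x => exp (@?f x)) => apply (mp_exp f); cbv beta
  | |- mono_nonneg (fun x => (@?f x) ^ ?n) => apply (mp_pow f n); cbv beta
  | |- mono_nonneg (fun x => Rmax 0 x) => exact mp_max
  | |- mono_nonneg (fun _ => ?c) => apply mp_const; lra
  | H : mono_nonneg ?f |- mono_nonneg (fun x => ?f x) => exact H
  end.

Lemma bound_1 {M : star_alg} (f : R -> M) : cont f ->
  exists k, mono_nonneg k /\ (forall x, 1 <= k x) /\ forall L s, Rabs s <= L -> nm (f s) <= k L.
Proof.
move=> cf.
have [k [k1 [k2 k3]]] := bound_fun (V := car M) (fun p : R * R => f (fst p)) ltac:(cts).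
exists k; split; last split => //.
  by split => // x; have := k2 x; lra.
move=> L s hs; apply: Rle_trans (k3 (s, 0)) _ => /=; apply: k1; rewrite Rabs_R0; lra.
Qed.

Lemma bound_2 {M : star_alg} (f : R -> R -> M) : c2 f ->
  exists k, mono_nonneg k /\ (forall x, 1 <= k x) /\ forall L x y, Rabs x + Rabs y <= L -> nm (f x y) <= k L.
Proof.
move=> cf.
have [k [k1 [k2 k3]]] := bound_fun (V := car M) (fun p : R * R => f (fst p) (snd p)) ltac:(cts).
exists k; split; last split => //.
  by split => // x; have := k2 x; lra.
move=> L x y h; apply: Rle_trans (k3 (x, y)) _ => /=; exact: k1.
Qed.

Section GoursatExistence.
Context {M : star_alg} (a a' : R -> M).
Hypothesis ca : cont a.
Hypothesis ca' : cont a'.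
Hypothesis Da : forall x, is_derive a x (a' x).

(** The nonlinearity is quadratic, yet the solution is global. The bound [2 k exp (kap |x|)] is
    stable under convolution up to a constant, and the integration along characteristics gains
    [1 / kap]; for [kap] large compared with k^2 (1 + 2 L) the bound is invariant. On the class it
    defines the map is Lipschitz, and [volterra_fix] applies. *)
Lemma goursat_fix : exists B : R * R -> M, cont B /\ forall p, goursat_map a a' B p = B p.
Proof.
have [k1 [mk1 [k11 hk1]]] := bound_1 a ca.
have [k2 [mk2 [k21 hk2]]] := bound_1 a' ca'.
pose k x := k1 x + k2 x.
have mk : mono_nonneg k by rewrite /k; mono_tac.
have kge x : 1 <= k x by rewrite /k; have := k11 x; have := k21 x; lra.
have ha L s : Rabs s <= L -> nm (a s) <= k L.
  by move=> h; have := hk1 L s h; have := k21 L; rewrite /k; lra.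
have ha' L s : Rabs s <= L -> nm (a' s) <= k L.
  by move=> h; have := hk2 L s h; have := k11 L; rewrite /k; lra.
(* Chosen so that [3 k^3 (1 + 2 L) / kap <= k]; together with the bound [k] on a' this reproduces
   [2 k exp (kap |x|)]. *)
pose kap x := 1 + 3 * (1 + 2 * Rmax 0 x) * (k x) ^ 2.
have mkap : mono_nonneg kap by rewrite /kap; mono_tac.
have kap1 x : 1 <= kap x.
  rewrite /kap; have := Rmax_l 0 x; have : 0 <= k x ^ 2 by exact: pow2_ge_0.
  nra.
pose K x := 2 * k x * exp (kap x * Rmax 0 x).
have mK : mono_nonneg K by rewrite /K; mono_tac.
pose C x := 1 + (k x * (k x * Rmax 0 x) + Rmax 0 x * k x * (k x + 2 * Rmax 0 x * K x)).
have mC : mono_nonneg C by rewrite /C; mono_tac.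
pose S (p : R * R) (v : M) := nm v <= 2 * k (Rabs (fst p) + Rabs (snd p)) *
   exp (kap (Rabs (fst p) + Rabs (snd p)) * Rabs (fst p)).
pose tau (p : R * R) := Rabs (fst p).
pose L (p : R * R) := Rabs (fst p) + Rabs (snd p).
have L0 p : 0 <= L p by rewrite /L; have := Rabs_pos (fst p); have := Rabs_pos (snd p); lra.
have LM p : Rmax 0 (L p) = L p by exact: Rmax_right.
have SK p v : S p v -> nm v <= K (L p).
  move=> h; apply: Rle_trans h _; rewrite /K LM; apply: Rmult_le_compat_l.
    have := kge (Rabs (fst p) + Rabs (snd p)); lra.
  apply: exp_mono; apply: Rmult_le_compat_l; first by have := kap1 (L p); rewrite /L; lra.
  rewrite /L; have := Rabs_pos (snd p); lra.
have Smon B p X t s : (forall p, S p (B p)) -> Rabs t <= X -> X + Rabs s <= L p ->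
    nm (B (t, s)) <= 2 * k (L p) * exp (kap (L p) * Rabs t).
  move=> hS ht hX; apply: Rle_trans (hS (t, s)) _ => /=.
  have h : Rabs t + Rabs s <= L p by lra.
  apply: Rmult_le_compat.
  - have := kge (Rabs t + Rabs s); lra.
  - apply: Rlt_le; exact: exp_pos.
  - have := proj1 mk _ _ h; lra.
  - apply: exp_mono; apply: Rmult_le_compat_r; [exact: Rabs_pos | exact: (proj1 mkap)].
have SG B p : cont B -> (forall p, S p (B p)) -> S p (goursat_map a a' B p).
  move=> cB hS; case: p => x l; rewrite /S /goursat_map /=.
  set Lp := Rabs x + Rabs l.
  have eL : L (x, l) = Lp by [].
  have cR := c2_Rof a ca B cB.
  have kp := kge Lp; have kk := kap1 Lp.
  have Lp0 : 0 <= Lp by rewrite -eL.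
  have h2 : nm (a' (x + l)) <= k Lp by apply: ha'; exact: Rabs_triang.
  set I := RInt _ _ _.
  have h3 : nm I <= 3 * k Lp ^ 3 * (1 + 2 * Lp) / kap Lp * exp (kap Lp * Rabs x).
    rewrite /I /nm norm_RInt_swap; last by cts.
    have -> : Rabs x = Rabs (l - (x + l)) by rewrite -Rabs_Ropp; congr Rabs; ring.
    apply: RInt_exp_bound; [by cts | lra |].
    move=> s hs; rewrite -(Rabs_Ropp (s - (x + l))).
    have -> : - (s - (x + l)) = x + l - s by ring.
    rewrite Rmin_comm Rmax_comm in hs.
    have [q1 q2] := absdiff_sum x s l hs.
    apply: (Rof_bound a ca (k Lp) Lp kp (ha Lp) B (kap Lp) (Rabs (x + l - s))) => //; try lra.
    + exact: Rabs_pos.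
    + by move=> t ht; apply: (Smon B (x, l) (Rabs (x + l - s))).
  have e4 : 1 <= exp (kap Lp * Rabs x).
    rewrite -exp_0; apply: exp_mono; apply: Rmult_le_pos; [lra | exact: Rabs_pos].
  have h4 : 3 * k Lp ^ 3 * (1 + 2 * Lp) / kap Lp <= k Lp.
    apply: (Rmult_le_reg_r (kap Lp)); first lra.
    rewrite /Rdiv Rmult_assoc Rinv_l; last lra.
    rewrite /kap -{4}eL LM eL; nra.
  apply: Rle_trans (nm_sub _ _) _.
  have := Rmult_le_compat_r (exp (kap Lp * Rabs x)) _ _ ltac:(lra) h4.
  nra.
have cn : cont (fun _ : R * R => nul : M) by cts.
have Sn p : S p nul.
  rewrite /S nm_nul; apply: Rmult_le_pos; last by apply: Rlt_le; exact: exp_pos.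
  have := kge (Rabs (fst p) + Rabs (snd p)); lra.
have [B [cB [_ hB]]] : exists B : R * R -> M, cont B /\ (forall p, S p (B p)) /\ forall p, goursat_map a a' B p = B p;
  last by exists B.
apply: (volterra_fix tau L K C S _ (fun _ => nul)) => //.
- case=> x y; rewrite /tau /L /=; have := Rabs_pos x; have := Rabs_pos y; lra.
- exact: locally_size.
- exact: (proj1 mK).
- move=> x; rewrite /K; apply: Rmult_lt_0_compat; [have := kge x; lra | exact: exp_pos].
- exact: (proj1 mC).
- move=> x; have := proj2 mC x.
  have : 0 <= k x * (k x * Rmax 0 x) + Rmax 0 x * k x * (k x + 2 * Rmax 0 x * K x).
    have : mono_nonneg (fun x => k x * (k x * Rmax 0 x) + Rmax 0 x * k x * (k x + 2 * Rmax 0 x * K x)) by mono_tac.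
    by case.
  rewrite /C; lra.
- move=> p v h; rewrite /S; apply: le_epsilon => eps he.
  have [u [h1 h2]] := h eps he.
  rewrite /S in h1.
  have : nm v <= nm (sub u v) + nm u.
    rewrite nm_sub_sym; have -> : nm v = nm (add (sub v u) u) by congr nm; vec.
    exact: nm_add.
  have : nm (sub u v) < eps by exact: h2.
  lra.
- move=> p; rewrite -[norm _]/(nm (sub (goursat_map a a' (fun _ => nul) p) nul)).
  have -> : sub (goursat_map a a' (fun _ => nul) p) nul = goursat_map a a' (fun _ => nul) p by vec.
  by apply: SK; apply: SG.
- move=> B cB hS; split; first exact: c2_Gth.
  by move=> p; apply: SG.
- move=> B B' p k' c cB cB' hS hS' hk' hc hd.
  case: p hd => x l hd; rewrite /tau /L /= in hd; rewrite /L /=.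
  set Lp := Rabs x + Rabs l in hd *.
  have eL : L (x, l) = Lp by [].
  have cR := c2_Rof a ca B cB; have cR' := c2_Rof a ca B' cB'.
  have kp := kge Lp.
  have Lp0 : 0 <= Lp by rewrite -eL.
  have eM : Rmax 0 Lp = Lp by rewrite -eL LM.
  rewrite -[norm _]/(nm (sub (goursat_map a a' B (x, l)) (goursat_map a a' B' (x, l)))).
  have -> : sub (goursat_map a a' B (x, l)) (goursat_map a a' B' (x, l)) =
     RInt (fun s => sub (goursat_R a B' (x + l - s) s) (goursat_R a B (x + l - s) s)) l (x + l).
    rewrite RInt_sub; try by cts.
    by rewrite /goursat_map /=; vec.
  rewrite /nm norm_RInt_swap; last by cts.
  rewrite /tau /=.
  have -> : Rabs x = Rabs (l - (x + l)) by rewrite -Rabs_Ropp; congr Rabs; ring.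
  have -> : C Lp / k' * (c * exp (k' * Rabs (l - (x + l)))) = (C Lp * c) / k' * exp (k' * Rabs (l - (x + l))).
    by rewrite /Rdiv; ring.
  apply: RInt_exp_bound => //; first by cts.
  move=> s hs; rewrite -(Rabs_Ropp (s - (x + l))).
  have -> : - (s - (x + l)) = x + l - s by ring.
  rewrite Rmin_comm Rmax_comm in hs.
  have [q1 q2] := absdiff_sum x s l hs.
  rewrite -[norm _]/(nm (sub (goursat_R a B' (x + l - s) s) (goursat_R a B (x + l - s) s))) nm_sub_sym.
  have HW t : Rabs t <= Rabs (x + l - s) -> Rabs t + Rabs s <= Lp by rewrite /Lp; lra.
  have := Rof_diff a ca (k Lp) Lp kp (ha Lp) B B' c k' (Rabs (x + l - s)) (K Lp) (x + l - s) s cB cB' hk' hc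
    (Rle_refl _) (Rabs_pos _) q2 (proj2 mK Lp) _ _ _.
  have hKm (B1 : R * R -> M) t : (forall p, S p (B1 p)) -> Rabs t <= Rabs (x + l - s) -> nm (B1 (t, s)) <= K Lp.
    move=> hS1 ht; apply: Rle_trans (SK (t, s) _ (hS1 _)) _; apply: (proj1 mK); rewrite /L /=; exact: HW.
  move=> H; apply: Rle_trans (H _ _ _) _.
  + by move=> t ht; apply: hKm.
  + by move=> t ht; apply: hKm.
  + by move=> t ht; apply: (hd (t, s)) => /=; [lra | exact: HW].
  + rewrite (Rmult_assoc (C Lp)) /C eM; apply: Rmult_le_compat_r; last lra.
    apply: Rmult_le_pos => //; apply: Rlt_le; exact: exp_pos.
Qed.

(** The fixed point is B = A_x. Comparing x-derivatives shows that A satisfies the undifferentiated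
    characteristic relation [eA]; differentiating that relation in l produces both the
    differentiability in l and the equation. *)
Lemma goursat : exists A B : R -> R -> M, flow a A B.
Proof.
have [B0 [cB0 hB0]] := goursat_fix.
pose B x l := B0 (x, l); pose A := goursat_A a B0.
have cB : c2 B by exact: c2_pair.
have cA : c2 A by exact: c2_Aof.
have cR := c2_Rof a ca B0 cB0.
have A0 l : A 0 l = a l by rewrite /A /goursat_A RInt_nul; vec.
have DA x l : is_derive (fun x => A x l) x (B x l).
  have -> : B x l = add nul (B x l) by vec.
  apply: D_add; first exact: D_const.
  apply: (deriv_RInt (fun t => B t l)); exact: (c2_1 B).
have cQ : c2 (Qf a A) by rewrite /Qf; cts.
have DQ y s : is_derive (fun y => Qf a A y s) y (goursat_R a B0 y s).
  have := cv_D (fun t => A t s) (fun t => B t s) (fun t => mul (adj (a s)) (A t s)) y.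
  rewrite A0; apply; [by move=> t; exact: DA | by cts | by cts].
have Q0 s : Qf a A 0 s = nul by exact: cv_0.
(* The upper limit contributes the value of [Qf] at first argument 0, which vanishes. A constant
   [al] serves the x-derivative, [al = id] the l-derivative. *)
have DG (al be : R -> R) (c : R) x da db : (forall x, be x = x + c) ->
   is_derive al x da -> is_derive be x db ->
   is_derive (fun x => RInt (fun s => Qf a A (x + c - s) s) (al x) (be x)) x
     (sub (RInt (fun s => goursat_R a B0 (x + c - s) s) (al x) (be x)) (rs da (Qf a A (x + c - al x) (al x)))).
  move=> hbe ha hb.
  have := Leibniz (fun x s => Qf a A (x + c - s) s) (fun x s => goursat_R a B0 (x + c - s) s) al be x da db.
  move=> H.
  have -> : sub (RInt (fun s => goursat_R a B0 (x + c - s) s) (al x) (be x)) (rs da (Qf a A (x + c - al x) (al x))) =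
    add (RInt (fun s => goursat_R a B0 (x + c - s) s) (al x) (be x))
      (sub (rs db (Qf a A (x + c - be x) (be x))) (rs da (Qf a A (x + c - al x) (al x)))).
    have -> : x + c - be x = 0 by rewrite hbe; ring.
    by rewrite Q0; vec.
  apply: H => //; try by cts.
  move=> s t.
  have -> : goursat_R a B0 (s + c - t) t = rs 1 (goursat_R a B0 (s + c - t) t) by vec.
  apply: (D_comp (fun y => Qf a A y t) (fun s => s + c - t)); first exact: DQ.
  by auto_derive.
have DaC c x : is_derive (fun x => a (x + c)) x (a' (x + c)).
  have -> : a' (x + c) = rs 1 (a' (x + c)) by vec.
  apply: (D_comp a (fun x => x + c)) => //; by auto_derive.
have eB x l : B x l = sub (a' (x + l)) (RInt (fun s => goursat_R a B0 (x + l - s) s) l (x + l)).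
  by rewrite /B -hB0.
have eA x l : A x l = sub (a (x + l)) (RInt (fun s => Qf a A (x + l - s) s) l (x + l)).
  apply: (eq_of_deriv (fun x => A x l)
    (fun x => sub (a (x + l)) (RInt (fun s => Qf a A (x + l - s) s) l (x + l))) (fun x => B x l) 0 x).
  - by move=> y _; exact: DA.
  - move=> y _; rewrite eB; apply: D_sub; first exact: DaC.
    have := DG (fun _ => l) (fun x => x + l) l y 0 1.
    have -> : sub (RInt (fun s => goursat_R a B0 (y + l - s) s) l (y + l)) (rs 0 (Qf a A (y + l - l) l)) =
      RInt (fun s => goursat_R a B0 (y + l - s) s) l (y + l) by vec.
    apply => //; [exact: (is_derive_const (V := R_NormedModule)) | by auto_derive].
  - by rewrite A0 Rplus_0_l RInt_nul; vec.
exists A, B; split => // x l.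
apply: (is_derive_ext (fun l => sub (a (l + x)) (RInt (fun s => Qf a A (l + x - s) s) l (l + x)))).
  by move=> t; rewrite (Rplus_comm t x) -eA.
rewrite eB.
have -> : add (sub (a' (x + l)) (RInt (fun s => goursat_R a B0 (x + l - s) s) l (x + l))) (Qf a A x l) =
  sub (a' (l + x)) (sub (RInt (fun s => goursat_R a B0 (l + x - s) s) l (l + x)) (rs 1 (Qf a A (l + x - l) l))).
  rewrite (Rplus_comm l x); have -> : x + l - l = x by ring.
  by vec.
apply: D_sub; first exact: DaC.
apply: (DG (fun l => l) (fun l => l + x) x l 1 1) => //; [exact: is_derive_id | by auto_derive].
Qed.

End GoursatExistence.

(** * The energy identity *)

Lemma FTC_R (f df : R -> R) a b : (forall x, Rmin a b <= x <= Rmax a b -> is_derive f x (df x)) -> cont df ->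
  RInt df a b = f b - f a.
Proof. move=> h c; apply: is_RInt_unique; apply: is_RInt_derive => // x _; exact: c. Qed.

Lemma RInt_Rminus (f g : R -> R) a b : cont f -> cont g ->
  RInt (fun t => f t - g t) a b = RInt f a b - RInt g a b.
Proof. by move=> cf cg; apply: (RInt_minus f g); apply: exR. Qed.
Lemma RInt_Rplus (f g : R -> R) a b : cont f -> cont g ->
  RInt (fun t => f t + g t) a b = RInt f a b + RInt g a b.
Proof. by move=> cf cg; apply: (RInt_plus f g); apply: exR. Qed.
Lemma RInt_Rmult c (f : R -> R) a b : cont f -> RInt (fun t => c * f t) a b = c * RInt f a b.
Proof. by move=> cf; apply: (RInt_scal f); apply: exR. Qed.
Lemma RInt_Rcst c a b : RInt (fun _ : R => c) a b = (b - a) * c.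
Proof. exact: (RInt_const a b c). Qed.
Lemma RInt_Rle (f g : R -> R) a b : a <= b -> cont f -> cont g -> (forall x, a <= x <= b -> f x <= g x) ->
  RInt f a b <= RInt g a b.
Proof. by move=> h cf cg hfg; apply: RInt_le => //; try exact: exR; move=> x hx; apply: hfg; lra. Qed.
Lemma RInt_Rge0 (f : R -> R) a b : a <= b -> cont f -> (forall x, a <= x <= b -> 0 <= f x) -> 0 <= RInt f a b.
Proof.
move=> h cf hf; have := RInt_Rle (fun _ => 0) f a b h (cont_const 0) cf hf; rewrite RInt_Rcst; lra.
Qed.

Lemma Leibniz_upper (F Fx : R -> R -> R) c x :
  (forall s t, is_derive (fun x => F x t) s (Fx s t)) -> c2 F -> c2 Fx ->
  is_derive (fun x => RInt (F x) 0 (c - x)) x (RInt (Fx x) 0 (c - x) - F x (c - x)).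
Proof.
move=> hF cF cFx.
have hb : is_derive (fun x : R => c - x) x (-1) by auto_derive => //; ring.
have H := Leibniz (V := R_CompleteNormedModule) F Fx (fun _ => 0) (fun x => c - x) x 0 (-1) hF cF cFx
  (is_derive_const (V := R_NormedModule) 0 x) hb.
have e : plus (RInt (Fx x) 0 (c - x)) (minus (scal (-1) (F x (c - x))) (scal 0 (F x 0))) =
   RInt (Fx x) 0 (c - x) - F x (c - x) :> R.
  by rewrite /plus /minus /plus /opp /scal /= /mult /=; ring.
by move: H; rewrite [X in is_derive _ _ X]e.
Qed.

Section Energy.
Context {M : star_alg}.

Lemma D_nmsq_diff (f g : R -> M) x f' g' : is_derive f x f' -> is_derive g x g' ->
  is_derive (fun x => nm (f x) ^ 2 - nm (g x) ^ 2) x (2 * inner (f x) f' - 2 * inner (g x) g').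
Proof. move=> hf hg; apply: (is_derive_minus (V := R_NormedModule)); exact: D_nmsq. Qed.

(* Differentiate in x the integral of |P|^2 - |E|^2 over [0, x0 + T - x]. *)
Lemma energy (P E Px Ex Et : R -> R -> M) (b : R -> M) x0 T : 0 <= T ->
  c2 P -> c2 E -> c2 Px -> c2 Ex -> c2 Et ->
  (forall x t, is_derive (fun x => P x t) x (Px x t)) ->
  (forall x t, is_derive (fun x => E x t) x (Ex x t)) ->
  (forall x t, is_derive (E x) t (Et x t)) ->
  (forall x t, x0 <= x <= x0 + T -> 0 <= t <= x0 + T - x -> Px x t = neg (mul (adj (b x)) (E x t)) /\
      Ex x t = sub (Et x t) (mul (b x) (P x t))) ->
  RInt (fun t => nm (P x0 t) ^ 2 - nm (E x0 t) ^ 2) 0 T =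
  RInt (fun x => nm (P x (x0 + T - x)) ^ 2 - nm (E x 0) ^ 2) x0 (x0 + T).
Proof.
move=> hT cP cE cPx cEx cEt dPx dEx dEt H.
pose X := x0 + T.
pose J x := RInt (fun t => nm (P x t) ^ 2 - nm (E x t) ^ 2) 0 (X - x).
have hJ x : x0 <= x <= X -> is_derive J x (- (nm (P x (X - x)) ^ 2 - nm (E x 0) ^ 2)).
  move=> hx.
  have hL := Leibniz_upper (fun x t => nm (P x t) ^ 2 - nm (E x t) ^ 2)
    (fun x t => 2 * inner (P x t) (Px x t) - 2 * inner (E x t) (Ex x t)) X x.
  have -> : - (nm (P x (X - x)) ^ 2 - nm (E x 0) ^ 2) =
    RInt (fun t => 2 * inner (P x t) (Px x t) - 2 * inner (E x t) (Ex x t)) 0 (X - x) -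
    (nm (P x (X - x)) ^ 2 - nm (E x (X - x)) ^ 2).
    (* The coupling terms cancel because the two equations contain [b] and its adjoint; what remains
       is the t-derivative of -|E|^2. *)
    have -> : RInt (fun t => 2 * inner (P x t) (Px x t) - 2 * inner (E x t) (Ex x t)) 0 (X - x) =
       RInt (fun t => - (2 * inner (E x t) (Et x t))) 0 (X - x).
      apply: RInt_ext => t; rewrite Rmin_left ?Rmax_right; try lra; move=> ht.
      have [-> ->] := H x t hx ltac:(rewrite -/X; lra).
      rewrite !(inner_neg, inner_sub) (inner_sym _ (E x t) (mul (b x) (P x t))) inner_mul; lra.
    have := FTC_R (fun t => - nm (E x t) ^ 2) (fun t => - (2 * inner (E x t) (Et x t))) 0 (X - x).
    move=> ->; [lra | | by cts].
    move=> t _; apply: (is_derive_opp (V := R_NormedModule)); apply: D_nmsq; exact: dEt.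
  apply: hL; [| by cts | by cts].
  move=> s t; exact: (D_nmsq_diff (fun x => P x t) (fun x => E x t)).
have := FTC_R J (fun x => - (nm (P x (X - x)) ^ 2 - nm (E x 0) ^ 2)) x0 X.
rewrite Rmin_left ?Rmax_right; try by rewrite /X; lra.
move=> /(_ hJ ltac:(cts)).
have -> : RInt (fun x => - (nm (P x (X - x)) ^ 2 - nm (E x 0) ^ 2)) x0 X =
   - RInt (fun x => nm (P x (X - x)) ^ 2 - nm (E x 0) ^ 2) x0 X.
  by apply: RInt_opp; apply: exR; cts.
have -> : J X = 0 by rewrite /J Rminus_diag; exact: RInt_point.
have -> : J x0 = RInt (fun t => nm (P x0 t) ^ 2 - nm (E x0 t) ^ 2) 0 T.
  by rewrite /J /X; congr (RInt _ _ _); ring.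
rewrite -/X; lra.
Qed.

End Energy.

(** * Waves driven by a solution of the equation *)

Section Wave.
Context {M : star_alg}.

Lemma flow_shift (a : R -> M) A B c : flow a A B ->
  flow (fun l => a (l + c)) (fun x l => A x (l + c)) (fun x l => B x (l + c)).
Proof.
case=> ca cA cB h0 hx hl; split; try by cts.
move=> x l.
  have -> : add (B x (l + c)) (Qf (fun l => a (l + c)) (fun x l => A x (l + c)) x l) =
    rs 1 (add (B x (l + c)) (Qf a A x (l + c))) by rewrite /Qf; vec.
  apply: (D_comp (A x) (fun l => l + c)); first exact: hl.
  by auto_derive.
Qed.

(** The evolution variable x of the wave is the second variable of A. The value c = 0 is used to
    test the convolution with A, the value c = 1 to recover A itself as initial value of E when P
    starts from 0. *)
Definition wave_E (c : R) (A P : R -> R -> M) (x t : R) : M :=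
  add (rs c (A t x)) (cv (fun t => A t x) (P x) t).

Lemma c2_wE c A P : c2 A -> c2 P -> c2 (wave_E c A P).
Proof. move=> cA cP; rewrite /wave_E; cts. Qed.

(** An ordinary differential equation in x for functions of t. Its right side is linear and causal
    in t, so the integral equation is of Volterra type with causal variable |x| and size |x| +
    |t|. *)
Lemma ode_P (a : R -> M) A (c : R) (g : R -> M) : cont a -> c2 A -> cont g ->
  exists P, c2 P /\ (forall t, P 0 t = g t) /\
    forall x t, is_derive (fun x => P x t) x (neg (mul (adj (a x)) (wave_E c A P x t))).
Proof.
move=> ca cA cg.
have [k1 [mk1 [k11 hk1]]] := bound_1 a ca.
have [k2 [mk2 [k21 hk2]]] := bound_2 A cA.
pose Th (P : R * R -> M) (p : R * R) := sub (g (snd p)) (RInt (fun s => mul (adj (a s))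
   (wave_E c A (fun x t => P (x, t)) s (snd p))) 0 (fst p)).
have cTh P : cont P -> cont (Th P).
  move=> /c2_pair cP; rewrite /Th; set P' := fun x t => P (x, t) in cP *.
  have := c2_wE c A P' cA cP => cw; cts.
have [K [mK [K1 hK]]] := bound_2 (fun x t => Th (fun _ => nul) (x, t)) (c2_pair _ (cTh _ (cont_const _))).
pose C x := 1 + k1 x * k2 x * Rmax 0 x.
have mC : mono_nonneg C by rewrite /C; mono_tac.
have [P [cP [_ hP]]] : exists P : R * R -> M, cont P /\ (forall p : R * R, True) /\ forall p, Th P p = P p; last first.
  have cP2 := c2_pair P cP.
  have cw := c2_wE c A _ cA cP2.
  exists (fun x t => P (x, t)); split => //; split.
    by move=> t; have := hP (0, t); rewrite /Th /= RInt_nul => <-; vec.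
  move=> x t.
  apply: (is_derive_ext (fun x => sub (g t) (RInt (fun s => mul (adj (a s))
    (wave_E c A (fun x t => P (x, t)) s t)) 0 x))); first by move=> s; rewrite -[in RHS]hP.
  have -> : neg (mul (adj (a x)) (wave_E c A (fun x0 t0 => P (x0, t0)) x t)) =
    sub nul (mul (adj (a x)) (wave_E c A (fun x0 t0 => P (x0, t0)) x t)) by vec.
  apply: D_sub; first exact: D_const.
  apply: (deriv_RInt (fun s => mul (adj (a s)) (wave_E c A (fun x0 t0 => P (x0, t0)) s t))); cts.
apply: (volterra_fix (fun p => Rabs (fst p)) (fun p => Rabs (fst p) + Rabs (snd p)) K C (fun _ _ => True) Th (fun _ => nul)) => //.
- case=> x y /=; have := Rabs_pos x; have := Rabs_pos y; lra.
- exact: locally_size.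
- exact: (proj1 mK).
- move=> x; have := K1 x; lra.
- exact: (proj1 mC).
- move=> x; have : mono_nonneg (fun x => k1 x * k2 x * Rmax 0 x) by mono_tac.
  case=> _ /(_ x); rewrite /C; lra.
- by cts.
- case=> x t /=; rewrite -[norm _]/(nm (sub (Th (fun _ => nul) (x, t)) nul)).
  have -> : sub (Th (fun _ => nul) (x, t)) nul = Th (fun _ => nul) (x, t) by vec.
  by apply: hK; lra.
- move=> P cP _; split => //; exact: cTh.
- move=> P P' [x t] k' c0 cP cP' _ _ hk' hc /= hd.
  have cP2 := c2_pair P cP; have cP2' := c2_pair P' cP'.
  have cw := c2_wE c A _ cA cP2; have cw' := c2_wE c A _ cA cP2'.
  set Lp := Rabs x + Rabs t in hd *.
  have px := Rabs_pos x; have pt := Rabs_pos t.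
  have eM : Rmax 0 Lp = Lp by apply: Rmax_right; rewrite /Lp; lra.
  rewrite -[norm _]/(nm (sub (Th P (x, t)) (Th P' (x, t)))).
  have -> : sub (Th P (x, t)) (Th P' (x, t)) =
     RInt (fun s => mul (adj (a s)) (cv (fun t => A t s) (fun t => sub (P' (s, t)) (P (s, t))) t)) 0 x.
    rewrite (RInt_ext _ (fun s => sub (mul (adj (a s)) (wave_E c A (fun x0 t0 => P' (x0, t0)) s t))
       (mul (adj (a s)) (wave_E c A (fun x0 t0 => P (x0, t0)) s t)))).
      rewrite RInt_sub; try by cts.
      by rewrite /Th /=; vec.
    move=> s _; rewrite cv_sub_r; try by cts.
    by rewrite /wave_E; dist; vec.
  have -> : C Lp / k' * (c0 * exp (k' * Rabs x)) = (C Lp * c0) / k' * exp (k' * Rabs (x - 0)).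
    by rewrite Rminus_0_r /Rdiv; ring.
  apply: RInt_exp_bound => //; first by cts.
  move=> s hs; have [q1 q2] := abs_between s x hs; rewrite Rminus_0_r.
  set E := exp (k' * Rabs s).
  have E0 : 0 < E by exact: exp_pos.
  rewrite -[norm _]/(nm (mul (adj (a s)) (cv (fun t => A t s) (fun t => sub (P' (s, t)) (P (s, t))) t))).
  apply: Rle_trans (nm_mul _ _) _; rewrite nm_adj.
  have ha : nm (a s) <= k1 Lp by apply: hk1; rewrite /Lp; lra.
  have hcv : nm (cv (fun t => A t s) (fun t => sub (P' (s, t)) (P (s, t))) t) <= Rabs t * (k2 Lp * (c0 * E)).
    apply: cv_bound; try by cts.
    move=> r hr; have [q3 q4] := abs_between r t hr; have pr := Rabs_pos r; have ptr := Rabs_pos (t - r).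
    apply: Rmult_le_compat; try exact: nm_ge0.
      by apply: hk2; rewrite /Lp; lra.
    rewrite nm_sub_sym; apply: (hd (s, r)) => /=; first lra.
    rewrite /Lp; lra.
  apply: Rle_trans (Rmult_le_compat _ _ _ _ (nm_ge0 _) (nm_ge0 _) ha hcv) _.
  have p1 : 0 <= k1 Lp * k2 Lp * (c0 * E).
    apply: Rmult_le_pos; last by apply: Rmult_le_pos; lra.
    apply: Rmult_le_pos; [exact: (proj2 mk1) | exact: (proj2 mk2)].
  have p2 : Rabs t * (k1 Lp * k2 Lp * (c0 * E)) <= Lp * (k1 Lp * k2 Lp * (c0 * E)).
    by apply: Rmult_le_compat_r => //; rewrite /Lp; lra.
  have p3 : 0 <= c0 * E by apply: Rmult_le_pos; lra.
  rewrite /C eM; lra.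
Qed.

(** Here the integral term of the equation for A earns its form. By associativity the convolution of
    A with P_x is minus (c Q + Q convolved with P), where Q is the quadratic term, and this cancels
    the contribution of Q to the x-derivative of E. The term a P is the boundary term A(0, x) P of
    the t-derivative of the convolution. *)
Lemma wave (a : R -> M) A B (c : R) P : flow a A B -> c2 P ->
  (forall x t, is_derive (fun x => P x t) x (neg (mul (adj (a x)) (wave_E c A P x t)))) ->
  exists Ex Et, c2 Ex /\ c2 Et /\
    (forall x t, is_derive (fun x => wave_E c A P x t) x (Ex x t)) /\
    (forall x t, is_derive (wave_E c A P x) t (Et x t)) /\
    (forall x t, Ex x t = sub (Et x t) (mul (a x) (P x t))).
Proof.
move=> fl cP hP.
have [ca cA cB h0 hx hl] := fl.
have cw := c2_wE c A P cA cP.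
have cQ : c2 (Qf a A) by rewrite /Qf; cts.
pose Px x t := neg (mul (adj (a x)) (wave_E c A P x t)).
have cPx : c2 Px by rewrite /Px; cts.
pose Et x t := add (rs c (B t x)) (add (mul (a x) (P x t)) (cv (fun t => B t x) (P x) t)).
pose Ex x t := add (rs c (add (B t x) (Qf a A t x)))
   (add (cv (fun t => add (B t x) (Qf a A t x)) (P x) t) (cv (fun t => A t x) (Px x) t)).
exists Ex, Et; split; [|split; [|split; [|split]]].
- rewrite /Ex; cts.
- rewrite /Et; cts.
- move=> x t; apply: D_add.
    apply: (D_lin (rs c) (Rabs c)) => [u v|r u|u|]; [by vec | by vec | by rewrite nm_rs; lra | exact: hl].
  apply: (cv_Dparam (fun x t => A t x) (fun x t => add (B t x) (Qf a A t x)) P Px) => //; cts.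
- move=> x t; apply: D_add.
    apply: (D_lin (rs c) (Rabs c)) => [u v|r u|u|]; [by vec | by vec | by rewrite nm_rs; lra | exact: hx].
  rewrite -h0; apply: (cv_D (fun t => A t x) (fun t => B t x)) => //; cts.
- move=> x t; rewrite /Ex /Et.
  rewrite cv_add_l; try by cts.
  have -> : cv (fun t => A t x) (Px x) t = neg (add (rs c (Qf a A t x)) (cv (fun t => Qf a A t x) (P x) t)).
    have -> : cv (fun t => Qf a A t x) (P x) t =
       cv (fun t => A t x) (cv (fun t => mul (adj (a x)) (A t x)) (P x)) t.
      by apply: cv_assoc; cts.
    have -> : rs c (Qf a A t x) = cv (fun t => A t x) (fun t => mul (adj (a x)) (rs c (A t x))) t.
      by rewrite /Qf /cv -RInt_rs; [apply: RInt_ext => s _; dist | cts].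
    rewrite -cv_add_r; try by cts.
    rewrite -cv_neg_r; try by cts.
    apply: cv_ext => // s _; rewrite /Px /wave_E cv_mul_l; try by cts.
    by dist.
  by vec.
Qed.

(* The energy identity with P(0, .) = g and E(0, .) = A * g. *)
Lemma contractive (a : R -> M) A B l T (g : R -> M) : flow a A B -> cont g -> 0 <= T ->
  RInt (fun t => nm (cv (fun t => A t l) g t) ^ 2) 0 T <= RInt (fun t => nm (g t) ^ 2) 0 T.
Proof.
move=> fl0 cg hT.
have fl := flow_shift a A B l fl0.
have [ca cA cB _ _ _] := fl.
have [P [cP [P0 hP]]] := ode_P _ _ 0 g ca cA cg.
set A' := fun x l0 => A x (l0 + l) in fl cA hP.
set a' := fun l0 => a (l0 + l) in fl ca hP.
have [Ex [Et [cEx [cEt [dEx [dEt hE]]]]]] := wave _ _ _ 0 P fl cP hP.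
have cw := c2_wE 0 A' P cA cP.
pose Px x t := neg (mul (adj (a' x)) (wave_E 0 A' P x t)).
have cPx : c2 Px by rewrite /Px; cts.
have H1 := energy P (wave_E 0 A' P) Px Ex Et a' 0 T hT cP cw cPx cEx cEt hP dEx dEt
  (fun x t _ _ => conj (erefl _) (hE x t)).
rewrite Rplus_0_l in H1.
(* With c = 0 the component E vanishes at t = 0, so the right side of the energy identity is an
   integral of squares. *)
have H2 : 0 <= RInt (fun x => nm (P x (T - x)) ^ 2 - nm (wave_E 0 A' P x 0) ^ 2) 0 T.
  apply: RInt_Rge0 => //; first by cts.
  move=> x _; have -> : wave_E 0 A' P x 0 = nul by rewrite /wave_E cv_0; vec.
  by rewrite nm_nul; have := pow2_ge_0 (nm (P x (T - x))); lra.
rewrite -H1 in H2.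
have H3 : RInt (fun t => nm (P 0 t) ^ 2 - nm (wave_E 0 A' P 0 t) ^ 2) 0 T =
   RInt (fun t => nm (g t) ^ 2) 0 T - RInt (fun t => nm (cv (fun t => A t l) g t) ^ 2) 0 T.
  rewrite -RInt_Rminus; try by case: fl0 => *; cts.
  apply: RInt_ext => t _; rewrite P0; congr (_ - nm _ ^ 2).
  have -> : wave_E 0 A' P 0 t = cv (fun t => A' t 0) (P 0) t by rewrite /wave_E; vec.
  by apply: cv_ext => s _; rewrite /A' ?Rplus_0_l.
rewrite H3 in H2; lra.
Qed.

End Wave.

(** * Truncated Weyl functions *)

Ltac eqR := match goal with |- @eq _ ?a ?b => change (@eq R a b) end.

Lemma pow_le_exp n r : 0 < r -> exists K, 0 < K /\ forall t, 0 <= t -> t ^ n <= K * exp (r * t).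
Proof.
elim: n r => [|n IH] r hr.
  exists 1; split; first lra.
  move=> t ht; rewrite /= Rmult_1_l -exp_0; apply: exp_mono; nra.
have hr2 : 0 < r / 2 by lra.
have [K [K0 hK]] := IH (r / 2) hr2.
exists (2 / r * K); split.
  by apply: Rmult_lt_0_compat => //; apply: Rdiv_lt_0_compat; lra.
move=> t ht /=.
have h1 : t <= 2 / r * exp (r / 2 * t).
  have := exp_ineq1_le (r / 2 * t) => h.
  have e : t = 2 / r * (r / 2 * t) by field; lra.
  rewrite {1}e; apply: Rmult_le_compat_l; last lra.
  by apply: Rlt_le; apply: Rdiv_lt_0_compat; lra.
have -> : exp (r * t) = exp (r / 2 * t) * exp (r / 2 * t) by rewrite -exp_plus; congr exp; field.
have -> : 2 / r * K * (exp (r / 2 * t) * exp (r / 2 * t)) = (2 / r * exp (r / 2 * t)) * (K * exp (r / 2 * t)) by ring.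
apply: Rmult_le_compat => //; [exact: pow_le | exact: hK].
Qed.

Lemma exp_small K r eps : 0 < r -> 0 < eps -> exists X0, 0 <= X0 /\ forall X, X0 <= X -> K * exp (- r * X) < eps.
Proof.
move=> hr he; exists (Rmax 0 (K / (eps * r))); split; first exact: Rmax_l.
move=> X hX.
have h0 : 0 <= X by apply: Rle_trans (Rmax_l _ _) hX.
have h1 : K / (eps * r) <= X by apply: Rle_trans (Rmax_r _ _) hX.
have h2 := exp_ineq1_le (r * X).
have h3 : K <= eps * (r * X).
  have -> : K = K / (eps * r) * (eps * r) by field; lra.
  have -> : eps * (r * X) = X * (eps * r) by ring.
  apply: Rmult_le_compat_r => //; nra.
have e : exp (- r * X) = / exp (r * X) by rewrite -exp_Ropp; congr exp; ring.
rewrite e; apply: (Rmult_lt_reg_r (exp (r * X))); first exact: exp_pos.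
rewrite Rmult_assoc Rinv_l; last by apply: Rgt_not_eq; exact: exp_pos.
nra.
Qed.

Lemma RInt_exp_decay r X Y : 0 < r -> RInt (fun t => exp (- r * t)) X Y = (exp (- r * X) - exp (- r * Y)) / r.
Proof.
move=> hr.
rewrite (FTC_R (fun t => - exp (- r * t) / r)).
- eqR; field; lra.
- by move=> x _; auto_derive => //; field; lra.
- cts.
Qed.

Lemma cexp_plus z w : cexp (z + w)%C = (cexp z * cexp w)%C.
Proof.
case: z => x y; case: w => x' y'; rewrite /cexp /= exp_plus cos_plus sin_plus /Cmult /=; congr pair; ring.
Qed.

Lemma Cmod_cexp z : Cmod (cexp z) = exp (Re z).
Proof.
case: z => x y; rewrite /Cmod /cexp /=.
have -> : exp x * cos y * (exp x * cos y * 1) + exp x * sin y * (exp x * sin y * 1) =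
   exp x ^ 2 * (Rsqr (sin y) + Rsqr (cos y)) by rewrite /Rsqr; ring.
rewrite sin2_cos2 Rmult_1_r sqrt_pow2 //; apply: Rlt_le; exact: exp_pos.
Qed.

Section Exponential.
Context {M : star_alg}.

Definition expc (lam : C) (t : R) : M := cs (cexp (lam * RtoC t)%C).

Lemma cs_add z w : cs (z + w)%C = add (cs z) (cs w) :> M.
Proof. exact: cs_plus. Qed.
Lemma cs_R r : cs (RtoC r) = rs r one :> M.
Proof. exact: cs_RtoC. Qed.
Lemma cs_ri (u v : R) : cs (u, v) = add (rs u one) (rs v (cs Ci)) :> M.
Proof.
have -> : (u, v) = (RtoC u + RtoC v * Ci)%C.
  by rewrite /Cplus /Cmult /RtoC /Ci /=; congr pair; ring.
by rewrite cs_add cs_mul !cs_R mul_rs_l mul1l.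
Qed.

Lemma expc_0 lam : expc lam 0 = one.
Proof.
rewrite /expc; have -> : cexp (lam * RtoC 0)%C = RtoC 1.
  case: lam => x y; rewrite /cexp /RtoC /=.
  have -> : x * 0 - y * 0 = 0 by ring.
  have -> : x * 0 + y * 0 = 0 by ring.
  by rewrite exp_0 cos_0 sin_0; congr pair; ring.
by rewrite cs_R; vec.
Qed.

Lemma expc_plus lam s t : expc lam (s + t) = mul (expc lam s) (expc lam t).
Proof.
rewrite /expc -cs_mul -cexp_plus; congr (cs (cexp _)); rewrite RtoC_plus; ring.
Qed.

Lemma expc_neg lam t : expc (- lam)%C t = expc lam (- t).
Proof. rewrite /expc; congr (cs (cexp _)); rewrite RtoC_opp; ring. Qed.

Lemma expc_comm lam t (x : M) : mul (expc lam t) x = mul x (expc lam t).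
Proof. exact: cs_comm. Qed.

Lemma nm_expc lam t (x : M) : nm (mul (expc lam t) x) = exp (Re lam * t) * nm x.
Proof.
rewrite /expc nm_cs Cmod_cexp; congr (exp _ * _); case: lam => u v /=; ring.
Qed.

Lemma D_rsc (k : R -> R) x (dk : R) (c : M) : is_derive k x dk -> is_derive (fun x => rs (k x) c) x (rs dk c).
Proof. move=> h; exact: (is_derive_scal_l k x dk c). Qed.

Lemma D_expc lam t : is_derive (expc lam) t (mul (cs lam) (expc lam t)).
Proof.
case: lam => u v.
have e s : expc (u, v) s = add (rs (exp (u * s) * cos (v * s)) one) (rs (exp (u * s) * sin (v * s)) (cs Ci)).
  rewrite /expc -cs_ri; congr cs; rewrite /cexp /RtoC /=.
  have -> : u * s - v * 0 = u * s by ring.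
  by have -> : u * 0 + v * s = v * s by ring.
apply: (is_derive_ext (fun s => add (rs (exp (u * s) * cos (v * s)) one) (rs (exp (u * s) * sin (v * s)) (cs Ci)))).
  by move=> s; rewrite e.
have hi : mul (cs Ci) (cs Ci) = rs (-1) one :> M.
  rewrite -cs_mul -cs_R; congr cs; rewrite /Ci /Cmult /RtoC /=; congr pair; ring.
have -> : mul (cs (u, v)) (expc (u, v) t) =
  add (rs (u * (exp (u * t) * cos (v * t)) - v * (exp (u * t) * sin (v * t))) one)
      (rs (u * (exp (u * t) * sin (v * t)) + v * (exp (u * t) * cos (v * t))) (cs Ci)).
  by rewrite e cs_ri; dist; rewrite hi !mul1l ?mul1r; vec.
apply: D_add; apply: D_rsc; auto_derive => //; ring.
Qed.

Lemma cont_expc {U : UniformSpace} lam (f : U -> R) : cont f -> cont (fun u => expc lam (f u)).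
Proof. move=> cf; apply: (cont_app1 (expc lam) f) => // t; exact: D_cont (D_expc lam t). Qed.

(** The remainder is w^2 times an iterated integral of exp(w s) over 0 <= s <= t <= 1, which yields
    the bound without power series. *)
Lemma exp_taylor2 (w : C) (x : M) :
  nm (mul (sub (cs (cexp w)) (add one (cs w))) x) <= Cmod w ^ 2 * exp (Cmod w) * nm x.
Proof.
have e1 : cs (cexp w) = expc w 1 :> M by rewrite /expc; congr (cs (cexp _)); rewrite Cmult_1_r.
have cE : cont (expc w) by move=> t; exact: D_cont (D_expc w t).
have h1 t : sub (expc w t) one = mul (cs w) (RInt (expc w) 0 t).
  rewrite -RInt_mulc // (FTC (expc w) (fun t => mul (cs w) (expc w t))); [| exact: D_expc | by cts].
  by rewrite expc_0.
have h2 : sub (cs (cexp w)) (add one (cs w)) = mul (cs w) (RInt (fun t => mul (cs w) (RInt (expc w) 0 t)) 0 1).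
  have -> : RInt (fun t => mul (cs w) (RInt (expc w) 0 t)) 0 1 = sub (RInt (expc w) 0 1) one.
    rewrite (RInt_ext _ (fun t => sub (expc w t) one)); last by move=> t _; rewrite h1.
    by rewrite RInt_sub; [rewrite RInt_cst; vec | cts | cts].
  by rewrite mul_sub_r -h1 mul1r e1; vec.
have bE s : 0 <= s <= 1 -> nm (mul (expc w s) x) <= exp (Cmod w) * nm x.
  move=> hs; rewrite nm_expc; apply: Rmult_le_compat_r; first exact: nm_ge0.
  apply: exp_mono; have := re_le_Cmod w; rewrite /Rabs; case: Rcase_abs => ? ?; have := Cmod_ge_0 w; nra.
rewrite h2 mulA nm_cs -RInt_cmul; last by cts.
have -> : Cmod w ^ 2 * exp (Cmod w) * nm x = Cmod w * (Rabs (1 - 0) * (Cmod w * (exp (Cmod w) * nm x))).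
  by rewrite Rminus_0_r Rabs_R1; ring.
apply: Rmult_le_compat_l; first exact: Cmod_ge_0.
apply: nm_RInt_const; first by cts.
move=> t; rewrite Rmin_left ?Rmax_right; try lra; move=> ht.
rewrite mulA nm_cs; apply: Rmult_le_compat_l; first exact: Cmod_ge_0.
rewrite -RInt_cmul //.
apply: Rle_trans (_ : Rabs (t - 0) * (exp (Cmod w) * nm x) <= _).
  apply: nm_RInt_const; first by cts.
  move=> s; rewrite Rmin_left ?Rmax_right; try lra; move=> hs; apply: bE; lra.
rewrite Rminus_0_r Rabs_pos_eq; last lra.
have : 0 <= exp (Cmod w) * nm x by apply: Rmult_le_pos; [apply: Rlt_le; exact: exp_pos | exact: nm_ge0].
nra.
Qed.

End Exponential.

Ltac cts_step3 :=
  match goal with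
  | |- cont (fun u => expc ?l (@?f u)) => apply (cont_expc l f); cbv beta
  | |- cont (expc ?l) => exact (cont_expc l (fun t => t) cont_id)
  | _ => cts_step2
  end.
Ltac cts ::= repeat cts_step3.

Section Laplace.
Context {M : star_alg} (a : R -> M) (A B : R -> R -> M).
Hypothesis fl : flow a A B.

(* [lam] stands for 2 i z. One integration by parts turns lam int e^(lam t) Ph1 into - lam^2 int e^(lam t) Ph2,
   where [Ph2] grows at most linearly in the mean. *)
Definition Ph1 (t l : R) : M := RInt (fun s => A s l) 0 t.
Definition Ph2 (t l : R) : M := RInt (fun s => Ph1 s l) 0 t.
Definition chi (lam : C) (X l : R) : M := RInt (fun t => mul (expc lam t) (Ph2 t l)) 0 X.
Definition phX (lam : C) (X l : R) : M := neg (mul (cs (lam * lam)%C) (chi lam X l)).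

Lemma c2_Ph1 : c2 Ph1.
Proof. have [ca cA cB h0 hx hl] := fl; rewrite /Ph1; cts. Qed.
Lemma c2_Ph2 : c2 Ph2.
Proof. have cP := c2_Ph1; rewrite /Ph2; cts. Qed.

Lemma D_Ph1 t l : is_derive (fun t => Ph1 t l) t (A t l).
Proof. have [ca cA cB h0 hx hl] := fl; apply: (deriv_RInt (fun s => A s l)); cts. Qed.
Lemma D_Ph2 t l : is_derive (fun t => Ph2 t l) t (Ph1 t l).
Proof. have cP := c2_Ph1; apply: (deriv_RInt (fun s => Ph1 s l)); cts. Qed.

(** Arises from |y| <= (1 + |y|^2) / 2 and the mean square bound |1|^2 on [Ph1]; the Frobenius norm
    of the unit is not 1. *)
Definition c0 : R := (1 + nm (one : M) ^ 2) / 2.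

Lemma c0_pos : 0 < c0.
Proof. rewrite /c0; have := pow2_ge_0 (nm (one : M)); lra. Qed.

(** The contraction property tested on the constant function [one], whose convolution with A is
    [Ph1]. *)
Lemma Ph1_L2 l T : 0 <= T -> RInt (fun t => nm (Ph1 t l) ^ 2) 0 T <= nm (one : M) ^ 2 * T.
Proof.
move=> hT; have [ca cA cB h0 hx hl] := fl.
have := contractive a A B l T (fun _ => one) fl (cont_const _) hT.
rewrite RInt_Rcst Rminus_0_r.
rewrite (RInt_ext _ (fun t => nm (Ph1 t l) ^ 2)); first by lra.
by move=> t _; rewrite cv_one_r //; cts.
Qed.

Lemma Ph1_L1 l T : 0 <= T -> RInt (fun t => nm (Ph1 t l)) 0 T <= c0 * T.
Proof.
move=> hT; have cP := c2_Ph1.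
apply: Rle_trans (_ : RInt (fun t => (1 + nm (Ph1 t l) ^ 2) / 2) 0 T <= _).
  apply: RInt_Rle => //; try by cts.
  move=> t _; have := pow2_ge_0 (nm (Ph1 t l) - 1); lra.
have -> : RInt (fun t => (1 + nm (Ph1 t l) ^ 2) / 2) 0 T = (T + RInt (fun t => nm (Ph1 t l) ^ 2) 0 T) / 2.
  rewrite (RInt_ext _ (fun t => / 2 * (1 + nm (Ph1 t l) ^ 2))); last by move=> t _; rewrite /= ; field.
  rewrite RInt_Rmult; last by cts.
  rewrite (RInt_Rplus (fun _ => 1)); try by cts.
  rewrite RInt_Rcst; eqR; field.
have := Ph1_L2 l T hT; rewrite /c0; lra.
Qed.

Lemma Ph2_bound l t : 0 <= t -> nm (Ph2 t l) <= c0 * t.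
Proof.
move=> ht; have cP := c2_Ph1; apply: Rle_trans (Ph1_L1 l t ht).
by apply: nm_RInt_le => //; [cts | cts | move=> s _; exact: Rle_refl].
Qed.

(** One half of the exponential absorbs the linear growth of [Ph2], by t exp(-r t / 2) <= 2 / r, and
    integrating the other half gives a second factor 2 / r. Only [Re lam <= - r] is assumed, because
    [chiL_holo] perturbs [lam]. *)
Lemma chi_diff lam r X Y l : 0 < r -> Re lam <= - r -> 0 <= X <= Y ->
  nm (sub (chi lam Y l) (chi lam X l)) <= c0 * (4 / r ^ 2) * exp (- (r / 2) * X).
Proof.
move=> hr hl hXY; have cP := c2_Ph2.
have ec : sub (chi lam Y l) (chi lam X l) = RInt (fun t => mul (expc lam t) (Ph2 t l)) X Y.
  have := RInt_cat (fun t => mul (expc lam t) (Ph2 t l)) 0 X Y ltac:(cts).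
  by rewrite -/(chi lam X l) -/(chi lam Y l) => <-; vec.
rewrite ec.
apply: Rle_trans (_ : RInt (fun t => c0 * (2 / r) * exp (- (r / 2) * t)) X Y <= _).
  apply: nm_RInt_le; [lra | by cts | by cts |].
  move=> t ht; rewrite nm_expc.
  have h1 := Ph2_bound l t ltac:(lra).
  have h2 : exp (Re lam * t) <= exp (- (r / 2) * t) * exp (- (r / 2) * t).
    by rewrite -exp_plus; apply: exp_mono; nra.
  have h3 : t * exp (- (r / 2) * t) <= 2 / r.
    have e : exp (- (r / 2) * t) = / exp (r / 2 * t) by rewrite -exp_Ropp; congr exp; ring.
    rewrite e; apply: (Rmult_le_reg_r (exp (r / 2 * t))); first exact: exp_pos.
    rewrite Rmult_assoc Rinv_l; last by apply: Rgt_not_eq; exact: exp_pos.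
    have := exp_ineq1_le (r / 2 * t) => h.
    have -> : t * 1 = 2 / r * (r / 2 * t) by field; lra.
    apply: Rmult_le_compat_l; last lra.
    by apply: Rlt_le; apply: Rdiv_lt_0_compat; lra.
  have E1 := exp_pos (- (r / 2) * t).
  have c00 := c0_pos.
  apply: Rle_trans (Rmult_le_compat _ _ _ _ (Rlt_le _ _ (exp_pos _)) (nm_ge0 _) h2 h1) _.
  have -> : exp (- (r / 2) * t) * exp (- (r / 2) * t) * (c0 * t) = c0 * (t * exp (- (r / 2) * t)) * exp (- (r / 2) * t) by ring.
  apply: Rmult_le_compat_r; first lra.
  by apply: Rmult_le_compat_l; lra.
rewrite RInt_Rmult; last by cts.
rewrite RInt_exp_decay; last lra.
have E1 := exp_pos (- (r / 2) * Y).
have c00 := c0_pos.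
have -> : c0 * (2 / r) * ((exp (- (r / 2) * X) - exp (- (r / 2) * Y)) / (r / 2)) =
  c0 * (4 / r ^ 2) * (exp (- (r / 2) * X) - exp (- (r / 2) * Y)) by field; lra.
apply: Rmult_le_compat_l; last lra.
apply: Rmult_le_pos; first lra.
apply: Rlt_le; apply: Rdiv_lt_0_compat; [lra | nra].
Qed.

End Laplace.

Lemma exp_cauchy_limit {M : star_alg} (u : R -> M) K r : 0 < r ->
  (forall X Y, 0 <= X <= Y -> nm (sub (u Y) (u X)) <= K * exp (- r * X)) ->
  exists l, forall X, 0 <= X -> nm (sub (u X) l) <= K * exp (- r * X).
Proof.
move=> hr H.
have [l hl] : exists l, filterlim u (Rbar_locally p_infty) (locally l).
  apply/filterlim_locally_cauchy => eps.
  have he : 0 < eps / 2 by have := cond_pos eps; lra.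
  have [X0 [X00 hX0]] := exp_small K r (eps / 2) hr he.
  exists (fun X => X0 < X); split; first by exists X0.
  move=> X Y hX hY; apply: norm_compat1; rewrite -[norm _]/(nm (sub (u Y) (u X))).
  apply: Rle_lt_trans (nm_sub_tri (u X0) _ _) _; rewrite (nm_sub_sym (u X0)).
  have h1 := H X0 X ltac:(lra); have h2 := H X0 Y ltac:(lra); have := hX0 X0 (Rle_refl _); lra.
exists l => X hX; apply: le_epsilon => eps he.
have nf := @norm_factor_gt_0 _ M.
have he' : 0 < eps / @norm_factor _ M by apply: Rdiv_lt_0_compat.
have [N hN] := proj1 (filterlim_locally u l) hl (mkposreal _ he').
pose Y := Rmax X (N + 1).
have hY1 : X <= Y by exact: Rmax_l.
have hY2 : N < Y by have := Rmax_r X (N + 1); rewrite /Y; lra.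
have h1 : nm (sub (u Y) l) < @norm_factor _ M * (eps / @norm_factor _ M) := norm_compat2 _ _ _ (hN Y hY2).
have e : @norm_factor _ M * (eps / @norm_factor _ M) = eps by field; apply: Rgt_not_eq.
rewrite e in h1.
apply: Rle_trans (nm_sub_tri (u Y) _ _) _; rewrite (nm_sub_sym (u X)).
have := H X Y ltac:(lra); lra.
Qed.

(** * The Riccati equation *)

(* On the complement of the triangle in the square, [s + t >= X], whence the factor [exp (- r X)]. *)
Lemma laplace_cv_error {M : star_alg} lam r (f g : R -> M) X : Re lam = - r -> 0 < r -> 0 <= X -> cont f -> cont g ->
  nm (sub (mul (RInt (fun t => mul (expc lam t) (f t)) 0 X) (RInt (fun t => mul (expc lam t) (g t)) 0 X))
          (RInt (fun t => mul (expc lam t) (cv f g t)) 0 X))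
  <= exp (- r * X) * (RInt (fun t => nm (f t)) 0 X * RInt (fun t => nm (g t)) 0 X).
Proof.
move=> hl hr hX cf cg.
have e1 : RInt (fun t => mul (expc lam t) (cv f g t)) 0 X =
  RInt (fun s => mul (RInt (fun t => mul (expc lam t) (f t)) 0 (X - s)) (mul (expc lam s) (g s))) 0 X.
  rewrite (RInt_ext _ (fun t => RInt (fun s => mul (expc lam t) (mul (f (t - s)) (g s))) 0 t)); last first.
    by move=> t _; rewrite /cv RInt_mulc //; cts.
  rewrite (Fubini_tri (fun t s => mul (expc lam t) (mul (f (t - s)) (g s)))); last by cts.
  apply: RInt_ext => s _; rewrite -RInt_cmul; last by cts.
  have := RInt_shift (fun t => mul (expc lam t) (mul (f (t - s)) (g s))) s 0 (X - s) ltac:(cts).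
  have -> : 0 + s = s by ring.
  have -> : X - s + s = X by ring.
  move=> <-; apply: RInt_ext => t _.
  have -> : t + s - s = t by ring.
  by rewrite expc_plus !mulA -(mulA _ (expc lam s) (f t)) (expc_comm lam s (f t)) !mulA.
have e2 : mul (RInt (fun t => mul (expc lam t) (f t)) 0 X) (RInt (fun t => mul (expc lam t) (g t)) 0 X) =
  RInt (fun s => mul (RInt (fun t => mul (expc lam t) (f t)) 0 X) (mul (expc lam s) (g s))) 0 X.
  by rewrite RInt_mulc //; cts.
rewrite e1 e2 -RInt_sub; try by cts.
set F := RInt (fun t => nm (f t)) 0 X.
have F0 : 0 <= F by apply: RInt_Rge0 => //; [cts | move=> *; exact: nm_ge0].
rewrite -Rmult_assoc -RInt_Rmult; last by cts.
apply: nm_RInt_le => //; try by cts.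
move=> s hs; rewrite -mul_sub_l.
apply: Rle_trans (nm_mul _ _) _; rewrite nm_expc hl.
have -> : sub (RInt (fun t => mul (expc lam t) (f t)) 0 X) (RInt (fun t => mul (expc lam t) (f t)) 0 (X - s)) =
   RInt (fun t => mul (expc lam t) (f t)) (X - s) X.
  by rewrite -(RInt_cat _ 0 (X - s) X); [vec | cts].
have h1 : nm (RInt (fun t => mul (expc lam t) (f t)) (X - s) X) <= exp (- r * (X - s)) * F.
  apply: Rle_trans (_ : RInt (fun t => exp (- r * (X - s)) * nm (f t)) (X - s) X <= _).
    apply: nm_RInt_le; [lra | by cts | by cts |].
    move=> t ht; rewrite nm_expc hl; apply: Rmult_le_compat_r; first exact: nm_ge0.
    apply: exp_mono; nra.
  rewrite RInt_Rmult; last by cts.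
  apply: Rmult_le_compat_l; first by apply: Rlt_le; exact: exp_pos.
  rewrite /F -(RInt_Chasles (fun t => nm (f t)) 0 (X - s) X); try (apply: exR; cts).
  have : 0 <= RInt (fun t => nm (f t)) 0 (X - s) by apply: RInt_Rge0; [lra | cts | move=> *; exact: nm_ge0].
  rewrite /plus /=; lra.
have -> : exp (- r * X) * F * nm (g s) = (exp (- r * (X - s)) * F) * (exp (- r * s) * nm (g s)).
  have -> : exp (- r * X) = exp (- r * (X - s)) * exp (- r * s) by rewrite -exp_plus; congr exp; ring.
  ring.
apply: Rmult_le_compat_r => //.
apply: Rmult_le_pos; [apply: Rlt_le; exact: exp_pos | exact: nm_ge0].
Qed.

(** Multiplied through by lam^2 to avoid division. It evaluates the transform of the source term t
    a(l) in [D_Ph2_l], which up to boundary terms at X contributes exactly a(l) to the Riccati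
    equation. *)
Lemma laplace_id {M : star_alg} (lam : C) (X : R) :
  mul (cs (lam * lam)%C) (RInt (fun t => rs t (expc lam t)) 0 X) =
  add (mul (sub (rs X (cs lam)) one) (expc lam X)) one :> M.
Proof.
have hD t : is_derive (fun t => mul (sub (rs t (cs lam)) one) (expc lam t) : M) t
    (mul (cs (lam * lam)%C) (rs t (expc lam t))).
  have -> : mul (cs (lam * lam)%C) (rs t (expc lam t)) =
    add (mul (sub (rs 1 (cs lam)) nul) (expc lam t)) (mul (sub (rs t (cs lam)) one) (mul (cs lam) (expc lam t))) :> M.
    by rewrite cs_mul; dist; rewrite mul1l; vec.
  apply: D_mul; last exact: D_expc.
  apply: D_sub; last exact: D_const.
  apply: D_rsc; exact: is_derive_id.
rewrite -RInt_mulc; last by cts.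
rewrite (FTC _ _ _ _ hD); last by cts.
rewrite -[minus _ _]/(sub _ _) expc_0; dist; rewrite !mul1l; vec.
Qed.

(** Here [u] is the truncated transform of [Ph1], [rho] the boundary term of the integration by
    parts linking [u] to [p = phX], [th] the transform of t, and [err] the defect of the product
    rule. Since lam is central, lam^2 times the quadratic term in [u] is the same quadratic
    expression in [p + rho]. *)
Lemma riccati_alg {M : star_alg} (lam : C) (X : R) (u p rho err al th e : M) :
  mul (cs lam) u = add p rho ->
  mul (cs (lam * lam)%C) th = add (mul (sub (rs X (cs lam)) one) e) one ->
  neg (mul (cs (lam * lam)%C) (sub (add u (sub (mul u (mul (adj al) u)) err)) (mul th al))) =
  add (sub al (add (mul (cs lam) p) (mul p (mul (adj al) p))))
    (add (add (mul (cs (lam * lam)%C) err) (mul (mul (sub (rs X (cs lam)) one) e) al))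
      (neg (add (add (mul (cs lam) rho) (mul rho (mul (adj al) p)))
        (add (mul p (mul (adj al) rho)) (mul rho (mul (adj al) rho)))))).
Proof.
move=> hu hth.
have hq : mul (cs (lam * lam)%C) (mul u (mul (adj al) u)) = mul (add p rho) (mul (adj al) (add p rho)).
  rewrite -hu cs_mul !mulA; congr (mul (cs lam) _).
  by rewrite (cs_comm _ lam (mul u _)) !mulA -cs_comm.
have hu2 : mul (cs (lam * lam)%C) u = mul (cs lam) (add p rho) by rewrite cs_mul mulA hu.
rewrite mul_sub_r mul_add_r mul_sub_r hq hu2 -(mulA _ _ th) hth; dist; rewrite !mul1l; vec.
Qed.

Section Riccati.
Context {M : star_alg} (a : R -> M) (A B : R -> R -> M).
Hypothesis fl : flow a A B.

Let cP1 : c2 (Ph1 A) := c2_Ph1 a A B fl.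
Let cP2 : c2 (Ph2 A) := c2_Ph2 a A B fl.

(** The equation for A is integrated twice in t. The term A_x contributes [Ph1 - t a]. In the
    quadratic term each integration is a convolution with [one], and associativity moves the two of
    them onto the two factors A separately. *)
Lemma D_Ph2_l t l : is_derive (fun l => Ph2 A t l) l
  (sub (add (Ph1 A t l) (cv (fun t => Ph1 A t l) (fun t => mul (adj (a l)) (Ph1 A t l)) t)) (rs t (a l))).
Proof.
have [ca cA cB h0 hx hl] := fl.
have cQ : c2 (Qf a A) by rewrite /Qf; cts.
pose V t l := RInt (fun s => add (B s l) (Qf a A s l)) 0 t.
have cV : c2 V by rewrite /V; cts.
have d1 t' l' : is_derive (fun l => Ph1 A t' l) l' (V t' l').
  apply: (deriv_param (fun l s => A s l) (fun l s => add (B s l) (Qf a A s l))) => //; cts.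
have eV t' : V t' l = add (sub (A t' l) (a l)) (cv (fun t => Ph1 A t l) (fun t => mul (adj (a l)) (A t l)) t').
  rewrite /V RInt_add; try by cts.
  rewrite (FTC (fun s => A s l)) //; last by cts.
  rewrite h0; congr add.
  rewrite -cv_one_l; last by cts.
  rewrite /Qf -(cv_assoc (fun _ => one) (fun t => A t l) (fun t => mul (adj (a l)) (A t l))); try by cts.
  by apply: cv_ext => // s _; rewrite cv_one_l //; cts.
have -> : sub (add (Ph1 A t l) (cv (fun t => Ph1 A t l) (fun t => mul (adj (a l)) (Ph1 A t l)) t)) (rs t (a l)) =
   RInt (fun s => V s l) 0 t.
  rewrite (RInt_ext _ (fun s => add (sub (A s l) (a l)) (cv (fun t => Ph1 A t l) (fun t => mul (adj (a l)) (A t l)) s)));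
    last by move=> s _; exact: eV.
  rewrite RInt_add; try by cts.
  rewrite RInt_sub; try by cts.
  rewrite RInt_cst Rminus_0_r -/(Ph1 A t l).
  have -> : RInt (fun s => cv (fun t => Ph1 A t l) (fun t => mul (adj (a l)) (A t l)) s) 0 t =
    cv (fun t => Ph1 A t l) (fun t => mul (adj (a l)) (Ph1 A t l)) t.
    rewrite -cv_one_r; last by cts.
    rewrite (cv_assoc (fun t => Ph1 A t l) (fun t => mul (adj (a l)) (A t l)) (fun _ => one)); try by cts.
    apply: cv_ext => // s _; rewrite cv_one_r; last by cts.
    by rewrite RInt_mulc //; cts.
  by vec.
apply: (deriv_param (fun l s => Ph1 A s l) (fun l s => V s l)) => //; cts.
Qed.

Lemma phX_bound lam r X l : 0 < r -> Re lam <= - r -> 0 <= X ->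
  nm (phX A lam X l) <= Cmod lam ^ 2 * (c0 (M := M) * (4 / r ^ 2)).
Proof.
move=> hr hl hX; rewrite /phX nm_neg nm_cs Cmod_mult.
have := chi_diff a A B fl lam r 0 X l hr hl ltac:(lra).
rewrite Rmult_0_r exp_0 Rmult_1_r.
have -> : sub (chi A lam X l) (chi A lam 0 l) = chi A lam X l by rewrite /chi RInt_nul; vec.
have -> : Cmod lam * Cmod lam = Cmod lam ^ 2 by ring.
by apply: Rmult_le_compat_l; exact: pow2_ge_0.
Qed.

(** For the truncated function the equation has an explicit error: the defect of the product rule
    for truncated transforms and boundary terms at X. All of these are polynomial in X times exp(-r
    X), and half of the exponent absorbs the polynomial. [K] does not depend on X or on |l| <= L,
    which the Gronwall argument for solutions of the Dirac system requires. *)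
Lemma riccati lam r L : 0 < r -> Re lam = - r -> exists K, 0 <= K /\ forall X, 0 <= X -> exists eps : R -> M,
  forall l, Rabs l <= L -> nm (eps l) <= K * exp (- (r / 2) * X) /\
   is_derive (phX A lam X) l (add (sub (a l) (add (mul (cs lam) (phX A lam X l))
      (mul (phX A lam X l) (mul (adj (a l)) (phX A lam X l))))) (eps l)).
Proof.
move=> hr hl; have [ca cA cB h0 hx hll] := fl.
have [k [mk [k1 hk]]] := bound_1 a ca.
have hr2 : 0 < r / 2 by lra.
have [K2 [K20 hK2]] := pow_le_exp 2 (r / 2) hr2.
set K0 := Cmod lam ^ 2 * (c0 (M := M) * (4 / r ^ 2)).
have c00 : 0 < c0 (M := M) := c0_pos.
set c := c0 (M := M) in c00 K0 *.
have m0 := Cmod_ge_0 lam; set m := Cmod lam in m0 K0 *.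
have kL := k1 L; set al := k L in kL.
have K00 : 0 <= K0.
  rewrite /K0; apply: Rmult_le_pos; first exact: pow2_ge_0.
  apply: Rmult_le_pos; first lra.
  apply: Rlt_le; apply: Rdiv_lt_0_compat; [lra | nra].
pose N := nm (one : M).
have N0 : 0 <= N by exact: nm_ge0.
(* After division by exp(-r X) the error is at most [p1 X + p2 X^2 + al]; [K2] converts this
   polynomial into exp(r X / 2). *)
pose p1 := (m + 2 * al * K0) * (m * c) + m * al.
pose p2 := 2 * al * (m * c) ^ 2.
pose K := (p1 + p2 + al) * (1 + K2).
have mc : 0 <= m * c by apply: Rmult_le_pos; lra.
have aK : 0 <= al * K0 by apply: Rmult_le_pos; lra.
have p10 : 0 <= p1.
  have h1 : 0 <= (m + 2 * al * K0) * (m * c) by apply: Rmult_le_pos; lra.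
  have h2 : 0 <= m * al by apply: Rmult_le_pos; lra.
  rewrite /p1; lra.
have p20 : 0 <= p2 by rewrite /p2; have := pow2_ge_0 (m * c); nra.
exists K; split; first by apply: Rmult_le_pos; lra.
move=> X hX.
pose u l := RInt (fun t => mul (expc lam t) (Ph1 A t l)) 0 X.
pose rho l := mul (cs lam) (mul (expc lam X) (Ph2 A X l)).
pose err l := sub (mul (u l) (mul (adj (a l)) (u l)))
  (RInt (fun t => mul (expc lam t) (cv (fun t => Ph1 A t l) (fun t => mul (adj (a l)) (Ph1 A t l)) t)) 0 X).
pose ph l := phX A lam X l.
pose eps l := add (add (mul (cs (lam * lam)%C) (err l)) (mul (mul (sub (rs X (cs lam)) one) (expc lam X)) (a l)))
  (neg (add (add (mul (cs lam) (rho l)) (mul (rho l) (mul (adj (a l)) (ph l))))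
       (add (mul (ph l) (mul (adj (a l)) (rho l))) (mul (rho l) (mul (adj (a l)) (rho l)))))).
exists eps => l hL.
have hu : mul (cs lam) (u l) = add (ph l) (rho l).
  have h1 : add (mul (cs lam) (chi A lam X l)) (u l) = mul (expc lam X) (Ph2 A X l).
    rewrite /chi /u -RInt_mulc; last by cts.
    rewrite -RInt_add; try by cts.
    rewrite (RInt_ext _ (fun t => add (mul (mul (cs lam) (expc lam t)) (Ph2 A t l)) (mul (expc lam t) (Ph1 A t l))));
      last by move=> t _; dist.
    rewrite (FTC (fun t => mul (expc lam t) (Ph2 A t l))); last 2 first.
    - move=> t; apply: D_mul; [exact: D_expc | exact: (D_Ph2 a A B fl)].
    - by cts.
    have -> : Ph2 A 0 l = nul by exact: RInt_nul.
    by rewrite mul_nul_r -[minus _ _]/(sub _ _); vec.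
  have -> : u l = sub (mul (expc lam X) (Ph2 A X l)) (mul (cs lam) (chi A lam X l)) by rewrite -h1; vec.
  by rewrite mul_sub_r /ph /phX /rho cs_mul mulA; vec.
split; last first.
  have hd : is_derive (fun l => chi A lam X l) l (RInt (fun t => mul (expc lam t)
     (sub (add (Ph1 A t l) (cv (fun t => Ph1 A t l) (fun t => mul (adj (a l)) (Ph1 A t l)) t)) (rs t (a l)))) 0 X).
    apply: (deriv_param (fun l t => mul (expc lam t) (Ph2 A t l)) (fun l t => mul (expc lam t)
     (sub (add (Ph1 A t l) (cv (fun t => Ph1 A t l) (fun t => mul (adj (a l)) (Ph1 A t l)) t)) (rs t (a l))))).
    - by move=> s t; apply: D_mulc; exact: D_Ph2_l.
    - cts.
    - cts.
  have := D_neg _ _ _ (D_mulc (cs (lam * lam)%C) _ _ _ hd).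
  set d1 := neg _; set d2 := add (sub _ _) _.
  have -> : d1 = d2; last by [].
  rewrite /d1 /d2.
  have -> : RInt (fun t => mul (expc lam t) (sub (add (Ph1 A t l)
     (cv (fun t => Ph1 A t l) (fun t => mul (adj (a l)) (Ph1 A t l)) t)) (rs t (a l)))) 0 X =
    sub (add (u l) (sub (mul (u l) (mul (adj (a l)) (u l))) (err l)))
        (mul (RInt (fun t => rs t (expc lam t)) 0 X) (a l)).
    rewrite (RInt_ext _ (fun t => sub (add (mul (expc lam t) (Ph1 A t l))
      (mul (expc lam t) (cv (fun t => Ph1 A t l) (fun t => mul (adj (a l)) (Ph1 A t l)) t)))
      (mul (rs t (expc lam t)) (a l)))); last by move=> t _; dist.
    rewrite RInt_sub; try by cts.
    rewrite RInt_add; try by cts.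
    rewrite RInt_cmul; last by cts.
    by rewrite /err -/(u l); vec.
  exact: riccati_alg hu (laplace_id lam X).
set X2 := exp (- r * X).
have X20 : 0 < X2 by exact: exp_pos.
have X21 : X2 <= 1 by rewrite -exp_0; apply: exp_mono; nra.
have hal : nm (a l) <= al by apply: hk.
have nal := nm_ge0 (a l).
have hP2 := Ph2_bound a A B fl l X hX.
have hrho : nm (rho l) <= m * c * (X * X2).
  rewrite /rho nm_cs nm_expc hl -/m -/X2.
  apply: Rle_trans (Rmult_le_compat_l _ _ _ m0 (Rmult_le_compat_l _ _ _ (Rlt_le _ _ X20) hP2)) _.
  by rewrite -/c; apply: Req_le; ring.
have hph : nm (ph l) <= K0 by apply: phX_bound => //; lra.
have nph := nm_ge0 (ph l); have nrho := nm_ge0 (rho l).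
have h3 (x y : M) : nm (mul x (mul (adj (a l)) y)) <= nm x * (al * nm y).
  apply: Rle_trans (nm_mul _ _) _; apply: Rmult_le_compat_l; first exact: nm_ge0.
  apply: Rle_trans (nm_mul _ _) _; rewrite nm_adj; apply: Rmult_le_compat_r => //; exact: nm_ge0.
have herr : nm (err l) <= X2 * ((c * X) * (al * (c * X))).
  apply: Rle_trans (_ : X2 * (RInt (fun t => nm (Ph1 A t l)) 0 X * RInt (fun t => nm (mul (adj (a l)) (Ph1 A t l))) 0 X) <= _).
    have := laplace_cv_error lam r (fun t => Ph1 A t l) (fun t => mul (adj (a l)) (Ph1 A t l)) X hl hr hX ltac:(cts) ltac:(cts).
    have -> : RInt (fun t => mul (expc lam t) (mul (adj (a l)) (Ph1 A t l))) 0 X = mul (adj (a l)) (u l).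
      rewrite /u -RInt_mulc; last by cts.
      by apply: RInt_ext => t _; rewrite -!mulA expc_comm.
    by [].
  apply: Rmult_le_compat_l; first lra.
  have L1 := Ph1_L1 a A B fl l X hX.
  apply: Rmult_le_compat => //.
  - by apply: RInt_Rge0 => //; [cts | move=> *; exact: nm_ge0].
  - by apply: RInt_Rge0 => //; [cts | move=> *; exact: nm_ge0].
  - apply: Rle_trans (_ : RInt (fun t => al * nm (Ph1 A t l)) 0 X <= _).
      apply: RInt_Rle => //; try by cts.
      move=> t _; apply: Rle_trans (nm_mul _ _) _; rewrite nm_adj; apply: Rmult_le_compat_r => //; exact: nm_ge0.
    rewrite RInt_Rmult; last by cts.
    by apply: Rmult_le_compat_l => //; lra.
have t1 : nm (mul (cs (lam * lam)%C) (err l)) <= m * m * (X2 * ((c * X) * (al * (c * X)))).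
  rewrite nm_cs Cmod_mult; apply: Rmult_le_compat_l => //; exact: Rmult_le_pos.
have t2 : nm (mul (mul (sub (rs X (cs lam)) one) (expc lam X)) (a l)) <= (X * m + 1) * (X2 * al).
  have -> : mul (mul (sub (rs X (cs lam)) one) (expc lam X)) (a l) =
    sub (rs X (mul (cs lam) (mul (expc lam X) (a l)))) (mul (expc lam X) (a l)) by dist; rewrite mul1l; vec.
  apply: Rle_trans (nm_sub _ _) _; rewrite nm_rs nm_cs nm_expc hl -/m -/X2 (Rabs_pos_eq _ hX).
  have := Rmult_le_compat_l X2 _ _ (Rlt_le _ _ X20) hal.
  have : 0 <= X * m by apply: Rmult_le_pos.
  nra.
have t3 : nm (mul (cs lam) (rho l)) <= m * (m * c * (X * X2)).
  by rewrite nm_cs; apply: Rmult_le_compat_l.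
have t4 : nm (mul (rho l) (mul (adj (a l)) (ph l))) <= (m * c * (X * X2)) * (al * K0).
  apply: Rle_trans (h3 _ _) _; apply: Rmult_le_compat => //; first by apply: Rmult_le_pos; lra.
  by apply: Rmult_le_compat_l; lra.
have t5 : nm (mul (ph l) (mul (adj (a l)) (rho l))) <= K0 * (al * (m * c * (X * X2))).
  apply: Rle_trans (h3 _ _) _; apply: Rmult_le_compat => //; first by apply: Rmult_le_pos; lra.
  by apply: Rmult_le_compat_l; lra.
have t6 : nm (mul (rho l) (mul (adj (a l)) (rho l))) <= (m * c * (X * X2)) * (al * (m * c * (X * 1))).
  apply: Rle_trans (h3 _ _) _; apply: Rmult_le_compat => //; first by apply: Rmult_le_pos; lra.
  apply: Rmult_le_compat_l; first lra.
  apply: Rle_trans hrho _; apply: Rmult_le_compat_l => //; apply: Rmult_le_compat_l => //.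
apply: Rle_trans (nm_add _ _) _.
apply: Rle_trans (Rplus_le_compat _ _ _ _ (nm_add _ _) (Req_le _ _ (nm_neg _))) _.
apply: Rle_trans (Rplus_le_compat_l _ _ _ (nm_add _ _)) _.
apply: Rle_trans (Rplus_le_compat_l _ _ _ (Rplus_le_compat _ _ _ _ (nm_add _ _) (nm_add _ _))) _.
apply: Rle_trans (_ : X2 * (p1 * X + p2 * X ^ 2 + al) <= _).
  rewrite /p1 /p2; lra.
have hX1 : X <= 1 + X ^ 2 by nra.
have hX2 := hK2 X hX.
have e1 : exp (r / 2 * X) >= 1 by apply: Rle_ge; rewrite -exp_0; apply: exp_mono; nra.
have e2 : exp (- (r / 2) * X) = X2 * exp (r / 2 * X) by rewrite /X2 -exp_plus; congr exp; field.
rewrite e2.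
have q1 : p1 * X + p2 * X ^ 2 + al <= (p1 + p2 + al) * (1 + X ^ 2).
  have := pow2_ge_0 X => sq.
  have := Rmult_le_compat_l p1 _ _ p10 hX1.
  have := Rmult_le_pos al (X ^ 2) ltac:(lra) sq.
  lra.
have q2 : 1 + X ^ 2 <= (1 + K2) * exp (r / 2 * X) by lra.
have -> : K * (X2 * exp (r / 2 * X)) = X2 * ((p1 + p2 + al) * ((1 + K2) * exp (r / 2 * X))) by rewrite /K; ring.
apply: Rmult_le_compat_l; first lra.
apply: Rle_trans q1 _; apply: Rmult_le_compat_l; lra.
Qed.

End Riccati.

(** * The Weyl function *)

Lemma le_of_exp_small x y K r : 0 < r -> (forall X, 0 <= X -> x <= y + K * exp (- r * X)) -> x <= y.
Proof.
move=> hr H; apply: le_epsilon => eps he.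
have [X0 [h0 hX]] := exp_small K r eps hr he.
have := H X0 h0; have := hX X0 (Rle_refl _); lra.
Qed.

Lemma RInt_Rcat (f : R -> R) x y z : cont f -> RInt f x y + RInt f y z = RInt f x z.
Proof. by move=> cf; apply: (RInt_Chasles f); apply: exR. Qed.

(** The mean value theorem is applied to exp(-C (x - x0)) f - d (x - x0), whose derivative is
    nonpositive; continuity of [f'] is not assumed. *)
Lemma gronwall (f f' : R -> R) C d x0 x1 : x0 <= x1 -> 0 <= C -> 0 <= d ->
  (forall x, x0 <= x <= x1 -> is_derive f x (f' x)) ->
  (forall x, x0 <= x <= x1 -> f' x <= C * f x + d) ->
  f x1 <= exp (C * (x1 - x0)) * (f x0 + d * (x1 - x0)).
Proof.
move=> h01 hC hd df H.
pose g x := exp (- C * (x - x0)) * f x - d * (x - x0).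
have dg x : x0 <= x <= x1 -> is_derive g x (exp (- C * (x - x0)) * (f' x - C * f x) - d).
  move=> hx.
  have -> : exp (- C * (x - x0)) * (f' x - C * f x) - d =
     (- C * exp (- C * (x - x0)) * f x + exp (- C * (x - x0)) * f' x) - d by ring.
  apply: (is_derive_minus (V := R_NormedModule)); last by auto_derive => //; ring.
  apply: (is_derive_mult (fun x => exp (- C * (x - x0))) f) => //.
  - by auto_derive => //; rewrite /Rminus; ring.
  - exact: df.
  - move=> *; exact: Rmult_comm.
have [c [hc e]] : exists c, (x0 <= c <= x1) /\ g x1 - g x0 = (exp (- C * (c - x0)) * (f' c - C * f c) - d) * (x1 - x0).
  have := MVT_gen g x0 x1 (fun x => exp (- C * (x - x0)) * (f' x - C * f x) - d).
  rewrite Rmin_left // Rmax_right //; apply.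
  - by move=> x hx; apply: dg; lra.
  - move=> x hx; apply/continuity_pt_filterlim; apply: ex_derive_continuous; eexists; exact: dg.
have E1 := exp_pos (- C * (c - x0)).
have E2 : exp (- C * (c - x0)) <= 1 by rewrite -exp_0; apply: exp_mono; nra.
have hH := H c hc.
have h1 : g x1 <= g x0.
  have : exp (- C * (c - x0)) * (f' c - C * f c) <= d by nra.
  nra.
move: h1; rewrite /g Rminus_diag !Rmult_0_r exp_0 Rmult_1_l Rminus_0_r => h1.
have e3 : exp (C * (x1 - x0)) * exp (- C * (x1 - x0)) = 1.
  by rewrite -exp_plus -exp_0; congr exp; ring.
have E3 := exp_pos (C * (x1 - x0)).
have -> : f x1 = exp (C * (x1 - x0)) * (exp (- C * (x1 - x0)) * f x1) by rewrite -Rmult_assoc e3; ring.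
apply: Rmult_le_compat_l; lra.
Qed.

Section Limit.
Context {M : star_alg} (a : R -> M) (A B : R -> R -> M).
Hypothesis fl : flow a A B.

(** The limit of [chi] as X tends to infinity, made total in [lam] by a choice operator; it is
    meaningful where Re lam < 0. The rate is quantified inside, so that the value does not depend on
    a chosen r. *)
Definition chiL (lam : C) (l : R) : M := epsilon (inhabits nul)
  (fun v => exists K r, 0 < r /\ forall X, 0 <= X -> nm (sub (chi A lam X l) v) <= K * exp (- r * X)).
Definition phL (lam : C) (l : R) : M := neg (mul (cs (lam * lam)%C) (chiL lam l)).

Lemma chiL_spec lam r X l : 0 < r -> Re lam <= - r -> 0 <= X ->
  nm (sub (chi A lam X l) (chiL lam l)) <= c0 (M := M) * (4 / r ^ 2) * exp (- (r / 2) * X).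
Proof.
move=> hr hl hX.
have hr2 : 0 < r / 2 by lra.
have [v hv] := exp_cauchy_limit (fun X => chi A lam X l) _ _ hr2 (fun X Y h => chi_diff a A B fl lam r X Y l hr hl h).
have hex : exists v, exists K r, 0 < r /\ forall X, 0 <= X -> nm (sub (chi A lam X l) v) <= K * exp (- r * X).
  by exists v; eexists; exists (r / 2); split; [exact: hr2 | exact: hv].
have [K [r' [hr' hK]]] := epsilon_spec (inhabits nul) _ hex.
rewrite -/(chiL lam l) in hK.
apply: (le_of_exp_small _ _ (c0 (M := M) * (4 / r ^ 2) + K) (Rmin (r / 2) r')); first exact: Rmin_pos.
move=> Y hY.
apply: Rle_trans (nm_sub_tri v _ _) _.
apply: Rle_trans (Rplus_le_compat_l _ _ _ (nm_sub_tri (chi A lam Y l) _ _)) _.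
rewrite (nm_sub_sym v).
have h1 := hv X hX; have h2 := hv Y hY; have h3 := hK Y hY.
have hm (p : R) K' : Rmin (r / 2) r' <= p -> 0 <= K' -> K' * exp (- p * Y) <= K' * exp (- Rmin (r / 2) r' * Y).
  move=> hp hK'; apply: Rmult_le_compat_l => //; apply: exp_mono; nra.
have K0 : 0 <= K by have := hK 0 (Rle_refl _); rewrite Rmult_0_r exp_0; have := nm_ge0 (sub (chi A lam 0 l) (chiL lam l)); lra.
have c00 : 0 <= c0 (M := M) * (4 / r ^ 2).
  apply: Rmult_le_pos; first by apply: Rlt_le; exact: c0_pos.
  apply: Rlt_le; apply: Rdiv_lt_0_compat; [lra | nra].
have m1 := hm (r / 2) _ (Rmin_l _ _) c00; have m2 := hm r' _ (Rmin_r _ _) K0.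
rewrite Rmult_plus_distr_r; lra.
Qed.

Definition phL_rate (lam : C) (r : R) := Cmod lam ^ 2 * (c0 (M := M) * (4 / r ^ 2)).

Lemma phL_spec lam r X l : 0 < r -> Re lam <= - r -> 0 <= X ->
  nm (sub (phX A lam X l) (phL lam l)) <= phL_rate lam r * exp (- (r / 2) * X).
Proof.
move=> hr hl hX.
have -> : sub (phX A lam X l) (phL lam l) = neg (mul (cs (lam * lam)%C) (sub (chi A lam X l) (chiL lam l))).
  by rewrite /phX /phL mul_sub_r; vec.
rewrite nm_neg nm_cs Cmod_mult /phL_rate.
have := chiL_spec lam r X l hr hl hX => h.
have := Rmult_le_compat_l (Cmod lam ^ 2) _ _ (pow2_ge_0 _) h; lra.
Qed.

(* Test [contractive] on [g t = exp (- lam t) C]: up to lower order terms, [A * g = - exp (- lam t) phX C]. *)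
Lemma phL_contractive lam r l (C : M) : 0 < r -> Re lam = - r -> nm (mul (phL lam l) C) <= nm C.
Proof.
move=> hr hl; have [ca cA cB h0 hx hll] := fl.
have cP1 := c2_Ph1 a A B fl; have cP2 := c2_Ph2 a A B fl.
apply: Rnot_lt_le => hlt.
have nC := nm_ge0 C.
set q := nm (mul (phL lam l) C) in hlt.
(* Argument by contradiction from q > |C|. The midpoint leaves room to replace [phL] by [phX] for
   large t. *)
pose p := (q + nm C) / 2.
have hp : nm C < p < q by rewrite /p; lra.
have hr2 : 0 < r / 2 by lra.
have [X0 [hX00 hX0]] := exp_small (phL_rate lam r * nm C) (r / 2) (q - p) hr2 ltac:(lra).
have hph t : X0 <= t -> p <= nm (mul (phX A lam t l) C).
  move=> ht; have h1 := phL_spec lam r t l hr ltac:(lra) ltac:(lra).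
  have h2 : q <= nm (mul (phX A lam t l) C) + nm (mul (sub (phX A lam t l) (phL lam l)) C).
    rewrite /q.
    have -> : mul (phL lam l) C = sub (mul (phX A lam t l) C) (mul (sub (phX A lam t l) (phL lam l)) C) by dist; vec.
    exact: nm_sub.
  have h3 := nm_mul (sub (phX A lam t l) (phL lam l)) C.
  have h4 := Rmult_le_compat_r _ _ _ nC h1.
  have := hX0 t ht; lra.
pose g t := mul (expc (- lam)%C t) C.
have cg : cont g by rewrite /g; cts.
pose w t := sub (Ph1 A t l) (mul (cs lam) (Ph2 A t l)).
(* The convolution is exp(-lam t) times a truncated transform of A. Two integrations by parts turn
   that transform into [- phX] plus boundary terms, which are collected in [w]. *)
have hcv t : cv (fun t => A t l) g t = sub (mul (w t) C) (mul (expc (- lam)%C t) (mul (phX A lam t l) C)).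
  have e1 : cv (fun t => A t l) g t = mul (expc (- lam)%C t) (mul (RInt (fun s => mul (expc lam s) (A s l)) 0 t) C).
    rewrite cv_flip //; last by cts.
    rewrite -RInt_cmul; last by cts.
    rewrite -RInt_mulc; last by cts.
    apply: RInt_ext => s _; rewrite /g.
    have -> : expc (- lam)%C (t - s) = mul (expc (- lam)%C t) (expc lam s) :> M.
      by rewrite -[t - s]/(t + - s) expc_plus; congr mul; rewrite expc_neg Ropp_involutive.
    rewrite !mulA -(mulA _ (A s l)) -(expc_comm (- lam)%C t (A s l)) !mulA.
    by rewrite -(mulA _ (A s l)) -expc_comm !mulA.
  have e2 : RInt (fun s => mul (expc lam s) (A s l)) 0 t =
     sub (mul (expc lam t) (w t)) (phX A lam t l).
    have i1 : add (mul (cs lam) (RInt (fun s => mul (expc lam s) (Ph1 A s l)) 0 t)) (RInt (fun s => mul (expc lam s) (A s l)) 0 t) =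
       mul (expc lam t) (Ph1 A t l).
      rewrite -RInt_mulc; last by cts.
      rewrite -RInt_add; try by cts.
      rewrite (RInt_ext _ (fun t => add (mul (mul (cs lam) (expc lam t)) (Ph1 A t l)) (mul (expc lam t) (A t l))));
        last by move=> s _; dist.
      rewrite (FTC (fun t => mul (expc lam t) (Ph1 A t l))); last 2 first.
      - by move=> s; apply: D_mul; [exact: D_expc | exact: (D_Ph1 a A B fl)].
      - by cts.
      have -> : Ph1 A 0 l = nul by exact: RInt_nul.
      by rewrite mul_nul_r -[minus _ _]/(sub _ _); vec.
    have i2 : add (mul (cs lam) (chi A lam t l)) (RInt (fun s => mul (expc lam s) (Ph1 A s l)) 0 t) =
       mul (expc lam t) (Ph2 A t l).
      rewrite /chi -RInt_mulc; last by cts.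
      rewrite -RInt_add; try by cts.
      rewrite (RInt_ext _ (fun t => add (mul (mul (cs lam) (expc lam t)) (Ph2 A t l)) (mul (expc lam t) (Ph1 A t l))));
        last by move=> s _; dist.
      rewrite (FTC (fun t => mul (expc lam t) (Ph2 A t l))); last 2 first.
      - by move=> s; apply: D_mul; [exact: D_expc | exact: (D_Ph2 a A B fl)].
      - by cts.
      have -> : Ph2 A 0 l = nul by exact: RInt_nul.
      by rewrite mul_nul_r -[minus _ _]/(sub _ _); vec.
    have j2 : RInt (fun s => mul (expc lam s) (Ph1 A s l)) 0 t =
      sub (mul (expc lam t) (Ph2 A t l)) (mul (cs lam) (chi A lam t l)) by rewrite -i2; vec.
    have j1 : RInt (fun s => mul (expc lam s) (A s l)) 0 t = sub (mul (expc lam t) (Ph1 A t l))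
      (mul (cs lam) (RInt (fun s => mul (expc lam s) (Ph1 A s l)) 0 t)) by rewrite -i1; vec.
    rewrite j1 j2 /w /phX cs_mul; dist.
    have -> : mul (expc lam t) (mul (cs lam) (Ph2 A t l)) = mul (cs lam) (mul (expc lam t) (Ph2 A t l)).
      by rewrite -!mulA; congr (mul _ _); rewrite expc_comm.
    by vec.
  rewrite e1 e2 mul_sub_l mul_sub_r; congr sub.
  have ee : mul (expc (- lam)%C t) (expc lam t) = one :> M.
    by rewrite expc_neg -expc_plus Rplus_opp_l expc_0.
  by rewrite -!mulA ee mul1l.
have hrel x y : (Re lam * x <= y) -> - r * x <= y by rewrite hl.
have RN : Re (- lam)%C = r by move: hl; case: (lam) => u v /=; lra.
(* [Ph1] is controlled in mean square and [Ph2] pointwise, so the integral of [W] over [0, T] grows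
   polynomially, against exp(2 r T) for the remaining terms. *)
pose W t := 2 * (nm (Ph1 A t l) ^ 2 + Cmod lam ^ 2 * (c0 (M := M) * t) ^ 2) * nm C ^ 2.
have hw t : 0 <= t -> nm (mul (w t) C) ^ 2 <= W t.
  move=> ht; have h1 : nm (w t) <= nm (Ph1 A t l) + Cmod lam * (c0 (M := M) * t).
    apply: Rle_trans (nm_sub _ _) _; rewrite nm_cs; apply: Rplus_le_compat_l.
    apply: Rmult_le_compat_l; [exact: Cmod_ge_0 | exact: (Ph2_bound a A B fl)].
  have h2 := nm_mul (w t) C; have h3 := nm_ge0 (mul (w t) C); have h4 := nm_ge0 (w t).
  have h5 := nm_ge0 (Ph1 A t l).
  have h6 : nm (mul (w t) C) ^ 2 <= (nm (w t) * nm C) ^ 2 by apply: pow_incr.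
  apply: Rle_trans h6 _; rewrite Rpow_mult_distr /W; apply: Rmult_le_compat_r; first exact: pow2_ge_0.
  have h7 : nm (w t) ^ 2 <= (nm (Ph1 A t l) + Cmod lam * (c0 (M := M) * t)) ^ 2 by apply: pow_incr.
  apply: Rle_trans h7 _; have := pow2_ge_0 (nm (Ph1 A t l) - Cmod lam * (c0 (M := M) * t)).
  set u := nm (Ph1 A t l); set v := c0 * t; set m := Cmod lam.
  have -> : 2 * (u ^ 2 + m ^ 2 * v ^ 2) = (u + m * v) ^ 2 + (u - m * v) ^ 2 by ring.
  lra.
(* A weight for the inequality (x + y)^2 <= (1 + sg) x^2 + (1 + 1/sg) y^2, so small that the strict
   gap between |C| and [p] survives. *)
have [sg [sg0 hsg]] : exists sg, 0 < sg /\ (1 + sg) * nm C ^ 2 < p ^ 2.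
  have d0 : nm C ^ 2 < p ^ 2 by nra.
  exists ((p ^ 2 - nm C ^ 2) / (2 * (nm C ^ 2 + 1))).
  have h1 := pow2_ge_0 (nm C).
  have h2 : 0 < (p ^ 2 - nm C ^ 2) / (2 * (nm C ^ 2 + 1)) by apply: Rdiv_lt_0_compat; lra.
  split => //; set s := _ / _ in h2 *.
  have e : s * (2 * (nm C ^ 2 + 1)) = p ^ 2 - nm C ^ 2 by rewrite /s; field; lra.
  nra.
have hpt t : X0 <= t -> p ^ 2 * exp (2 * r * t) <= (1 + sg) * nm (cv (fun t => A t l) g t) ^ 2 + (1 + / sg) * W t.
  move=> ht.
  have h1 : p * exp (r * t) <= nm (cv (fun t => A t l) g t) + nm (mul (w t) C).
    have -> : cv (fun t => A t l) g t = neg (sub (mul (expc (- lam)%C t) (mul (phX A lam t l) C)) (mul (w t) C)).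
      by rewrite hcv; vec.
    rewrite nm_neg.
    have -> : p * exp (r * t) = exp (r * t) * p by ring.
    apply: Rle_trans (Rmult_le_compat_l _ _ _ (Rlt_le _ _ (exp_pos _)) (hph t ht)) _.
    have := nm_expc (- lam)%C t (mul (phX A lam t l) C); rewrite RN => <-.
    have {1}-> : mul (expc (- lam)%C t) (mul (phX A lam t l) C) =
      add (sub (mul (expc (- lam)%C t) (mul (phX A lam t l) C)) (mul (w t) C)) (mul (w t) C) by vec.
    exact: nm_add.
  have h2 := hw t ltac:(lra).
  set x := nm (cv _ _ _) in h1 *; set y := nm (mul (w t) C) in h1 h2.
  have x0 : 0 <= x by exact: nm_ge0.
  have y0 : 0 <= y by exact: nm_ge0.
  have E := exp_pos (r * t).
  have e2 : exp (2 * r * t) = exp (r * t) * exp (r * t) by rewrite -exp_plus; congr exp; ring.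
  have h3 : (p * exp (r * t)) ^ 2 <= (x + y) ^ 2 by apply: pow_incr; split => //; apply: Rmult_le_pos; lra.
  have isg : 0 < / sg by exact: Rinv_0_lt_compat.
  have h4 : 2 * x * y <= sg * x ^ 2 + / sg * y ^ 2.
    have := pow2_ge_0 (sg * x - y) => sq.
    have : 0 <= / sg * (sg * x - y) ^ 2 by apply: Rmult_le_pos; lra.
    have -> : / sg * (sg * x - y) ^ 2 = sg * x ^ 2 - 2 * x * y + / sg * y ^ 2 by field; lra.
    lra.
  have h5 := Rmult_le_compat_l (1 + / sg) _ _ ltac:(lra) h2.
  rewrite e2; nra.
have cW : cont W by rewrite /W; cts.
have cphi : cont (cv (fun t => A t l) g) by cts.
pose N := nm (one : M) ^ 2.
have hWint T : 0 <= T -> RInt W 0 T <= 2 * (N * T + Cmod lam ^ 2 * (c0 (M := M) * T) ^ 2 * T) * nm C ^ 2.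
  move=> hT.
  have e : RInt W 0 T = 2 * nm C ^ 2 * (RInt (fun t => nm (Ph1 A t l) ^ 2) 0 T +
     RInt (fun t => Cmod lam ^ 2 * (c0 (M := M) * t) ^ 2) 0 T).
    rewrite -RInt_Rplus; try by cts.
    rewrite -RInt_Rmult; last by cts.
    by apply: RInt_ext => t _; rewrite /W; eqR; ring.
  have h1 : RInt (fun t => Cmod lam ^ 2 * (c0 (M := M) * t) ^ 2) 0 T <= Cmod lam ^ 2 * (c0 (M := M) * T) ^ 2 * T.
    have := RInt_Rle (fun t => Cmod lam ^ 2 * (c0 (M := M) * t) ^ 2) (fun _ => Cmod lam ^ 2 * (c0 (M := M) * T) ^ 2) 0 T hT ltac:(cts) ltac:(cts).
    rewrite RInt_Rcst => H; apply: Rle_trans (H _) _; last lra.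
    move=> t ht; apply: Rmult_le_compat_l; first exact: pow2_ge_0.
    apply: pow_incr; have := c0_pos (M := M); nra.
  have h2 := Ph1_L2 a A B fl l T hT.
  rewrite e; have := pow2_ge_0 (nm C); rewrite -/N in h2; nra.
have hexp2 X Y : RInt (fun t => exp (2 * r * t)) X Y = (exp (2 * r * Y) - exp (2 * r * X)) / (2 * r).
  rewrite (FTC_R (fun t => exp (2 * r * t) / (2 * r))); [by eqR; field; lra | | by cts].
  by move=> x _; auto_derive => //; field; lra.
(* The coefficient of exp(2 r T) is p^2 on the left and (1 + sg) |C|^2 on the right, everything else
   being of lower order; for large T this is impossible. *)
have main T : X0 <= T -> p ^ 2 * ((exp (2 * r * T) - exp (2 * r * X0)) / (2 * r)) <=
   (1 + sg) * (nm C ^ 2 * ((exp (2 * r * T) - 1) / (2 * r))) +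
   (1 + / sg) * (2 * (N * T + Cmod lam ^ 2 * (c0 (M := M) * T) ^ 2 * T) * nm C ^ 2).
  move=> hT; rewrite -hexp2 -RInt_Rmult; last by cts.
  have h1 := RInt_Rle (fun t => p ^ 2 * exp (2 * r * t)) (fun t => (1 + sg) * nm (cv (fun t => A t l) g t) ^ 2 + (1 + / sg) * W t)
    X0 T hT ltac:(cts) ltac:(cts) (fun t ht => hpt t (proj1 ht)).
  have isg : 0 < / sg by exact: Rinv_0_lt_compat.
  have h2 : RInt (fun t => (1 + sg) * nm (cv (fun t => A t l) g t) ^ 2 + (1 + / sg) * W t) X0 T <=
     RInt (fun t => (1 + sg) * nm (cv (fun t => A t l) g t) ^ 2 + (1 + / sg) * W t) 0 T.
    rewrite -(RInt_Rcat (fun t => (1 + sg) * nm (cv (fun t => A t l) g t) ^ 2 + (1 + / sg) * W t) 0 X0 T); last by cts.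
    have : 0 <= RInt (fun t => (1 + sg) * nm (cv (fun t => A t l) g t) ^ 2 + (1 + / sg) * W t) 0 X0; last lra.
    apply: RInt_Rge0 => //; first by cts.
    move=> t ht; apply: Rplus_le_le_0_compat; apply: Rmult_le_pos; try lra; first exact: pow2_ge_0.
    rewrite /W; apply: Rmult_le_pos; last exact: pow2_ge_0.
    apply: Rmult_le_pos; first lra.
    apply: Rplus_le_le_0_compat; first exact: pow2_ge_0.
    apply: Rmult_le_pos; exact: pow2_ge_0.
  have h3 : RInt (fun t => nm (cv (fun t => A t l) g t) ^ 2) 0 T <= nm C ^ 2 * ((exp (2 * r * T) - 1) / (2 * r)).
    apply: Rle_trans (contractive a A B l T g fl cg _) _; first lra.
    have -> : RInt (fun t => nm (g t) ^ 2) 0 T = nm C ^ 2 * RInt (fun t => exp (2 * r * t)) 0 T.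
      rewrite -RInt_Rmult; last by cts.
      apply: RInt_ext => t _; rewrite /g nm_expc RN Rpow_mult_distr.
      have -> : exp (2 * r * t) = exp (r * t) ^ 2 by rewrite /= Rmult_1_r -exp_plus; congr exp; ring.
      by eqR; ring.
    rewrite hexp2 Rmult_0_r exp_0; exact: Rle_refl.
  rewrite RInt_Rplus in h2; try by cts.
  rewrite (RInt_Rplus (fun t => (1 + sg) * nm (cv (fun t => A t l) g t) ^ 2)) in h2; try by cts.
  rewrite [X in _ <= X + _]RInt_Rmult in h2; last by cts.
  rewrite [X in _ <= _ + X]RInt_Rmult in h2; last by cts.
  rewrite (RInt_Rplus (fun t => (1 + sg) * nm (cv (fun t => A t l) g t) ^ 2)) in h1; try by cts.
  have h4 := Rmult_le_compat_l (1 + sg) _ _ ltac:(lra) h3.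
  have h5 := Rmult_le_compat_l (1 + / sg) _ _ ltac:(lra) (hWint T ltac:(lra)).
  lra.
(* The lower order terms are multiples of 1, T and T^3, all of them dominated by exp(r T). *)
have [K3 [K30 hK3]] := pow_le_exp 3 r hr.
have [K1 [K10 hK1]] := pow_le_exp 1 r hr.
have isg : 0 < / sg by exact: Rinv_0_lt_compat.
pose D := p ^ 2 - (1 + sg) * nm C ^ 2.
have D0 : 0 < D by rewrite /D; lra.
pose b0 := p ^ 2 * exp (2 * r * X0).
pose b1 := 2 * r * ((1 + / sg) * (2 * (N * K1 + Cmod lam ^ 2 * c0 (M := M) ^ 2 * K3) * nm C ^ 2)).
have [T0 [T00 hT0]] := exp_small (b0 + b1) r D hr D0.
pose T := Rmax T0 X0.
have hTT : T0 <= T /\ X0 <= T by split; [exact: Rmax_l | exact: Rmax_r].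
have hm := main T (proj2 hTT).
have h1 := hT0 T (proj1 hTT).
have hT : 0 <= T by lra.
have e1 := hK1 T hT; have e3 := hK3 T hT.
have Er := exp_pos (r * T).
have E1 : 1 <= exp (r * T) by rewrite -exp_0; apply: exp_mono; nra.
have e2 : exp (2 * r * T) = exp (r * T) * exp (r * T) by rewrite -exp_plus; congr exp; ring.
have N0 : 0 <= N by exact: pow2_ge_0.
have hm2 : p ^ 2 * (exp (2 * r * T) - exp (2 * r * X0)) <= (1 + sg) * (nm C ^ 2 * (exp (2 * r * T) - 1)) +
   2 * r * ((1 + / sg) * (2 * (N * T + Cmod lam ^ 2 * (c0 (M := M) * T) ^ 2 * T) * nm C ^ 2)).
  have := Rmult_le_compat_l (2 * r) _ _ ltac:(lra) hm.
  have -> : 2 * r * (p ^ 2 * ((exp (2 * r * T) - exp (2 * r * X0)) / (2 * r))) =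
     p ^ 2 * (exp (2 * r * T) - exp (2 * r * X0)) by field; lra.
  set Z := _ * nm C ^ 2.
  have -> : 2 * r * ((1 + sg) * (nm C ^ 2 * ((exp (2 * r * T) - 1) / (2 * r))) + (1 + / sg) * Z) =
    (1 + sg) * (nm C ^ 2 * (exp (2 * r * T) - 1)) + 2 * r * ((1 + / sg) * Z) by field; lra.
  by [].
have hb1 : 2 * r * ((1 + / sg) * (2 * (N * T + Cmod lam ^ 2 * (c0 (M := M) * T) ^ 2 * T) * nm C ^ 2)) <= b1 * exp (r * T).
  have -> : b1 * exp (r * T) = 2 * r * ((1 + / sg) * (2 * (N * (K1 * exp (r * T)) +
     Cmod lam ^ 2 * c0 (M := M) ^ 2 * (K3 * exp (r * T))) * nm C ^ 2)) by rewrite /b1; ring.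
  apply: Rmult_le_compat_l; first lra.
  apply: Rmult_le_compat_l; first lra.
  apply: Rmult_le_compat_r; first exact: pow2_ge_0.
  apply: Rmult_le_compat_l; first lra.
  apply: Rplus_le_compat.
    by apply: Rmult_le_compat_l => //; lra.
  have -> : Cmod lam ^ 2 * (c0 (M := M) * T) ^ 2 * T = Cmod lam ^ 2 * c0 (M := M) ^ 2 * T ^ 3 by ring.
  apply: Rmult_le_compat_l => //; apply: Rmult_le_pos; exact: pow2_ge_0.
have hfin : D * exp (2 * r * T) <= (b0 + b1) * exp (r * T).
  have b00 : 0 <= b0 by rewrite /b0; apply: Rmult_le_pos; [exact: pow2_ge_0 | apply: Rlt_le; exact: exp_pos].
  have : b0 <= b0 * exp (r * T) by nra.
  have hsq : 0 <= (1 + sg) * nm C ^ 2 by apply: Rmult_le_pos; [lra | exact: pow2_ge_0].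
  have eb : b0 = p ^ 2 * exp (2 * r * X0) by [].
  rewrite /D; lra.
have e4 : exp (- r * T) * exp (r * T) = 1 by rewrite -exp_plus -exp_0; congr exp; ring.
have : D * exp (2 * r * T) * exp (- r * T) <= b0 + b1.
  have -> : b0 + b1 = (b0 + b1) * exp (r * T) * exp (- r * T) by rewrite Rmult_assoc (Rmult_comm (exp (r * T))) e4; ring.
  by apply: Rmult_le_compat_r => //; apply: Rlt_le; exact: exp_pos.
have -> : D * exp (2 * r * T) * exp (- r * T) = D * exp (r * T).
  by rewrite e2 -[in RHS](Rmult_1_r (exp (r * T))) -e4; ring.
move=> h9.
have : (b0 + b1) * exp (- r * T) * exp (r * T) < D * exp (r * T) by apply: Rmult_lt_compat_r.
rewrite Rmult_assoc e4; lra.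
Qed.

End Limit.

(** * The Dirac system *)

(** The derivative of the defect [d - p u], where [u] and [d] are the two components of a solution
    and [p] satisfies the Riccati equation with error [e]. Except for the term with [e], everything
    regroups into multiples of the defect itself. *)
Lemma weyl_alg {M : star_alg} (iz : C) (al be p e u d : M) :
  neg (add (add (mul (cs iz) (sub d (mul p u))) (mul p (mul be (sub d (mul p u))))) (mul e u)) =
  sub (sub (mul al u) (mul (cs iz) d))
    (add (mul (add (sub al (add (mul (cs (iz + iz)%C) p) (mul p (mul be p)))) e) u)
         (mul p (add (mul (cs iz) u) (mul be d)))).
Proof.
have ec : mul p (mul (cs iz) u) = mul (cs iz) (mul p u) by rewrite -!mulA -cs_comm.
rewrite cs_add; dist; rewrite ec; by vec.
Qed.

Section Dirac.
Context {M : star_alg} (a : R -> M) (Pi : M) (iz : C) (r : R).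
Hypothesis ca : cont a.
Hypothesis PiPi : mul Pi Pi = Pi.
Hypothesis Piadj : adj Pi = Pi.
Hypothesis aPi : forall x, mul (a x) Pi = a x.
Hypothesis Pia : forall x, mul Pi (a x) = nul.
Hypothesis hr : 0 < r.
Hypothesis hiz : Re iz = - (r / 2).

(** The right side i (z J + J V) y of the system: [Pi] projects onto the first block, J = 2 [Pi] -
    1, and i J V is the sum of [a] and its adjoint, [a] being the lower left block -i v^*. *)
Definition dirac (x : R) (y : M) : M :=
  add (mul (cs iz) (sub (rs 2 (mul Pi y)) y)) (add (mul (a x) y) (mul (adj (a x)) y)).

Definition uppart (y : M) : M := mul Pi y.
Definition lowpart (y : M) : M := sub y (mul Pi y).

Lemma Pi_aadj x y : mul Pi (mul (adj (a x)) y) = mul (adj (a x)) y.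
Proof. by rewrite -mulA -{1}Piadj -adj_mul aPi. Qed.

Lemma aadj_dn x y : mul (adj (a x)) y = mul (adj (a x)) (lowpart y).
Proof.
rewrite /lowpart mul_sub_r -(mulA _ (adj (a x)) Pi) -{1}Piadj -adj_mul Pia adj_nul mul_nul_l; by vec.
Qed.

Lemma a_up x y : mul (a x) y = mul (a x) (uppart y).
Proof. by rewrite /uppart -mulA aPi. Qed.

Lemma up_dirac x y : uppart (dirac x y) = add (mul (cs iz) (uppart y)) (mul (adj (a x)) (lowpart y)).
Proof.
rewrite /uppart /dirac !(mul_add_r Pi) -(mulA _ Pi (a x)) Pia mul_nul_l Pi_aadj -aadj_dn.
rewrite -(mulA _ Pi (cs iz)) -(cs_comm _ iz Pi) mulA mul_sub_r mul_rs_r -(mulA _ Pi Pi) PiPi; dist; by vec.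
Qed.

Lemma dn_dirac x y : lowpart (dirac x y) = sub (mul (a x) (uppart y)) (mul (cs iz) (lowpart y)).
Proof.
rewrite {1}/lowpart -/(uppart _) up_dirac -a_up -aadj_dn /dirac /lowpart /uppart; dist; by vec.
Qed.

Lemma pyth y : nm y ^ 2 = nm (uppart y) ^ 2 + nm (lowpart y) ^ 2.
Proof.
have e : inner (mul Pi y) (mul Pi y) = inner y (mul Pi y).
  by rewrite inner_mul Piadj -(mulA _ Pi Pi) PiPi.
rewrite -!inner_nm /lowpart /uppart !(inner_sub, inner_subl) e (inner_sym _ (mul Pi y) y); ring.
Qed.

Variable (Y : R -> M) (l : R).
Hypothesis cY : cont Y.
Hypothesis dY : forall x, l <= x -> is_derive Y x (dirac x (Y x)).

Lemma D_uppart x : l <= x -> is_derive (fun x => uppart (Y x)) x (add (mul (cs iz) (uppart (Y x))) (mul (adj (a x)) (lowpart (Y x)))).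
Proof. by move=> hx; rewrite -up_dirac; apply: D_mulc; apply: dY. Qed.

Lemma D_lowpart x : l <= x -> is_derive (fun x => lowpart (Y x)) x (sub (mul (a x) (uppart (Y x))) (mul (cs iz) (lowpart (Y x)))).
Proof.
by move=> hx; rewrite -dn_dirac; apply: D_sub; [apply: dY | apply: D_mulc; apply: dY].
Qed.

(** The coupling through [a] cancels by adjointness, and [iz] enters only through its real part
    -r/2, with opposite signs in the two components; hence the derivative of |upper|^2 - |lower|^2
    is -r |Y|^2. *)
Lemma dirac_energy T : l <= T ->
  r * RInt (fun x => nm (Y x) ^ 2) l T =
  (nm (uppart (Y l)) ^ 2 - nm (lowpart (Y l)) ^ 2) - (nm (uppart (Y T)) ^ 2 - nm (lowpart (Y T)) ^ 2).
Proof.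
move=> hT.
have := FTC_R (fun x => nm (uppart (Y x)) ^ 2 - nm (lowpart (Y x)) ^ 2) (fun x => - r * nm (Y x) ^ 2) l T.
rewrite Rmin_left // Rmax_right // => H.
have := H _ ltac:(cts); rewrite RInt_Rmult; last by cts.
move=> H2; have := H2 _; move=> H3.
suff : - r * RInt (fun x => nm (Y x) ^ 2) l T =
  nm (uppart (Y T)) ^ 2 - nm (lowpart (Y T)) ^ 2 - (nm (uppart (Y l)) ^ 2 - nm (lowpart (Y l)) ^ 2) by lra.
apply: H3 => x hx.
have -> : - r * nm (Y x) ^ 2 =
  2 * inner (uppart (Y x)) (add (mul (cs iz) (uppart (Y x))) (mul (adj (a x)) (lowpart (Y x)))) -
  2 * inner (lowpart (Y x)) (sub (mul (a x) (uppart (Y x))) (mul (cs iz) (lowpart (Y x)))).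
  have n2 (y : M) : nm y ^ 2 = norm y ^ 2 by [].
  rewrite inner_add inner_sub !inner_cs hiz -inner_mul (inner_sym _ (lowpart (Y x))) -!n2 pyth; field.
apply: D_nmsq_diff; [apply: D_uppart; lra | apply: D_lowpart; lra].
Qed.

(** Solutions that start in the lower block never become smaller than their initial value, so a
    nonzero one is not square integrable; this gives uniqueness of the Weyl function. *)
Lemma dirac_lower_growth T : l <= T -> uppart (Y l) = nul -> nm (Y l) ^ 2 <= nm (Y T) ^ 2.
Proof.
move=> hT h0; have := dirac_energy T hT.
have := pyth (Y l); rewrite h0 nm_nul => e.
have := pyth (Y T).
have : 0 <= RInt (fun x => nm (Y x) ^ 2) l T.
  by apply: RInt_Rge0 => //; [cts | move=> x _; exact: pow2_ge_0].
have := pow2_ge_0 (nm (uppart (Y T))).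
move=> h1 h2 h3 h4; have : 0 <= r * RInt (fun x => nm (Y x) ^ 2) l T by apply: Rmult_le_pos; lra.
lra.
Qed.

Variables (A B : R -> R -> M).
Hypothesis fl : flow a A B.
Let lam : C := (iz + iz)%C.

Lemma Re_lam : Re lam = - r.
Proof. rewrite /lam; move: hiz; case: (iz) => u v /=; lra. Qed.

Hypothesis Yl : Y l = add Pi (phL A lam l).
Hypothesis phPi : mul (phL A lam l) Pi = phL A lam l.
Hypothesis Piph : mul Pi (phL A lam l) = nul.

(* [lowpart Y - phX uppart Y] solves a linear equation with a source that vanishes as [X] tends to infinity. *)
Lemma weyl_rel T : l <= T -> lowpart (Y T) = mul (phL A lam T) (uppart (Y T)).
Proof.
move=> hT.
have hl := Re_lam; have hl' : Re lam <= - r by lra.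
pose L := Rabs l + Rabs T.
have hL x : l <= x <= T -> Rabs x <= L.
  by rewrite /L => hx; rewrite /Rabs; repeat case: Rcase_abs; lra.
have [K [K0 hK]] := riccati a A B fl lam r L hr hl.
have [ka [mka [ka1 hka]]] := bound_1 a ca.
have [kY [mkY [kY1 hkY]]] := bound_1 Y cY.
pose S := kY L * nm Pi.
pose Kp := phL_rate (M := M) lam r.
have Kp0 : 0 <= Kp by have := phX_bound a A B fl lam r 0 l hr hl' (Rle_refl _); have := nm_ge0 (phX A lam 0 l); rewrite -/(phL_rate (M := M) lam r) -/Kp; lra.
have S0 : 0 <= S by apply: Rmult_le_pos; [have := kY1 L; lra | exact: nm_ge0].
have hS x : l <= x <= T -> nm (uppart (Y x)) <= S.
  move=> hx; apply: Rle_trans (nm_mul _ _) _; rewrite /S Rmult_comm; apply: Rmult_le_compat_r; first exact: nm_ge0.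
  by apply: hkY; apply: hL.
(* Contributions to the derivative of |D|^2: [r] from the term with [iz], [2 Kp ka] from the
   coupling, and 1 from splitting 2 |D| E <= |D|^2 + E^2, where E bounds the source. *)
pose C := r + 2 * (Kp * ka L) + 1.
have C0 : 0 <= C.
  have : 0 <= Kp * ka L by apply: Rmult_le_pos => //; have := ka1 L; lra.
  rewrite /C; lra.
have key X : 0 <= X -> nm (sub (lowpart (Y T)) (mul (phX A lam X T) (uppart (Y T)))) ^ 2 <=
   exp (C * (T - l)) * ((Kp * nm Pi) ^ 2 + K ^ 2 * S ^ 2 * (T - l)) * exp (- r * X).
  move=> hX; have [eps heps] := hK X hX.
  pose ph := phX A lam X.
  pose D x := sub (lowpart (Y x)) (mul (ph x) (uppart (Y x))).
  pose D' x := neg (add (add (mul (cs iz) (D x)) (mul (ph x) (mul (adj (a x)) (D x)))) (mul (eps x) (uppart (Y x)))).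
  have dD x : l <= x <= T -> is_derive D x (D' x).
    move=> hx; have [h1 h2] := heps x (hL x hx).
    have -> : D' x = sub (sub (mul (a x) (uppart (Y x))) (mul (cs iz) (lowpart (Y x))))
       (add (mul (add (sub (a x) (add (mul (cs lam) (ph x)) (mul (ph x) (mul (adj (a x)) (ph x))))) (eps x)) (uppart (Y x)))
            (mul (ph x) (add (mul (cs iz) (uppart (Y x))) (mul (adj (a x)) (lowpart (Y x)))))).
      exact: weyl_alg.
    apply: D_sub; first by apply: D_lowpart; lra.
    apply: D_mul => //; apply: D_uppart; lra.
  set d := (K * exp (- (r / 2) * X)) ^ 2 * S ^ 2.
  have G := gronwall (fun x => nm (D x) ^ 2) (fun x => 2 * inner (D x) (D' x)) C d l T hT C0 _
    (fun x hx => D_nmsq _ _ _ (dD x hx)) _.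
  have d0 : 0 <= d by apply: Rmult_le_pos; exact: pow2_ge_0.
  apply: Rle_trans (G d0 _) _.
    move=> x hx; have [h1 _] := heps x (hL x hx).
    have hph : nm (ph x) <= Kp by apply: (phX_bound a A B fl).
    have n1 : inner (D x) (mul (cs iz) (D x)) = - (r / 2) * nm (D x) ^ 2 by rewrite inner_cs hiz.
    have n2 : nm (mul (ph x) (mul (adj (a x)) (D x))) <= Kp * (ka L * nm (D x)).
      apply: Rle_trans (nm_mul _ _) _; apply: Rmult_le_compat => //; try exact: nm_ge0.
      apply: Rle_trans (nm_mul _ _) _; rewrite nm_adj; apply: Rmult_le_compat_r; first exact: nm_ge0.
      by apply: hka; apply: hL.
    have n3 : nm (mul (eps x) (uppart (Y x))) <= K * exp (- (r / 2) * X) * S.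
      apply: Rle_trans (nm_mul _ _) _; apply: Rmult_le_compat => //; try exact: nm_ge0.
      exact: hS.
    have c1 := CS' (D x) (mul (ph x) (mul (adj (a x)) (D x))).
    have c2' := CS' (D x) (mul (eps x) (uppart (Y x))).
    have nD := nm_ge0 (D x).
    have c3 := Rmult_le_compat_l _ _ _ nD n2.
    have c4 := Rmult_le_compat_l _ _ _ nD n3.
    rewrite /D' inner_neg !inner_add n1.
    have c5 := Rle_trans _ _ _ (Rle_abs (- inner (D x) (mul (ph x) (mul (adj (a x)) (D x))))) (Req_le _ _ (Rabs_Ropp _)).
    have c6 := Rle_trans _ _ _ (Rle_abs (- inner (D x) (mul (eps x) (uppart (Y x))))) (Req_le _ _ (Rabs_Ropp _)).
    set E := K * exp (- (r / 2) * X) * S in n3 c4.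
    have -> : d = E ^ 2 by rewrite /d /E; ring.
    have sq := pow2_ge_0 (nm (D x) - E).
    rewrite /C.
    have -> : (r + 2 * (Kp * ka L) + 1) * nm (D x) ^ 2 + E ^ 2 =
      r * nm (D x) ^ 2 + 2 * (nm (D x) * (Kp * (ka L * nm (D x)))) + nm (D x) ^ 2 + E ^ 2 by ring.
    have e5 : (nm (D x) - E) ^ 2 = nm (D x) ^ 2 - 2 * (nm (D x) * E) + E ^ 2 by ring.
    lra.
  rewrite (Rmult_assoc (exp (C * (T - l)))); apply: Rmult_le_compat_l; first by apply: Rlt_le; exact: exp_pos.
  have eX : exp (- r * X) = exp (- (r / 2) * X) ^ 2 by rewrite /= Rmult_1_r -exp_plus; congr exp; field.
  (* At the initial point the defect is the difference between [phL] and its truncation, multiplied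
     by [Pi]; it is exponentially small in X. *)
  have hDl : nm (D l) ^ 2 <= (Kp * nm Pi) ^ 2 * exp (- r * X).
    have -> : D l = neg (mul (sub (ph l) (phL A lam l)) Pi).
      have e1 : uppart (Y l) = Pi by rewrite /uppart Yl mul_add_r PiPi Piph; vec.
      have e2 : lowpart (Y l) = phL A lam l by rewrite /lowpart -/(uppart (Y l)) e1 Yl; vec.
      by rewrite /D e1 e2 mul_sub_l phPi; vec.
    rewrite nm_neg eX -Rpow_mult_distr; apply: pow_incr; split; first exact: nm_ge0.
    apply: Rle_trans (nm_mul _ _) _.
    have := Rmult_le_compat_r _ _ _ (nm_ge0 Pi) (phL_spec a A B fl lam r X l hr hl' hX); rewrite -/Kp => hh.
    by apply: Rle_trans hh _; apply: Req_le; ring.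
  rewrite /d eX; rewrite eX in hDl.
  have -> : ((Kp * nm Pi) ^ 2 + K ^ 2 * S ^ 2 * (T - l)) * exp (- (r / 2) * X) ^ 2 = (Kp * nm Pi) ^ 2 * exp (- (r / 2) * X) ^ 2 +
    (K * exp (- (r / 2) * X)) ^ 2 * S ^ 2 * (T - l) by ring.
  lra.
pose K1 := exp (C * (T - l)) * ((Kp * nm Pi) ^ 2 + K ^ 2 * S ^ 2 * (T - l)).
have fin : nm (sub (lowpart (Y T)) (mul (phL A lam T) (uppart (Y T)))) ^ 2 <= 0.
  apply: (le_of_exp_small _ _ (2 * K1 + 2 * (Kp * S) ^ 2) r) => // X hX; rewrite Rplus_0_l.
  have h1 := key X hX; rewrite -/K1 in h1.
  have h2 : nm (mul (sub (phX A lam X T) (phL A lam T)) (uppart (Y T))) <= Kp * exp (- (r / 2) * X) * S.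
    apply: Rle_trans (nm_mul _ _) _; apply: Rmult_le_compat; try exact: nm_ge0.
      exact: (phL_spec a A B fl).
    by apply: hS; lra.
  have -> : sub (lowpart (Y T)) (mul (phL A lam T) (uppart (Y T))) =
    add (sub (lowpart (Y T)) (mul (phX A lam X T) (uppart (Y T)))) (mul (sub (phX A lam X T) (phL A lam T)) (uppart (Y T))).
    by dist; vec.
  set u := sub _ (mul (phX _ _ _ _) _) in h1 *; set v := mul (sub _ _) _ in h2 *.
  have h3 : nm (add u v) ^ 2 <= (nm u + nm v) ^ 2 by apply: pow_incr; split; [exact: nm_ge0 | exact: nm_add].
  have h4 : nm v ^ 2 <= (Kp * exp (- (r / 2) * X) * S) ^ 2 by apply: pow_incr; split => //; exact: nm_ge0.
  have h5 := pow2_ge_0 (nm u - nm v).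
  have eX : exp (- r * X) = exp (- (r / 2) * X) ^ 2 by rewrite /= Rmult_1_r -exp_plus; congr exp; field.
  have h6 : (Kp * exp (- (r / 2) * X) * S) ^ 2 = (Kp * S) ^ 2 * exp (- r * X) by rewrite eX; ring.
  have e1 : (nm u + nm v) ^ 2 = 2 * nm u ^ 2 + 2 * nm v ^ 2 - (nm u - nm v) ^ 2 by ring.
  lra.
have nz := nm_ge0 (sub (lowpart (Y T)) (mul (phL A lam T) (uppart (Y T)))).
have z : nm (sub (lowpart (Y T)) (mul (phL A lam T) (uppart (Y T)))) = 0 by nra.
have := nm_eq0 _ z => e.
have -> : lowpart (Y T) = add (sub (lowpart (Y T)) (mul (phL A lam T) (uppart (Y T)))) (mul (phL A lam T) (uppart (Y T))) by vec.
by rewrite e; vec.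
Qed.

(** By [weyl_rel] and contractivity of [phL] at every T, the lower component of Y(T) is dominated by
    the upper one. The boundary term of the energy identity at T then has the favourable sign, and
    only the initial |[Pi]|^2 remains. *)
Lemma weyl_L2 T : l <= T -> r * RInt (fun x => nm (Y x) ^ 2) l T <= nm Pi ^ 2.
Proof.
move=> hT; rewrite dirac_energy //.
have e1 : uppart (Y l) = Pi by rewrite /uppart Yl mul_add_r PiPi Piph; vec.
have h1 := phL_contractive a A B fl lam r T (uppart (Y T)) hr Re_lam.
rewrite -weyl_rel // in h1.
have h2 : nm (lowpart (Y T)) ^ 2 <= nm (uppart (Y T)) ^ 2 by apply: pow_incr; split => //; exact: nm_ge0.
rewrite e1; have := pow2_ge_0 (nm (lowpart (Y l))); lra.
Qed.

End Dirac.

(** * Laplace representation and holomorphy *)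

Lemma eq_of_exp_small {M : star_alg} (x y : M) K r : 0 < r ->
  (forall X, 0 <= X -> nm (sub x y) <= K * exp (- r * X)) -> x = y.
Proof.
move=> hr H; have h : nm (sub x y) <= 0.
  by apply: (le_of_exp_small _ _ K r hr) => X hX; rewrite Rplus_0_l; exact: H.
have h0 := nm_ge0 (sub x y).
have e := nm_eq0 (sub x y) ltac:(lra).
have -> : x = add (sub x y) y by vec.
by rewrite e; vec.
Qed.

Section Phi.
Context {M : star_alg} (a : R -> M) (A B : R -> R -> M).
Hypothesis fl : flow a A B.

Let cP1 : c2 (Ph1 A) := c2_Ph1 a A B fl.
Let cP2 : c2 (Ph2 A) := c2_Ph2 a A B fl.

(** A bounded additive relation that holds for every truncation passes to the limit; it is applied
    to the two conditions describing the lower left block. *)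
Lemma phL_lin (h : M -> M) K lam r l : 0 < r -> Re lam <= - r -> 0 <= K ->
  (forall x y, h (sub x y) = sub (h x) (h y)) -> (forall x, nm (h x) <= K * nm x) ->
  (forall X, h (phX A lam X l) = nul) -> h (phL A lam l) = nul.
Proof.
move=> hr hl hK hs hb h0.
apply: (eq_of_exp_small _ _ (K * phL_rate (M := M) lam r) (r / 2)); first lra.
move=> X hX.
have -> : sub (h (phL A lam l)) nul = h (neg (sub (phX A lam X l) (phL A lam l))).
  have -> : neg (sub (phX A lam X l) (phL A lam l)) = sub (phL A lam l) (phX A lam X l) by vec.
  by rewrite hs h0.
apply: Rle_trans (hb _) _; rewrite nm_neg.
have := Rmult_le_compat_l K _ _ hK (phL_spec a A B fl lam r X l hr hl hX); lra.
Qed.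

Lemma phL_support Pi lam r l : 0 < r -> Re lam <= - r ->
  (forall x l, mul (A x l) Pi = A x l) -> (forall x l, mul Pi (A x l) = nul) ->
  mul (phL A lam l) Pi = phL A lam l /\ mul Pi (phL A lam l) = nul.
Proof.
move=> hr hl hA1 hA2; have [ca cA cB h0 hx hll] := fl.
have p1 t l' : mul (Ph1 A t l') Pi = Ph1 A t l'.
  by rewrite /Ph1 -RInt_cmul; [apply: RInt_ext => s _; exact: hA1 | cts].
have p2 t l' : mul (Ph2 A t l') Pi = Ph2 A t l'.
  by rewrite /Ph2 -RInt_cmul; [apply: RInt_ext => s _; exact: p1 | cts].
have q1 t l' : mul Pi (Ph1 A t l') = nul.
  rewrite /Ph1 -RInt_mulc; last by cts.
  rewrite (RInt_ext _ (fun _ => nul)); last by move=> s _; exact: hA2.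
  by rewrite RInt_cst; vec.
have q2 t l' : mul Pi (Ph2 A t l') = nul.
  rewrite /Ph2 -RInt_mulc; last by cts.
  rewrite (RInt_ext _ (fun _ => nul)); last by move=> s _; exact: q1.
  by rewrite RInt_cst; vec.
split.
  have h : sub (mul (phL A lam l) Pi) (phL A lam l) = nul.
    apply: (phL_lin (fun x => sub (mul x Pi) x) (nm Pi + 1) lam r l hr hl).
    - by have := nm_ge0 Pi; lra.
    - by move=> x y; dist; vec.
    - move=> x; apply: Rle_trans (nm_sub _ _) _; have := nm_mul x Pi; lra.
    - move=> X; rewrite /phX /chi mul_neg_l mulA -RInt_cmul; last by cts.
      rewrite (RInt_ext _ (fun t => mul (expc lam t) (Ph2 A t l))); first by vec.
      by move=> t _; rewrite mulA p2.
  have -> : mul (phL A lam l) Pi = add (sub (mul (phL A lam l) Pi) (phL A lam l)) (phL A lam l) by vec.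
  by rewrite h; vec.
apply: (phL_lin (fun x => mul Pi x) (nm Pi) lam r l hr hl).
- exact: nm_ge0.
- by move=> x y; rewrite mul_sub_r.
- by move=> x; exact: nm_mul.
- move=> X; rewrite /phX /chi mul_neg_r -mulA -cs_comm mulA -RInt_mulc; last by cts.
  rewrite (RInt_ext _ (fun _ => nul)).
    by rewrite RInt_cst (nul_rs one) !mul_rs_r; vec.
  by move=> t _; rewrite -mulA -expc_comm mulA q2 mul_nul_r.
Qed.

(** The boundary term of the integration by parts is a linearly growing factor times exp(-r X). In
    the limit this is the required representation of the Weyl function, with [Ph1] as Phi. *)
Lemma laplace_Ph1 lam r l : 0 < r -> Re lam = - r -> exists K, forall X, 0 <= X ->
  nm (sub (mul (cs lam) (RInt (fun t => mul (expc lam t) (Ph1 A t l)) 0 X)) (phL A lam l)) <= K * exp (- (r / 2) * X).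
Proof.
move=> hr hl.
have hr2 : 0 < r / 2 by lra.
have [K1 [K10 hK1]] := pow_le_exp 1 (r / 2) hr2.
exists (phL_rate (M := M) lam r + Cmod lam * c0 (M := M) * K1) => X hX.
have h1 : add (mul (cs lam) (chi A lam X l)) (RInt (fun t => mul (expc lam t) (Ph1 A t l)) 0 X) = mul (expc lam X) (Ph2 A X l).
  rewrite /chi -RInt_mulc; last by cts.
  rewrite -RInt_add; try by cts.
  rewrite (RInt_ext _ (fun t => add (mul (mul (cs lam) (expc lam t)) (Ph2 A t l)) (mul (expc lam t) (Ph1 A t l))));
    last by move=> t _; dist.
  rewrite (FTC (fun t => mul (expc lam t) (Ph2 A t l))); last 2 first.
  - move=> t; apply: D_mul; [exact: D_expc | exact: (D_Ph2 a A B fl)].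
  - by cts.
  have -> : Ph2 A 0 l = nul by exact: RInt_nul.
  by rewrite mul_nul_r -[minus _ _]/(sub _ _); vec.
have -> : sub (mul (cs lam) (RInt (fun t => mul (expc lam t) (Ph1 A t l)) 0 X)) (phL A lam l) =
  add (sub (phX A lam X l) (phL A lam l)) (mul (cs lam) (mul (expc lam X) (Ph2 A X l))).
  by rewrite -h1 mul_add_r /phX cs_mul mulA; vec.
apply: Rle_trans (nm_add _ _) _.
have b1 := phL_spec a A B fl lam r X l hr ltac:(lra) hX.
have b2 : nm (mul (cs lam) (mul (expc lam X) (Ph2 A X l))) <= Cmod lam * c0 (M := M) * K1 * exp (- (r / 2) * X).
  rewrite nm_cs nm_expc hl.
  have h2 := Ph2_bound a A B fl l X hX.
  have h3 := hK1 X hX; rewrite /= Rmult_1_r in h3.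
  have e : exp (- r * X) * exp (r / 2 * X) = exp (- (r / 2) * X) by rewrite -exp_plus; congr exp; field.
  rewrite -e.
  have m0 := Cmod_ge_0 lam; have E := exp_pos (- r * X).
  have c00 := c0_pos (M := M).
  apply: Rle_trans (_ : Cmod lam * (exp (- r * X) * (c0 (M := M) * (K1 * exp (r / 2 * X)))) <= _); last by apply: Req_le; ring.
  apply: Rmult_le_compat_l => //; apply: Rmult_le_compat_l; first lra.
  apply: Rle_trans h2 _; apply: Rmult_le_compat_l; lra.
lra.
Qed.

(** The derivative is the integral of t exp(lam t) [Ph2]. For |h| <= r/2 the second order remainder
    of the exponential is still integrable: exp(|h| t) uses up half of the decay, and a quarter
    absorbs the factor t^3. A quadratic estimate uniform in h passes easily to the limit in X. *)
Lemma chiL_holo lam r l : 0 < r -> Re lam = - r -> exists (d : M) K, 0 <= K /\ forall h : C, Cmod h <= r / 2 ->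
  nm (sub (sub (chiL A (lam + h)%C l) (chiL A lam l)) (mul (cs h) d)) <= K * Cmod h ^ 2.
Proof.
move=> hr hl.
have c00 := c0_pos (M := M).
have hr4 : 0 < r / 4 by lra.
have hr2 : 0 < r / 2 by lra.
have [K2 [K20 hK2]] := pow_le_exp 2 (r / 2) hr2.
have [K3 [K30 hK3]] := pow_le_exp 3 (r / 4) hr4.
pose dX X := RInt (fun t => rs t (mul (expc lam t) (Ph2 A t l))) 0 X.
have [d hd] : exists d, forall X, 0 <= X -> nm (sub (dX X) d) <= c0 (M := M) * K2 * (2 / r) * exp (- (r / 2) * X).
  apply: exp_cauchy_limit => // X Y hXY.
  have -> : sub (dX Y) (dX X) = RInt (fun t => rs t (mul (expc lam t) (Ph2 A t l))) X Y.
    rewrite /dX -(RInt_cat (fun t => rs t (mul (expc lam t) (Ph2 A t l))) 0 X Y); last by cts.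
    by vec.
  apply: Rle_trans (_ : RInt (fun t => c0 (M := M) * K2 * exp (- (r / 2) * t)) X Y <= _).
    apply: nm_RInt_le; [lra | by cts | by cts |].
    move=> t ht; rewrite nm_rs nm_expc hl Rabs_pos_eq; last lra.
    have h2 := Ph2_bound a A B fl l t ltac:(lra).
    have h3 := hK2 t ltac:(lra).
    have E := exp_pos (- r * t).
    have e : exp (- r * t) * exp (r / 2 * t) = exp (- (r / 2) * t) by rewrite -exp_plus; congr exp; field.
    rewrite -e.
    apply: Rle_trans (_ : t * (exp (- r * t) * (c0 (M := M) * t)) <= _).
      apply: Rmult_le_compat_l; first lra.
      by apply: Rmult_le_compat_l; first lra.
    have -> : t * (exp (- r * t) * (c0 (M := M) * t)) = c0 (M := M) * exp (- r * t) * t ^ 2 by ring.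
    have -> : c0 (M := M) * K2 * (exp (- r * t) * exp (r / 2 * t)) = c0 (M := M) * exp (- r * t) * (K2 * exp (r / 2 * t)) by ring.
    apply: Rmult_le_compat_l => //; apply: Rmult_le_pos; lra.
  rewrite RInt_Rmult; last by cts.
  rewrite RInt_exp_decay //.
  have -> : c0 (M := M) * K2 * ((exp (- (r / 2) * X) - exp (- (r / 2) * Y)) / (r / 2)) =
     c0 (M := M) * K2 * (2 / r) * (exp (- (r / 2) * X) - exp (- (r / 2) * Y)) by field; lra.
  apply: Rmult_le_compat_l; last by have := exp_pos (- (r / 2) * Y); lra.
  apply: Rmult_le_pos; first by apply: Rmult_le_pos; lra.
  by apply: Rlt_le; apply: Rdiv_lt_0_compat; lra.
exists d, (c0 (M := M) * K3 * (4 / r)); split.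
  apply: Rmult_le_pos; first by apply: Rmult_le_pos; lra.
  by apply: Rlt_le; apply: Rdiv_lt_0_compat; lra.
move=> h hh.
have hRe : Re (lam + h)%C <= - (r / 2).
  have := re_le_Cmod h; move: hl hh; case: (lam) => u v; case: (h) => u' v' /= hl hh.
  rewrite /Rabs; case: Rcase_abs; lra.
have bX X : 0 <= X -> nm (sub (sub (chi A (lam + h)%C X l) (chi A lam X l)) (mul (cs h) (dX X))) <=
   c0 (M := M) * K3 * (4 / r) * Cmod h ^ 2.
  move=> hX.
  have -> : sub (sub (chi A (lam + h)%C X l) (chi A lam X l)) (mul (cs h) (dX X)) =
    RInt (fun t => mul (expc lam t) (mul (sub (cs (cexp (h * RtoC t)%C)) (add one (cs (h * RtoC t)%C))) (Ph2 A t l))) 0 X.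
    rewrite /chi /dX -RInt_mulc; last by cts.
    rewrite -RInt_sub; try by cts.
    rewrite -RInt_sub; try by cts.
    apply: RInt_ext => t _.
    have -> : expc (lam + h)%C t = mul (expc lam t) (cs (cexp (h * RtoC t)%C)) :> M.
      rewrite /expc -cs_mul -cexp_plus; congr (cs (cexp _)); ring.
    have -> : cs (h * RtoC t)%C = rs t (cs h) :> M.
      have -> : (h * RtoC t = RtoC t * h)%C by ring.
      by rewrite cs_mul cs_R mul_rs_l mul1l.
    have e : mul (cs h) (mul (expc lam t) (Ph2 A t l)) = mul (expc lam t) (mul (cs h) (Ph2 A t l)).
      by rewrite -!mulA; congr mul; rewrite expc_comm.
    by dist; rewrite e mul1l; vec.
  have cc : cont (fun t => mul (expc lam t) (mul (sub (cs (cexp (h * RtoC t)%C)) (add one (cs (h * RtoC t)%C))) (Ph2 A t l))).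
    have c1 : cont (fun t => cs (cexp (h * RtoC t)%C) : M) by exact: (cont_expc h (fun t => t) cont_id).
    have c3 : cont (fun t => cs (h * RtoC t)%C : M).
      apply: (cont_ext (fun t => rs t (cs h))).
        move=> t; have -> : (h * RtoC t = RtoC t * h)%C by ring.
        by rewrite cs_mul cs_R mul_rs_l mul1l.
      cts.
    by apply: cont_mul; [cts | apply: cont_mul; [apply: cont_sub; [exact: c1 | apply: cont_add; [cts | exact: c3]] | cts]].
  apply: Rle_trans (_ : RInt (fun t => c0 (M := M) * K3 * Cmod h ^ 2 * exp (- (r / 4) * t)) 0 X <= _).
    apply: nm_RInt_le => //; first by cts.
    move=> t [ht _]; rewrite nm_expc hl.
    have h1 := exp_taylor2 (h * RtoC t)%C (Ph2 A t l).
    rewrite Cmod_mult Cmod_R (Rabs_pos_eq _ ht) in h1.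
    have h2 := Ph2_bound a A B fl l t ht.
    have h3 := hK3 t ht.
    have E := exp_pos (- r * t).
    have m0 := Cmod_ge_0 h.
    have h4 : exp (Cmod h * t) <= exp (r / 2 * t) by apply: exp_mono; apply: Rmult_le_compat_r.
    have E4 := exp_pos (Cmod h * t).
    apply: Rle_trans (Rmult_le_compat_l _ _ _ (Rlt_le _ _ E) h1) _.
    have q0 : 0 <= (Cmod h * t) ^ 2 by exact: pow2_ge_0.
    have h5 : (Cmod h * t) ^ 2 * exp (Cmod h * t) * nm (Ph2 A t l) <= (Cmod h * t) ^ 2 * exp (r / 2 * t) * (c0 (M := M) * t).
      apply: Rmult_le_compat => //; try exact: nm_ge0; first by apply: Rmult_le_pos; lra.
      by apply: Rmult_le_compat_l.
    apply: Rle_trans (Rmult_le_compat_l _ _ _ (Rlt_le _ _ E) h5) _.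
    have e : exp (- r * t) * exp (r / 2 * t) * exp (r / 4 * t) = exp (- (r / 4) * t).
      by rewrite -!exp_plus; congr exp; field.
    rewrite -e.
    have -> : exp (- r * t) * ((Cmod h * t) ^ 2 * exp (r / 2 * t) * (c0 (M := M) * t)) =
      (c0 (M := M) * Cmod h ^ 2 * exp (- r * t) * exp (r / 2 * t)) * t ^ 3 by ring.
    have -> : c0 (M := M) * K3 * Cmod h ^ 2 * (exp (- r * t) * exp (r / 2 * t) * exp (r / 4 * t)) =
      (c0 (M := M) * Cmod h ^ 2 * exp (- r * t) * exp (r / 2 * t)) * (K3 * exp (r / 4 * t)) by ring.
    apply: Rmult_le_compat_l => //.
    apply: Rmult_le_pos; last by apply: Rlt_le; exact: exp_pos.
    apply: Rmult_le_pos; last lra.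
    by apply: Rmult_le_pos; [lra | exact: pow2_ge_0].
  rewrite RInt_Rmult; last by cts.
  rewrite RInt_exp_decay // Rmult_0_r exp_0.
  have -> : c0 (M := M) * K3 * Cmod h ^ 2 * ((1 - exp (- (r / 4) * X)) / (r / 4)) =
    c0 (M := M) * K3 * (4 / r) * Cmod h ^ 2 * (1 - exp (- (r / 4) * X)) by field; lra.
  rewrite -[X in _ <= X]Rmult_1_r; apply: Rmult_le_compat_l; last by have := exp_pos (- (r / 4) * X); lra.
  apply: Rmult_le_pos; last exact: pow2_ge_0.
  apply: Rmult_le_pos; first by apply: Rmult_le_pos; lra.
  by apply: Rlt_le; apply: Rdiv_lt_0_compat; lra.
pose k1 := c0 (M := M) * (4 / (r / 2) ^ 2); pose k2 := c0 (M := M) * (4 / r ^ 2).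
pose k3 := Cmod h * (c0 (M := M) * K2 * (2 / r)).
have kp (s : R) : 0 < s -> 0 <= c0 (M := M) * (4 / s ^ 2).
  move=> hs; apply: Rmult_le_pos; first lra.
  apply: Rlt_le; apply: Rdiv_lt_0_compat; [lra | nra].
apply: (le_of_exp_small _ _ (k1 + k2 + k3) (r / 4)) => // X hX.
have m0 := Cmod_ge_0 h.
have b1 := chiL_spec a A B fl (lam + h)%C (r / 2) X l hr2 hRe hX.
have b2 := chiL_spec a A B fl lam r X l hr ltac:(lra) hX.
have b3 := Rmult_le_compat_l _ _ _ m0 (hd X hX).
have b4 := bX X hX.
have ee : exp (- (r / 2) * X) <= exp (- (r / 4) * X) by apply: exp_mono; nra.
have e1 : - (r / 2 / 2) * X = - (r / 4) * X by field.
rewrite e1 -/k1 in b1.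
have -> : sub (sub (chiL A (lam + h)%C l) (chiL A lam l)) (mul (cs h) d) =
  add (sub (sub (chi A (lam + h)%C X l) (chi A lam X l)) (mul (cs h) (dX X)))
   (sub (add (sub (chi A lam X l) (chiL A lam l)) (mul (cs h) (sub (dX X) d))) (sub (chi A (lam + h)%C X l) (chiL A (lam + h)%C l))).
  by rewrite mul_sub_r; vec.
apply: Rle_trans (nm_add _ _) _.
apply: Rle_trans (Rplus_le_compat_l _ _ _ (nm_sub _ _)) _.
apply: Rle_trans (Rplus_le_compat_l _ _ _ (Rplus_le_compat_r _ _ _ (nm_add _ _))) _.
rewrite nm_cs.
have q2 := Rmult_le_compat_l _ _ _ (kp r hr) ee; rewrite -/k2 in q2 b2.
have q3 : Cmod h * (c0 (M := M) * K2 * (2 / r) * exp (- (r / 2) * X)) <= k3 * exp (- (r / 4) * X).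
  rewrite -Rmult_assoc -/k3; apply: Rmult_le_compat_l => //.
  apply: Rmult_le_pos => //; apply: Rmult_le_pos; first by apply: Rmult_le_pos; lra.
  by apply: Rlt_le; apply: Rdiv_lt_0_compat; lra.
lra.
Qed.

End Phi.

(** * The truncated wave system *)

Section Clip.
Context {M : star_alg}.

(* Truncation in norm, so that the nonlinear wave system becomes globally Lipschitz. *)
Definition clip (m : R) (v : M) : M := rs (m / Rmax m (nm v)) v.

Lemma clip_bound m v : 0 < m -> nm (clip m v) <= m.
Proof.
move=> hm; rewrite /clip nm_rs.
have h1 : m <= Rmax m (nm v) by exact: Rmax_l.
have h2 : nm v <= Rmax m (nm v) by exact: Rmax_r.
rewrite Rabs_pos_eq; last by apply: Rlt_le; apply: Rdiv_lt_0_compat; lra.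
have -> : m / Rmax m (nm v) * nm v = m * (nm v / Rmax m (nm v)) by rewrite /Rdiv; ring.
rewrite -[X in _ <= X]Rmult_1_r; apply: Rmult_le_compat_l; first lra.
by apply/Rle_div_l; lra.
Qed.

Lemma clip_id m v : 0 < m -> nm v <= m -> clip m v = v.
Proof.
move=> hm hv; rewrite /clip Rmax_left //.
by have -> : m / m = 1; [field; lra | vec].
Qed.

Lemma clip_lip m u v : 0 < m -> nm (sub (clip m u) (clip m v)) <= 2 * nm (sub u v).
Proof.
move=> hm; rewrite /clip; set x := Rmax m (nm u); set y := Rmax m (nm v).
have hx : m <= x by exact: Rmax_l.
have hy : m <= y by exact: Rmax_l.
have hv : nm v <= y by exact: Rmax_r.
have -> : sub (rs (m / x) u) (rs (m / y) v) = add (rs (m / x) (sub u v)) (rs (m / x - m / y) v) by vec.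
apply: Rle_trans (nm_add _ _) _; rewrite !nm_rs.
have d0 := nm_ge0 (sub u v); have v0 := nm_ge0 v.
have h1 : Rabs (m / x) <= 1.
  rewrite Rabs_pos_eq; last by apply: Rlt_le; apply: Rdiv_lt_0_compat; lra.
  by apply/Rle_div_l; lra.
have h2 : Rabs (y - x) <= nm (sub u v).
  have a1 : nm u <= nm v + nm (sub u v).
    have {1}-> : u = add v (sub u v) by vec.
    exact: nm_add.
  have a2 : nm v <= nm u + nm (sub u v).
    rewrite nm_sub_sym; have {1}-> : v = add u (sub v u) by vec.
    exact: nm_add.
  apply: Rabs_le; rewrite /x /y /Rmax; case: Rle_dec => ?; case: Rle_dec => ?; lra.
have h3 : Rabs (m / x - m / y) * nm v <= nm (sub u v).
  have -> : m / x - m / y = (y - x) * (m / x) * / y by field; lra.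
  rewrite Rabs_mult (Rabs_mult (y - x)) (Rabs_pos_eq (/ y)); last by apply: Rlt_le; apply: Rinv_0_lt_compat; lra.
  have h4 : / y * nm v <= 1.
    by rewrite Rmult_comm; apply/Rle_div_l; lra.
  have p1 := Rabs_pos (y - x); have p2 := Rabs_pos (m / x).
  have p3 : 0 <= / y * nm v by apply: Rmult_le_pos => //; apply: Rlt_le; apply: Rinv_0_lt_compat; lra.
  have h5 : Rabs (y - x) * Rabs (m / x) <= nm (sub u v) * 1 by apply: Rmult_le_compat.
  have h6 : (Rabs (y - x) * Rabs (m / x)) * (/ y * nm v) <= nm (sub u v) * 1 * 1.
    by apply: Rmult_le_compat => //; apply: Rmult_le_pos.
  lra.
have : Rabs (m / x) * nm (sub u v) <= 1 * nm (sub u v) by apply: Rmult_le_compat_r.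
lra.
Qed.

Lemma cont_clip {U : UniformSpace} m (f : U -> M) : 0 < m -> cont f -> cont (fun u => clip m (f u)).
Proof. by move=> hm cf; apply: (cont_Lip (clip m) f 2) => // x y; apply: clip_lip. Qed.

End Clip.

Section GL.
Context {M : star_alg}.

(** The wave system with its first component eliminated: F(s, .) is minus the integral of b^* E over
    [0, s], and the equation for E is integrated along l + t = const. *)
Definition wave_op (b : R -> M) (E : R * R -> M) (l t : R) : M :=
  RInt (fun s => mul (b s) (RInt (fun r => mul (adj (b r)) (E (r, l + t - s))) 0 s)) 0 l.

Lemma c2_Op b E : cont b -> cont E -> c2 (wave_op b E).
Proof. move=> cb cE; rewrite /wave_op; cts. Qed.

Lemma dep_region r s l t : Rmin 0 l <= s <= Rmax 0 l -> Rmin 0 s <= r <= Rmax 0 s ->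
  Rabs r <= Rabs s <= Rabs l /\ Rabs r + Rabs (l + t - s) <= Rabs l + Rabs t.
Proof.
move=> h1 h2; have [a1 a2] := abs_between s l h1; have [a3 a4] := abs_between r s h2.
have : Rabs (l + t - s) <= Rabs (l - s) + Rabs t.
  have -> : l + t - s = (l - s) + t by ring.
  exact: Rabs_triang.
lra.
Qed.

Lemma Op_bound_gen (G : R -> R -> M) l c k : c2 G -> 0 < k -> 0 <= c ->
  (forall s r, Rmin 0 l <= s <= Rmax 0 l -> Rmin 0 s <= r <= Rmax 0 s -> nm (G s r) <= c * exp (k * Rabs s)) ->
  nm (RInt (fun s => RInt (G s) 0 s) 0 l) <= Rabs l * c / k * exp (k * Rabs l).
Proof.
move=> cG hk hc H.
have {3}-> : l = l - 0 by ring.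
apply: RInt_exp_bound => //; first by cts.
move=> s hs; rewrite Rminus_0_r.
have [a1 a2] := abs_between s l hs.
apply: Rle_trans (_ : Rabs (s - 0) * (c * exp (k * Rabs s)) <= _).
  apply: nm_RInt_const; first exact: c2_2.
  by move=> r hr; apply: H.
rewrite Rminus_0_r Rmult_assoc; apply: Rmult_le_compat_r => //.
apply: Rmult_le_pos => //; apply: Rlt_le; exact: exp_pos.
Qed.

Lemma Op_flat b E l t : cont b -> cont E ->
  wave_op b E l t = RInt (fun s => RInt (fun r => mul (b s) (mul (adj (b r)) (E (r, l + t - s)))) 0 s) 0 l.
Proof. by move=> cb cE; apply: RInt_ext => s _; rewrite RInt_mulc //; cts. Qed.

Lemma Op_sub b E E' l t : cont b -> cont E -> cont E' ->
  sub (wave_op b E l t) (wave_op b E' l t) = wave_op b (fun p => sub (E p) (E' p)) l t.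
Proof.
move=> cb cE cE'; rewrite !Op_flat //; try by cts.
rewrite -RInt_sub; try by cts.
apply: RInt_ext => s _; rewrite -RInt_sub; try by cts.
by apply: RInt_ext => r _; dist.
Qed.

(** The double integral gains [1 / kap] against the weight exp(kap |l|), with constant X k1^2; the
    choice of [kap] makes the total factor at most 1/2. *)
Lemma Op_zero b D : cont b -> cont D -> (forall l t, D (l, t) = wave_op b D l t) -> forall l t, D (l, t) = nul.
Proof.
move=> cb cD hD.
have [k1 [mk1 [k11 hk1]]] := bound_1 b cb.
have [k2 [mk2 [k21 hk2]]] := bound_2 (fun l t => D (l, t)) (c2_pair _ cD).
move=> l0 t0.
pose X := Rabs l0 + Rabs t0.
have X0 : 0 <= X by rewrite /X; have := Rabs_pos l0; have := Rabs_pos t0; lra.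
have kb := k11 X; have kD := k21 X.
pose kap := 1 + 2 * (X * k1 X ^ 2).
have kp : 0 <= X * k1 X ^ 2 by apply: Rmult_le_pos => //; exact: pow2_ge_0.
have kap0 : 0 < kap by rewrite /kap; lra.
have H := halving_zero (fun p : R * R => Rabs (fst p) + Rabs (snd p) <= X) (fun p => exp (kap * Rabs (fst p)))
  (fun p => nm (D p)) (k2 X) _ _ _ (l0, t0) _.
have h0 : nm (D (l0, t0)) <= 0.
  apply: H => /=; last exact: Rle_refl.
  - move=> [l t] /= hp; apply: Rle_trans (hk2 X l t hp) _.
    rewrite -{1}(Rmult_1_r (k2 X)); apply: Rmult_le_compat_l; first lra.
    rewrite -exp_0; apply: exp_mono; have := Rabs_pos l; nra.
  - lra.
  - move=> c hc hD' [l t] /= hp.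
    rewrite hD Op_flat //.
    apply: Rle_trans (Op_bound_gen _ l (k1 X ^ 2 * c) kap _ kap0 _ _) _.
    + cts.
    + apply: Rmult_le_pos => //; exact: pow2_ge_0.
    + move=> s r hs hr; have [[q1 q2] q3] := dep_region r s l t hs hr.
      have pr := Rabs_pos r; have pt := Rabs_pos t; have pls := Rabs_pos (l + t - s).
      have -> : k1 X ^ 2 * c * exp (kap * Rabs s) = k1 X * (k1 X * (c * exp (kap * Rabs s))) by ring.
      apply: Rle_trans (nm_mul _ _) _; apply: Rmult_le_compat; try exact: nm_ge0.
        by apply: hk1; lra.
      apply: Rle_trans (nm_mul _ _) _; rewrite nm_adj; apply: Rmult_le_compat; try exact: nm_ge0.
        by apply: hk1; lra.
      apply: Rle_trans (hD' (r, l + t - s) _) _ => /=; first lra.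
      apply: Rmult_le_compat_l => //; apply: exp_mono; apply: Rmult_le_compat_l; lra.
    + apply: Rmult_le_compat_r; first by apply: Rlt_le; exact: exp_pos.
      apply/Rle_div_l; first lra.
      have -> : c / 2 * kap = c / 2 + X * (k1 X ^ 2 * c) by rewrite /kap; field.
      have : Rabs l * (k1 X ^ 2 * c) <= X * (k1 X ^ 2 * c).
        apply: Rmult_le_compat_r; last by have := Rabs_pos t; lra.
        apply: Rmult_le_pos => //; exact: pow2_ge_0.
      lra.
apply: nm_eq0; have := nm_ge0 (D (l0, t0)); lra.
Qed.

(** With [b] frozen, the t-derivative of E must solve the same linear equation with c' in place of
    c. This lemma constructs that candidate, and [Op_zero] identifies it with the derivative in
    [clipped_wave]. *)
Lemma lin_fix b (c : R -> M) : cont b -> cont c ->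
  exists e : R * R -> M, cont e /\ forall l t, e (l, t) = add (c (l + t)) (wave_op b e l t).
Proof.
move=> cb cc.
have [k1 [mk1 [k11 hk1]]] := bound_1 b cb.
have [k2 [mk2 [k21 hk2]]] := bound_1 c cc.
pose Th (e : R * R -> M) (p : R * R) := add (c (fst p + snd p)) (wave_op b e (fst p) (snd p)).
have cTh e : cont e -> cont (Th e) by move=> ce; have cO := c2_Op b e cb ce; rewrite /Th; cts.
pose C x := 1 + Rmax 0 x * k1 x ^ 2.
have mC : mono_nonneg C by rewrite /C; mono_tac.
have [e [ce [_ he]]] : exists e : R * R -> M, cont e /\ (forall p : R * R, True) /\ forall p, Th e p = e p.
  apply: (volterra_fix (fun p => Rabs (fst p)) (fun p => Rabs (fst p) + Rabs (snd p)) k2 C (fun _ _ => True) Th (fun _ => nul)) => //.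
  - case=> x y /=; have := Rabs_pos x; have := Rabs_pos y; lra.
  - exact: locally_size.
  - exact: (proj1 mk2).
  - move=> x; have := k21 x; lra.
  - exact: (proj1 mC).
  - move=> x; have : mono_nonneg (fun x => Rmax 0 x * k1 x ^ 2) by mono_tac.
    case=> _ /(_ x); rewrite /C; lra.
  - by cts.
  - case=> x t /=; rewrite -[norm _]/(nm (sub (Th (fun _ => nul) (x, t)) nul)).
    have -> : sub (Th (fun _ => nul) (x, t)) nul = c (x + t).
      rewrite /Th /= Op_flat //; last by cts.
      rewrite (RInt_ext _ (fun _ => nul)); first by rewrite RInt_cst; vec.
      move=> s _; rewrite (RInt_ext _ (fun _ => nul)); first by rewrite RInt_cst; vec.
      by move=> r _; rewrite !mul_nul_r.
    by apply: hk2; exact: Rabs_triang.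
  - by move=> E cE _; split => //; apply: cTh.
  - move=> E E' [l t] k c0 cE cE' _ _ hk hc /= hd.
    rewrite -[norm _]/(nm (sub (Th E (l, t)) (Th E' (l, t)))).
    have -> : sub (Th E (l, t)) (Th E' (l, t)) = wave_op b (fun p => sub (E p) (E' p)) l t.
      by rewrite -Op_sub // /Th /=; vec.
    set X := Rabs l + Rabs t in hd *.
    have X0 : 0 <= X by rewrite /X; have := Rabs_pos l; have := Rabs_pos t; lra.
    have kb := k11 X.
    rewrite Op_flat //; last by cts.
    apply: Rle_trans (Op_bound_gen _ l (k1 X ^ 2 * c0) k _ hk _ _) _.
    + cts.
    + apply: Rmult_le_pos => //; exact: pow2_ge_0.
    + move=> s r hs hr; have [[q1 q2] q3] := dep_region r s l t hs hr.
      have pr := Rabs_pos r; have pt := Rabs_pos t; have pls := Rabs_pos (l + t - s).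
      have -> : k1 X ^ 2 * c0 * exp (k * Rabs s) = k1 X * (k1 X * (c0 * exp (k * Rabs s))) by ring.
      apply: Rle_trans (nm_mul _ _) _; apply: Rmult_le_compat; try exact: nm_ge0.
        by apply: hk1; rewrite /X; lra.
      apply: Rle_trans (nm_mul _ _) _; rewrite nm_adj; apply: Rmult_le_compat; try exact: nm_ge0.
        by apply: hk1; rewrite /X; lra.
      apply: Rle_trans (_ : c0 * exp (k * Rabs r) <= _).
        by apply: (hd (r, l + t - s)) => /=; [lra | rewrite /X; lra].
      apply: Rmult_le_compat_l => //; apply: exp_mono; apply: Rmult_le_compat_l; lra.
    + have -> : C X / k * (c0 * exp (k * Rabs l)) = C X * c0 / k * exp (k * Rabs l) by rewrite /Rdiv; ring.
      apply: Rmult_le_compat_r; first by apply: Rlt_le; exact: exp_pos.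
      apply: Rmult_le_compat_r; first by apply: Rlt_le; exact: Rinv_0_lt_compat.
      rewrite /C Rmax_right //.
      have : Rabs l * (k1 X ^ 2 * c0) <= X * (k1 X ^ 2 * c0).
        apply: Rmult_le_compat_r; last by rewrite /X; have := Rabs_pos t; lra.
        apply: Rmult_le_pos => //; exact: pow2_ge_0.
      lra.
by exists e; split => // l t; rewrite -he.
Qed.

(** Truncation bounds [b] by m, so that the bound on E is invariant as for a linear equation. The
    Lipschitz constant is m^2 from E itself plus 2 m K from each of the two occurrences of [b], the
    2 being the Lipschitz constant of [clip]. *)
Lemma clip_fix (m : R) (c : R -> M) : 0 < m -> cont c ->
  exists E : R * R -> M, cont E /\ forall l t, E (l, t) = add (c (l + t)) (wave_op (fun s => clip m (E (s, 0))) E l t).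
Proof.
move=> hm cc.
have [k2 [mk2 [k21 hk2]]] := bound_1 c cc.
pose bb (E : R * R -> M) s := clip m (E (s, 0)).
have cbb E : cont E -> cont (bb E) by move=> cE; apply: cont_clip => //; cts.
pose Th (E : R * R -> M) (p : R * R) := add (c (fst p + snd p)) (wave_op (bb E) E (fst p) (snd p)).
have cTh e : cont e -> cont (Th e) by move=> ce; have cO := c2_Op (bb e) e (cbb e ce) ce; rewrite /Th; cts.
pose kap x := 1 + 2 * m ^ 2 * Rmax 0 x.
have m20 : 0 <= m ^ 2 by exact: pow2_ge_0.
have mkap : mono_nonneg kap by rewrite /kap; mono_tac.
have kap1 x : 1 <= kap x by rewrite /kap; have := Rmax_l 0 x; nra.
pose K x := 2 * k2 x * exp (kap x * Rmax 0 x).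
have mK : mono_nonneg K by rewrite /K; mono_tac.
pose C x := 1 + Rmax 0 x * (m ^ 2 + 4 * m * K x).
have mC : mono_nonneg C by rewrite /C; mono_tac.
pose L (p : R * R) := Rabs (fst p) + Rabs (snd p).
pose S (p : R * R) (v : M) := nm v <= 2 * k2 (L p) * exp (kap (L p) * Rabs (fst p)).
have L0 p : 0 <= L p by rewrite /L; have := Rabs_pos (fst p); have := Rabs_pos (snd p); lra.
have SK p v : S p v -> nm v <= K (L p).
  move=> h; apply: Rle_trans h _; rewrite /K Rmax_right //; apply: Rmult_le_compat_l.
    have := k21 (L p); lra.
  apply: exp_mono; apply: Rmult_le_compat_l; first by have := kap1 (L p); lra.
  rewrite /L; have := Rabs_pos (snd p); lra.
have SKX E X r y : (forall p, S p (E p)) -> Rabs r + Rabs y <= X -> nm (E (r, y)) <= K X.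
  by move=> hS h; apply: Rle_trans (SK _ _ (hS (r, y))) _; apply: (proj1 mK).
have SO E p : cont E -> (forall p, S p (E p)) -> S p (Th E p).
  move=> cE hS; case: p => l t; rewrite /S /Th /= -/(L (l, t)); set X := L (l, t).
  have X0 : 0 <= X by exact: L0.
  have k0 := k21 X; have kk := kap1 X.
  have h1 : nm (c (l + t)) <= k2 X by apply: hk2; exact: Rabs_triang.
  have h2 : nm (wave_op (bb E) E l t) <= Rabs l * (m ^ 2 * (2 * k2 X)) / kap X * exp (kap X * Rabs l).
    have cb := cbb E cE.
    rewrite Op_flat //; apply: Op_bound_gen; [by cts | lra | by apply: Rmult_le_pos; lra |].
    move=> s r hs hr; have [[q1 q2] q3] := dep_region r s l t hs hr.
    have pr := Rabs_pos r.
    have -> : m ^ 2 * (2 * k2 X) * exp (kap X * Rabs s) = m * (m * (2 * k2 X * exp (kap X * Rabs s))) by ring.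
    apply: Rle_trans (nm_mul _ _) _; apply: Rmult_le_compat; try exact: nm_ge0; first exact: clip_bound.
    apply: Rle_trans (nm_mul _ _) _; rewrite nm_adj; apply: Rmult_le_compat; try exact: nm_ge0; first exact: clip_bound.
    have hX : L (r, l + t - s) <= X by [].
    apply: Rle_trans (hS (r, l + t - s)) _; apply: Rmult_le_compat.
    + have := k21 (L (r, l + t - s)); lra.
    + apply: Rlt_le; exact: exp_pos.
    + have := proj1 mk2 _ _ hX; lra.
    + apply: exp_mono => /=; apply: Rle_trans (_ : kap X * Rabs r <= _).
        by apply: Rmult_le_compat_r => //; exact: (proj1 mkap).
      by apply: Rmult_le_compat_l; lra.
  have h3 : Rabs l * (m ^ 2 * (2 * k2 X)) / kap X <= k2 X.
    apply/Rle_div_l; first lra.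
    have hl : Rabs l <= X by rewrite /X /L /=; have := Rabs_pos t; lra.
    have := Rmult_le_compat_r (m ^ 2 * (2 * k2 X)) _ _ ltac:(apply: Rmult_le_pos; lra) hl.
    rewrite /kap Rmax_right //; lra.
  have e4 : 1 <= exp (kap X * Rabs l).
    rewrite -exp_0; apply: exp_mono; apply: Rmult_le_pos; [lra | exact: Rabs_pos].
  apply: Rle_trans (nm_add _ _) _.
  have := Rmult_le_compat_r (exp (kap X * Rabs l)) _ _ ltac:(lra) h3; nra.
have Sn p : S p nul.
  rewrite /S nm_nul; apply: Rmult_le_pos; last by apply: Rlt_le; exact: exp_pos.
  have := k21 (L p); lra.
have [E [cE [_ hE]]] : exists E : R * R -> M, cont E /\ (forall p, S p (E p)) /\ forall p, Th E p = E p;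
  last by exists E; split => // l t; rewrite -{1}hE.
apply: (volterra_fix (fun p => Rabs (fst p)) L K C S Th (fun _ => nul)) => //.
- case=> x y; rewrite /L /=; have := Rabs_pos x; have := Rabs_pos y; lra.
- exact: locally_size.
- exact: (proj1 mK).
- move=> x; rewrite /K; apply: Rmult_lt_0_compat; [have := k21 x; lra | exact: exp_pos].
- exact: (proj1 mC).
- move=> x; have : mono_nonneg (fun x => Rmax 0 x * (m ^ 2 + 4 * m * K x)) by mono_tac.
  case=> _ /(_ x); rewrite /C; lra.
- move=> p v h; rewrite /S; apply: le_epsilon => eps he.
  have [u [h1 h2]] := h eps he.
  rewrite /S in h1.
  have : nm v <= nm (sub u v) + nm u.
    rewrite nm_sub_sym; have -> : nm v = nm (add (sub v u) u) by congr nm; vec.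
    exact: nm_add.
  have : nm (sub u v) < eps by exact: h2.
  lra.
- by cts.
- move=> p; rewrite -[norm _]/(nm (sub (Th (fun _ => nul) p) nul)).
  have -> : sub (Th (fun _ => nul) p) nul = Th (fun _ => nul) p by vec.
  by apply: SK; apply: SO => //; cts.
- by move=> E cE hS; split; [exact: cTh | move=> p; exact: SO].
- move=> E E' [l t] k c0 cE cE' hS hS' hk hc /= hd.
  have cb := cbb E cE; have cb' := cbb E' cE'.
  rewrite -[norm _]/(nm (sub (Th E (l, t)) (Th E' (l, t)))).
  rewrite -/(L (l, t)); rewrite -/(L (l, t)) in hd; set X := L (l, t) in hd *.
  have X0 : 0 <= X by exact: L0.
  have KX : 0 <= K X by exact: (proj2 mK).
  pose G s r := sub (mul (bb E s) (mul (adj (bb E r)) (E (r, l + t - s))))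
      (mul (bb E' s) (mul (adj (bb E' r)) (E' (r, l + t - s)))).
  have cG : c2 G by rewrite /G; cts.
  have -> : sub (Th E (l, t)) (Th E' (l, t)) = RInt (fun s => RInt (G s) 0 s) 0 l.
    have -> : sub (Th E (l, t)) (Th E' (l, t)) = sub (wave_op (bb E) E l t) (wave_op (bb E') E' l t) by rewrite /Th /=; vec.
    rewrite !Op_flat // -RInt_sub; try by cts.
    by apply: RInt_ext => s _; rewrite -RInt_sub //; cts.
  apply: Rle_trans (Op_bound_gen G l ((m ^ 2 + 4 * m * K X) * c0) k cG hk _ _) _.
  + apply: Rmult_le_pos => //; have : 0 <= m * K X by apply: Rmult_le_pos; lra.
    lra.
  + move=> s r hs hr; have [[q1 q2] q3] := dep_region r s l t hs hr.
    have pr := Rabs_pos r; have ps := Rabs_pos s; have pt := Rabs_pos t; have pls := Rabs_pos (l + t - s).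
    have hXl : Rabs l <= X by rewrite /X /L /=; lra.
    set W := c0 * exp (k * Rabs s).
    have W0 : 0 <= W by apply: Rmult_le_pos => //; apply: Rlt_le; exact: exp_pos.
    have hq3 : Rabs r + Rabs (l + t - s) <= X by [].
    have db u : Rabs u <= Rabs s -> nm (sub (bb E u) (bb E' u)) <= 2 * W.
      move=> hu; apply: Rle_trans (clip_lip m _ _ hm) _; apply: Rmult_le_compat_l; first lra.
      apply: Rle_trans (_ : c0 * exp (k * Rabs u) <= _).
        by apply: (hd (u, 0)); rewrite /L /= ?Rabs_R0; lra.
      apply: Rmult_le_compat_l => //; apply: exp_mono; apply: Rmult_le_compat_l; lra.
    have dE : nm (sub (E (r, l + t - s)) (E' (r, l + t - s))) <= W.
      apply: Rle_trans (_ : c0 * exp (k * Rabs r) <= _).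
        by apply: (hd (r, l + t - s)); rewrite /L /=; lra.
      apply: Rmult_le_compat_l => //; apply: exp_mono; apply: Rmult_le_compat_l; lra.
    have nE := SKX E X r (l + t - s) hS hq3.
    have nb (E1 : R * R -> M) u : nm (bb E1 u) <= m by exact: clip_bound.
    have e1 : G s r = add (mul (sub (bb E s) (bb E' s)) (mul (adj (bb E r)) (E (r, l + t - s))))
       (add (mul (bb E' s) (mul (adj (sub (bb E r) (bb E' r))) (E (r, l + t - s))))
            (mul (bb E' s) (mul (adj (bb E' r)) (sub (E (r, l + t - s)) (E' (r, l + t - s)))))).
      by rewrite /G adj_sub; dist; vec.
    have n3 (x y z : M) x' y' z' : nm x <= x' -> nm y <= y' -> nm z <= z' -> nm (mul x (mul (adj y) z)) <= x' * (y' * z').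
      move=> h1 h2 h3; apply: Rle_trans (nm_mul _ _) _; apply: Rmult_le_compat => //; try exact: nm_ge0.
      by apply: Rle_trans (nm_mul _ _) _; rewrite nm_adj; apply: Rmult_le_compat => //; exact: nm_ge0.
    rewrite e1; apply: Rle_trans (nm_add _ _) _.
    apply: Rle_trans (Rplus_le_compat_l _ _ _ (nm_add _ _)) _.
    have r1 := n3 _ _ _ _ _ _ (db s (Rle_refl _)) (nb E r) nE.
    have r2 := n3 _ _ _ _ _ _ (nb E' s) (db r q1) nE.
    have r3 := n3 _ _ _ _ _ _ (nb E' s) (nb E' r) dE.
    rewrite Rmult_assoc -/W; lra.
  + have -> : C X / k * (c0 * exp (k * Rabs l)) = C X * c0 / k * exp (k * Rabs l) by rewrite /Rdiv; ring.
    apply: Rmult_le_compat_r; first by apply: Rlt_le; exact: exp_pos.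
    apply: Rmult_le_compat_r; first by apply: Rlt_le; exact: Rinv_0_lt_compat.
    rewrite /C Rmax_right //.
    have p0 : 0 <= (m ^ 2 + 4 * m * K X) * c0.
      apply: Rmult_le_pos => //; have : 0 <= m * K X by apply: Rmult_le_pos; lra.
      lra.
    have : Rabs l * ((m ^ 2 + 4 * m * K X) * c0) <= X * ((m ^ 2 + 4 * m * K X) * c0).
      by apply: Rmult_le_compat_r => //; rewrite /X /L /=; have := Rabs_pos t; lra.
    lra.
Qed.

Definition wave_F (b : R -> M) (E : R * R -> M) (l t : R) : M := neg (RInt (fun r => mul (adj (b r)) (E (r, t))) 0 l).

Lemma clipped_wave (m : R) (c c' : R -> M) : 0 < m -> cont c -> cont c' -> (forall x, is_derive c x (c' x)) ->
  exists (E F e f : R -> R -> M) (b : R -> M), c2 E /\ c2 F /\ c2 e /\ c2 f /\ cont b /\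
    (forall l, b l = clip m (E l 0)) /\
    (forall l t, is_derive (E l) t (e l t)) /\ (forall l t, is_derive (F l) t (f l t)) /\
    (forall l t, is_derive (fun l => E l t) l (sub (e l t) (mul (b l) (F l t)))) /\
    (forall l t, is_derive (fun l => F l t) l (neg (mul (adj (b l)) (E l t)))) /\
    (forall t, F 0 t = nul) /\ (forall t, E 0 t = c t) /\
    (forall l t, E l t = sub (c (l + t)) (RInt (fun s => mul (b s) (F s (l + t - s))) 0 l)).
Proof.
move=> hm cc cc' dc.
have [E [cE hE]] := clip_fix m c hm cc.
pose b s := clip m (E (s, 0)).
have cb : cont b by apply: cont_clip => //; cts.
have [e [ce he]] := lin_fix b c' cb cc'.
pose F l t := wave_F b E l t; pose f l t := wave_F b e l t.
have cF : c2 F by rewrite /F /wave_F; cts.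
have cf : c2 f by rewrite /f /wave_F; cts.
have cE2 := c2_pair E cE; have ce2 := c2_pair e ce.
have OpF E1 l t : cont E1 -> wave_op b E1 l t = neg (RInt (fun s => mul (b s) (wave_F b E1 s (l + t - s))) 0 l).
  move=> cE1; rewrite -RInt_neg; last by rewrite /wave_F; cts.
  by apply: RInt_ext => s _; rewrite /wave_F mul_neg_r; vec.
(* Differentiability of E in t. The coefficient [b] does not depend on t, so the increment of E
   minus the integral of [e] solves the homogeneous linear equation and vanishes by [Op_zero]. *)
have inc h l t : E (l, t + h) = add (E (l, t)) (RInt (fun u => e (l, t + u)) 0 h).
  pose D (p : R * R) := sub (sub (E (fst p, snd p + h)) (E p)) (RInt (fun u => e (fst p, snd p + u)) 0 h).
  have cD : cont D by rewrite /D; cts.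
  have hD : forall l t, D (l, t) = wave_op b D l t.
    move=> l' t'; rewrite /D /= hE (hE l' t') -/b.
    have -> : RInt (fun u => e (l', t' + u)) 0 h = add (sub (c (l' + (t' + h))) (c (l' + t')))
        (wave_op b (fun p => RInt (fun u => e (fst p, snd p + u)) 0 h) l' t').
      rewrite (RInt_ext _ (fun u => add (c' (l' + t' + u)) (wave_op b e l' (t' + u)))); last first.
        by move=> u _; rewrite he; congr (add (c' _) _); ring.
      have cO := c2_Op b e cb ce.
      rewrite RInt_add; try by cts.
      congr add.
        have := RInt_shift c' (l' + t') 0 h cc'.
        rewrite (RInt_ext _ (fun u => c' (l' + t' + u))); last by move=> u _; congr c'; ring.
        move=> ->; rewrite (FTC c) // -[minus _ _]/(sub _ _); congr (sub (c _) (c _)); ring.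
      rewrite (RInt_ext _ (fun u => RInt (fun s => RInt (fun r => mul (b s) (mul (adj (b r)) (e (r, l' + t' - s + u)))) 0 s) 0 l')); last first.
        move=> u _; rewrite Op_flat //; apply: RInt_ext => s _; apply: RInt_ext => r _.
        by congr (mul _ (mul _ (e (_, _)))); ring.
      rewrite (Fubini_rect (fun u s => RInt (fun r => mul (b s) (mul (adj (b r)) (e (r, l' + t' - s + u)))) 0 s)); last by cts.
      rewrite Op_flat //; last by cts.
      apply: RInt_ext => s _.
      rewrite (Fubini_rect (fun u r => mul (b s) (mul (adj (b r)) (e (r, l' + t' - s + u))))); last by cts.
      apply: RInt_ext => r _ /=; rewrite -RInt_mulc; last by cts.
      by rewrite -RInt_mulc //; cts.
    have -> : wave_op b E l' (t' + h) = wave_op b (fun p => E (fst p, snd p + h)) l' t'.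
      rewrite /wave_op; apply: RInt_ext => s _; congr mul; apply: RInt_ext => r _ /=.
      by congr (mul _ (E (_, _))); ring.
    rewrite /D -Op_sub; try by cts.
    rewrite -Op_sub; try by cts.
    by vec.
  have := Op_zero b D cb cD hD l t; rewrite /D /= => hz.
  have -> : E (l, t + h) = add (add (sub (sub (E (l, t + h)) (E (l, t))) (RInt (fun u => e (l, t + u)) 0 h)) (E (l, t)))
     (RInt (fun u => e (l, t + u)) 0 h) by vec.
  by rewrite hz; vec.
have dE (l t : R) : is_derive (fun t => E (l, t)) t (e (l, t)).
  apply: (is_derive_ext (fun t => add (E (l, 0)) (RInt (fun u => e (l, 0 + u)) 0 t))).
    by move=> s; rewrite -inc Rplus_0_l.
  have -> : e (l, t) = add nul (e (l, 0 + t)) by rewrite Rplus_0_l; vec.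
  apply: D_add; first exact: D_const.
  apply: (deriv_RInt (fun u => e (l, 0 + u))); cts.
have dF (l t : R) : is_derive (F l) t (f l t).
  apply: D_neg; apply: (deriv_param (fun t r => mul (adj (b r)) (E (r, t))) (fun t r => mul (adj (b r)) (e (r, t)))).
  - by move=> s r; apply: D_mulc.
  - cts.
  - cts.
have eE l t : E (l, t) = sub (c (l + t)) (RInt (fun s => mul (b s) (F s (l + t - s))) 0 l).
  by rewrite hE -/b OpF //; vec.
exists (fun l t => E (l, t)), F, (fun l t => e (l, t)), f, b.
do 4 (split => //); split => //; split => //; split => //; split => //; split; last split; last split; last split => //.
- move=> l; change (forall t : R, is_derive (fun l => E (l, t)) (l : R) (sub (e (l, t)) (mul (b l) (F l t)))) => t.
  apply: (is_derive_ext (fun l => sub (c (l + t)) (RInt (fun s => mul (b s) (F s (l + t - s))) 0 l))).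
    by move=> s; rewrite -eE.
  have -> : sub (e (l, t)) (mul (b l) (F l t)) = sub (c' (l + t)) (add (RInt (fun s => mul (b s) (f s (l + t - s))) 0 l)
     (sub (rs 1 (mul (b l) (F l (l + t - l)))) (rs 0 (mul (b 0) (F 0 (l + t - 0)))))).
    have -> : l + t - l = t by ring.
    have OpF' : wave_op b e l t = neg (RInt (fun s => mul (b s) (f s (l + t - s))) 0 l) := OpF e l t ce.
    by rewrite he OpF'; vec.
  apply: D_sub.
    have -> : c' (l + t) = rs 1 (c' (l + t)) by vec.
    by apply: (D_comp c (fun l => l + t)) => //; auto_derive.
  apply: (Leibniz (fun l s => mul (b s) (F s (l + t - s))) (fun l s => mul (b s) (f s (l + t - s))) (fun _ => 0) (fun l => l)).
  + move=> s r; apply: D_mulc.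
    have -> : f r (s + t - r) = rs 1 (f r (s + t - r)) by vec.
    by apply: (D_comp (F r) (fun s => s + t - r)) => //; auto_derive.
  + cts.
  + cts.
  + exact: (is_derive_const (V := R_NormedModule)).
  + exact: is_derive_id.
- move=> l t; apply: D_neg; apply: (deriv_RInt (fun r => mul (adj (b r)) (E (r, t)))); cts.
- move=> t; rewrite /F /wave_F RInt_nul; by vec.
- by move=> t; rewrite eE RInt_nul Rplus_0_l; vec.
Qed.

End GL.

(** * The a priori bound and local inversion *)

Definition contracts {M : star_alg} (c : R -> M) (eps L : R) : Prop :=
  forall g : R -> M, cont g ->
    RInt (fun t => nm (cv c g t) ^ 2) 0 L <= (1 - eps) * RInt (fun t => nm (g t) ^ 2) 0 L.

Lemma Rabs_near (x y e : R) : Rabs (y + - x) < e -> Rabs y <= Rabs x + e.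
Proof. rewrite /Rabs; repeat case: Rcase_abs; lra. Qed.

Section Inverse.
Context {M : star_alg}.

Lemma nmsq_zero (f : R -> M) L : 0 < L -> cont f -> RInt (fun t => nm (f t) ^ 2) 0 L <= 0 ->
  forall t, 0 <= t <= L -> f t = nul.
Proof.
move=> hL cf hI.
have key s : 0 < s < L -> nm (f s) <= 0.
  move=> hs; apply: Rnot_lt_le => hn.
  have hn2 : 0 < nm (f s) / 2 by lra.
  have [d hd] := proj1 (contP _ _) (cf s) _ hn2.
  have d0 := cond_pos d.
  pose h := Rmin (d / 2) (Rmin s (L - s)).
  have h0 : 0 < h by rewrite /h; repeat apply: Rmin_pos; lra.
  have h1 : h <= d / 2 by exact: Rmin_l.
  have h2 : h <= s by apply: Rle_trans (Rmin_r _ _) (Rmin_l _ _).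
  have h3 : h <= L - s by apply: Rle_trans (Rmin_r _ _) (Rmin_r _ _).
  have hlow t : s - h <= t <= s + h -> (nm (f s) / 2) ^ 2 <= nm (f t) ^ 2.
    move=> ht; have hb : nm (sub (f t) (f s)) < nm (f s) / 2.
      apply: hd; rewrite /ball /= /AbsRing_ball /abs /minus /plus /opp /=; apply: Rabs_def1; lra.
    have : nm (f s) <= nm (f t) + nm (sub (f t) (f s)).
      have {1}-> : f s = sub (f t) (sub (f t) (f s)) by vec.
      exact: nm_sub.
    move=> hb2; apply: pow_incr; lra.
  have c2' : cont (fun t => nm (f t) ^ 2) by cts.
  have q x y : x <= y -> 0 <= RInt (fun t => nm (f t) ^ 2) x y.
    by move=> hxy; apply: RInt_Rge0 => // t _; exact: pow2_ge_0.
  have e := RInt_Rcat (fun t => nm (f t) ^ 2) 0 (s - h) L c2'.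
  have e2 := RInt_Rcat (fun t => nm (f t) ^ 2) (s - h) (s + h) L c2'.
  have q1 := q 0 (s - h) ltac:(lra); have q2 := q (s + h) L ltac:(lra).
  have q3 := RInt_Rle (fun _ => (nm (f s) / 2) ^ 2) (fun t => nm (f t) ^ 2) (s - h) (s + h) ltac:(lra)
    (cont_const _) c2' hlow.
  rewrite RInt_Rcst in q3.
  have : 0 < (s + h - (s - h)) * (nm (f s) / 2) ^ 2.
    apply: Rmult_lt_0_compat; first lra.
    by apply: pow_lt.
  lra.
move=> t ht; apply: nm_eq0; apply: Rle_antisym; last exact: nm_ge0.
apply: le_epsilon => eps he; rewrite Rplus_0_l.
have [d hd] := proj1 (contP _ _) (cf t) _ he.
have d0 := cond_pos d.
have [s [hs1 hs2]] : exists s, 0 < s < L /\ Rabs (s - t) < d.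
  case: (Rle_lt_dec t (L / 2)) => h.
    exists (t + Rmin (d / 2) (L / 4)); have := Rmin_l (d / 2) (L / 4); have := Rmin_r (d / 2) (L / 4).
    have : 0 < Rmin (d / 2) (L / 4) by apply: Rmin_pos; lra.
    by split; [lra | apply: Rabs_def1; lra].
  exists (t - Rmin (d / 2) (L / 4)); have := Rmin_l (d / 2) (L / 4); have := Rmin_r (d / 2) (L / 4).
  have : 0 < Rmin (d / 2) (L / 4) by apply: Rmin_pos; lra.
  by split; [lra | apply: Rabs_def1; lra].
have h1 : nm (sub (f s) (f t)) < eps by apply: hd.
have h2 := key s hs1.
have : nm (f t) <= nm (f s) + nm (sub (f s) (f t)).
  have {1}-> : f t = sub (f s) (sub (f s) (f t)) by vec.
  exact: nm_sub.
lra.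
Qed.

(* Test the contraction on [g] cut off after [T] by a fast exponential; causality keeps [c * g] on [0, T]. *)
Lemma contracts_restrict (c : R -> M) eps L T : cont c -> 0 < eps <= 1 -> 0 <= T <= L ->
  contracts c eps L -> contracts c eps T.
Proof.
move=> cc he hT H g cg.
have [k [mk [k1 hk]]] := bound_1 g cg.
have kL := k1 L.
apply: le_epsilon => de hde.
(* The cut-off tail contributes at most k^2 times the integral of exp(-2 n (t - T)), that is at most
   k^2 / (2 n). *)
have [n [n0 hn]] : exists n, 0 < n /\ k L ^ 2 / (2 * n) <= de.
  have k2 : 0 < k L ^ 2 by apply: pow_lt; lra.
  exists (k L ^ 2 / (2 * de)); split; first by apply: Rdiv_lt_0_compat; lra.
  by apply: Req_le; field; lra.
pose gn t := rs (exp (- n * Rmax 0 (t - T))) (g t).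
have cgn : cont gn by rewrite /gn; cts.
have eg t : t <= T -> gn t = g t.
  move=> ht; rewrite /gn Rmax_left; last lra.
  by rewrite Rmult_0_r exp_0; vec.
have h1 : RInt (fun t => nm (cv c g t) ^ 2) 0 T <= RInt (fun t => nm (cv c gn t) ^ 2) 0 L.
  rewrite -(RInt_Rcat (fun t => nm (cv c gn t) ^ 2) 0 T L); last by cts.
  have -> : RInt (fun t => nm (cv c gn t) ^ 2) 0 T = RInt (fun t => nm (cv c g t) ^ 2) 0 T.
    apply: RInt_ext => t; rewrite Rmin_left ?Rmax_right; try lra; move=> ht.
    congr (nm _ ^ 2); apply: cv_ext => // s; rewrite Rmin_left ?Rmax_right; try lra; move=> hs.
    by apply: eg; lra.
  have : 0 <= RInt (fun t => nm (cv c gn t) ^ 2) T L; last lra.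
  by apply: RInt_Rge0; [lra | cts | move=> t _; exact: pow2_ge_0].
have h2 : RInt (fun t => nm (gn t) ^ 2) 0 L <= RInt (fun t => nm (g t) ^ 2) 0 T + de.
  rewrite -(RInt_Rcat (fun t => nm (gn t) ^ 2) 0 T L); last by cts.
  have -> : RInt (fun t => nm (gn t) ^ 2) 0 T = RInt (fun t => nm (g t) ^ 2) 0 T.
    apply: RInt_ext => t; rewrite Rmin_left ?Rmax_right; try lra; move=> ht.
    by rewrite eg //; lra.
  apply: Rplus_le_compat_l.
  apply: Rle_trans (_ : RInt (fun t => k L ^ 2 * exp (- (2 * n) * (t - T))) T L <= _).
    apply: RInt_Rle; [lra | by cts | by cts |] => t ht.
    rewrite /gn nm_rs Rmax_right; last lra.
    rewrite Rabs_pos_eq; last by apply: Rlt_le; exact: exp_pos.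
    have -> : exp (- (2 * n) * (t - T)) = exp (- n * (t - T)) ^ 2.
      by rewrite /= Rmult_1_r -exp_plus; congr exp; ring.
    rewrite Rpow_mult_distr Rmult_comm; apply: Rmult_le_compat_r; first exact: pow2_ge_0.
    apply: pow_incr; split; first exact: nm_ge0.
    by apply: hk; rewrite Rabs_pos_eq; lra.
  rewrite RInt_Rmult; last by cts.
  rewrite (FTC_R (fun t => - exp (- (2 * n) * (t - T)) / (2 * n))); last by cts.
    rewrite Rminus_diag Rmult_0_r exp_0.
    apply: Rle_trans hn.
    have E := exp_pos (- (2 * n) * (L - T)).
    have -> : k L ^ 2 * (- exp (- (2 * n) * (L - T)) / (2 * n) - - (1) / (2 * n)) =
      k L ^ 2 / (2 * n) - k L ^ 2 / (2 * n) * exp (- (2 * n) * (L - T)) by field; lra.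
    have : 0 <= k L ^ 2 / (2 * n) * exp (- (2 * n) * (L - T)); last lra.
    apply: Rmult_le_pos; last lra.
    apply: Rmult_le_pos; first exact: pow2_ge_0.
    by apply: Rlt_le; apply: Rinv_0_lt_compat; lra.
  by move=> x _; auto_derive => //; rewrite /Rminus; field; lra.
have h3 := H gn cgn.
have h4 := Rmult_le_compat_l (1 - eps) _ _ ltac:(lra) h2.
have : (1 - eps) * de <= de by nra.
lra.
Qed.

(** At the point y the kernel is F(T - y, .), evaluated on the characteristic l + t = T. It varies
    with y, so this is not a convolution equation, but it is still causal. *)
Lemma volterra_second_kind (F : R -> R -> M) T : c2 F ->
  exists g : R -> M, cont g /\ forall y, add (g y) (cv (F (T - y)) g y) = F (T - y) y.
Proof.
move=> cF.
pose G y t := F (T - y) t.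
have cG : c2 G by rewrite /G; cts.
have [k [mk [k1 hk]]] := bound_2 G cG.
pose Th (g : R -> M) y := sub (G y y) (cv (G y) g y).
have cTh g : cont g -> cont (Th g) by move=> cg; rewrite /Th; cts.
pose C x := k (2 * Rmax 0 x).
pose K x := k (2 * Rmax 0 x).
have mK x y : x <= y -> k (2 * Rmax 0 x) <= k (2 * Rmax 0 y).
  by move=> h; apply: (proj1 mk); have := proj1 mp_max _ _ h; lra.
have aM y : Rmax 0 (Rabs y) = Rabs y by rewrite Rmax_right //; exact: Rabs_pos.
have [g [cg [_ hg]]] : exists g : R -> M, cont g /\ (forall p : R, True) /\ forall p, Th g p = g p.
  apply: (volterra_fix (fun p => Rabs p) (fun p => Rabs p) K C (fun _ _ => True) Th (fun _ => nul)) => //.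
  - by move=> p; have := Rabs_pos p; lra.
  - move=> p; exists (mkposreal 1 Rlt_0_1) => q; rewrite /ball /= /AbsRing_ball /abs /minus /plus /opp /= => h.
    exact: Rabs_near h.
  - move=> x; have := k1 (2 * Rmax 0 x); rewrite /K; lra.
  - move=> x; have := k1 (2 * Rmax 0 x); rewrite /C; lra.
  - by cts.
  - move=> y; rewrite -[norm _]/(nm (sub (Th (fun _ => nul) y) nul)).
    have -> : sub (Th (fun _ => nul) y) nul = G y y.
      rewrite /Th /cv (RInt_ext _ (fun _ => nul)); first by rewrite RInt_cst; vec.
      by move=> s _; rewrite mul_nul_r.
    by apply: hk; rewrite aM; lra.
  - by move=> g cg _; split => //; exact: cTh.
  - move=> g g' y k' c0 cg cg' _ _ hk' hc hd.
    rewrite -[norm _]/(nm (sub (Th g y) (Th g' y))).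
    have -> : sub (Th g y) (Th g' y) = cv (G y) (fun t => sub (g' t) (g t)) y.
      by rewrite cv_sub_r; [rewrite /Th; vec | cts | cts | cts].
    rewrite /C aM.
    have -> : k (2 * Rabs y) / k' * (c0 * exp (k' * Rabs y)) = (k (2 * Rabs y) * c0) / k' * exp (k' * Rabs (y - 0)).
      by rewrite Rminus_0_r /Rdiv; ring.
    apply: RInt_exp_bound => //; first by cts.
    move=> s hs; have [q1 q2] := abs_between s y hs; rewrite Rminus_0_r.
    rewrite -[norm _]/(nm (mul (G y (y - s)) (sub (g' s) (g s)))).
    apply: Rle_trans (nm_mul _ _) _; rewrite Rmult_assoc; apply: Rmult_le_compat; try exact: nm_ge0.
      by apply: hk; have := Rabs_pos s; lra.
    by rewrite nm_sub_sym; apply: hd.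
exists g; split => // y.
have := hg y; rewrite -[Th g y]/(sub (F (T - y) y) (cv (F (T - y)) g y)) => <-.
by set p := cv _ g y; vec.
Qed.

(** Since [b] depends on l only, convolution with g in t commutes with the system. The sole
    exception is the boundary term E(l, 0) g(t) in the t-derivative; subtracting g from the first
    component compensates it where b(l) = E(l, 0). *)
Lemma wave_cv (E F e f : R -> R -> M) (b g : R -> M) :
  c2 E -> c2 F -> c2 e -> c2 f -> cont b -> cont g ->
  (forall l t, is_derive (E l) t (e l t)) ->
  (forall l t, is_derive (fun l => E l t) l (sub (e l t) (mul (b l) (F l t)))) ->
  (forall l t, is_derive (fun l => F l t) l (neg (mul (adj (b l)) (E l t)))) ->
  (forall l t, is_derive (fun l => sub (F l t) (add (g t) (cv (F l) g t))) l
     (neg (mul (adj (b l)) (sub (E l t) (cv (E l) g t))))) /\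
  (forall l t, is_derive (fun l => sub (E l t) (cv (E l) g t)) l
     (sub (sub (e l t) (cv (e l) g t)) (mul (b l) (sub (F l t) (cv (F l) g t))))) /\
  (forall l t, is_derive (fun t => sub (E l t) (cv (E l) g t)) t
     (sub (e l t) (add (mul (E l 0) (g t)) (cv (e l) g t)))).
Proof.
move=> cE cF ce cf cb cg dE dEl dFl.
have cFl : c2 (fun l t => neg (mul (adj (b l)) (E l t))) by cts.
have cEl : c2 (fun l t => sub (e l t) (mul (b l) (F l t))) by cts.
have dcv (X Xs : R -> R -> M) l t : c2 X -> c2 Xs -> (forall l t, is_derive (fun l => X l t) l (Xs l t)) ->
    is_derive (fun l => cv (X l) g t) l (cv (Xs l) g t).
  move=> cX cXs dX.
  have -> : cv (Xs l) g t = add (cv (Xs l) g t) (cv (X l) (fun _ => nul) t).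
    have -> : cv (X l) (fun _ => nul) t = nul; last by vec.
    rewrite /cv (RInt_ext _ (fun _ => nul)); first by rewrite RInt_cst; vec.
    by move=> s _; rewrite mul_nul_r.
  apply: (cv_Dparam X Xs (fun _ => g) (fun _ _ => nul)) => //; try by cts.
  by move=> *; exact: D_const.
split; last split.
- move=> l t.
  have -> : neg (mul (adj (b l)) (sub (E l t) (cv (E l) g t))) =
    sub (neg (mul (adj (b l)) (E l t))) (add nul (cv (fun t => neg (mul (adj (b l)) (E l t))) g t)).
    rewrite cv_neg_l ?cv_mul_l; try by cts.
    by dist; vec.
  apply: D_sub; first exact: dFl.
  apply: D_add; first exact: D_const.
  exact: (dcv F (fun l t => neg (mul (adj (b l)) (E l t)))).
- move=> l t.
  have -> : sub (sub (e l t) (cv (e l) g t)) (mul (b l) (sub (F l t) (cv (F l) g t))) =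
    sub (sub (e l t) (mul (b l) (F l t))) (cv (fun t => sub (e l t) (mul (b l) (F l t))) g t).
    rewrite cv_sub_l ?cv_mul_l; try by cts.
    by dist; vec.
  apply: D_sub; first exact: dEl.
  exact: (dcv E (fun l t => sub (e l t) (mul (b l) (F l t)))).
- move=> l t; apply: D_sub; first exact: dE.
  by apply: cv_D => //; cts.
Qed.

Section APriori.
Variables (m L eps k : R) (c : R -> M) (E F e f : R -> R -> M) (b : R -> M).
Hypothesis hm : 0 < m.
Hypothesis he : 0 < eps <= 1.
Hypothesis cc : cont c.
Hypothesis hc : contracts c eps L.
Hypothesis hk : forall t, 0 <= t <= L -> nm (c t) <= k.
Hypothesis cE : c2 E.
Hypothesis cF : c2 F.
Hypothesis ce : c2 e.
Hypothesis cf : c2 f.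
Hypothesis cb : cont b.
Hypothesis bE : forall l, b l = clip m (E l 0).
Hypothesis dE : forall l t, is_derive (E l) t (e l t).
Hypothesis dEl : forall l t, is_derive (fun l => E l t) l (sub (e l t) (mul (b l) (F l t))).
Hypothesis dFl : forall l t, is_derive (fun l => F l t) l (neg (mul (adj (b l)) (E l t))).
Hypothesis F0 : forall t, F 0 t = nul.
Hypothesis E0 : forall t, E 0 t = c t.
Hypothesis EF : forall l t, E l t = sub (c (l + t)) (RInt (fun s => mul (b s) (F s (l + t - s))) 0 l).

(** [k] bounds c. The other term bounds the integral of |E(s, 0)|^2 and with it the integral in
    [EF]; the factor 1 + 1/eps comes from Young's inequality. *)
Definition apriori_bound : R := k + (1 + / eps) * (L * k ^ 2).

(* Choose g with F = g + F * g on the characteristic l + t = T. The energy identity for F - g - F * g and E - E * g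
   then bounds the integral of |a|^2 by means of the strict contraction. *)
Lemma apriori T : 0 <= T <= L -> (forall s, 0 <= s <= T -> nm (E s 0) <= m) -> nm (E T 0) <= apriori_bound.
Proof.
move=> hT hs.
have ba s : 0 <= s <= T -> b s = E s 0 by move=> h; rewrite bE clip_id //; apply: hs.
have hcT := contracts_restrict c eps L T cc he hT hc.
have cFl : c2 (fun l t => neg (mul (adj (b l)) (E l t))) by cts.
have cEl : c2 (fun l t => sub (e l t) (mul (b l) (F l t))) by cts.
have [g [cg hg]] := volterra_second_kind F T cF.
have [d1 [d2 d3]] := wave_cv E F e f b g cE cF ce cf cb cg dE dEl dFl.
have ie0 : 0 < / eps by apply: Rinv_0_lt_compat; lra.
pose IA := RInt (fun x => nm (E x 0) ^ 2) 0 T.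
pose IC := RInt (fun t => nm (c t) ^ 2) 0 T.
have hIC : IC <= L * k ^ 2.
  apply: Rle_trans (_ : RInt (fun _ => k ^ 2) 0 T <= _).
    apply: RInt_Rle; [lra | by cts | by cts |] => t ht.
    by apply: pow_incr; split; [exact: nm_ge0 | apply: hk; lra].
  rewrite RInt_Rcst Rminus_0_r; apply: Rmult_le_compat_r; [exact: pow2_ge_0 | lra].
have e1 : RInt (fun t => nm (sub (F 0 t) (add (g t) (cv (F 0) g t))) ^ 2 - nm (sub (E 0 t) (cv (E 0) g t)) ^ 2) 0 T =
   RInt (fun x => nm (sub (F x (0 + T - x)) (add (g (0 + T - x)) (cv (F x) g (0 + T - x)))) ^ 2 - nm (sub (E x 0) (cv (E x) g 0)) ^ 2) 0 (0 + T).
  apply: (energy (fun x t => sub (F x t) (add (g t) (cv (F x) g t))) (fun x t => sub (E x t) (cv (E x) g t))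
    (fun l t => neg (mul (adj (b l)) (sub (E l t) (cv (E l) g t))))
    (fun l t => sub (sub (e l t) (cv (e l) g t)) (mul (b l) (sub (F l t) (cv (F l) g t))))
    (fun l t => sub (e l t) (add (mul (E l 0) (g t)) (cv (e l) g t))) b 0 T (proj1 hT)) => //; try by cts.
  move=> x t hx ht; split => //.
  rewrite -ba; last lra.
  by dist; vec.
have e2 : RInt (fun t => nm (F 0 t) ^ 2 - nm (E 0 t) ^ 2) 0 T =
   RInt (fun x => nm (F x (0 + T - x)) ^ 2 - nm (E x 0) ^ 2) 0 (0 + T).
  apply: (energy F E (fun l t => neg (mul (adj (b l)) (E l t))) (fun l t => sub (e l t) (mul (b l) (F l t))) e b 0 T (proj1 hT)) => //.
rewrite !Rplus_0_l in e1 e2.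
(* By the choice of g the first component vanishes on the characteristic, so the energy identity
   reads -IA = int |g|^2 - int |c - c conv g|^2. Young's inequality with weight eps gives (1 + eps)
   in front of |c conv g|^2, and (1 + eps) (1 - eps) <= 1 lets int |g|^2 absorb that term. *)
have hA : IA <= (1 + / eps) * IC.
  have f1 : RInt (fun x => nm (sub (F x (T - x)) (add (g (T - x)) (cv (F x) g (T - x)))) ^ 2 - nm (sub (E x 0) (cv (E x) g 0)) ^ 2) 0 T = - IA.
    have -> : - IA = -1 * IA by ring.
    rewrite /IA -RInt_Rmult; last by cts.
    apply: RInt_ext => x _.
    have h := hg (T - x).
    rewrite (_ : T - (T - x) = x) in h; last by ring.
    rewrite h cv_0.
    have -> : sub (F x (T - x)) (F x (T - x)) = nul by vec.
    have -> : sub (E x 0) nul = E x 0 by vec.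
    by rewrite nm_nul; eqR; ring.
  have f2 : RInt (fun t => nm (sub (F 0 t) (add (g t) (cv (F 0) g t))) ^ 2 - nm (sub (E 0 t) (cv (E 0) g t)) ^ 2) 0 T =
     RInt (fun t => nm (g t) ^ 2) 0 T - RInt (fun t => nm (sub (c t) (cv c g t)) ^ 2) 0 T.
    rewrite -RInt_Rminus; try by cts.
    apply: RInt_ext => t _.
    have -> : cv (F 0) g t = nul.
      rewrite /cv (RInt_ext _ (fun _ => nul)); first by rewrite RInt_cst; vec.
      by move=> s _; rewrite F0 mul_nul_l.
    have -> : cv (E 0) g t = cv c g t by apply: cv_ext => // s _; exact: E0.
    rewrite F0 E0; congr (_ ^ 2 - _).
    have -> : sub nul (add (g t) nul) = neg (g t) by vec.
    exact: nm_neg.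
  have f3 : RInt (fun t => nm (sub (c t) (cv c g t)) ^ 2) 0 T <=
     (1 + / eps) * IC + (1 + eps) * RInt (fun t => nm (cv c g t) ^ 2) 0 T.
    rewrite /IC -RInt_Rmult; last by cts.
    rewrite -RInt_Rmult; last by cts.
    rewrite -RInt_Rplus; try by cts.
    apply: RInt_Rle; [lra | by cts | by cts |] => t _.
    have n1 := nm_sub (c t) (cv c g t).
    move: n1; set x := nm (c t); set y := nm (cv c g t) => n1.
    have n2 : nm (sub (c t) (cv c g t)) ^ 2 <= (x + y) ^ 2 by apply: pow_incr; split; [exact: nm_ge0 | by []].
    apply: Rle_trans n2 _.
    have sq : 0 <= / eps * (x - eps * y) ^ 2 by apply: Rmult_le_pos; [lra | exact: pow2_ge_0].
    have e5 : / eps * (x - eps * y) ^ 2 = / eps * x ^ 2 - 2 * x * y + eps * y ^ 2 by field; lra.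
    lra.
  have f4 := hcT g cg.
  have G0 : 0 <= RInt (fun t => nm (g t) ^ 2) 0 T.
    by apply: RInt_Rge0; [lra | cts | move=> t _; exact: pow2_ge_0].
  have f5 : (1 + eps) * RInt (fun t => nm (cv c g t) ^ 2) 0 T <= RInt (fun t => nm (g t) ^ 2) 0 T.
    have := Rmult_le_compat_l (1 + eps) _ _ ltac:(lra) f4; nra.
  lra.
(* The energy identity for the unmodified pair. As F starts from 0, the square of F over the
   characteristic is [IA] minus the nonnegative [IC]. *)
have hF : RInt (fun x => nm (F x (T - x)) ^ 2) 0 T <= IA.
  have f1 : RInt (fun t => nm (F 0 t) ^ 2 - nm (E 0 t) ^ 2) 0 T = - IC.
    have -> : - IC = -1 * IC by ring.
    rewrite /IC -RInt_Rmult; last by cts.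
    by apply: RInt_ext => t _; rewrite F0 E0 nm_nul; eqR; ring.
  rewrite f1 RInt_Rminus -/IA in e2; try by cts.
  have : 0 <= IC by apply: RInt_Rge0; [lra | cts | move=> t _; exact: pow2_ge_0].
  lra.
have hI : nm (RInt (fun s => mul (b s) (F s (T - s))) 0 T) <= IA.
  apply: Rle_trans (_ : RInt (fun s => / 2 * (nm (E s 0) ^ 2 + nm (F s (T - s)) ^ 2)) 0 T <= _).
    apply: nm_RInt_le; [lra | by cts | by cts |] => s hs'.
    rewrite ba //; apply: Rle_trans (nm_mul _ _) _.
    have := pow2_ge_0 (nm (E s 0) - nm (F s (T - s))); lra.
  rewrite RInt_Rmult; last by cts.
  rewrite RInt_Rplus; try by cts.
  rewrite -/IA; lra.
rewrite EF Rplus_0_r; apply: Rle_trans (nm_sub _ _) _.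
have h1 : nm (c T) <= k by apply: hk; lra.
have h2 : (1 + / eps) * IC <= (1 + / eps) * (L * k ^ 2) by apply: Rmult_le_compat_l; lra.
rewrite /apriori_bound; lra.
Qed.

(** A continuation argument: while |E(s, 0)| <= m the a priori bound holds, and it is strictly
    smaller than m, so by continuity the inequality persists slightly beyond the supremum of
    admissible times unless that is already L. *)
Lemma clip_inactive : apriori_bound < m -> 0 <= L -> forall s, 0 <= s <= L -> nm (E s 0) <= m.
Proof.
move=> hMm hL.
pose P T := 0 <= T <= L /\ forall s, 0 <= s <= T -> nm (E s 0) <= m.
have P0 : P 0.
  split; first lra.
  move=> s hs; have -> : s = 0 by lra.
  rewrite E0; have := hk 0 ltac:(lra).
  have : k <= apriori_bound; last lra.
  rewrite /apriori_bound; have : 0 <= (1 + / eps) * (L * k ^ 2); last lra.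
  apply: Rmult_le_pos; last by apply: Rmult_le_pos => //; exact: pow2_ge_0.
  have : 0 < / eps by apply: Rinv_0_lt_compat; lra.
  lra.
have [T [ub lb]] := completeness P (ex_intro _ L (fun x (h : P x) => proj2 (proj1 h))) (ex_intro _ 0 P0).
have hT0 : 0 <= T by apply: ub.
have hTL : T <= L by apply: lb => x [[]].
have cEd : cont (fun s => E s 0) by cts.
have hd2 : 0 < (m - apriori_bound) / 2 by lra.
have [d hd] := proj1 (contP _ _) (cEd T) _ hd2.
have d0 := cond_pos d.
have near s : Rabs (s - T) < d -> nm (E s 0) <= nm (E T 0) + (m - apriori_bound) / 2.
  move=> h; have h1 : nm (sub (E s 0) (E T 0)) < (m - apriori_bound) / 2 by apply: hd.
  have {1}-> : E s 0 = add (E T 0) (sub (E s 0) (E T 0)) by vec.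
  apply: Rle_trans (nm_add _ _) _; lra.
have near' s : Rabs (s - T) < d -> nm (E T 0) <= nm (E s 0) + (m - apriori_bound) / 2.
  move=> h; have h1 : nm (sub (E s 0) (E T 0)) < (m - apriori_bound) / 2 by apply: hd.
  have {1}-> : E T 0 = sub (E s 0) (sub (E s 0) (E T 0)) by vec.
  apply: Rle_trans (nm_sub _ _) _; lra.
have [x [Px hx]] : exists x, P x /\ T - d < x.
  apply: NNPP => hn.
  have : T <= T - d; last lra.
  apply: lb => x Px; case: (Rle_lt_dec x (T - d)) => // hx.
  by case: hn; exists x.
have hxT : x <= T by apply: ub.
have hMx : nm (E x 0) <= apriori_bound by case: Px => hx1 hx2; exact: apriori.
have hMT : nm (E T 0) <= apriori_bound + (m - apriori_bound) / 2.
  by have := near' x ltac:(apply: Rabs_def1; lra); lra.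
have PT : P (Rmin L (T + d / 2)).
  have a1 := Rmin_l L (T + d / 2); have a2 := Rmin_r L (T + d / 2).
  split.
    by split => //; apply: Rmin_glb; lra.
  move=> s hs; case: (Rle_lt_dec s x) => hsx; first by case: Px => _; apply; lra.
  have := near s ltac:(apply: Rabs_def1; lra); lra.
have := ub _ PT => hle.
have hLT : L <= T.
  by move: hle; rewrite /Rmin; case: Rle_dec; lra.
move=> s hs; case: PT => _; apply; split; first lra.
by apply: Rmin_glb; lra.
Qed.

End APriori.

(** The truncated solution is compared with the wave driven by the given flow, started from P = 0
    with c = 1, so that its E starts from A(., 0). On the triangle both solve one linear system, and
    their E-components agree at t = 0. For the difference the energy identity equates -int |c - A(.,
    0)|^2 with an integral of squares, so both vanish. *)
Lemma inverse_local (c c' : R -> M) eps L : 0 < L -> 0 < eps <= 1 -> cont c -> cont c' ->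
  (forall x, is_derive c x (c' x)) -> contracts c eps L ->
  exists a a' : R -> M, cont a /\ cont a' /\ (forall x, is_derive a x (a' x)) /\
    forall (al : R -> M) (A B : R -> R -> M), flow al A B -> (forall s, 0 <= s <= L -> al s = a s) ->
    forall x, 0 <= x <= L -> A x 0 = c x.
Proof.
move=> hL he cc cc' dc hc.
have [k [mk [k1 hk]]] := bound_1 c cc.
have hkL t : 0 <= t <= L -> nm (c t) <= k L by move=> ht; apply: hk; rewrite Rabs_pos_eq; lra.
pose m := apriori_bound L eps (k L) + 1.
have hM0 : 0 <= apriori_bound L eps (k L).
  rewrite /apriori_bound; have := k1 L.
  have : 0 <= (1 + / eps) * (L * k L ^ 2).
    apply: Rmult_le_pos; last by apply: Rmult_le_pos; [lra | exact: pow2_ge_0].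
    have : 0 < / eps by apply: Rinv_0_lt_compat; lra.
    lra.
  lra.
have hm : 0 < m by rewrite /m; lra.
have [E [F [e [f [b [cE [cF [ce [cf [cb [bE [dE [dF [dEl [dFl [F0 [E0 EF]]]]]]]]]]]]]]]]] := clipped_wave m c c' hm cc cc' dc.
have ina := clip_inactive m L eps (k L) c E F e f b hm he cc hc hkL cE cF ce cf cb bE dE dEl dFl F0 E0 EF
  ltac:(rewrite /m; lra) ltac:(lra).
pose a l := E l 0.
pose a' l := sub (e l 0) (mul (b l) (F l 0)).
have ca : cont a by rewrite /a; cts.
have ca' : cont a' by rewrite /a'; cts.
have da x : is_derive a x (a' x) by exact: dEl.
exists a, a'; do 3 (split => //).
move=> al A B fl al_a.
have [cal cA cB A0 Ax Al] := fl.
have [P [cP [P0 dP]]] := ode_P al A 1 (fun _ => nul) cal cA (cont_const _).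
have [Ex [Et [cEx [cEt [dEx [dEt hE]]]]]] := wave al A B 1 P fl cP dP.
have cw := c2_wE 1 A P cA cP.
have ba s : 0 <= s <= L -> b s = al s by move=> h; rewrite al_a // bE clip_id //; exact: ina.
have en : RInt (fun t => nm (sub (F 0 t) (P 0 t)) ^ 2 - nm (sub (E 0 t) (wave_E 1 A P 0 t)) ^ 2) 0 L =
  RInt (fun x => nm (sub (F x (0 + L - x)) (P x (0 + L - x))) ^ 2 - nm (sub (E x 0) (wave_E 1 A P x 0)) ^ 2) 0 (0 + L).
  apply: (energy (fun x t => sub (F x t) (P x t)) (fun x t => sub (E x t) (wave_E 1 A P x t))
    (fun x t => sub (neg (mul (adj (b x)) (E x t))) (neg (mul (adj (al x)) (wave_E 1 A P x t))))
    (fun x t => sub (sub (e x t) (mul (b x) (F x t))) (Ex x t))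
    (fun x t => sub (e x t) (Et x t)) al 0 L ltac:(lra)); try by cts.
  - by move=> x t; apply: D_sub.
  - by move=> x t; apply: D_sub.
  - by move=> x t; apply: D_sub.
  - move=> x t hx ht; rewrite ba; last lra.
    rewrite hE; split; dist; by vec.
have hz : RInt (fun t => nm (sub (c t) (A t 0)) ^ 2) 0 L <= 0.
  have e1 : RInt (fun t => nm (sub (F 0 t) (P 0 t)) ^ 2 - nm (sub (E 0 t) (wave_E 1 A P 0 t)) ^ 2) 0 L =
     -1 * RInt (fun t => nm (sub (c t) (A t 0)) ^ 2) 0 L.
    rewrite -RInt_Rmult; last by cts.
    apply: RInt_ext => t _; rewrite F0 P0 E0.
    have -> : sub nul nul = nul :> M by vec.
    have -> : wave_E 1 A P 0 t = A t 0.
      rewrite /wave_E /cv (RInt_ext _ (fun _ => nul)); first by rewrite RInt_cst; vec.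
      by move=> s _; rewrite P0 mul_nul_r.
    by rewrite nm_nul; eqR; ring.
  have e2 : 0 <= RInt (fun x => nm (sub (F x (0 + L - x)) (P x (0 + L - x))) ^ 2 - nm (sub (E x 0) (wave_E 1 A P x 0)) ^ 2) 0 (0 + L).
    apply: RInt_Rge0; [lra | by cts |] => x hx.
    have -> : sub (E x 0) (wave_E 1 A P x 0) = nul.
      by rewrite /wave_E cv_0 A0 al_a /a; [vec | lra].
    by rewrite nm_nul; have := pow2_ge_0 (nm (sub (F x (0 + L - x)) (P x (0 + L - x)))); lra.
  rewrite -en e1 in e2; lra.
move=> x hx.
have := nmsq_zero (fun t => sub (c t) (A t 0)) L hL ltac:(cts) hz x hx => h.
have -> : A x 0 = sub (c x) (sub (c x) (A x 0)) by vec.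
by rewrite h; vec.
Qed.

End Inverse.

(** * Uniqueness along characteristics *)

(** The equation integrated along x + l = const. It requires only continuity, and on a triangle only
    values in the quadrant enter, so it is shared by flows on the plane and by one-sided
    solutions. *)
Definition mild {M : star_alg} (c : R -> M) (A : R -> R -> M) (L : R) : Prop :=
  forall x l, 0 <= x -> 0 <= l -> x + l <= L ->
    A x l = add (c (x + l)) (RInt (fun s => Qf (A 0) A (x + l - s) s) 0 l).

Section Mild.
Context {M : star_alg}.

Lemma c2_Qf (a : R -> M) (A : R -> R -> M) : cont a -> c2 A -> c2 (Qf a A).
Proof. by move=> ca cA; rewrite /Qf; cts. Qed.

Lemma triple_diff (p q r p' q' r' : M) K d : 0 <= d -> nm p <= K -> nm q <= K -> nm q' <= K -> nm r <= K ->
  nm r' <= K -> nm p' <= K ->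
  nm (sub p p') <= d -> nm (sub q q') <= d -> nm (sub r r') <= d ->
  nm (sub (mul p (mul (adj q) r)) (mul p' (mul (adj q') r'))) <= 3 * K ^ 2 * d.
Proof.
move=> d0 hp hq hq' hr hr' hp' h1 h2 h3.
have -> : sub (mul p (mul (adj q) r)) (mul p' (mul (adj q') r')) =
  add (mul (sub p p') (mul (adj q) r)) (add (mul p' (mul (adj (sub q q')) r)) (mul p' (mul (adj q') (sub r r')))).
  by rewrite adj_sub; dist; vec.
have n3 (u v w : M) a b c : nm u <= a -> nm v <= b -> nm w <= c -> nm (mul u (mul (adj v) w)) <= a * (b * c).
  move=> hu hv hw; apply: Rle_trans (nm_mul _ _) _; apply: Rmult_le_compat => //; try exact: nm_ge0.
  apply: Rle_trans (nm_mul _ _) _; rewrite nm_adj; apply: Rmult_le_compat => //; exact: nm_ge0.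
have e1 := n3 _ _ _ _ _ _ h1 hq hr.
have e2 := n3 _ _ _ _ _ _ hp' h2 hr.
have e3 := n3 _ _ _ _ _ _ hp' hq' h3.
apply: Rle_trans (nm_add _ _) _.
have := nm_add (mul p' (mul (adj (sub q q')) r)) (mul p' (mul (adj q') (sub r r'))).
nra.
Qed.

(** Differences are weighted with exp(kap l). The integrand contributes 3 K^2, its inner integral a
    length at most L, and the integration in l gains [1 / kap]; [kap > 6 K^2 L] makes the factor
    less than 1/2. *)
Lemma mild_unique (c c' : R -> M) (A A' : R -> R -> M) L : 0 <= L -> c2 A -> c2 A' ->
  (forall x, 0 <= x <= L -> c x = c' x) -> mild c A L -> mild c' A' L ->
  forall x l, 0 <= x -> 0 <= l -> x + l <= L -> A x l = A' x l.
Proof.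
move=> hL cA cA' hc mA mA' x l hx hl hxl.
have [k1 [mk1 [k11 hk1]]] := bound_2 A cA.
have [k2 [mk2 [k21 hk2]]] := bound_2 A' cA'.
pose K := k1 L + k2 L.
have K2 : 2 <= K by rewrite /K; have := k11 L; have := k21 L; lra.
have bA y s : 0 <= y -> 0 <= s -> y + s <= L -> nm (A y s) <= K.
  move=> h1 h2 h3; have := hk1 L y s; rewrite !Rabs_pos_eq //; have := k21 L; rewrite /K => q1 q2; have := q2 h3; lra.
have bA' y s : 0 <= y -> 0 <= s -> y + s <= L -> nm (A' y s) <= K.
  move=> h1 h2 h3; have := hk2 L y s; rewrite !Rabs_pos_eq //; have := k11 L; rewrite /K => q1 q2; have := q2 h3; lra.
pose Reg (p : R * R) := 0 <= fst p /\ 0 <= snd p /\ fst p + snd p <= L.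
pose D (p : R * R) := nm (sub (A (fst p) (snd p)) (A' (fst p) (snd p))).
pose kap := 6 * K ^ 2 * L + 1.
have kK : 0 <= K ^ 2 * L by apply: Rmult_le_pos => //; exact: pow2_ge_0.
have kap0 : 0 < kap by rewrite /kap; lra.
pose w (p : R * R) := exp (kap * snd p).
have cQ := c2_Qf (A 0) A ltac:(cts) cA.
have cQ' := c2_Qf (A' 0) A' ltac:(cts) cA'.
suff hD : D (x, l) <= 0.
  have : sub (A x l) (A' x l) = nul by apply: nm_eq0; apply: Rle_antisym; [exact: hD | exact: nm_ge0].
  move=> h; have -> : A x l = add (A' x l) (sub (A x l) (A' x l)) by vec.
  by rewrite h; vec.
apply: (halving_zero Reg w D (2 * K)); [ | lra | | by split].
  move=> [y s] [/= h1 [h2 h3]]; rewrite /D /w /=.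
  apply: Rle_trans (nm_sub _ _) _.
  have := bA y s h1 h2 h3; have := bA' y s h1 h2 h3.
  have : 1 <= exp (kap * s) by rewrite -exp_0; apply: exp_mono; apply: Rmult_le_pos => //; lra.
  nra.
move=> c0 hc0 IH0 [y s] [/= h1 [h2 h3]]; rewrite /D /w /=.
have IH y' s' : 0 <= y' -> 0 <= s' -> y' + s' <= L -> nm (sub (A y' s') (A' y' s')) <= c0 * exp (kap * s').
  by move=> q1 q2 q3; apply: (IH0 (y', s')).
rewrite mA // mA' // hc; last lra.
set I := RInt _ 0 s; set I' := RInt _ 0 s.
have -> : sub (add (c' (y + s)) I) (add (c' (y + s)) I') = sub I I' by vec.
rewrite /I /I' -RInt_sub; try by cts.
apply: Rle_trans (_ : 3 * K ^ 2 * c0 * L / kap * exp (kap * Rabs (s - 0)) <= _).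
  apply: RInt_exp_bound => //; first by cts.
  move=> t; rewrite Rmin_left // Rmax_right // => ht; rewrite Rminus_0_r (Rabs_pos_eq t); last lra.
  rewrite -[norm _]/(nm (sub (Qf (A 0) A (y + s - t) t) (Qf (A' 0) A' (y + s - t) t))).
  rewrite /Qf /cv -RInt_sub; try by cts.
  apply: Rle_trans (_ : (y + s - t) * (3 * K ^ 2 * (c0 * exp (kap * t))) <= _).
    apply: Rle_trans (_ : Rabs (y + s - t - 0) * (3 * K ^ 2 * (c0 * exp (kap * t))) <= _); last first.
      by rewrite Rabs_pos_eq; lra.
    apply: nm_RInt_const; first by cts.
    move=> u; rewrite Rmin_left ?Rmax_right; try lra; move=> hu.
    have ex : 0 <= c0 * exp (kap * t) by apply: Rmult_le_pos => //; apply: Rlt_le; exact: exp_pos.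
    apply: triple_diff => //; try (apply: bA; lra); try (apply: bA'; lra).
    - apply: IH; lra.
    - apply: IH; lra.
    - apply: IH; lra.
  have ex := exp_pos (kap * t).
  have q : 0 <= 3 * K ^ 2 * (c0 * exp (kap * t)).
    apply: Rmult_le_pos; first by have := pow2_ge_0 K; lra.
    by apply: Rmult_le_pos; lra.
  have -> : 3 * K ^ 2 * c0 * L * exp (kap * t) = L * (3 * K ^ 2 * (c0 * exp (kap * t))) by ring.
  by apply: Rmult_le_compat_r => //; lra.
rewrite Rminus_0_r (Rabs_pos_eq s) //.
apply: Rmult_le_compat_r; first by apply: Rlt_le; exact: exp_pos.
have -> : 3 * K ^ 2 * c0 * L / kap = c0 / 2 - c0 / 2 / kap by rewrite /kap; field; rewrite -/kap; lra.
have : 0 <= c0 / 2 / kap; last lra.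
by apply: Rmult_le_pos; [lra | apply: Rlt_le; apply: Rinv_0_lt_compat].
Qed.

Lemma flow_mild (a : R -> M) A B x l : flow a A B ->
  A x l = add (A (x + l) 0) (RInt (fun s => Qf (A 0) A (x + l - s) s) 0 l).
Proof.
case=> ca cA cB A0 Ax Al.
have ea : A 0 = a by apply: functional_extensionality.
rewrite ea.
have cQ := c2_Qf a A ca cA.
have d s : is_derive (fun s => A (x + l - s) s) s (Qf a A (x + l - s) s).
  have -> : Qf a A (x + l - s) s =
     plus (scal (-1) (B (x + l - s) s)) (scal 1 (add (B (x + l - s) s) (Qf a A (x + l - s) s))).
    rewrite -[plus _ _]/(add (rs (-1) (B (x + l - s) s)) (rs 1 (add (B (x + l - s) s) (Qf a A (x + l - s) s)))).
    by vec.
  apply: (chain2 A B (add (B (x + l - s) s) (Qf a A (x + l - s) s)) (fun s => x + l - s) (fun s => s)) => //.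
    by auto_derive => //; ring.
  by auto_derive.
have h := FTC' (fun s => A (x + l - s) s) (fun s => Qf a A (x + l - s) s) 0 l d ltac:(cts).
have e : x + l - l = x by ring.
by rewrite /= e Rminus_0_r in h; rewrite h.
Qed.

(** Agreement on one side suffices; it is needed at the left end 0, where the pieces glued below
    need not agree on the negative axis. *)
Lemma right_derive_unique (f g : R -> M) x d u v : 0 < d -> (forall y, x <= y < x + d -> f y = g y) ->
  is_derive f x u -> is_derive g x v -> u = v.
Proof.
move=> hd e /DP Df /DP Dg.
have h : nm (sub u v) <= 0.
  apply: le_epsilon => eps he; rewrite Rplus_0_l.
  have he2 : 0 < eps / 2 by lra.
  have [d1 [h1 H1]] := Df _ he2.
  have [d2 [h2 H2]] := Dg _ he2.
  pose h := Rmin d (Rmin d1 d2) / 2.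
  have hm : 0 < Rmin d (Rmin d1 d2) by repeat apply: Rmin_pos.
  have m1 := Rmin_l d (Rmin d1 d2); have m2 := Rmin_r d (Rmin d1 d2).
  have m3 := Rmin_l d1 d2; have m4 := Rmin_r d1 d2.
  have h0 : 0 < h by rewrite /h; lra.
  have a1 := H1 h ltac:(rewrite Rabs_pos_eq /h; lra).
  have a2 := H2 h ltac:(rewrite Rabs_pos_eq /h; lra).
  have q : h * nm (sub u v) <= h * eps.
    have -> : h * nm (sub u v) = nm (rs h (sub u v)) by rewrite nm_rs Rabs_pos_eq //; lra.
    have -> : rs h (sub u v) = sub (sub (sub (g (x + h)) (g x)) (rs h v)) (sub (sub (f (x + h)) (f x)) (rs h u)).
      by rewrite !e; [vec | lra | rewrite /h; lra].
    apply: Rle_trans (nm_sub _ _) _; rewrite Rabs_pos_eq in a1 a2; lra.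
  by apply: (Rmult_le_reg_l h).
have h' : nm (sub u v) = 0 by apply: Rle_antisym => //; exact: nm_ge0.
have -> : u = add v (sub u v) by vec.
by rewrite (nm_eq0 _ h'); vec.
Qed.

(** The local potentials depend on L through the truncation level and eps. They agree where they
    overlap because each one, fed into [goursat], yields a flow with initial values c, and these
    determine the flow. They are glued through their derivatives. *)
Lemma inverse_global (c c' : R -> M) : cont c -> cont c' -> (forall x, is_derive c x (c' x)) ->
  (forall L, 0 < L -> exists eps, 0 < eps <= 1 /\ contracts c eps L) ->
  exists a a' : R -> M, cont a /\ cont a' /\ (forall x, is_derive a x (a' x)) /\
    forall (al : R -> M) (A B : R -> R -> M), flow al A B -> (forall s, 0 <= s -> al s = a s) ->
    forall x, 0 <= x -> A x 0 = c x.
Proof.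
move=> cc cc' dc hc.
pose P (n : nat) (aa : (R -> M) * (R -> M)) := cont (fst aa) /\ cont (snd aa) /\
  (forall x, is_derive (fst aa) x (snd aa x)) /\
    forall (al : R -> M) (A B : R -> R -> M), flow al A B -> (forall s, 0 <= s <= INR n + 1 -> al s = fst aa s) ->
    forall x, 0 <= x <= INR n + 1 -> A x 0 = c x.
have ex n : exists aa, P n aa.
  have hn : 0 < INR n + 1 by have := pos_INR n; lra.
  have [eps [he hce]] := hc _ hn.
  have [a [a' [h1 [h2 [h3 h4]]]]] := inverse_local c c' eps (INR n + 1) hn he cc cc' dc hce.
  by exists (a, a').
have [aa haa] : exists aa : nat -> (R -> M) * (R -> M), forall n, P n (aa n).
  by exists (fun n => proj1_sig (constructive_indefinite_description _ (ex n))) => n; case: constructive_indefinite_description.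
pose an n := fst (aa n); pose an' n := snd (aa n).
have can n : cont (an n) by case: (haa n).
have can' n : cont (an' n) by case: (haa n) => _ [].
have dan n x : is_derive (an n) x (an' n x) by case: (haa n) => _ [_ []].
(* Both Goursat solutions start from c on [0, p], so they agree at (0, p), that is, in their
   boundary values. *)
have eq n m p : 0 <= p <= INR n + 1 -> p <= INR m + 1 -> an n p = an m p.
  move=> hp hm.
  have [A [B fl]] := goursat (an n) (an' n) (can n) (can' n) (dan n).
  have [A1 [B1 fl1]] := goursat (an m) (an' m) (can m) (can' m) (dan m).
  have [_ [_ [_ hn]]] := haa n; have [_ [_ [_ hm1]]] := haa m.
  rewrite -(fl_0 _ _ _ fl) -(fl_0 _ _ _ fl1).
  apply: (mild_unique (fun x => A x 0) (fun x => A1 x 0) A A1 p) => //; try lra; try by case: fl; case: fl1.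
  - by move=> x hx; rewrite (hn _ _ _ fl) ?(hm1 _ _ _ fl1) //; lra.
  - by move=> x l _ _ _; exact: flow_mild fl.
  - by move=> x l _ _ _; exact: flow_mild fl1.
have eq' n m p : 0 <= p < INR n + 1 -> p < INR m + 1 -> an' n p = an' m p.
  move=> hp hm; have q : 0 < Rmin (INR n + 1 - p) (INR m + 1 - p) by apply: Rmin_pos; lra.
  apply: (right_derive_unique (an n) (an m) p _ _ _ q _ (dan n p) (dan m p)) => y hy.
  by apply: eq; have := Rmin_l (INR n + 1 - p) (INR m + 1 - p); have := Rmin_r (INR n + 1 - p) (INR m + 1 - p); lra.
(* The index satisfies a strict inequality because derivatives are compared from the right, so the
   pieces must agree slightly beyond the point. To the left of 0 the derivative is continued as a
   constant. *)
pose N x := Z.to_nat (up (Rmax 0 x)).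
have hN x : Rmax 0 x < INR (N x) + 1.
  have [h1 _] := archimed (Rmax 0 x); have h2 := Rmax_l 0 x.
  rewrite /N INR_IZR_INZ Z2Nat.id; first lra.
  by apply: le_IZR; lra.
pose a' x := an' (N x) (Rmax 0 x).
have ea' m x : Rmax 0 x < INR m + 1 -> a' x = an' m (Rmax 0 x).
  by move=> hx; apply: eq' => //; split; [exact: Rmax_l | exact: hN].
have ca' : cont a'.
  move=> x.
  pose m := N (x + 1).
  have cm : cont (fun y => an' m (Rmax 0 y)) by have := can' m => cam; cts.
  apply: (continuous_ext_loc _ (fun y => an' m (Rmax 0 y))); last exact: cm.
  exists (mkposreal 1 Rlt_0_1) => y hy; symmetry; apply: ea'.
  apply: Rle_lt_trans (hN (x + 1)); apply: Rle_max_compat_l.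
  by move: hy; rewrite /ball /= /AbsRing_ball /abs /minus /plus /opp /= => /Rabs_def2; lra.
(* Defined from its derivative, [a] is automatically differentiable on the whole line, also at 0 and
   where the index changes. *)
pose a x := add (c 0) (RInt a' 0 x).
have ca : cont a by rewrite /a; cts.
have da x : is_derive a x (a' x).
  have -> : a' x = add nul (a' x) by vec.
  apply: D_add; first exact: D_const.
  exact: deriv_RInt.
exists a, a'; do 3 (split => //).
have ea m s : 0 <= s <= INR m + 1 -> a s = an m s.
  move=> hs; have := can' m => cam.
  rewrite (FTC' (an m) (an' m) 0 s (dan m) cam) /a.
  have -> : an m 0 = c 0.
    have [A1 [B1 fl1]] := goursat (an m) (an' m) (can m) (can' m) (dan m).
    have [_ [_ [_ hm1]]] := haa m.
    have pm := pos_INR m.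
    by rewrite -(fl_0 _ _ _ fl1) (hm1 _ _ _ fl1) //; lra.
  congr (add _ _); apply: RInt_ext => t; rewrite Rmin_left ?Rmax_right; try lra; move=> ht.
  by rewrite (ea' m) Rmax_right //; lra.
move=> al A B fl hal x hx.
have hNx := hN x; rewrite Rmax_right // in hNx.
have [_ [_ [_ hm1]]] := haa (N x).
by apply: (hm1 al A B fl) => [s hs|]; [rewrite hal; [exact: ea | lra] | lra].
Qed.
End Mild.

(** * Complex matrices with the Frobenius norm *)

Fixpoint rsum (k : nat) (f : nat -> R) : R := match k with O => 0 | S k' => rsum k' f + f k' end.

Section Sums.
Implicit Types (k : nat).

Lemma csum_ext k f g : (forall i, (i < k)%nat -> f i = g i) -> csum k f = csum k g.
Proof. by elim: k => [|k IH] h //=; rewrite IH ?h //; auto with arith. Qed.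
Lemma csum_plus k f g : csum k (fun i => f i + g i)%C = (csum k f + csum k g)%C.
Proof. by elim: k => [|k IH] /=; [ring | rewrite IH; ring]. Qed.
Lemma csum_mul_l k (z : C) f : csum k (fun i => z * f i)%C = (z * csum k f)%C.
Proof. by elim: k => [|k IH] /=; [ring | rewrite IH; ring]. Qed.
Lemma csum_mul_r k (z : C) f : csum k (fun i => f i * z)%C = (csum k f * z)%C.
Proof. by elim: k => [|k IH] /=; [ring | rewrite IH; ring]. Qed.
Lemma csum_0 k : csum k (fun _ => 0%C) = 0%C.
Proof. by elim: k => [|k IH] //=; rewrite IH; ring. Qed.
Lemma csum_conj k f : Cconj (csum k f) = csum k (fun i => Cconj (f i)).
Proof.
elim: k => [|k IH] /=; last by rewrite -IH -Cplus_conj.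
by rewrite /Cconj /= Ropp_0.
Qed.
Lemma csum_swap k n (f : nat -> nat -> C) : csum k (fun i => csum n (f i)) = csum n (fun j => csum k (fun i => f i j)).
Proof. by elim: k => [|k IH] /=; [rewrite csum_0 | rewrite IH -csum_plus]. Qed.
Lemma csum_delta k i (f : nat -> C) : (i < k)%nat -> csum k (fun j => if Nat.eqb i j then f j else 0%C) = f i.
Proof.
elim: k => [|k IH] h; first lia.
rewrite /=; case: (Nat.eqb_spec i k) => [-> | hn].
  rewrite (csum_ext k _ (fun _ => 0%C)) ?csum_0; first ring.
  by move=> j hj; case: (Nat.eqb_spec k j) => //; lia.
by rewrite IH; [ring | lia].
Qed.
Lemma csum_split k n f : csum (k + n) f = (csum k f + csum n (fun i => f (k + i)%nat))%C.
Proof.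
elim: n => [|n IH] /=; first by rewrite Nat.add_0_r; ring.
by rewrite Nat.add_succ_r /= IH; ring.
Qed.

Lemma rsum_ext k f g : (forall i, (i < k)%nat -> f i = g i) -> rsum k f = rsum k g.
Proof. by elim: k => [|k IH] h //=; rewrite IH ?h //; auto with arith. Qed.
Lemma rsum_le k f g : (forall i, (i < k)%nat -> f i <= g i) -> rsum k f <= rsum k g.
Proof. by elim: k => [|k IH] h //=; [lra | apply: Rplus_le_compat; auto with arith]. Qed.
Lemma rsum_plus k f g : rsum k (fun i => f i + g i) = rsum k f + rsum k g.
Proof. by elim: k => [|k IH] /=; [ring | rewrite IH; ring]. Qed.
Lemma rsum_mul_l k (z : R) f : rsum k (fun i => z * f i) = z * rsum k f.
Proof. by elim: k => [|k IH] /=; [ring | rewrite IH; ring]. Qed.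
Lemma rsum_0 k : rsum k (fun _ => 0) = 0.
Proof. by elim: k => [|k IH] //=; rewrite IH; ring. Qed.
Lemma rsum_ge0 k f : (forall i, (i < k)%nat -> 0 <= f i) -> 0 <= rsum k f.
Proof. by move=> h; rewrite -(rsum_0 k); exact: rsum_le. Qed.
Lemma rsum_swap k n (f : nat -> nat -> R) : rsum k (fun i => rsum n (f i)) = rsum n (fun j => rsum k (fun i => f i j)).
Proof. by elim: k => [|k IH] /=; [rewrite rsum_0 | rewrite IH -rsum_plus]. Qed.
Lemma rsum_ge k f i : (i < k)%nat -> (forall i, (i < k)%nat -> 0 <= f i) -> f i <= rsum k f.
Proof.
elim: k => [|k IH] h h0; first lia.
rewrite /=; have hk := h0 k ltac:(lia).
case: (Nat.eq_dec i k) => [-> | hn].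
  have : 0 <= rsum k f by apply: rsum_ge0 => j hj; apply: h0; lia.
  lra.
have := IH ltac:(lia) ltac:(move=> j hj; apply: h0; lia); lra.
Qed.
Lemma Re_csum k f : Re (csum k f) = rsum k (fun i => Re (f i)).
Proof. by elim: k => [|k IH] //=; rewrite -IH. Qed.
Lemma Cmod_csum k f : Cmod (csum k f) <= rsum k (fun i => Cmod (f i)).
Proof.
elim: k => [|k IH] /=; first by rewrite Cmod_0; lra.
apply: Rle_trans (Cmod_triangle _ _) _; lra.
Qed.

Lemma discriminant a b c : (forall t, 0 <= a + 2 * b * t + c * t ^ 2) -> b ^ 2 <= a * c.
Proof.
move=> h.
have a0 := h 0.
case: (Req_dec c 0) => hc.
  case: (Req_dec b 0) => hb; first by rewrite hb hc; lra.
  have := h (- (a + 1) / (2 * b)).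
  have -> : a + 2 * b * (- (a + 1) / (2 * b)) + c * (- (a + 1) / (2 * b)) ^ 2 = -1 by rewrite hc; field.
  lra.
have c0 : 0 < c.
  apply: Rnot_le_lt => hc0.
  have := h ((Rabs b + a + 1) / - c * 2 + 1); have hcn : 0 < - c by lra.
  set t := _ / - c * 2 + 1.
  have ab := Rle_abs b; have ab' := Rabs_pos b; have a00 : 0 <= a by lra.
  have t1 : 1 <= t.
    have : 0 <= (Rabs b + a + 1) / - c by apply: Rdiv_le_0_compat; lra.
    rewrite /t; lra.
  have e : - c * (t - 1) = 2 * (Rabs b + a + 1) by rewrite /t; field.
  nra.
have := h (- b / c).
have -> : a + 2 * b * (- b / c) + c * (- b / c) ^ 2 = (a * c - b ^ 2) / c by field.
move=> h1; have := Rmult_le_compat_r c _ _ ltac:(lra) h1.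
have -> : (a * c - b ^ 2) / c * c = a * c - b ^ 2 by field.
lra.
Qed.

Lemma rsum_CS k f g : rsum k (fun i => f i * g i) ^ 2 <= rsum k (fun i => f i ^ 2) * rsum k (fun i => g i ^ 2).
Proof.
apply: discriminant => t.
rewrite (_ : _ + _ = rsum k (fun i => (f i + t * g i) ^ 2)).
  by apply: rsum_ge0 => i _; exact: pow2_ge_0.
rewrite (Rmult_comm 2) (Rmult_comm _ t) (Rmult_comm (rsum _ _) 2) (Rmult_comm _ (t ^ 2)) -!rsum_mul_l -!rsum_plus.
by apply: rsum_ext => i _; ring.
Qed.

End Sums.

Section Matrices.
Variable N : nat.

Definition inside (i j : nat) : bool := andb (i <? N)%nat (j <? N)%nat.
Lemma insideP i j : (i < N)%nat -> (j < N)%nat -> inside i j = true.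
Proof. by move=> hi hj; apply/andb_true_intro; split; apply/Nat.ltb_lt. Qed.

(** Entries outside the N x N block are forced to be zero, so that agreement of the relevant entries
    is genuine equality and the algebra laws hold as equations. *)
Definition mx : Type := {f : Mat | forall i j, inside i j = false -> f i j = 0%C}.
Definition ent (x : mx) : Mat := proj1_sig x.
Definition mk (f : Mat) : mx.
Proof. exists (fun i j => if inside i j then f i j else 0%C) => i j; by case: inside. Defined.

Lemma ent_mk f i j : (i < N)%nat -> (j < N)%nat -> ent (mk f) i j = f i j.
Proof. by move=> hi hj; rewrite /= insideP. Qed.

Lemma mx_ext (x y : mx) : (forall i j, (i < N)%nat -> (j < N)%nat -> ent x i j = ent y i j) -> x = y.
Proof.
case: x => f hf; case: y => g hg /= h; apply: subset_eq_compat.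
apply: functional_extensionality => i; apply: functional_extensionality => j.
case e : (inside i j); last by rewrite hf // hg.
by move/andb_prop: e => [/Nat.ltb_lt hi /Nat.ltb_lt hj]; exact: h.
Qed.

Definition mxplus (x y : mx) : mx := mk (fun i j => ent x i j + ent y i j)%C.
Definition mxopp (x : mx) : mx := mk (fun i j => - ent x i j)%C.
Definition mxzero : mx := mk (fun _ _ => 0%C).
Definition mxscal (r : R) (x : mx) : mx := mk (fun i j => RtoC r * ent x i j)%C.
Definition mxmul (x y : mx) : mx := mk (fun i j => mmul N (ent x) (ent y) i j).
Definition mxadj (x : mx) : mx := mk (fun i j => Cconj (ent x j i)).
Definition mxcs (z : C) : mx := mk (fun i j => if Nat.eqb i j then z else 0%C).
Definition mxcinner (x y : mx) : C := csum N (fun i => csum N (fun j => Cconj (ent x i j) * ent y i j)%C).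
Definition mxinner (x y : mx) : R := Re (mxcinner x y).
Definition mxnorm (x : mx) : R := sqrt (mxinner x x).

Ltac mxe := apply: mx_ext => ? ? ? ?; rewrite ?ent_mk //; try ring.

Lemma mxplusC x y : mxplus x y = mxplus y x. Proof. mxe. Qed.
Lemma mxplusA x y z : mxplus x (mxplus y z) = mxplus (mxplus x y) z. Proof. mxe. Qed.
Lemma mxplus0 x : mxplus x mxzero = x. Proof. mxe. Qed.
Lemma mxplusN x : mxplus x (mxopp x) = mxzero. Proof. mxe. Qed.
Lemma mxscalA (r s : R) x : mxscal r (mxscal s x) = mxscal (r * s) x.
Proof. mxe; rewrite RtoC_mult; ring. Qed.
Lemma mxscal1 x : mxscal 1 x = x. Proof. mxe. Qed.
Lemma mxscalDr (r : R) x y : mxscal r (mxplus x y) = mxplus (mxscal r x) (mxscal r y). Proof. mxe. Qed.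
Lemma mxscalDl (r s : R) x : mxscal (r + s) x = mxplus (mxscal r x) (mxscal s x).
Proof. mxe; rewrite RtoC_plus; ring. Qed.

Lemma mxcinner_plus x y z : mxcinner x (mxplus y z) = (mxcinner x y + mxcinner x z)%C.
Proof.
rewrite /mxcinner -csum_plus; apply: csum_ext => i hi; rewrite -csum_plus; apply: csum_ext => j hj.
by rewrite ent_mk //; ring.
Qed.
Lemma mxcinner_scal (z : C) x y w : (forall i j, (i < N)%nat -> (j < N)%nat -> ent w i j = z * ent y i j)%C ->
  mxcinner x w = (z * mxcinner x y)%C.
Proof.
move=> h; rewrite /mxcinner -csum_mul_l; apply: csum_ext => i hi; rewrite -csum_mul_l; apply: csum_ext => j hj.
by rewrite h //; ring.
Qed.
Lemma mxcinner_sym x y : mxcinner x y = Cconj (mxcinner y x).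
Proof.
rewrite /mxcinner csum_conj; apply: csum_ext => i hi; rewrite csum_conj; apply: csum_ext => j hj.
by rewrite Cmult_conj Cconj_conj; ring.
Qed.
Lemma mxinner_plus x y z : mxinner x (mxplus y z) = mxinner x y + mxinner x z.
Proof. by rewrite /mxinner mxcinner_plus. Qed.
Lemma mxinner_scal (r : R) x y : mxinner x (mxscal r y) = r * mxinner x y.
Proof.
rewrite /mxinner (mxcinner_scal (RtoC r) x y); first by case: mxcinner => a b /=; ring.
by move=> i j hi hj; rewrite ent_mk.
Qed.
Lemma mxinner_sym x y : mxinner x y = mxinner y x.
Proof. by rewrite /mxinner mxcinner_sym. Qed.
Lemma mxinner_sq x : mxinner x x = rsum N (fun i => rsum N (fun j => Cmod (ent x i j) ^ 2)).
Proof.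
rewrite /mxinner /mxcinner Re_csum; apply: rsum_ext => i hi; rewrite Re_csum; apply: rsum_ext => j hj.
by rewrite /Cmod pow2_sqrt /=; [ring | nra].
Qed.
Lemma mxinner_ge0 x : 0 <= mxinner x x.
Proof. by rewrite mxinner_sq; apply: rsum_ge0 => i _; apply: rsum_ge0 => j _; exact: pow2_ge_0. Qed.
Lemma mxnorm_ge0 x : 0 <= mxnorm x.
Proof. exact: sqrt_pos. Qed.
Lemma mxnorm_sq x : mxnorm x ^ 2 = mxinner x x.
Proof. by rewrite /mxnorm pow2_sqrt //; exact: mxinner_ge0. Qed.
Lemma mxinner_CS x y : mxinner x y ^ 2 <= mxinner x x * mxinner y y.
Proof.
apply: discriminant => t.
have -> : mxinner x x + 2 * mxinner x y * t + mxinner y y * t ^ 2 =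
  mxinner (mxplus x (mxscal t y)) (mxplus x (mxscal t y)).
  rewrite mxinner_plus mxinner_scal !(mxinner_sym (mxplus _ _)) !mxinner_plus !mxinner_scal (mxinner_sym y x); ring.
exact: mxinner_ge0.
Qed.
Lemma mxnorm_triangle x y : mxnorm (mxplus x y) <= mxnorm x + mxnorm y.
Proof.
have px := mxnorm_ge0 x; have py := mxnorm_ge0 y.
apply: Rsqr_incr_0_var; last lra.
rewrite !Rsqr_pow2 mxnorm_sq mxinner_plus !(mxinner_sym (mxplus _ _)) !mxinner_plus (mxinner_sym y x).
have h := mxinner_CS x y; rewrite -!mxnorm_sq in h |- *.
have : mxinner x y <= mxnorm x * mxnorm y; last nra.
apply: Rsqr_incr_0_var; last by apply: Rmult_le_pos.
by rewrite !Rsqr_pow2; nra.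
Qed.
Lemma mxnorm_scal (r : R) x : mxnorm (mxscal r x) = Rabs r * mxnorm x.
Proof.
rewrite /mxnorm mxinner_scal mxinner_sym mxinner_scal -Rmult_assoc sqrt_mult_alt; last by nra.
by rewrite -[r * r]/(Rsqr r) sqrt_Rsqr_abs.
Qed.
Lemma mxnorm_ent x i j : (i < N)%nat -> (j < N)%nat -> Cmod (ent x i j) <= mxnorm x.
Proof.
move=> hi hj; apply: Rsqr_incr_0_var; last exact: mxnorm_ge0.
rewrite !Rsqr_pow2 mxnorm_sq mxinner_sq.
apply: Rle_trans (rsum_ge N (fun j => Cmod (ent x i j) ^ 2) j hj _) _; first by move=> *; exact: pow2_ge_0.
apply: (rsum_ge N (fun i => rsum N (fun j => Cmod (ent x i j) ^ 2)) i hi) => k _.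
by apply: rsum_ge0 => *; exact: pow2_ge_0.
Qed.
Lemma mxnorm_eq0 x : mxnorm x = 0 -> x = mxzero.
Proof.
move=> h; apply: mx_ext => i j hi hj; rewrite ent_mk //; apply: Cmod_eq_0.
by apply: Rle_antisym; [rewrite -h; exact: mxnorm_ent | exact: Cmod_ge_0].
Qed.
Lemma mxnorm_lt x e : (forall i j, (i < N)%nat -> (j < N)%nat -> Cmod (ent x i j) < e) -> 0 < e ->
  mxnorm x <= INR N * e.
Proof.
move=> h he; apply: Rsqr_incr_0_var; last by apply: Rmult_le_pos; [exact: pos_INR | lra].
rewrite !Rsqr_pow2 mxnorm_sq mxinner_sq.
have rc k z : rsum k (fun _ => z) = INR k * z.
  by elim: k => [|k IH]; [rewrite /=; ring | rewrite S_INR -[rsum _ _]/(rsum k (fun _ => z) + z) IH; ring].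
apply: Rle_trans (_ : rsum N (fun _ => rsum N (fun _ => e ^ 2)) <= _).
  apply: rsum_le => i hi; apply: rsum_le => j hj; apply: pow_incr; split; first exact: Cmod_ge_0.
  by apply: Rlt_le; exact: h.
by rewrite !rc; apply: Req_le; ring.
Qed.

Definition mx_AM := AbelianMonoid.Mixin mx mxplus mxzero mxplusC mxplusA mxplus0.
Definition mx_AbelianMonoid := AbelianMonoid.Pack mx mx_AM mx.
Definition mx_AG := AbelianGroup.Mixin mx_AbelianMonoid mxopp mxplusN.
Definition mx_AGc := AbelianGroup.Class mx mx_AM mx_AG.
Definition mx_MS := ModuleSpace.Mixin R_Ring (AbelianGroup.Pack mx mx_AGc mx) mxscal mxscalA mxscal1 mxscalDr mxscalDl.
Definition mx_MSc := ModuleSpace.Class R_Ring mx mx_AGc mx_MS.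
Definition mxball (x : mx) (e : R) (y : mx) : Prop := mxnorm (mxplus y (mxopp x)) < e.
Lemma mxball_refl x (e : posreal) : mxball x e x.
Proof.
rewrite /mxball mxplusN /mxnorm; have -> : mxinner mxzero mxzero = 0.
  have e0 : mxzero = mxscal 0 mxzero by mxe.
  by rewrite {2}e0 mxinner_scal; ring.
by rewrite sqrt_0; exact: cond_pos.
Qed.
Lemma mxball_sym x y e : mxball x e y -> mxball y e x.
Proof.
rewrite /mxball; have -> : mxplus x (mxopp y) = mxscal (-1) (mxplus y (mxopp x)).
  by mxe; rewrite RtoC_opp; ring.
by rewrite mxnorm_scal Rabs_Ropp Rabs_R1 Rmult_1_l.
Qed.
Lemma mxball_tri x y z e1 e2 : mxball x e1 y -> mxball y e2 z -> mxball x (e1 + e2) z.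
Proof.
rewrite /mxball => h1 h2.
have -> : mxplus z (mxopp x) = mxplus (mxplus y (mxopp x)) (mxplus z (mxopp y)) by mxe.
apply: Rle_lt_trans (mxnorm_triangle _ _) _; lra.
Qed.
Definition mx_US := UniformSpace.Mixin mx mxzero mxball mxball_refl mxball_sym mxball_tri.
Definition mx_NAc := NormedModuleAux.Class R_AbsRing mx mx_MSc mx_US.
Definition mx_NM := NormedModule.Mixin R_AbsRing (NormedModuleAux.Pack R_AbsRing mx mx_NAc mx) mxnorm 1
  mxnorm_triangle (fun r x => Req_le _ _ (mxnorm_scal r x)) (fun x y e h => h)
  (fun x y e h => eq_ind_r (fun t => _ < t) h (Rmult_1_l e)) mxnorm_eq0.
Definition mx_NMc := NormedModule.Class R_AbsRing mx mx_NAc mx_NM.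

Definition mxlim (F : (mx -> Prop) -> Prop) : mx :=
  mk (fun i j => @lim C_R_CompleteNormedModule (fun P => F (fun x => P (ent x i j)))).

Lemma filter_forall_lt {T : Type} (F : (T -> Prop) -> Prop) {FF : Filter F} k (P : nat -> T -> Prop) :
  (forall i, (i < k)%nat -> F (P i)) -> F (fun x => forall i, (i < k)%nat -> P i x).
Proof.
elim: k => [|k IH] h; first by apply: filter_forall => x i hi; lia.
have hk : F (fun x => (forall i, (i < k)%nat -> P i x) /\ P k x).
  by apply: filter_and; [apply: IH => i hi; apply: h; lia | apply: h; lia].
apply: (filter_imp _ _ _ hk) => x [h1 h2] i hi.
by case: (Nat.eq_dec i k) => [-> // | hn]; apply: h1; lia.
Qed.

Lemma mxlim_ball (F : (mx -> Prop) -> Prop) : ProperFilter F -> (forall eps : posreal, exists x, F (mxball x eps)) ->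
  forall eps : posreal, F (mxball (mxlim F) eps).
Proof.
move=> PF hc eps.
have FF : Filter F by apply: filter_filter.
have he : 0 < eps / (INR N + 1) by apply: Rdiv_lt_0_compat; [exact: cond_pos | have := pos_INR N; lra].
have key i j : (i < N)%nat -> (j < N)%nat -> F (fun x => Cmod (ent x i j - ent (mxlim F) i j)%C < eps / (INR N + 1)).
  move=> hi hj.
  pose G P := F (fun x => P (ent x i j)).
  have PG : ProperFilter G.
    split.
      by move=> P hP; have [x hx] := filter_ex (F := F) _ hP; exists (ent x i j).
    split; rewrite /G.
    - exact: filter_true.
    - by move=> P Q hP hQ; exact: filter_and.
    - move=> P Q hPQ; apply: filter_imp => x; exact: hPQ.
  have cG : @cauchy C_R_CompleteNormedModule G.
    move=> e.
    have [x hx] := hc e.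
    exists (ent x i j); rewrite /G; apply: filter_imp hx => y hy.
    have h : Cmod (ent y i j - ent x i j)%C < e.
      apply: Rle_lt_trans hy.
      have := mxnorm_ent (mxplus y (mxopp x)) i j hi hj; rewrite !ent_mk //.
    by apply: (@norm_compat1 R_AbsRing C_R_NormedModule); rewrite -Cmod_norm.
  have nf := @norm_factor_gt_0 R_AbsRing C_R_NormedModule.
  pose e' := mkposreal _ (Rdiv_lt_0_compat _ _ he nf).
  have h : F (fun x => @ball C_R_CompleteNormedModule (@lim C_R_CompleteNormedModule G) e' (ent x i j)) := @complete_cauchy C_R_CompleteNormedModule G PG cG e'.
  apply: (filter_imp _ _ _ h) => x hx.
  rewrite [ent (mxlim F) i j]ent_mk // -[lim _]/(@lim C_R_CompleteNormedModule G).
  have := @norm_compat2 R_AbsRing C_R_NormedModule _ _ _ hx; rewrite -Cmod_norm => h2.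
  apply: Rlt_le_trans h2 _; apply: Req_le; rewrite /e' /=; field; split; last lra.
  by have := pos_INR N; lra.
have key2 : F (fun x => forall i, (i < N)%nat -> forall j, (j < N)%nat -> Cmod (ent x i j - ent (mxlim F) i j)%C < eps / (INR N + 1)).
  apply: filter_forall_lt => i hi; apply: filter_forall_lt => j hj; exact: key.
apply: (filter_imp _ _ _ key2) => x hx; rewrite /mxball.
apply: Rle_lt_trans (mxnorm_lt _ _ _ he) _.
  by move=> i j hi hj; have := hx i hi j hj; rewrite !ent_mk //; rewrite /= insideP.
apply: Rlt_le_trans (_ : (INR N + 1) * (eps / (INR N + 1)) <= _); first by apply: Rmult_lt_compat_r => //; lra.
by apply: Req_le; field; have := pos_INR N; lra.
Qed.

Lemma mxlim_close (F1 F2 : (mx -> Prop) -> Prop) : (forall P, F2 P -> F1 P) -> (forall P, F1 P -> F2 P) ->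
  forall eps : posreal, mxball (mxlim F1) eps (mxlim F2).
Proof.
move=> h1 h2 eps; have -> : F1 = F2.
  by apply: functional_extensionality => P; apply: propositional_extensionality; split; auto.
exact: mxball_refl.
Qed.

Definition mx_CS := CompleteSpace.Mixin (UniformSpace.Pack mx mx_US mx) mxlim mxlim_ball mxlim_close.
Definition mx_CNc := CompleteNormedModule.Class R_AbsRing mx mx_NMc mx_CS.
Definition mx_CN := CompleteNormedModule.Pack R_AbsRing mx mx_CNc mx.

Lemma mmul_ent (x y : mx) i j : (i < N)%nat -> (j < N)%nat -> ent (mxmul x y) i j = csum N (fun k => ent x i k * ent y k j)%C.
Proof. by move=> hi hj; rewrite ent_mk. Qed.

Lemma mxcs_mul z x i j : (i < N)%nat -> (j < N)%nat -> ent (mxmul (mxcs z) x) i j = (z * ent x i j)%C.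
Proof.
move=> hi hj; rewrite mmul_ent // (csum_ext _ _ (fun k => if Nat.eqb i k then z * ent x k j else 0)%C).
  exact: (csum_delta N i (fun k => z * ent x k j)%C hi).
by move=> k hk; rewrite ent_mk //; case: Nat.eqb; ring.
Qed.
Lemma mxmul_cs z x i j : (i < N)%nat -> (j < N)%nat -> ent (mxmul x (mxcs z)) i j = (z * ent x i j)%C.
Proof.
move=> hi hj; rewrite mmul_ent // (csum_ext _ _ (fun k => if Nat.eqb j k then z * ent x i k else 0)%C).
  exact: (csum_delta N j (fun k => z * ent x i k)%C hj).
by move=> k hk; rewrite ent_mk // Nat.eqb_sym; case: Nat.eqb; ring.
Qed.

Ltac mxs := apply: mx_ext => i j hi hj; rewrite ?(mmul_ent, ent_mk) //.

Lemma mxmul_plus_l x y z : mxmul (mxplus x y) z = mxplus (mxmul x z) (mxmul y z).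
Proof. by mxs; rewrite -csum_plus; apply: csum_ext => k hk; rewrite ent_mk //; ring. Qed.
Lemma mxmul_plus_r x y z : mxmul x (mxplus y z) = mxplus (mxmul x y) (mxmul x z).
Proof. by mxs; rewrite -csum_plus; apply: csum_ext => k hk; rewrite ent_mk //; ring. Qed.
Lemma mxmul_scal_l (r : R) x y : mxmul (mxscal r x) y = mxscal r (mxmul x y).
Proof. by mxs; rewrite -csum_mul_l; apply: csum_ext => k hk; rewrite ent_mk //; ring. Qed.
Lemma mxmul_scal_r (r : R) x y : mxmul x (mxscal r y) = mxscal r (mxmul x y).
Proof. by mxs; rewrite -csum_mul_l; apply: csum_ext => k hk; rewrite ent_mk //; ring. Qed.
Lemma mxmulA x y z : mxmul (mxmul x y) z = mxmul x (mxmul y z).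
Proof.
mxs; rewrite (csum_ext _ _ (fun k => csum N (fun l => ent x i l * ent y l k * ent z k j)%C)).
  rewrite csum_swap; apply: csum_ext => l hl; rewrite mmul_ent // -csum_mul_l.
  by apply: csum_ext => k hk; ring.
by move=> k hk; rewrite mmul_ent // -csum_mul_r.
Qed.
Lemma mxmul1l x : mxmul (mxcs 1%C) x = x.
Proof. by apply: mx_ext => i j hi hj; rewrite mxcs_mul //; ring. Qed.
Lemma mxmul1r x : mxmul x (mxcs 1%C) = x.
Proof. by apply: mx_ext => i j hi hj; rewrite mxmul_cs //; ring. Qed.
Lemma mxadj_plus x y : mxadj (mxplus x y) = mxplus (mxadj x) (mxadj y).
Proof. by mxs; rewrite Cplus_conj. Qed.
Lemma mxadj_scal (r : R) x : mxadj (mxscal r x) = mxscal r (mxadj x).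
Proof.
mxs; rewrite Cmult_conj; congr (_ * _)%C.
by rewrite /Cconj /RtoC /= Ropp_0.
Qed.
Lemma mxadj_mul x y : mxadj (mxmul x y) = mxmul (mxadj y) (mxadj x).
Proof. by mxs; rewrite csum_conj; apply: csum_ext => k hk; rewrite !ent_mk // Cmult_conj Cmult_comm. Qed.
Lemma mxadjK x : mxadj (mxadj x) = x.
Proof. by mxs; rewrite Cconj_conj. Qed.
Lemma mxnorm_adj x : mxnorm (mxadj x) = mxnorm x.
Proof.
rewrite /mxnorm !mxinner_sq; congr sqrt; rewrite rsum_swap; apply: rsum_ext => i hi; apply: rsum_ext => j hj.
by rewrite ent_mk // Cmod_conj.
Qed.
Lemma mxinner_mul x y z : mxinner (mxmul x y) z = mxinner y (mxmul (mxadj x) z).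
Proof.
rewrite /mxinner /mxcinner; congr Re.
rewrite (csum_ext _ _ (fun i => csum N (fun j => csum N (fun k => Cconj (ent x i k) * Cconj (ent y k j) * ent z i j)%C))); last first.
  move=> i hi; apply: csum_ext => j hj; rewrite mmul_ent // csum_conj -csum_mul_r.
  by apply: csum_ext => k hk; rewrite Cmult_conj.
rewrite (csum_ext _ _ (fun i => csum N (fun k => csum N (fun j => Cconj (ent x i k) * Cconj (ent y k j) * ent z i j)%C))); last first.
  by move=> i hi; exact: csum_swap.
rewrite csum_swap; apply: csum_ext => k hk.
rewrite csum_swap; apply: csum_ext => j hj.
rewrite mmul_ent // -csum_mul_l; apply: csum_ext => i hi; rewrite ent_mk //; ring.
Qed.
Lemma mxcs_plus z w : mxcs (z + w) = mxplus (mxcs z) (mxcs w).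
Proof. by mxs; case: Nat.eqb; ring. Qed.
Lemma mxcs_mulc z w : mxcs (z * w) = mxmul (mxcs z) (mxcs w).
Proof. by apply: mx_ext => i j hi hj; rewrite mxcs_mul // !ent_mk //; case: Nat.eqb; ring. Qed.
Lemma mxcs_RtoC (r : R) : mxcs r = mxscal r (mxcs 1%C).
Proof. by mxs; case: Nat.eqb; ring. Qed.
Lemma mxcs_comm z x : mxmul (mxcs z) x = mxmul x (mxcs z).
Proof. by apply: mx_ext => i j hi hj; rewrite mxcs_mul // mxmul_cs. Qed.
Lemma mxinner_cs z x : mxinner x (mxmul (mxcs z) x) = Re z * mxnorm x ^ 2.
Proof.
rewrite mxnorm_sq /mxinner (mxcinner_scal z x x); last by move=> i j hi hj; exact: mxcs_mul.
have : Im (mxcinner x x) = 0.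
  have := f_equal Im (mxcinner_sym x x); rewrite /Im /=; lra.
by case: mxcinner => a b; case: z => c d /= ->; ring.
Qed.
Lemma mxnorm_cs z x : mxnorm (mxmul (mxcs z) x) = Cmod z * mxnorm x.
Proof.
apply: Rsqr_inj; [exact: mxnorm_ge0 | by apply: Rmult_le_pos; [exact: Cmod_ge_0 | exact: mxnorm_ge0] |].
rewrite !Rsqr_pow2 Rpow_mult_distr !mxnorm_sq !mxinner_sq -rsum_mul_l; apply: rsum_ext => i hi.
by rewrite -rsum_mul_l; apply: rsum_ext => j hj; rewrite mxcs_mul // Cmod_mult Rpow_mult_distr.
Qed.
Lemma mxnorm_mul x y : mxnorm (mxmul x y) <= mxnorm x * mxnorm y.
Proof.
apply: Rsqr_incr_0_var; last by apply: Rmult_le_pos; exact: mxnorm_ge0.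
rewrite !Rsqr_pow2 Rpow_mult_distr !mxnorm_sq !mxinner_sq.
rewrite (rsum_swap N N (fun i j => Cmod (ent y i j) ^ 2)) Rmult_comm -rsum_mul_l; apply: rsum_le => i hi.
rewrite Rmult_comm -rsum_mul_l; apply: rsum_le => j hj.
apply: Rle_trans (rsum_CS N (fun k => Cmod (ent x i k)) (fun k => Cmod (ent y k j))).
rewrite mmul_ent //; apply: pow_incr; split; first exact: Cmod_ge_0.
apply: Rle_trans (Cmod_csum _ _) _; apply: Req_le; apply: rsum_ext => k hk; exact: Cmod_mult.
Qed.

Definition mx_alg : star_alg := Build_star_alg mx_CN mxmul (mxcs 1%C) mxadj mxinner mxcs
  mxmul_plus_l mxmul_plus_r mxmul_scal_l mxmul_scal_r mxmulA mxmul1l mxmul1r mxnorm_mul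
  mxadj_plus mxadj_scal mxadj_mul mxadjK mxnorm_adj mxinner_plus mxinner_scal mxinner_sym
  (fun x => eq_sym (mxnorm_sq x)) mxinner_mul mxcs_plus mxcs_mulc mxcs_RtoC mxcs_comm mxnorm_cs mxinner_cs.

End Matrices.

(** * Half-line and quadrant functions as total continuous functions *)

Definition contC {U : UniformSpace} (g : U -> C) : Prop := cont (fun u => Re (g u)) /\ cont (fun u => Im (g u)).

Section ComplexValued.

Lemma CRInt_pair (g : R -> C) a b : contC g -> CRInt g a b = (RInt (fun t => Re (g t)) a b, RInt (fun t => Im (g t)) a b).
Proof.
move=> [c1 c2]; rewrite /CRInt; apply: (is_RInt_unique (V := C_R_CompleteNormedModule)).
apply: (is_RInt_fct_extend_pair (U := R_NormedModule) (V := R_NormedModule)); apply: (RInt_correct (V := R_CompleteNormedModule)); exact: exR.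
Qed.

Lemma CRInt_ext (f g : R -> C) a b : (forall x, Rmin a b < x < Rmax a b -> f x = g x) -> CRInt f a b = CRInt g a b.
Proof. exact: (RInt_ext (V := C_R_CompleteNormedModule)). Qed.

Lemma cont_C {U : UniformSpace} (g : U -> C) : contC g -> cont (g : U -> C_UniformSpace).
Proof.
move=> [h1 h2]; apply: (cont_ext (fun u => (Re (g u), Im (g u)))); last exact: cont_pair.
by move=> u; case: (g u).
Qed.

(** Composition with [Rmax 0] turns one-sided continuity on the half-line into continuity on the
    whole line, the extension being constant to the left of 0. *)
Lemma half_clamp x : filterlim (fun x => Rmax 0 x) (locally x) (within (fun t => 0 <= t) (locally (Rmax 0 x))).
Proof.
move=> P hP; apply: locally_imp (cont_clamp x _ hP) => y h; apply: h; exact: (Rmax_l 0 y).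
Qed.

Lemma cont_half_clamp (g : R -> C) : cont_half g -> contC (fun x => g (Rmax 0 x)).
Proof.
move=> h; split => x.
  apply: filterlim_comp (filterlim_comp _ _ _ _ _ _ _ _ (half_clamp x) (h _ (Rmax_l _ _))) _.
  exact: (continuous_fst (U := R_UniformSpace) (V := R_UniformSpace)).
apply: filterlim_comp (filterlim_comp _ _ _ _ _ _ _ _ (half_clamp x) (h _ (Rmax_l _ _))) _.
exact: (continuous_snd (U := R_UniformSpace) (V := R_UniformSpace)).
Qed.

Lemma cont_half_of (g g' : R -> C) : contC g' -> (forall x, 0 <= x -> g x = g' x) -> cont_half g.
Proof.
move=> /cont_C h e x hx; rewrite e // => P hP.
have h2 := h x P hP; apply: locally_imp h2 => y hy h0; rewrite e //.
Qed.

Lemma quad_clamp (p : R * R) :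
  filterlim (fun p : R * R => (Rmax 0 (fst p), Rmax 0 (snd p))) (locally p) (within quad (locally (Rmax 0 (fst p), Rmax 0 (snd p)))).
Proof.
move=> P hP.
have c : cont (fun p : R * R => (Rmax 0 (fst p), Rmax 0 (snd p))).
  by apply: cont_pair; [apply: (cont_app1 _ _ cont_clamp); apply: cont_fst; exact: cont_id | apply: (cont_app1 _ _ cont_clamp); apply: cont_snd; exact: cont_id].
apply: locally_imp (c p _ hP) => y h; apply: h; split; exact: Rmax_l.
Qed.

Lemma cont_quad_clamp (g : R -> R -> C) : cont_quad g -> contC (fun p : R * R => g (Rmax 0 (fst p)) (Rmax 0 (snd p))).
Proof.
move=> h; split => p.
  apply: filterlim_comp (filterlim_comp _ _ _ _ _ _ _ _ (quad_clamp p) (h _ _ (Rmax_l _ _) (Rmax_l _ _))) _.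
  exact: (continuous_fst (U := R_UniformSpace) (V := R_UniformSpace)).
apply: filterlim_comp (filterlim_comp _ _ _ _ _ _ _ _ (quad_clamp p) (h _ _ (Rmax_l _ _) (Rmax_l _ _))) _.
exact: (continuous_snd (U := R_UniformSpace) (V := R_UniformSpace)).
Qed.

Lemma cont_quad_of (g g' : R -> R -> C) : contC (fun p : R * R => g' (fst p) (snd p)) ->
  (forall x l, 0 <= x -> 0 <= l -> g x l = g' x l) -> cont_quad g.
Proof.
move=> /cont_C h e x l hx hl; rewrite e // => P hP.
have h2 := h (x, l) P hP; apply: locally_imp h2 => y hy [h0 h1]; rewrite e //.
Qed.

End ComplexValued.

Section Entries.
Variable N : nat.
Notation M := (mx_alg N).

(** Inner products with the matrix units for z = 1 and z = i are the real and imaginary parts of an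
    entry; continuity and integrals of entries thus reduce to those of [inner]. *)
Definition unit_mx (z : C) (i j : nat) : M := mk N (fun k l => if Nat.eqb i k then if Nat.eqb j l then z else 0%C else 0%C).

Lemma mxcinner_unit z (x : M) i j : (i < N)%nat -> (j < N)%nat -> mxcinner N (unit_mx z i j) x = (Cconj z * ent N x i j)%C.
Proof.
move=> hi hj; rewrite /mxcinner.
have c0 : Cconj 0%C = 0%C by rewrite /Cconj /= Ropp_0.
rewrite (csum_ext _ _ (fun k => if Nat.eqb i k then Cconj z * ent N x k j else 0)%C).
  exact: (csum_delta N i (fun k => Cconj z * ent N x k j)%C hi).
move=> k hk; rewrite (csum_ext _ _ (fun l => if Nat.eqb j l then (if Nat.eqb i k then Cconj z * ent N x k l else 0) else 0)%C).
  exact: (csum_delta N j (fun l => if Nat.eqb i k then Cconj z * ent N x k l else 0)%C hj).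
by move=> l hl; rewrite ent_mk //; case: Nat.eqb; case: Nat.eqb => //; rewrite c0; ring.
Qed.

Lemma Re_ent (x : M) i j : (i < N)%nat -> (j < N)%nat -> Re (ent N x i j) = inner (unit_mx 1%C i j) x.
Proof.
move=> hi hj; rewrite -[inner _ _]/(Re (mxcinner N (unit_mx 1%C i j) x)) mxcinner_unit //.
by case: ent => a b /=; ring.
Qed.
Lemma Im_ent (x : M) i j : (i < N)%nat -> (j < N)%nat -> Im (ent N x i j) = inner (unit_mx Ci i j) x.
Proof.
move=> hi hj; rewrite -[inner _ _]/(Re (mxcinner N (unit_mx Ci i j) x)) mxcinner_unit //.
by case: ent => a b /=; ring.
Qed.

Lemma contC_ent {U : UniformSpace} (f : U -> M) i j : cont f -> (i < N)%nat -> (j < N)%nat -> contC (fun u => ent N (f u) i j).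
Proof.
move=> cf hi hj; split.
  by apply: (cont_ext (fun u => inner (unit_mx 1%C i j) (f u))) => [u|]; [rewrite Re_ent | cts].
by apply: (cont_ext (fun u => inner (unit_mx Ci i j) (f u))) => [u|]; [rewrite Im_ent | cts].
Qed.

Lemma ent_RInt (f : R -> M) a b i j : cont f -> (i < N)%nat -> (j < N)%nat ->
  ent N (RInt f a b) i j = CRInt (fun t => ent N (f t) i j) a b.
Proof.
move=> cf hi hj; rewrite CRInt_pair; last exact: contC_ent.
have e1 : RInt (fun t => Re (ent N (f t) i j)) a b = Re (ent N (RInt f a b) i j).
  rewrite Re_ent // -RInt_inner //; apply: RInt_ext => t _; exact: Re_ent.
have e2 : RInt (fun t => Im (ent N (f t) i j)) a b = Im (ent N (RInt f a b) i j).
  rewrite Im_ent // -RInt_inner //; apply: RInt_ext => t _; exact: Im_ent.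
by rewrite e1 e2; case: ent.
Qed.

Lemma cont_mx {U : UniformSpace} (f : U -> M) :
  (forall i j, (i < N)%nat -> (j < N)%nat -> contC (fun u => ent N (f u) i j)) -> cont f.
Proof.
move=> h u; apply/contP => eps he.
have he2 : 0 < eps / (INR N + 1) / 2.
  by have := pos_INR N; move=> hN; apply: Rdiv_lt_0_compat; last lra; apply: Rdiv_lt_0_compat; lra.
have key : locally u (fun y => forall i, (i < N)%nat -> forall j, (j < N)%nat ->
    Cmod (ent N (f y) i j - ent N (f u) i j)%C < eps / (INR N + 1)).
  apply: filter_forall_lt => i hi; apply: filter_forall_lt => j hj.
  have [c1 c2] := h i j hi hj.
  have h1 := proj1 (contRP _ _) (c1 u) _ he2.
  have h2 := proj1 (contRP _ _) (c2 u) _ he2.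
  apply: locally_imp (locally_and _ _ _ h1 h2) => y [].
  move: (ent N (f y) i j) (ent N (f u) i j) => [p q] [p' q'] /= k1 k2.
  rewrite -[(_ - _)%C]/((p + - p', q + - q') : C).
  have -> : ((p + - p', q + - q') : C) = (RtoC (p - p') + Ci * RtoC (q - q'))%C.
    by apply: injective_projections; rewrite /RtoC /Ci /Cplus /Cmult /=; eqR; ring.
  apply: Rle_lt_trans (Cmod_triangle _ _) _; rewrite Cmod_mult !Cmod_R.
  have -> : Cmod Ci = 1 by rewrite /Cmod /= (_ : _ + _ = 1) ?sqrt_1 //; ring.
  rewrite Rmult_1_l; lra.
apply: locally_imp key => y hy.
rewrite -[nm _]/(mxnorm N (sub (f y) (f u))).
have he3 : 0 < eps / (INR N + 1) by lra.
apply: Rle_lt_trans (mxnorm_lt _ _ _ _ he3) _.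
  move=> i j hi hj; have := hy i hi j hj.
  by rewrite -[sub (f y) (f u)]/(mxplus N (f y) (mxopp N (f u))) !ent_mk.
have hN := pos_INR N.
apply: Rlt_le_trans (_ : (INR N + 1) * (eps / (INR N + 1)) <= _); first by apply: Rmult_lt_compat_r => //; lra.
by apply: Req_le; field; lra.
Qed.

End Entries.

(** * Lower left blocks *)

Section Blocks.
Variable N : nat.
Notation M := (mx_alg N).
Implicit Types x y : M.

Lemma ent_add x y i j : (i < N)%nat -> (j < N)%nat -> ent N (add x y) i j = (ent N x i j + ent N y i j)%C.
Proof. exact: ent_mk. Qed.
Lemma ent_neg x i j : (i < N)%nat -> (j < N)%nat -> ent N (neg x) i j = (- ent N x i j)%C.
Proof. exact: ent_mk. Qed.
Lemma ent_sub x y i j : (i < N)%nat -> (j < N)%nat -> ent N (sub x y) i j = (ent N x i j - ent N y i j)%C.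
Proof. by move=> hi hj; rewrite -[sub x y]/(add x (neg y)) ent_add // ent_neg. Qed.
Lemma ent_rs r x i j : (i < N)%nat -> (j < N)%nat -> ent N (rs r x) i j = (RtoC r * ent N x i j)%C.
Proof. exact: ent_mk. Qed.
Lemma ent_nul i j : (i < N)%nat -> (j < N)%nat -> ent N (nul : M) i j = 0%C.
Proof. exact: ent_mk. Qed.
Lemma ent_mul x y i j : (i < N)%nat -> (j < N)%nat -> ent N (mul x y) i j = mmul N (ent N x) (ent N y) i j.
Proof. exact: ent_mk. Qed.
Lemma ent_csmul z x i j : (i < N)%nat -> (j < N)%nat -> ent N (mul (cs z) x) i j = (z * ent N x i j)%C.
Proof. exact: mxcs_mul. Qed.
Lemma ent_adj x i j : (i < N)%nat -> (j < N)%nat -> ent N (adj x) i j = Cconj (ent N x j i).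
Proof. exact: ent_mk. Qed.
Lemma ent_one i j : (i < N)%nat -> (j < N)%nat -> ent N (one : M) i j = idm i j.
Proof. exact: ent_mk. Qed.

End Blocks.

Lemma if_ltb {T : Type} i n (x y : T) : (i < n)%nat -> (if (i <? n)%nat then x else y) = x.
Proof. by move/Nat.ltb_lt => ->. Qed.
Lemma if_geb {T : Type} i n (x y : T) : (n <= i)%nat -> (if (i <? n)%nat then x else y) = y.
Proof. by move/Nat.ltb_ge => ->. Qed.

Section LowerLeft.
Variables m1 m2 : nat.
Notation N := (m1 + m2)%nat.
Notation M := (mx_alg N).

(* An m2 x m1 matrix is embedded as the lower left block of an (m1 + m2) x (m1 + m2) matrix. *)
Definition low (f : Mat) : M := mk N (fun i j => if (i <? m1)%nat then RtoC 0 else if (j <? m1)%nat then f (i - m1)%nat j else 0%C).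
Definition Pi1 : M := mk N (fun i j => if (i <? m1)%nat then idm i j else 0%C).
Definition blk (x : M) : Mat := fun i j => ent N x (m1 + i)%nat j.

Lemma ent_low f i j : (i < m2)%nat -> (j < m1)%nat -> blk (low f) i j = f i j.
Proof.
move=> hi hj; rewrite /blk ent_mk; [|lia|lia].
by rewrite if_geb ?if_ltb; [congr f; lia | lia | lia].
Qed.
Lemma ent_low_up f i j : (i < m1)%nat -> (j < N)%nat -> ent N (low f) i j = 0%C.
Proof. by move=> hi hj; rewrite ent_mk ?if_ltb //; lia. Qed.
Lemma ent_low_right f i j : (i < N)%nat -> (m1 <= j < N)%nat -> ent N (low f) i j = 0%C.
Proof. by move=> hi hj; rewrite ent_mk; [rewrite (if_geb j); [case: Nat.ltb | lia] | lia | lia]. Qed.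

Lemma ent_mul_Pi (x : M) i j : (i < N)%nat -> (j < N)%nat -> ent N (mul x Pi1) i j = if (j <? m1)%nat then ent N x i j else 0%C.
Proof.
move=> hi hj; rewrite ent_mul // /mmul.
rewrite (csum_ext _ _ (fun k => if Nat.eqb j k then (if (j <? m1)%nat then ent N x i k else 0) else 0)%C).
  exact: (csum_delta N j (fun k => if (j <? m1)%nat then ent N x i k else 0)%C hj).
move=> k hk; rewrite ent_mk // /idm Nat.eqb_sym.
by case: (Nat.eqb_spec j k) => [->|h]; case: Nat.ltb; ring.
Qed.
Lemma ent_Pi_mul (x : M) i j : (i < N)%nat -> (j < N)%nat -> ent N (mul Pi1 x) i j = if (i <? m1)%nat then ent N x i j else 0%C.
Proof.
move=> hi hj; rewrite ent_mul // /mmul.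
rewrite (csum_ext _ _ (fun k => if Nat.eqb i k then (if (i <? m1)%nat then ent N x k j else 0) else 0)%C).
  exact: (csum_delta N i (fun k => if (i <? m1)%nat then ent N x k j else 0)%C hi).
move=> k hk; rewrite ent_mk // /idm.
by case: (Nat.eqb_spec i k) => [->|h]; case: Nat.ltb; ring.
Qed.

Lemma Pi1_Pi1 : mul Pi1 Pi1 = Pi1.
Proof. by apply: mx_ext => i j hi hj; rewrite ent_Pi_mul // ent_mk //; case: Nat.ltb. Qed.
Lemma adj_Pi1 : adj Pi1 = Pi1.
Proof.
apply: mx_ext => i j hi hj; rewrite ent_adj // !ent_mk // /idm Nat.eqb_sym.
have c0 : Cconj 0%C = 0%C by rewrite /Cconj /= Ropp_0.
have c1 : Cconj 1%C = 1%C by rewrite /Cconj /= Ropp_0.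
by case: (Nat.eqb_spec i j) => [->|_]; case: Nat.ltb; case: Nat.ltb => //.
Qed.

(** Vanishing outside the lower left block, expressed algebraically so that the sections over an
    abstract star-algebra can use it with any projection. *)
Definition supp (x : M) : Prop := mul x Pi1 = x /\ mul Pi1 x = nul.

Lemma supp_ext x y : supp x -> supp y -> (forall i j, (i < m2)%nat -> (j < m1)%nat -> blk x i j = blk y i j) -> x = y.
Proof.
move=> [x1 x2] [y1 y2] h; apply: mx_ext => i j hi hj.
have e z : mul z Pi1 = z -> (m1 <= j)%nat -> ent N z i j = RtoC 0 by move=> <- q; rewrite ent_mul_Pi // if_geb.
have e' z : mul Pi1 z = nul -> (i < m1)%nat -> ent N z i j = 0%C.
  by move=> q1 q2; have := ent_Pi_mul z i j hi hj; rewrite q1 ent_nul // if_ltb.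
case: (Nat.lt_ge_cases j m1) => hj1; last by rewrite !e.
case: (Nat.lt_ge_cases i m1) => hi1; first by rewrite !e'.
by have := h (i - m1)%nat j ltac:(lia) hj1; rewrite /blk; have -> : (m1 + (i - m1) = i)%nat by lia.
Qed.
Lemma supp_up x i j : supp x -> (i < m1)%nat -> (j < N)%nat -> ent N x i j = 0%C.
Proof.
by move=> [_ h] hi hj; have := ent_Pi_mul x i j ltac:(lia) hj; rewrite h ent_nul ?if_ltb //; lia.
Qed.
Lemma supp_right x i j : supp x -> (i < N)%nat -> (m1 <= j < N)%nat -> ent N x i j = 0%C.
Proof. by move=> [<- _] hi hj; rewrite ent_mul_Pi ?if_geb //; lia. Qed.

Lemma supp_low f : supp (low f).
Proof.
split; apply: mx_ext => i j hi hj.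
  rewrite ent_mul_Pi //; case: Nat.ltb_spec => // h; by rewrite ent_low_right.
by rewrite ent_Pi_mul // ent_nul //; case: Nat.ltb_spec => // h; exact: ent_low_up.
Qed.
Lemma supp_add x y : supp x -> supp y -> supp (add x y).
Proof. by move=> [h1 h2] [h3 h4]; split; rewrite ?mul_add_l ?mul_add_r ?h1 ?h2 ?h3 ?h4 //; vec. Qed.
Lemma supp_RInt f a b : cont f -> (forall t, supp (f t)) -> supp (RInt f a b).
Proof.
move=> cf h; split.
  by rewrite -RInt_cmul //; apply: RInt_ext => t _; case: (h t).
rewrite -RInt_mulc // (RInt_ext _ (fun _ => nul)); first by rewrite RInt_cst; vec.
by move=> t _; case: (h t).
Qed.

Lemma cont_low (f : R -> Mat) : (forall i j, (i < m2)%nat -> (j < m1)%nat -> contC (fun x => f x i j)) -> cont (fun x => low (f x)).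
Proof.
move=> h; apply: cont_mx => i j hi hj.
case: (Nat.lt_ge_cases j m1) => hj1; last first.
  by split; apply: (cont_ext (fun _ => 0)) => [u|]; try exact: cont_const; rewrite ent_low_right.
case: (Nat.lt_ge_cases i m1) => hi1.
  by split; apply: (cont_ext (fun _ => 0)) => [u|]; try exact: cont_const; rewrite ent_low_up.
have e u : f u (i - m1)%nat j = ent N (low (f u)) i j.
  by rewrite ent_mk // if_geb // if_ltb.
have [c1 c2] := h (i - m1)%nat j ltac:(lia) hj1.
by split; [exact: (cont_ext _ _ (fun u => f_equal Re (e u)) c1) | exact: (cont_ext _ _ (fun u => f_equal Im (e u)) c2)].
Qed.

(** The derivative is continued to negative arguments by its value at 0 and then integrated, so the
    extension is C^1 on the whole line, affine on the left, and stays in the block. *)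
Lemma C1_lift (F : R -> Mat) : C1_half_mat m2 m1 F ->
  exists a a' : R -> M, cont a /\ cont a' /\ (forall x, is_derive a x (a' x)) /\ (forall x, supp (a x)) /\
    forall x, 0 <= x -> a x = low (F x).
Proof.
move=> hF.
pose Fd x : Mat := fun i j => epsilon (inhabits (fun _ => RtoC 0)) (has_C1_deriv_half (fun x => F x i j)) (Rmax 0 x).
have hd i j : (i < m2)%nat -> (j < m1)%nat ->
    has_C1_deriv_half (fun x => F x i j) (epsilon (inhabits (fun _ => RtoC 0)) (has_C1_deriv_half (fun x => F x i j))).
  by move=> hi hj; apply: (epsilon_spec _ (has_C1_deriv_half (fun x => F x i j))); exact: hF.
pose a' x := low (Fd x).
have ca' : cont a' by apply: cont_low => i j hi hj; apply: cont_half_clamp; exact: (proj1 (hd i j hi hj)).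
pose a x := add (low (F 0)) (RInt a' 0 x).
have ca : cont a by rewrite /a; cts.
have sa x : supp (a x).
  by apply: supp_add; [exact: supp_low | apply: supp_RInt => // t; exact: supp_low].
exists a, a'; split => //; split => //; split; last split => //.
  move=> x; have -> : a' x = add nul (a' x) by vec.
  by apply: D_add; [exact: D_const | exact: deriv_RInt].
move=> x hx; apply: supp_ext => [//||i j hi hj]; first exact: supp_low.
rewrite ent_low // /blk ent_add; [|lia|lia].
rewrite -[ent N (low _) _ _]/(blk (low (F 0)) i j) ent_low // ent_RInt //; [|lia|lia].
have [_ h] := hd i j hi hj; rewrite (h x hx); congr (_ + _)%C.
apply: CRInt_ext => t; rewrite Rmin_left // Rmax_right // => ht.
rewrite -[ent N _ _ _]/(blk (a' t) i j) /a' ent_low // /Fd Rmax_right //; lra.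
Qed.

Lemma has_C1_ent (f f' : R -> M) i j : cont f' -> (forall x, is_derive f x (f' x)) -> (i < N)%nat -> (j < N)%nat ->
  has_C1_deriv_half (fun x => ent N (f x) i j) (fun x => ent N (f' x) i j).
Proof.
move=> cf df hi hj; split.
  by apply: (cont_half_of _ (fun x => ent N (f' x) i j)) => //; exact: contC_ent.
move=> x hx; rewrite -ent_RInt // (FTC' f f' 0 x df cf).
exact: ent_add.
Qed.

Lemma CRInt_nconj (f : R -> C) a b : contC f -> CRInt (fun t => - Ci * Cconj (f t))%C a b = (- Ci * Cconj (CRInt f a b))%C.
Proof.
move=> [c1 c2].
have e1 t : - Im (f t) = Re (- Ci * Cconj (f t))%C by case: (f t) => p q /=; ring.
have e2 t : - Re (f t) = Im (- Ci * Cconj (f t))%C by case: (f t) => p q /=; ring.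
rewrite !CRInt_pair //; last first.
  by split; [apply: (cont_ext _ _ e1) | apply: (cont_ext _ _ e2)]; apply: cont_Ropp.
rewrite -(RInt_ext (V := R_CompleteNormedModule) _ _ a b (fun t _ => e1 t)) -(RInt_ext (V := R_CompleteNormedModule) _ _ a b (fun t _ => e2 t)).
have o g : cont g -> RInt (fun t => - g t) a b = - RInt g a b.
  by move=> cg; apply: (RInt_opp (V := R_CompleteNormedModule) g); exact: exR.
rewrite !o //; apply: injective_projections; rewrite /Ci /Cconj /Cmult /Copp /=; eqR; ring.
Qed.

Lemma C1_nconj f : C1_half f -> C1_half (fun x => - Ci * Cconj (f x))%C.
Proof.
move=> [f' [h1 h2]]; exists (fun x => - Ci * Cconj (f' x))%C; split.
  have [c1 c2] := cont_half_clamp _ h1.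
  apply: (cont_half_of _ (fun x => - Ci * Cconj (f' (Rmax 0 x)))%C); last by move=> x hx; rewrite Rmax_right.
  have e1 t : - Im (f' (Rmax 0 t)) = Re (- Ci * Cconj (f' (Rmax 0 t)))%C by case: (f' _) => p q /=; ring.
  have e2 t : - Re (f' (Rmax 0 t)) = Im (- Ci * Cconj (f' (Rmax 0 t)))%C by case: (f' _) => p q /=; ring.
  by split; [apply: (cont_ext _ _ e1) | apply: (cont_ext _ _ e2)]; apply: cont_Ropp.
move=> x hx; rewrite h2 //.
rewrite (CRInt_ext (fun t => - Ci * Cconj (f' t))%C (fun t => - Ci * Cconj (f' (Rmax 0 t)))%C); last first.
  by move=> t; rewrite Rmin_left // Rmax_right // => ht; rewrite Rmax_right //; lra.
rewrite (CRInt_ext f' (fun t => f' (Rmax 0 t))); last first.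
  by move=> t; rewrite Rmin_left // Rmax_right // => ht; rewrite Rmax_right //; lra.
rewrite CRInt_nconj; last exact: cont_half_clamp.
by rewrite Cplus_conj; ring.
Qed.

End LowerLeft.

(** * The A-function of a potential *)

(** Existence alone says nothing about the block structure of A. Compression to the block maps the
    quadratic term to the quadratic term of the compressed function, because a^* only connects the
    complementary ranges; so it yields a solution with the same boundary values, without uniqueness
    on the whole plane. *)
Lemma flow_compress {M : star_alg} (Pi : M) (a : R -> M) A B : flow a A B -> mul Pi Pi = Pi -> adj Pi = Pi ->
  (forall x, mul (a x) Pi = a x) -> (forall x, mul Pi (a x) = nul) ->
  exists A' B', flow a A' B' /\ (forall x l, mul (A' x l) Pi = A' x l /\ mul Pi (A' x l) = nul).
Proof.
move=> [ca cA cB A0 Ax Al] PP Pa h1 h2.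
pose c x := mul (sub one Pi) (mul x Pi).
have cP x : mul (c x) Pi = c x by rewrite /c !mulA PP.
have Pc x : mul Pi (c x) = nul by rewrite /c -mulA mul_sub_r PP mul1r (_ : sub Pi Pi = nul) ?mul_nul_l //; vec.
have ca_ x : c (a x) = a x.
  by rewrite /c h1 mul_sub_l mul1l h2; vec.
have dc f (x : R) (d : M) : is_derive f x d -> is_derive (fun x => c (f x)) x (c d).
  by move=> hf; apply: D_mulc; apply: D_cmul.
exists (fun x l => c (A x l)), (fun x l => c (B x l)); split; last by move=> x l; split.
split => //.
- by rewrite /c; cts.
- by rewrite /c; cts.
- by move=> l; rewrite A0.
- by move=> x l; apply: dc.
move=> x l.
have -> : add (c (B x l)) (Qf a (fun x l => c (A x l)) x l) = c (add (B x l) (Qf a A x l)).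
  have -> : Qf a (fun x l => c (A x l)) x l = c (Qf a A x l).
    rewrite /Qf /c -cv_mul_r; try by cts.
    rewrite -cv_mul_l; try by cts.
    rewrite /cv; apply: RInt_ext => t _.
    have e1 z : mul Pi (mul (adj (a l)) z) = mul (adj (a l)) z by rewrite -mulA -{1}Pa -adj_mul h1.
    have e2 z : mul (adj (a l)) (mul (sub one Pi) z) = mul (adj (a l)) z.
      rewrite mul_sub_l mul1l mul_sub_r -(mulA _ (adj (a l)) Pi) -{1}Pa -adj_mul h2 adj_nul mul_nul_l; by vec.
    by rewrite !mulA e1 e2.
  by rewrite /c; dist; vec.
exact: dc.
Qed.

Section AFunction.
Variables m1 m2 : nat.
Notation N := (m1 + m2)%nat.
Notation M := (mx_alg N).
Notation Pi := (Pi1 m1 m2).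
Variables (v : R -> Mat) (a : R -> M) (A B : R -> R -> M).
Hypothesis fl : flow a A B.
Hypothesis sA : forall x l, supp m1 m2 (A x l).
Hypothesis av : forall x i j, 0 <= x -> (i < m2)%nat -> (j < m1)%nat -> blk m1 m2 (a x) i j = (- Ci * Cconj (v x j i))%C.

Let ca : cont a := fl_a _ _ _ fl.
Let sa x : supp m1 m2 (a x).
Proof. by rewrite -(fl_0 _ _ _ fl). Qed.
Let aPi x : mul (a x) Pi = a x := proj1 (sa x).
Let Pia x : mul Pi (a x) = nul := proj2 (sa x).

Lemma dirac_coefE z t : 0 <= t ->
  add (mul (cs (Ci * z)%C) (sub (rs 2 Pi) one)) (add (a t) (adj (a t))) = (mk N (dirac_coef m1 v z t) : M).
Proof.
move=> ht; apply: mx_ext => i j hi hj; rewrite [RHS]ent_mk // !ent_add // ent_csmul // ent_sub // ent_rs // ent_one // ent_adj //.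
have c0 : Cconj 0%C = 0%C by rewrite /Cconj /= Ropp_0.
have low i' j' : (m1 <= i' < N)%nat -> (j' < m1)%nat -> ent N (a t) i' j' = (- Ci * Cconj (v t j' (i' - m1)%nat))%C.
  by move=> h1 h2; rewrite -av //; [rewrite /blk; congr ent; lia | lia].
rewrite /Pi1 ent_mk // /dirac_coef /idm.
case: (Nat.ltb_spec i m1) => hi1; case: (Nat.ltb_spec j m1) => hj1.
- rewrite !(supp_up _ _ _ _ _ (sa t)) // c0; case: Nat.eqb; rewrite ?RtoC_minus; ring.
- rewrite (supp_up _ _ _ i j (sa t)) // low; [|lia|lia].
  case: (Nat.eqb_spec i j) => h; first lia.
  by rewrite Cmult_conj Cconj_conj /Cconj /=; apply: injective_projections => /=; eqR; ring.
- rewrite (supp_up _ _ _ j i (sa t)) // low // c0; case: (Nat.eqb_spec i j) => h; first lia.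
  ring.
- rewrite (supp_right _ _ _ i j (sa t)) ?(supp_right _ _ _ j i (sa t)) //; try lia.
  rewrite c0; case: Nat.eqb; ring.
Qed.

Lemma diracE z t (y : M) : 0 <= t -> dirac a Pi (Ci * z)%C t y = mul (mk N (dirac_coef m1 v z t) : M) y.
Proof.
move=> ht; rewrite -dirac_coefE // /dirac !mul_add_l mulA mul_sub_l mul_rs_l mul1l.
done.
Qed.

Lemma fund_sol_extend l z u : 0 <= l -> fund_sol m1 m2 v l z u -> exists U : R -> M,
  cont U /\ (forall x, 0 <= x -> is_derive U x (dirac a Pi (Ci * z)%C x (U x))) /\
  (forall x i j, 0 <= x -> (i < N)%nat -> (j < N)%nat -> ent N (U x) i j = u x i j) /\ U l = one.
Proof.
move=> hl hu.
pose U0 x : M := mk N (u (Rmax 0 x)).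
have cU0 : cont U0.
  apply: cont_mx => i j hi hj.
  have [c1 c2] := cont_half_clamp _ (proj1 (hu i j hi hj)).
  by split; [apply: (cont_ext _ _ _ c1) | apply: (cont_ext _ _ _ c2)] => x; rewrite ent_mk.
pose G x := dirac a Pi (Ci * z)%C x (U0 x).
have cG : cont G by rewrite /G /dirac; cts.
pose U x := add one (RInt G l x).
have cU : cont U by rewrite /U; cts.
have e x : 0 <= x -> U x = U0 x.
  move=> hx; apply: mx_ext => i j hi hj; rewrite ent_add // ent_one // ent_RInt // ent_mk // Rmax_right //.
  have [_ h] := hu i j hi hj; rewrite (h x hx); congr (_ + _)%C; apply: CRInt_ext => t ht.
  have t0 : 0 <= t by have := Rmin_glb l x 0 hl hx; lra.
  rewrite /G diracE // ent_mul // /mmul; apply: csum_ext => k hk.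
  by rewrite ent_mk // ent_mk // Rmax_right.
exists U; split => //; split; last split.
- move=> x hx; rewrite e //.
  rewrite -[dirac _ _ _ _ _]/(G x); have -> : G x = add nul (G x) by vec.
  by apply: D_add; [exact: D_const | exact: deriv_RInt].
- by move=> x i j hx hi hj; rewrite e // ent_mk // Rmax_right.
- by rewrite /U RInt_nul; vec.
Qed.

Lemma Cmod_sq (z : C) : Cmod z ^ 2 = Re z ^ 2 + Im z ^ 2.
Proof. by rewrite /Cmod pow2_sqrt //; have := pow2_ge_0 (Re z); have := pow2_ge_0 (Im z); rewrite /Re /Im; lra. Qed.

Lemma cont_Cmod_sq (g : R -> C) : contC g -> cont (fun x => Cmod (g x) ^ 2).
Proof.
move=> [c1 c2]; apply: (cont_ext (fun x => Re (g x) ^ 2 + Im (g x) ^ 2)) => [u|]; first by rewrite Cmod_sq.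
by cts.
Qed.

Definition phz (l : R) (z : C) : M := phL A (Ci * z + Ci * z)%C l.

Lemma Re_iz (z : C) : Re (Ci * z)%C = - (2 * Im z / 2).
Proof. by case: z => p q /=; field. Qed.
Lemma Re_lamz (z : C) : Re (Ci * z + Ci * z)%C = - (2 * Im z).
Proof. by case: z => p q /=; ring. Qed.

Lemma supp_phz l z : 0 < Im z -> supp m1 m2 (phz l z).
Proof.
move=> hz; apply: (phL_support a A B fl Pi _ (2 * Im z)); first lra.
- by rewrite Re_lamz; lra.
- by move=> x l'; case: (sA x l').
- by move=> x l'; case: (sA x l').
Qed.

(** The first m1 columns of the product of [U] with [Pi] + phi are those of u [I; phi], so [weyl_L2]
    with r = 2 Im z applies and Frobenius norms dominate entries. *)
Lemma weyl_solution_L2 l z u i j : 0 <= l -> 0 < Im z -> fund_sol m1 m2 v l z u -> (i < N)%nat -> (j < m1)%nat ->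
  L2_from l (fun x => mmul N (u x) (stack_I m1 (blk m1 m2 (phz l z))) i j).
Proof.
move=> hl hz hu hi hj.
have [U [cU [dU [eU Ul]]]] := fund_sol_extend l z u hl hu.
pose W : M := add Pi (phz l z).
pose Y x := mul (U x) W.
have cY : cont Y by rewrite /Y; cts.
have dY x : l <= x -> is_derive Y x (dirac a Pi (Ci * z)%C x (Y x)).
  move=> hx; have -> : dirac a Pi (Ci * z)%C x (Y x) = mul (dirac a Pi (Ci * z)%C x (U x)) W.
    by rewrite !diracE; [rewrite mulA | lra | lra].
  by apply: D_cmul; apply: dU; lra.
have r0 : 0 < 2 * Im z by lra.
have sp := supp_phz l z hz.
have hj' : (j < N)%nat by lia.
have e x : 0 <= x -> mmul N (u x) (stack_I m1 (blk m1 m2 (phz l z))) i j = ent N (Y x) i j.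
  move=> hx; rewrite ent_mul //; apply: csum_ext => k hk; rewrite eU // ent_add // [ent N Pi k j]ent_mk // /stack_I.
  case: (Nat.ltb_spec k m1) => hk1; first by rewrite (supp_up _ _ _ k j sp) //; ring.
  have -> : blk m1 m2 (phz l z) (k - m1)%nat j = ent N (phz l z) k j by rewrite /blk; congr ent; lia.
  ring.
have Yl : Y l = add Pi (phL A (Ci * z + Ci * z)%C l) by rewrite /Y Ul mul1l.
have h := weyl_L2 a Pi (Ci * z)%C (2 * Im z) ca (Pi1_Pi1 m1 m2) (adj_Pi1 m1 m2) aPi Pia r0 (Re_iz z) Y l cY dY A B fl Yl (proj1 sp) (proj2 sp).
exists (nm Pi ^ 2 / (2 * Im z)) => T hT.
have h1 := h T hT.
apply: Rle_trans (_ : RInt (fun x => nm (Y x) ^ 2) l T <= _).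
  have cE := contC_ent N Y i j cY hi hj'.
  rewrite (RInt_ext _ (fun x => Cmod (ent N (Y x) i j) ^ 2)); last first.
    by move=> x; rewrite Rmin_left // => hx; rewrite e //; lra.
  apply: RInt_Rle => //; first exact: cont_Cmod_sq.
    by cts.
  move=> x _; apply: pow_incr; split; [exact: Cmod_ge_0 | exact: mxnorm_ent].
apply: (Rmult_le_reg_l (2 * Im z)) => //.
by have -> : 2 * Im z * (nm Pi ^ 2 / (2 * Im z)) = nm Pi ^ 2 by field; lra.
Qed.

End AFunction.

Lemma is_derive_C_quad (f : C -> C) (z d : C) K rho : 0 < rho -> 0 <= K ->
  (forall h : C, Cmod h <= rho -> Cmod (f (z + h) - f z - h * d)%C <= K * Cmod h ^ 2) ->
  @is_derive C_AbsRing C_NormedModule f z d.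
Proof.
move=> hr hK H; split; first exact: (is_linear_scal_l (K := C_AbsRing) (V := C_NormedModule)).
move=> y /is_filter_lim_locally_unique <- eps.
have he := cond_pos eps.
have d0 : 0 < Rmin rho (eps / (K + 1)) by apply: Rmin_pos => //; apply: Rdiv_lt_0_compat; lra.
exists (mkposreal _ d0) => w hw.
have hw' : Cmod (w - z)%C < Rmin rho (eps / (K + 1)) by [].
have m1 := Rmin_l rho (eps / (K + 1)); have m2 := Rmin_r rho (eps / (K + 1)).
have h := H (w - z)%C ltac:(lra).
have e : (z + (w - z))%C = w by ring.
rewrite e in h.
have g : Cmod (f w - f z - (w - z) * d)%C <= eps * Cmod (w - z)%C.
  apply: Rle_trans h _; have c0 := Cmod_ge_0 (w - z)%C.
  rewrite /= Rmult_1_r -Rmult_assoc; apply: Rmult_le_compat_r => //.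
  apply: Rle_trans (_ : (K + 1) * (eps / (K + 1)) <= _); last by apply: Req_le; field; lra.
  by apply: Rmult_le_compat; lra.
exact: g.
Qed.

Lemma is_CRInt_pinfty_of (f : R -> C) (I : C) : contC f ->
  (forall eps, 0 < eps -> exists X0, forall X, X0 <= X -> Cmod (CRInt f 0 X - I)%C < eps) -> is_CRInt_pinfty f 0 I.
Proof.
move=> cf H P [eps hP].
have [X0 hX] := H eps (cond_pos eps).
exists (fun x => x = 0) (fun x => X0 < x); first by [].
  by exists X0.
move=> x y -> hy; exists (CRInt f 0 y); split => /=.
  apply: (RInt_correct (V := C_R_CompleteNormedModule)).
  have [c1 c2] := cf.
  eexists; apply: (is_RInt_fct_extend_pair (U := R_NormedModule) (V := R_NormedModule)); apply: (RInt_correct (V := R_CompleteNormedModule)); exact: exR.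
apply: hP; apply: (@norm_compat1 R_AbsRing C_R_NormedModule); rewrite -Cmod_norm; apply: hX; lra.
Qed.

Lemma is_CRInt_pinfty_lim (f : R -> C) (I : C) : is_CRInt_pinfty f 0 I ->
  forall eps, 0 < eps -> exists X0, forall X, X0 <= X -> Cmod (CRInt f 0 X - I)%C < eps.
Proof.
move=> H eps he.
have nf := @norm_factor_gt_0 R_AbsRing C_R_NormedModule.
pose e' := mkposreal _ (Rdiv_lt_0_compat _ _ he nf).
have [Q R hQ [X0 hX0] hQR] := H _ (@locally_ball C_R_NormedModule I e').
exists (X0 + 1) => X hX.
have [y [hy1 hy2]] := hQR 0 X hQ (hX0 X ltac:(lra)).
have -> : CRInt f 0 X = y by apply: (is_RInt_unique (V := C_R_CompleteNormedModule)).
have := @norm_compat2 R_AbsRing C_R_NormedModule _ _ _ hy2; rewrite -Cmod_norm => h2.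
apply: Rlt_le_trans h2 _; apply: Req_le; rewrite /e' /=; field; lra.
Qed.

(** * Entries of the Weyl function: holomorphy and Laplace representation *)

Section Holomorphic.
Variables m1 m2 : nat.
Notation N := (m1 + m2)%nat.
Notation M := (mx_alg N).
Variables (a : R -> M) (A B : R -> R -> M).
Hypothesis fl : flow a A B.

Lemma nm_ent (x : M) i j : (i < N)%nat -> (j < N)%nat -> Cmod (ent N x i j) <= nm x.
Proof. exact: mxnorm_ent. Qed.

Lemma ent_phz l z i j : (i < N)%nat -> (j < N)%nat ->
  ent N (phz m1 m2 A l z) i j = (4 * z * z * ent N (chiL A (Ci * z + Ci * z)%C l) i j)%C.
Proof.
move=> hi hj; rewrite /phz /phL ent_neg // ent_csmul //.
have -> : ((Ci * z + Ci * z) * (Ci * z + Ci * z))%C = (- (4 * z * z))%C.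
  by apply: injective_projections; rewrite /Ci /Cplus /Cmult /Copp /RtoC /=; eqR; ring.
ring.
Qed.

Lemma phz_holo l z i j : 0 < Im z -> (i < N)%nat -> (j < N)%nat ->
  exists d : C, @is_derive C_AbsRing C_NormedModule (fun w => ent N (phz m1 m2 A l w) i j) z d.
Proof.
move=> hz hi hj.
have r0 : 0 < 2 * Im z by lra.
have [d [K [K0 hK]]] := chiL_holo a A B fl (Ci * z + Ci * z)%C (2 * Im z) l r0 (Re_lamz z).
pose c w := ent N (chiL A (Ci * w + Ci * w)%C l) i j.
pose D := ((Ci + Ci) * ent N d i j)%C.
have est h : Cmod h <= Im z / 2 -> Cmod (c (z + h)%C - c z - h * D)%C <= 4 * K * Cmod h ^ 2.
  move=> hh.
  have c2i : Cmod (Ci + Ci)%C = 2.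
    have -> : (Ci + Ci)%C = (0, 2) by apply: injective_projections; rewrite /=; eqR; ring.
    rewrite /Cmod /= (_ : _ + _ = 2 * 2); last by ring.
    by rewrite sqrt_square; lra.
  have c2h : Cmod ((Ci + Ci) * h)%C = 2 * Cmod h by rewrite Cmod_mult c2i.
  have h1 := hK ((Ci + Ci) * h)%C ltac:(rewrite c2h; lra).
  rewrite c2h in h1.
  have e : (Ci * z + Ci * z + (Ci + Ci) * h)%C = (Ci * (z + h) + Ci * (z + h))%C by ring.
  rewrite e in h1.
  apply: Rle_trans (_ : Cmod (ent N (sub (sub (chiL A (Ci * (z + h) + Ci * (z + h))%C l) (chiL A (Ci * z + Ci * z)%C l))
     (mul (cs ((Ci + Ci) * h)%C) d)) i j) <= _).
    by rewrite !ent_sub // ent_csmul //; apply: Req_le; congr Cmod; rewrite /c /D; ring.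
  apply: Rle_trans (nm_ent _ _ _ hi hj) (Rle_trans _ _ _ h1 _).
  by apply: Req_le; ring.
have ew w : ent N (phz m1 m2 A l w) i j = (4 * w * w * c w)%C by exact: ent_phz.
rewrite (functional_extensionality _ _ ew).
clearbody c D; clear ew hK.
exists (8 * z * c z + 4 * z * z * D)%C.
pose rho := Im z / 2.
have rho0 : 0 < rho by rewrite /rho; lra.
have cz := Cmod_ge_0 z; have cD := Cmod_ge_0 D; have cc := Cmod_ge_0 (c z).
pose K' := 4 * (Cmod z + rho) ^ 2 * (4 * K) + (4 * Cmod (c z) + 8 * Cmod z * Cmod D + 4 * rho * Cmod D).
have q0 : 0 <= 4 * (Cmod z + rho) ^ 2 by have := pow2_ge_0 (Cmod z + rho); lra.
have K'0 : 0 <= K'.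
  have q1 : 0 <= 4 * (Cmod z + rho) ^ 2 * (4 * K) by apply: Rmult_le_pos; lra.
  have q2 : 0 <= Cmod z * Cmod D by apply: Rmult_le_pos.
  have q3 : 0 <= rho * Cmod D by apply: Rmult_le_pos; lra.
  rewrite /K'; lra.
apply: (is_derive_C_quad _ _ _ K' rho) => // h hh.
set E := (c (z + h)%C - c z - h * D)%C.
have -> : (4 * (z + h) * (z + h) * c (z + h)%C - 4 * z * z * c z - h * (8 * z * c z + 4 * z * z * D))%C =
   (4 * ((z + h) * (z + h)) * E + h * h * (4 * c z + 8 * z * D + 4 * h * D))%C by rewrite /E; ring.
have ch := Cmod_ge_0 h.
have hE : Cmod E <= 4 * K * Cmod h ^ 2 by apply: est.
have h4 : Cmod 4 = 4 by rewrite Cmod_R Rabs_pos_eq; lra.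
have h8 : Cmod 8 = 8 by rewrite Cmod_R Rabs_pos_eq; lra.
apply: Rle_trans (Cmod_triangle _ _) _; rewrite !Cmod_mult h4.
have t1 : Cmod (z + h)%C <= Cmod z + rho by apply: Rle_trans (Cmod_triangle _ _) _; lra.
have t2 : Cmod (4 * c z + 8 * z * D + 4 * h * D)%C <= 4 * Cmod (c z) + 8 * Cmod z * Cmod D + 4 * rho * Cmod D.
  apply: Rle_trans (Cmod_triangle _ _) _.
  apply: Rle_trans (Rplus_le_compat_r _ _ _ (Cmod_triangle _ _)) _.
  rewrite !Cmod_mult h4 h8; have : Cmod h * Cmod D <= rho * Cmod D by apply: Rmult_le_compat_r.
  lra.
have t3 : Cmod (z + h)%C * Cmod (z + h)%C <= (Cmod z + rho) ^ 2.
  rewrite /= Rmult_1_r; apply: Rmult_le_compat => //; exact: Cmod_ge_0.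
have t4 : 4 * (Cmod (z + h)%C * Cmod (z + h)%C) * Cmod E <= 4 * (Cmod z + rho) ^ 2 * (4 * K * Cmod h ^ 2).
  apply: Rmult_le_compat => //; [|exact: Cmod_ge_0|lra].
  by have := Rmult_le_pos _ _ (Cmod_ge_0 (z + h)%C) (Cmod_ge_0 (z + h)%C); lra.
have t5 : Cmod h * Cmod h * Cmod (4 * c z + 8 * z * D + 4 * h * D)%C <= Cmod h * Cmod h * (4 * Cmod (c z) + 8 * Cmod z * Cmod D + 4 * rho * Cmod D).
  by apply: Rmult_le_compat_l => //; apply: Rmult_le_pos.
rewrite /K'; lra.
Qed.

Lemma phz_laplace l z i j : 0 < Im z -> (i < N)%nat -> (j < N)%nat -> exists I : C,
  is_CRInt_pinfty (fun x => (cexp (2 * Ci * RtoC x * z) * ent N (Ph1 A x l) i j)%C) 0 I /\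
  ent N (phz m1 m2 A l z) i j = (2 * Ci * z * I)%C.
Proof.
move=> hz hi hj.
have r0 : 0 < 2 * Im z by lra.
set lam := (Ci * z + Ci * z)%C.
have [K hK] := laplace_Ph1 a A B fl lam (2 * Im z) l r0 (Re_lamz z).
have [ca cA cB _ _ _] := fl.
have cP1 := c2_Ph1 a A B fl.
have el : lam = (2 * Ci * z)%C by rewrite /lam; ring.
have l0 : lam <> 0%C.
  move=> h; have := Re_lamz z; rewrite -/lam h /=; lra.
exists (ent N (phz m1 m2 A l z) i j / lam)%C; split; last by rewrite -el; field.
pose F t : M := mul (expc lam t) (Ph1 A t l).
have ce := cont_expc (M := M) lam.
have cF : cont F by rewrite /F; cts.
have eF x : (cexp (2 * Ci * RtoC x * z) * ent N (Ph1 A x l) i j)%C = ent N (F x) i j.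
  rewrite /F /expc ent_csmul //; congr (cexp _ * _)%C; rewrite el; ring.
have cE := contC_ent N F i j cF hi hj.
rewrite (functional_extensionality _ _ eF).
apply: is_CRInt_pinfty_of => // eps he.
have hl : 0 < Cmod lam by apply/Cmod_gt_0.
have [X0 [hX0 hX]] : exists X0, 0 <= X0 /\ forall X, X0 <= X -> K * exp (- (2 * Im z / 2) * X) < eps * Cmod lam.
  have hp : 0 < eps * Cmod lam by apply: Rmult_lt_0_compat.
  have K1 : 0 < Rabs K + 1 by have := Rabs_pos K; lra.
  exists (Rmax 0 (- ln (eps * Cmod lam / (Rabs K + 1)) / (2 * Im z / 2))); split; first exact: Rmax_l.
  move=> X hX; have hX' := Rle_trans _ _ _ (Rmax_r _ _) hX.
  apply: Rle_lt_trans (_ : Rabs K * exp (- (2 * Im z / 2) * X) < _).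
    by apply: Rmult_le_compat_r; [apply: Rlt_le; exact: exp_pos | exact: Rle_abs].
  have : exp (- (2 * Im z / 2) * X) <= eps * Cmod lam / (Rabs K + 1).
    rewrite -[X in _ <= X]exp_ln; last by apply: Rdiv_lt_0_compat.
    apply: exp_mono.
    have := Rmult_le_compat_l (2 * Im z / 2) _ _ ltac:(lra) hX'.
    have -> : 2 * Im z / 2 * (- ln (eps * Cmod lam / (Rabs K + 1)) / (2 * Im z / 2)) = - ln (eps * Cmod lam / (Rabs K + 1)) by field; lra.
    lra.
  move=> h; have ep := exp_pos (- (2 * Im z / 2) * X).
  apply: Rlt_le_trans (_ : (Rabs K + 1) * exp (- (2 * Im z / 2) * X) <= _); first lra.
  apply: Rle_trans (Rmult_le_compat_l _ _ _ (Rlt_le _ _ K1) h) _.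
  by apply: Req_le; field; lra.
exists X0 => X h.
have h1 := hK X ltac:(lra); have h2 := hX X h.
have h3 := nm_ent (sub (mul (cs lam) (RInt F 0 X)) (phL A lam l)) i j hi hj.
rewrite ent_sub // ent_csmul // ent_RInt // in h3.
apply: (Rmult_lt_reg_l (Cmod lam)) => //; rewrite -Cmod_mult.
have -> : (lam * (CRInt (fun t => ent N (F t) i j) 0 X - ent N (phz m1 m2 A l z) i j / lam))%C =
  (lam * CRInt (fun t => ent N (F t) i j) 0 X - ent N (phL A lam l) i j)%C by rewrite -[phz _ _ _ _ _]/(phL A lam l); field.
apply: Rle_lt_trans h3 _; rewrite (Rmult_comm (Cmod lam)).
exact: Rle_lt_trans h1 h2.
Qed.

End Holomorphic.

Lemma A_function_of_flow m1 m2 (v : R -> Mat) (a : R -> mx_alg (m1 + m2)) A B :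
  flow a A B -> (forall x l, supp m1 m2 (A x l)) ->
  (forall x i j, 0 <= x -> (i < m2)%nat -> (j < m1)%nat -> blk m1 m2 (a x) i j = (- Ci * Cconj (v x j i))%C) ->
  is_A_function m1 m2 v (fun x l => blk m1 m2 (A x l)).
Proof.
move=> fl sA av l hl.
have [ca cA cB A0 Ax Al] := fl.
exists (fun x => blk m1 m2 (Ph1 A x l)), (fun z => blk m1 m2 (phz m1 m2 A l z)); split; last split.
- split.
    by move=> i j hi hj z hz; apply: (phz_holo m1 m2 a A B fl) => //; lia.
  by move=> z hz u hu i j hi hj; apply: (weyl_solution_L2 m1 m2 v a A B fl sA av).
- move=> i j hi hj; split.
    by apply: (has_C1_ent m1 m2 (fun x => Ph1 A x l) (fun x => A x l)); [cts | move=> x; exact: (D_Ph1 a A B fl) | lia | lia].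
  exists (fun x => ent (m1 + m2) (B x l) (m1 + i)%nat j).
  by apply: (has_C1_ent m1 m2 (fun x => A x l) (fun x => B x l)); [cts | move=> x; exact: Ax | lia | lia].
- by move=> z hz i j hi hj; apply: (phz_laplace m1 m2 a A B fl) => //; lia.
Qed.

(** * Lerch's theorem *)

Definition vanishing (I : R -> R) : Prop := forall eps, 0 < eps -> exists X0, forall X, X0 <= X -> Rabs (I X) < eps.

Lemma vanishing_scal (I : R -> R) a : vanishing I -> vanishing (fun X => a * I X).
Proof.
move=> hI eps he; have pa := Rabs_pos a.
have [X0 h0] := hI (eps / (Rabs a + 1)) ltac:(apply: Rdiv_lt_0_compat; lra).
exists X0 => X hX; have k := h0 X hX; have py := Rabs_pos (I X).
rewrite Rabs_mult; apply: Rle_lt_trans (_ : (Rabs a + 1) * Rabs (I X) < _); first lra.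
have -> : eps = (Rabs a + 1) * (eps / (Rabs a + 1)) by field; lra.
by apply: Rmult_lt_compat_l => //; lra.
Qed.

Lemma vanishing_plus (I J : R -> R) : vanishing I -> vanishing J -> vanishing (fun X => I X + J X).
Proof.
move=> hI hJ eps he.
have [X0 h0] := hI (eps / 2) ltac:(lra); have [X1 h1] := hJ (eps / 2) ltac:(lra).
exists (Rmax X0 X1) => X hX.
have m0 := Rmax_l X0 X1; have m1 := Rmax_r X0 X1.
have k0 := h0 X ltac:(lra); have k1 := h1 X ltac:(lra).
have := Rabs_triang (I X) (J X); lra.
Qed.

Lemma vanishing_ext (I J : R -> R) : (forall X, 0 <= X -> I X = J X) -> vanishing I -> vanishing J.
Proof.
move=> e h eps he; have [X0 h0] := h eps he; exists (Rmax 0 X0) => X hX.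
have m0 := Rmax_l 0 X0; have m1 := Rmax_r 0 X0.
by rewrite -e; [apply: h0; lra | lra].
Qed.

Lemma vanishing_expM (f : R -> R) q B : 0 < q -> (forall X, 0 <= X -> Rabs (f X) <= B) -> vanishing (fun X => exp (- q * X) * f X).
Proof.
move=> hq hB eps he.
have B0 : 0 <= B by have := hB 0 (Rle_refl 0); have := Rabs_pos (f 0); lra.
exists (Rmax 0 ((B / eps + 1) / q)) => X hX.
have m0 := Rmax_l 0 ((B / eps + 1) / q); have m1 := Rmax_r 0 ((B / eps + 1) / q).
have hX0 : 0 <= X by lra.
rewrite Rabs_mult Rabs_pos_eq; last by apply: Rlt_le; exact: exp_pos.
have Be : 0 <= B / eps by apply: Rdiv_le_0_compat.
have h1 : B / eps + 1 <= q * X.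
  have := Rmult_le_compat_l q _ _ (Rlt_le _ _ hq) (Rle_trans _ _ _ m1 hX).
  by have -> : q * ((B / eps + 1) / q) = B / eps + 1 by field; lra.
have h2 : B / eps + 1 < exp (q * X).
  apply: Rle_lt_trans h1 _; have := exp_ineq1_le (q * X); lra.
have ep := exp_pos (q * X).
have e : exp (- q * X) = / exp (q * X) by rewrite -exp_Ropp; congr exp; ring.
rewrite e; apply: (Rmult_lt_reg_l (exp (q * X))) => //.
rewrite -Rmult_assoc Rinv_r ?Rmult_1_l; last lra.
apply: Rle_lt_trans (hB X hX0) _.
have : B < (B / eps + 1) * eps.
  have -> : (B / eps + 1) * eps = B + eps by field; lra.
  lra.
have := Rmult_lt_compat_r eps _ _ he h2; lra.
Qed.

Lemma zero_of_RInt (g : R -> R) : cont g -> (forall x, 0 <= x -> RInt g 0 x = 0) -> forall x, 0 <= x -> g x = 0.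
Proof.
move=> cg h x hx.
have h0 : Rabs (g x) <= 0.
  apply: le_epsilon => eps he; rewrite Rplus_0_l.
  have [d hd] := proj1 (contRP g x) (cg x) _ he.
  have d0 := cond_pos d.
  have e1 : RInt g x (x + d / 2) = 0.
    have := RInt_Rcat g 0 x (x + d / 2) cg; rewrite !h; lra.
  have e2 : RInt (fun t => g t - g x) x (x + d / 2) = - (d / 2 * g x).
    rewrite RInt_Rminus //; last exact: cont_const.
    by rewrite e1 RInt_Rcst; eqR; ring.
  have := norm_RInt_const (V := R_CompleteNormedModule) (fun t => g t - g x) x (x + d / 2) eps ltac:(cts).
  rewrite e2 => H.
  have : Rabs (- (d / 2 * g x)) <= Rabs (x + d / 2 - x) * eps.
    apply: H => t; rewrite Rmin_left ?Rmax_right; try lra; move=> ht.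
    apply: Rlt_le; apply: hd; rewrite /ball /= /AbsRing_ball /abs /minus /plus /opp /=; apply: Rabs_def1; lra.
  rewrite Rabs_Ropp Rabs_mult (Rabs_pos_eq (d / 2)); last lra.
  have -> : x + d / 2 - x = d / 2 by ring.
  rewrite (Rabs_pos_eq (d / 2)); last lra.
  by move=> k; apply: (Rmult_le_reg_l (d / 2)); lra.
by have := Rabs_pos (g x) => p; move: h0 p; rewrite /Rabs; case: Rcase_abs; lra.
Qed.

Section Lerch.
Variable h : R -> R.
Hypothesis ch : cont h.
Hypothesis hv : forall p, 0 < p -> vanishing (fun X => RInt (fun x => exp (- p * x) * h x) 0 X).

(** No growth bound on h is available, but this primitive is bounded because it converges.
    Integration by parts expresses its transform at q through that of h at q + 1. *)
Definition damped (x : R) : R := RInt (fun s => exp (- (1) * s) * h s) 0 x.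
Notation H := damped.

Lemma cont_damped : cont H.
Proof. by rewrite /H; cts. Qed.

Lemma damped_bounded : exists B, 0 < B /\ forall x, 0 <= x -> Rabs (H x) <= B.
Proof.
have [X0 h0] := hv 1 Rlt_0_1 1 Rlt_0_1.
have cH := cont_damped.
have [k [k1 [k2 k3]]] := bound_fun (V := R_CompleteNormedModule) (fun p : R * R => H (fst p)) ltac:(cts).
exists (1 + k (Rabs X0)); split; first by have := k2 (Rabs X0); lra.
move=> x hx; case: (Rle_lt_dec X0 x) => hX.
  have q : Rabs (H x) < 1 by exact: h0.
  have := k2 (Rabs X0); lra.
have q : Rabs (H x) <= k (Rabs x + Rabs 0) by exact: (k3 (x, 0)).
have q2 : k (Rabs x + Rabs 0) <= k (Rabs X0) by apply: k1; rewrite Rabs_R0 !Rabs_pos_eq; lra.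
lra.
Qed.

Lemma damped_vanishing q : 0 < q -> vanishing (fun X => RInt (fun x => exp (- q * x) * H x) 0 X).
Proof.
move=> hq.
have [B [B0 hB]] := damped_bounded.
have cH := cont_damped.
have e X : RInt (fun x => exp (- q * x) * H x) 0 X =
   / q * RInt (fun x => exp (- (q + 1) * x) * h x) 0 X + (- / q) * (exp (- q * X) * H X).
  have d x : is_derive (fun x => - / q * (exp (- q * x) * H x)) x
      (exp (- q * x) * H x - / q * (exp (- (q + 1) * x) * h x)).
    have dH : is_derive H x (exp (- (1) * x) * h x).
      apply: (deriv_RInt (V := R_CompleteNormedModule) (fun s => exp (- (1) * s) * h s)); cts.
    have dE : is_derive (fun x => exp (- q * x)) x (- q * exp (- q * x)) by auto_derive => //; ring.
    have -> : exp (- q * x) * H x - / q * (exp (- (q + 1) * x) * h x) =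
      - / q * (- q * exp (- q * x) * H x + exp (- q * x) * (exp (- (1) * x) * h x)).
      have -> : exp (- (q + 1) * x) = exp (- q * x) * exp (- (1) * x) by rewrite -exp_plus; congr exp; ring.
      by field; lra.
    apply: (is_derive_scal (fun x => exp (- q * x) * H x)).
    exact: (is_derive_mult (K := R_AbsRing) (fun x => exp (- q * x)) H x _ _ dE dH Rmult_comm).
  have := FTC_R (fun x => - / q * (exp (- q * x) * H x)) _ 0 X (fun x _ => d x) ltac:(cts).
  rewrite RInt_Rminus; try by cts.
  rewrite RInt_Rmult; last by cts.
  have -> : H 0 = 0 by rewrite /H; exact: (RInt_point (V := R_CompleteNormedModule)).
  lra.
apply: (vanishing_ext _ _ (fun X _ => esym (e X))); apply: vanishing_plus; apply: vanishing_scal.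
  by apply: hv; lra.
exact: vanishing_expM hB.
Qed.

(** Each factor 1 - (e^(-x) - t0)^2 expands into 1 - t0^2, 2 t0 e^(-x) and - e^(-2x), which shift q
    by 0, 1 and 2. *)
Lemma damped_bump t0 n q : 0 < q -> vanishing (fun X => RInt (fun x => exp (- q * x) * (1 - (exp (- (1) * x) - t0) ^ 2) ^ n * H x) 0 X).
Proof.
have cH := cont_damped.
elim: n q => [|n IH] q hq.
  apply: vanishing_ext (damped_vanishing q hq) => X _; apply: RInt_ext => x _ /=; eqR; ring.
pose J q X := RInt (fun x => exp (- q * x) * (1 - (exp (- (1) * x) - t0) ^ 2) ^ n * H x) 0 X.
have e X : (1 - t0 ^ 2) * J q X + (2 * t0 * J (q + 1) X + -1 * J (q + 2) X) =
  RInt (fun x => exp (- q * x) * (1 - (exp (- (1) * x) - t0) ^ 2) ^ (S n) * H x) 0 X.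
  rewrite /J -!RInt_Rmult; try by cts.
  rewrite -!RInt_Rplus; try by cts.
  apply: RInt_ext => x _; eqR.
  have -> : exp (- (q + 1) * x) = exp (- q * x) * exp (- (1) * x) by rewrite -exp_plus; congr exp; ring.
  have -> : exp (- (q + 2) * x) = exp (- q * x) * exp (- (1) * x) * exp (- (1) * x) by rewrite -!exp_plus; congr exp; ring.
  have -> : (1 - (exp (- (1) * x) - t0) ^ 2) ^ S n = (1 - (exp (- (1) * x) - t0) ^ 2) * (1 - (exp (- (1) * x) - t0) ^ 2) ^ n by [].
  by move: (exp (- (1) * x)) (exp (- q * x)) (H x) (_ ^ n) => *; ring.
apply: (vanishing_ext _ _ (fun X _ => e X)).
by repeat apply: vanishing_plus; apply: vanishing_scal; apply: IH; lra.
Qed.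

Lemma RInt_expN_le a b : 0 <= a <= b -> RInt (fun x => exp (- (1) * x)) a b <= 1.
Proof.
move=> hab; rewrite (FTC_R (fun x => - exp (- (1) * x))); last by cts.
  have := exp_pos (- (1) * b).
  have q : exp (- (1) * a) <= exp 0 by apply: exp_mono; lra.
  rewrite exp_0 in q.
  lra.
by move=> x _; auto_derive => //; ring.
Qed.

(* The kernel [exp (- x) * (1 - (exp (- x) - exp (- x0)) ^ 2) ^ n] concentrates at [x0] as [n] grows. *)
Lemma damped_nonpos x0 : 0 < x0 -> H x0 <= 0.
Proof.
move=> hx0; apply: Rnot_lt_le => hH.
have cH := cont_damped.
have [B [B0 hB]] := damped_bounded.
set eta := H x0 in hH.
have [d hd] := proj1 (contRP _ _) (cH x0) (eta / 2) ltac:(lra).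
have d0 := cond_pos d.
pose d1 := Rmin (d / 2) (x0 / 2).
have d1p : 0 < d1 by apply: Rmin_pos; lra.
have d1a : d1 <= d / 2 by exact: Rmin_l.
have d1b : d1 <= x0 / 2 by exact: Rmin_r.
have near x : Rabs (x - x0) <= d1 -> eta / 2 <= H x.
  move=> hx; have : Rabs (H x - H x0) < eta / 2 by apply: hd; apply: Rle_lt_trans hx _; lra.
  by move/Rabs_def2; rewrite -/eta; lra.
pose e x := exp (- (1) * x).
have ce : cont e by rewrite /e; cts.
have em x y : x < y -> e y < e x by move=> hxy; apply: exp_increasing; lra.
have ep x : 0 < e x by exact: exp_pos.
have e1 x : 0 <= x -> e x <= 1 by move=> hx; rewrite -[X in _ <= X]exp_0; apply: exp_mono; lra.
pose t0 := e x0.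
pose de := Rmin (t0 - e (x0 + d1)) (e (x0 - d1) - t0).
have g1 : e (x0 + d1) < t0 by apply: em; lra.
have g2 : t0 < e (x0 - d1) by apply: em; lra.
have dep : 0 < de by apply: Rmin_pos; lra.
have dea : de <= t0 - e (x0 + d1) by exact: Rmin_l.
have deb : de <= e (x0 - d1) - t0 by exact: Rmin_r.
have t01 : t0 <= 1 by apply: e1; lra.
have t0p : 0 < t0 by exact: ep.
have de1 : de < 1 by have := ep (x0 + d1); lra.
have loc x : Rabs (e x - t0) < de -> Rabs (x - x0) <= d1.
  move=> hx; apply: Rnot_lt_le => h1; move/Rabs_def2: hx => hx.
  case: (Rle_lt_dec x x0) => hxx.
    rewrite Rabs_left1 in h1; last lra.
    have := em x (x0 - d1) ltac:(lra); lra.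
  rewrite Rabs_pos_eq in h1; last lra.
  have := em (x0 + d1) x ltac:(lra); lra.
have [d' hd'] := proj1 (contRP _ _) (ce x0) (de / 2) ltac:(lra).
have d'0 := cond_pos d'.
pose d2 := Rmin (d' / 2) d1.
have d2p : 0 < d2 by apply: Rmin_pos; lra.
have d2a : d2 <= d' / 2 by exact: Rmin_l.
have d2b : d2 <= d1 by exact: Rmin_r.
(* [sg] bounds the base of the power from below near x0, [rh] bounds it from above where e^(-x) is
   at distance at least [de] from [t0]. Since [rh < sg], the n-th powers separate. *)
pose sg := 1 - (de / 2) ^ 2; pose rh := 1 - de ^ 2.
have rhp : 0 < rh by rewrite /rh; nra.
have rs : rh < sg by rewrite /rh /sg; nra.
pose c := eta / 2 * e (x0 + d2).
have cp : 0 < c by apply: Rmult_lt_0_compat; [lra | exact: ep].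
pose k x := 1 - (e x - t0) ^ 2.
have ck : cont k by rewrite /k; cts.
have k0 x : 0 <= x -> 0 <= k x.
  by move=> hx; have := e1 x hx; have := ep x; rewrite /k; nra.
pose f n x := e x * k x ^ n * H x.
have cf n : cont (f n) by rewrite /f; cts.
have L1 n x : 0 <= x -> (- B * rh ^ n) * e x <= f n x.
  move=> hx; have rn : 0 <= rh ^ n by apply: pow_le; lra.
  have kn : 0 <= k x ^ n by apply: pow_le; exact: k0.
  have ek : 0 <= e x * k x ^ n by apply: Rmult_le_pos => //; apply: Rlt_le; exact: ep.
  have eB : 0 <= B * rh ^ n * e x.
    by apply: Rmult_le_pos; [apply: Rmult_le_pos; lra | apply: Rlt_le; exact: ep].
  case: (Rlt_le_dec (Rabs (e x - t0)) de) => hc.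
    have : 0 <= f n x; last lra.
    by apply: Rmult_le_pos => //; have := near x (loc x hc); lra.
  have hk : k x ^ n <= rh ^ n.
    apply: pow_incr; split; first exact: k0.
    rewrite /k /rh -(pow2_abs (e x - t0)).
    have : de ^ 2 <= Rabs (e x - t0) ^ 2 by apply: pow_incr; lra.
    lra.
  have hH2 : - B <= H x by have := hB x hx; move/Rabs_le_between; lra.
  have q1 : e x * k x ^ n * - B <= f n x by apply: Rmult_le_compat_l.
  have q2 : e x * k x ^ n <= e x * rh ^ n by apply: Rmult_le_compat_l => //; apply: Rlt_le; exact: ep.
  have q3 : e x * k x ^ n * B <= e x * rh ^ n * B by apply: Rmult_le_compat_r; lra.
  lra.
have L2 n x : x0 - d2 <= x <= x0 + d2 -> c * sg ^ n <= f n x.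
  move=> hx.
  have hk : sg <= k x.
    have : Rabs (e x - t0) < de / 2.
      apply: hd'; rewrite /ball /= /AbsRing_ball /abs /minus /plus /opp /=; apply: Rabs_def1; lra.
    move=> q; rewrite /sg /k -(pow2_abs (e x - t0)).
    have : Rabs (e x - t0) ^ 2 <= (de / 2) ^ 2 by apply: pow_incr; split; [exact: Rabs_pos | lra].
    lra.
  have hs : sg ^ n <= k x ^ n by apply: pow_incr; lra.
  have s0 : 0 <= sg ^ n by apply: pow_le; lra.
  have hn : eta / 2 <= H x by apply: near; apply: Rabs_le; lra.
  have he : e (x0 + d2) <= e x by case: (Req_dec x (x0 + d2)) => [->|hne]; [lra | apply: Rlt_le; apply: em; lra].
  have -> : c * sg ^ n = e (x0 + d2) * sg ^ n * (eta / 2) by rewrite /c; ring.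
  apply: Rmult_le_compat => //; [by apply: Rmult_le_pos => //; apply: Rlt_le; exact: ep | lra |].
  by apply: Rmult_le_compat => //; apply: Rlt_le; exact: ep.
(* The middle interval of length 2 [d2] contributes at least 2 [d2] c sg^n and each of the two outer
   ones at least -B rh^n, the integral of e^(-x) being at most 1; the total is smaller than any eps
   for large X. *)
have main n : d2 * c * sg ^ n <= B * rh ^ n.
  have hvn := damped_bump t0 n 1 Rlt_0_1.
  have rn : 0 <= rh ^ n by apply: pow_le; lra.
  suff : 2 * d2 * c * sg ^ n - 2 * B * rh ^ n <= 0 by lra.
  apply: le_epsilon => eps he; rewrite Rplus_0_l.
  have [X0 hX0] := hvn eps he.
  pose X := Rmax X0 (x0 + d2).
  have X1 : X0 <= X by exact: Rmax_l.
  have X2 : x0 + d2 <= X by exact: Rmax_r.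
  have hI : RInt (f n) 0 X < eps by have /Rabs_def2 := hX0 X X1; case.
  have s1 := RInt_Rcat (f n) 0 (x0 - d2) X (cf n).
  have s2 := RInt_Rcat (f n) (x0 - d2) (x0 + d2) X (cf n).
  have out a b : 0 <= a <= b -> - B * rh ^ n <= RInt (f n) a b.
    move=> hab; apply: Rle_trans (_ : RInt (fun x => (- B * rh ^ n) * e x) a b <= _).
      rewrite RInt_Rmult //; have q := RInt_expN_le a b hab.
      rewrite -[RInt e a b]/(RInt (fun x => exp (- (1) * x)) a b).
      have BB : 0 <= B * rh ^ n by apply: Rmult_le_pos; lra.
      have := Rmult_le_compat_l _ _ _ BB q; lra.
    apply: RInt_Rle; [lra | by cts | by [] |] => x hx; apply: L1; lra.
  have o1 := out 0 (x0 - d2) ltac:(lra).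
  have o2 := out (x0 + d2) X ltac:(lra).
  have mid : 2 * d2 * (c * sg ^ n) <= RInt (f n) (x0 - d2) (x0 + d2).
    have := RInt_Rle (fun _ => c * sg ^ n) (f n) (x0 - d2) (x0 + d2) ltac:(lra) (cont_const _) (cf n) (L2 n).
    rewrite RInt_Rcst; lra.
  lra.
have r1 : Rabs (rh / sg) < 1.
  rewrite Rabs_pos_eq; last by apply: Rdiv_le_0_compat; lra.
  have e2 : rh / sg * sg = rh by field; lra.
  by apply: (Rmult_lt_reg_r sg); [lra | rewrite e2; lra].
have y0 : 0 < d2 * c / B by apply: Rdiv_lt_0_compat => //; apply: Rmult_lt_0_compat.
have [n hn] := pow_lt_1_zero _ r1 _ y0.
have h1 := hn n ltac:(lia).
have h2 := main n.
have s0 : 0 < sg ^ n by apply: pow_lt; lra.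
rewrite Rabs_pos_eq in h1; last by apply: pow_le; apply: Rdiv_le_0_compat; lra.
have h3 := Rmult_lt_compat_r (B * sg ^ n) _ _ (Rmult_lt_0_compat _ _ B0 s0) h1.
have q1 : (rh / sg) ^ n * (B * sg ^ n) = B * rh ^ n.
  have {2}-> : rh = rh / sg * sg by field; lra.
  by rewrite Rpow_mult_distr; ring.
have q2 : d2 * c / B * (B * sg ^ n) = d2 * c * sg ^ n by field; lra.
lra.
Qed.

End Lerch.

(** Apply [damped_nonpos] to h and to -h; the damped primitive then vanishes identically, and so
    does its integrand. *)
Lemma lerch (h : R -> R) : cont h ->
  (forall p, 0 < p -> vanishing (fun X => RInt (fun x => exp (- p * x) * h x) 0 X)) -> forall x, 0 <= x -> h x = 0.
Proof.
move=> ch hv.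
have ch' : cont (fun x => -1 * h x) by cts.
have hv' p : 0 < p -> vanishing (fun X => RInt (fun x => exp (- p * x) * (-1 * h x)) 0 X).
  move=> hp; apply: vanishing_ext (vanishing_scal _ (-1) (hv p hp)) => X _.
  by rewrite -RInt_Rmult; [apply: RInt_ext => x _; eqR; ring | cts].
have opp x : damped (fun x => -1 * h x) x = - damped h x.
  rewrite /damped; set I := RInt (fun s => exp (- (1) * s) * h s) 0 x.
  have -> : - I = -1 * I by ring.
  by rewrite /I -RInt_Rmult; [apply: RInt_ext => t _; eqR; ring | cts].
have z x : 0 <= x -> damped h x = 0.
  move=> hx; case: (Req_dec x 0) => [->|h0]; first exact: (RInt_point (V := R_CompleteNormedModule)).
  have h1 := damped_nonpos h ch hv x ltac:(lra).
  have h2 := damped_nonpos _ ch' hv' x ltac:(lra).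
  rewrite opp in h2; lra.
move=> x hx.
have := zero_of_RInt (fun s => exp (- (1) * s) * h s) ltac:(cts) z x hx => e.
have := exp_pos (- (1) * x) => ep.
by case: (Rmult_integral _ _ e); lra.
Qed.

(** * Uniqueness of the Weyl function *)

Lemma linear_ode {M : star_alg} (H : R -> M) l : cont H ->
  exists U : R -> M, cont U /\ forall x, U x = add one (RInt (fun t => mul (H t) (U t)) l x).
Proof.
move=> cH.
have [k [mk [k1 hk]]] := bound_1 H cH.
pose Th (U : R -> M) x := add one (RInt (fun t => mul (H t) (U t)) l x).
have cTh U : cont U -> cont (Th U) by move=> cU; rewrite /Th; cts.
pose tau x := Rabs (x - l).
pose C x := k (Rabs l + Rmax 0 x).
pose K x := C x * nm (one : M) * Rmax 0 x + 1.
have mC x y : x <= y -> C x <= C y.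
  by move=> h; apply: (proj1 mk); have := proj1 mp_max _ _ h; lra.
have C0 x : 1 <= C x by exact: k1.
have n1 := nm_ge0 (one : M).
have aM x : Rmax 0 (tau x) = tau x by rewrite Rmax_right //; exact: Rabs_pos.
have hH s x : Rmin l x <= s <= Rmax l x -> nm (H s) <= C (tau x).
  move=> hs; apply: hk; rewrite aM /tau.
  by move: hs; rewrite /Rmin /Rmax /Rabs; repeat (case: Rle_dec => ?); repeat (case: Rcase_abs => ?); lra.
have loc s x : Rmin l x <= s <= Rmax l x -> tau s <= tau x.
  by rewrite /tau /Rmin /Rmax /Rabs; repeat (case: Rle_dec => ?); repeat (case: Rcase_abs => ?); lra.
have [U [cU [_ hU]]] : exists U : R -> M, cont U /\ (forall p : R, True) /\ forall p, Th U p = U p.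
  apply: (volterra_fix tau tau K C (fun _ _ => True) Th (fun _ => one)) => //.
  - by move=> p; have := Rabs_pos (p - l); rewrite /tau; lra.
  - move=> p; exists (mkposreal 1 Rlt_0_1) => q; rewrite /ball /= /AbsRing_ball /abs /minus /plus /opp /= => h.
    rewrite /tau; apply: Rabs_near; move: h; have -> : q - l + - (p - l) = (q : R) + - (p : R) by ring.
    by [].
  - move=> x y h; rewrite /K; apply: Rplus_le_compat_r.
    apply: Rmult_le_compat; [by apply: Rmult_le_pos => //; have := C0 x; lra | exact: Rmax_l | | exact: (proj1 mp_max)].
    by apply: Rmult_le_compat_r => //; exact: mC.
  - move=> x; have : 0 <= C x * nm (one : M) * Rmax 0 x; last by rewrite /K; lra.
    by apply: Rmult_le_pos; [apply: Rmult_le_pos => //; have := C0 x; lra | exact: Rmax_l].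
  - by move=> x; have := C0 x; lra.
  - by cts.
  - move=> x; rewrite -[norm _]/(nm (sub (Th (fun _ => one) x) one)).
    have -> : sub (Th (fun _ => one) x) one = RInt (fun t => mul (H t) one) l x by rewrite /Th; vec.
    apply: Rle_trans (_ : Rabs (x - l) * (C (tau x) * nm (one : M)) <= _).
      apply: nm_RInt_const; first by cts.
      move=> s hs; apply: Rle_trans (nm_mul _ _) _; apply: Rmult_le_compat_r => //; exact: hH.
    rewrite /K aM -/(tau x); lra.
  - by move=> U cU _; split => //; exact: cTh.
  - move=> U U' x k' c0 cU cU' _ _ hk' hc hd.
    rewrite -[norm _]/(nm (sub (Th U x) (Th U' x))).
    have -> : sub (Th U x) (Th U' x) = RInt (fun t => mul (H t) (sub (U t) (U' t))) l x.
      rewrite (RInt_ext _ (fun t => sub (mul (H t) (U t)) (mul (H t) (U' t)))); last by move=> t _; exact: mul_sub_r.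
      by rewrite RInt_sub; [rewrite /Th; vec | cts | cts].
    have -> : C (tau x) / k' * (c0 * exp (k' * tau x)) = (C (tau x) * c0) / k' * exp (k' * Rabs (x - l)).
      by rewrite /Rdiv /tau; ring.
    apply: RInt_exp_bound => //; first by cts.
    move=> s hs; rewrite -[norm _]/(nm (mul (H s) (sub (U s) (U' s)))).
    apply: Rle_trans (nm_mul _ _) _; rewrite Rmult_assoc; apply: Rmult_le_compat; try exact: nm_ge0.
      exact: hH.
    by apply: hd; exact: loc.
by exists U; split => // x; rewrite -{1}hU.
Qed.

Lemma RInt_rsum n (f : nat -> R -> R) a b : (forall i, (i < n)%nat -> cont (f i)) ->
  cont (fun x => rsum n (fun i => f i x)) /\ RInt (fun x => rsum n (fun i => f i x)) a b = rsum n (fun i => RInt (f i) a b).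
Proof.
elim: n => [|n IH] h.
  by split; [exact: cont_const | rewrite /= RInt_Rcst; ring].
have [c e] := IH (fun i hi => h i ltac:(lia)).
have cn := h n ltac:(lia).
split; first by rewrite /=; apply: cont_Rplus.
by rewrite /= RInt_Rplus // e.
Qed.

Section Uniqueness.
Variables m1 m2 : nat.
Notation N := (m1 + m2)%nat.
Notation M := (mx_alg N).
Notation Pi := (Pi1 m1 m2).
Variables (v : R -> Mat) (a : R -> M) (A B : R -> R -> M).
Hypothesis fl : flow a A B.
Hypothesis sA : forall x l, supp m1 m2 (A x l).
Hypothesis av : forall x i j, 0 <= x -> (i < m2)%nat -> (j < m1)%nat -> blk m1 m2 (a x) i j = (- Ci * Cconj (v x j i))%C.

(** The definition of a Weyl function quantifies over all fundamental solutions; an actual one is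
    needed to draw conclusions from it. *)
Lemma fund_sol_exists l z : 0 <= l -> exists u, fund_sol m1 m2 v l z u.
Proof.
move=> hl.
have ca := fl_a _ _ _ fl.
pose H t := add (mul (cs (Ci * z)%C) (sub (rs 2 Pi) one)) (add (a t) (adj (a t))).
have cH : cont H by rewrite /H; cts.
have [U [cU hU]] := linear_ode H l cH.
exists (fun x => ent N (U x)) => i j hi hj; split.
  by apply: (cont_half_of _ (fun x => ent N (U x) i j)) => //; exact: contC_ent.
move=> x hx; rewrite {1}hU ent_add // ent_one // ent_RInt //; last by cts.
congr (_ + _)%C; apply: CRInt_ext => t ht.
have t0 : 0 <= t by have := Rmin_glb l x 0 hl hx; lra.
rewrite /H (dirac_coefE m1 m2 v a A B fl sA av z t t0) ent_mul //; apply: csum_ext => k hk.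
by rewrite ent_mk.
Qed.

(** The difference of the two square integrable solutions starts in the lower block at [W0]. By
    [dirac_lower_growth] its norm never falls below |[W0]|, so square integrability forces
    [W0 = 0]. *)
Lemma weyl_unique l phi phi' : 0 <= l -> weyl_fun m1 m2 v l phi -> weyl_fun m1 m2 v l phi' ->
  forall z i j, 0 < Im z -> (i < m2)%nat -> (j < m1)%nat -> phi z i j = phi' z i j.
Proof.
move=> hl [_ H] [_ H'] z i j hz hi hj.
have [u hu] := fund_sol_exists l z hl.
have [U [cU [dU [eU Ul]]]] := fund_sol_extend m1 m2 v a A B fl sA av l z u hl hu.
pose W0 : M := low m1 m2 (fun i j => phi z i j - phi' z i j)%C.
pose W x := mul (U x) W0.
have cW : cont W by rewrite /W; cts.
have dW x : l <= x -> is_derive W x (dirac a Pi (Ci * z)%C x (W x)).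
  move=> hx; have -> : dirac a Pi (Ci * z)%C x (W x) = mul (dirac a Pi (Ci * z)%C x (U x)) W0.
    by rewrite !(diracE m1 m2 v a A B fl sA av); [rewrite mulA | lra | lra].
  by apply: D_cmul; apply: dU; lra.
have s0 : supp m1 m2 W0 by exact: supp_low.
have Wl : W l = W0 by rewrite /W Ul mul1l.
have r0 : 0 < 2 * Im z by lra.
have ca := fl_a _ _ _ fl.
have sa x : supp m1 m2 (a x) by rewrite -(fl_0 _ _ _ fl).
have grow T : l <= T -> nm W0 ^ 2 <= nm (W T) ^ 2.
  move=> hT; rewrite -Wl.
  apply: (dirac_lower_growth a Pi (Ci * z)%C (2 * Im z) (Pi1_Pi1 m1 m2) (adj_Pi1 m1 m2)
     (fun x => proj1 (sa x)) (fun x => proj2 (sa x)) r0 (Re_iz z) W l cW dW T hT).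
  by rewrite Wl; exact: (proj2 s0).
pose g (p : Mat) x : M := mul (U x) (mk N (stack_I m1 p) : M).
have eg p x p' q : 0 <= x -> (p' < N)%nat -> (q < m1)%nat -> mmul N (u x) (stack_I m1 p) p' q = ent N (g p x) p' q.
  move=> hx hp hq; rewrite ent_mul //; last by lia.
  by apply: csum_ext => k hk; rewrite eU // ent_mk //; lia.
have cg p : cont (g p) by rewrite /g; cts.
have eW x p q : 0 <= x -> (p < N)%nat -> (q < m1)%nat -> ent N (W x) p q = (ent N (g (phi z) x) p q - ent N (g (phi' z) x) p q)%C.
  move=> hx hp hq; have hq' : (q < N)%nat by lia.
  rewrite -ent_sub // -mul_sub_r !ent_mul //; apply: csum_ext => k hk; congr (_ * _)%C.
  rewrite ent_sub // !ent_mk // /stack_I (proj2 (Nat.ltb_lt q m1) hq).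
  by case: (k <? m1)%nat; ring.
have bound p q : (p < N)%nat -> (q < N)%nat -> exists K, forall T, l <= T -> RInt (fun x => Cmod (ent N (W x) p q) ^ 2) l T <= K.
  move=> hp hq; case: (Nat.lt_ge_cases q m1) => hq1; last first.
    exists 0 => T hT; rewrite (RInt_ext _ (fun _ => 0)); first by rewrite RInt_Rcst; lra.
    move=> x _; have -> : ent N (W x) p q = 0%C.
      have -> : W x = mul (W x) Pi by rewrite /W mulA (proj1 s0).
      by rewrite ent_mul_Pi // if_geb.
    by rewrite Cmod_0 /=; eqR; ring.
  have [K1 h1] := H z hz u hu p q hp hq1; have [K2 h2] := H' z hz u hu p q hp hq1.
  exists (2 * K1 + 2 * K2) => T hT.
  have c1 := cont_Cmod_sq _ (contC_ent N _ p q (cg (phi z)) hp hq).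
  have c2' := cont_Cmod_sq _ (contC_ent N _ p q (cg (phi' z)) hp hq).
  have c3 := cont_Cmod_sq _ (contC_ent N _ p q cW hp hq).
  have f1 : RInt (fun x => Cmod (ent N (g (phi z) x) p q) ^ 2) l T <= K1.
    rewrite -(RInt_ext (fun x => Cmod (mmul N (u x) (stack_I m1 (phi z)) p q) ^ 2)); first exact: h1.
    by move=> x; rewrite Rmin_left // => hx; rewrite eg //; lra.
  have f2 : RInt (fun x => Cmod (ent N (g (phi' z) x) p q) ^ 2) l T <= K2.
    rewrite -(RInt_ext (fun x => Cmod (mmul N (u x) (stack_I m1 (phi' z)) p q) ^ 2)); first exact: h2.
    by move=> x; rewrite Rmin_left // => hx; rewrite eg //; lra.
  apply: Rle_trans (_ : RInt (fun x => 2 * Cmod (ent N (g (phi z) x) p q) ^ 2 + 2 * Cmod (ent N (g (phi' z) x) p q) ^ 2) l T <= _).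
    apply: RInt_Rle => //; first by apply: cont_Rplus; apply: cont_Rmult => //; exact: cont_const.
    move=> x hx; rewrite eW //; last lra.
    have := Cmod_triangle (ent N (g (phi z) x) p q) (- ent N (g (phi' z) x) p q)%C; rewrite Cmod_opp.
    have := Cmod_ge_0 (ent N (g (phi z) x) p q - ent N (g (phi' z) x) p q)%C.
    rewrite -/(Cminus _ _); set r1 := Cmod _; set r2 := Cmod _; set r3 := Cmod _ => q1 q2.
    have : r1 ^ 2 <= (r2 + r3) ^ 2 by apply: pow_incr.
    have := pow2_ge_0 (r2 - r3); lra.
  have c4 : cont (fun x => 2 * Cmod (ent N (g (phi z) x) p q) ^ 2) by apply: cont_Rmult => //; exact: cont_const.
  have c5 : cont (fun x => 2 * Cmod (ent N (g (phi' z) x) p q) ^ 2) by apply: cont_Rmult => //; exact: cont_const.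
  rewrite (RInt_Rplus (fun x => 2 * Cmod (ent N (g (phi z) x) p q) ^ 2) (fun x => 2 * Cmod (ent N (g (phi' z) x) p q) ^ 2)) //.
  rewrite (RInt_Rmult 2 (fun x => Cmod (ent N (g (phi z) x) p q) ^ 2)) //.
  rewrite (RInt_Rmult 2 (fun x => Cmod (ent N (g (phi' z) x) p q) ^ 2)) //; lra.
have sumb n (f : nat -> R -> R) : (forall p, (p < n)%nat -> exists K, forall T, l <= T -> f p T <= K) ->
    exists K, forall T, l <= T -> rsum n (fun p => f p T) <= K.
  elim: n => [|n IH] hf; first by exists 0 => T _ /=; lra.
  have [K1 h1] := IH (fun p hp => hf p ltac:(lia)); have [K2 h2] := hf n ltac:(lia).
  exists (K1 + K2) => T hT /=; have := h1 T hT; have := h2 T hT; lra.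
have [K hK] : exists K, forall T, l <= T -> RInt (fun x => nm (W x) ^ 2) l T <= K.
  have cc p q : (p < N)%nat -> (q < N)%nat -> cont (fun x => Cmod (ent N (W x) p q) ^ 2).
    by move=> hp hq; apply: cont_Cmod_sq; exact: contC_ent.
  have [K hK] := sumb N (fun p T => rsum N (fun q => RInt (fun x => Cmod (ent N (W x) p q) ^ 2) l T))
    (fun p hp => sumb N (fun q T => RInt (fun x => Cmod (ent N (W x) p q) ^ 2) l T) (fun q hq => bound p q hp hq)).
  exists K => T hT; apply: Rle_trans (hK T hT); apply: Req_le.
  rewrite (RInt_ext _ (fun x => rsum N (fun p => rsum N (fun q => Cmod (ent N (W x) p q) ^ 2)))); last first.
    by move=> x _; rewrite -[nm _]/(mxnorm N (W x)) mxnorm_sq mxinner_sq.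
  have r p := RInt_rsum N (fun q x => Cmod (ent N (W x) p q) ^ 2) l T.
  rewrite (proj2 (RInt_rsum N (fun p x => rsum N (fun q => Cmod (ent N (W x) p q) ^ 2)) l T _)); last first.
    by move=> p hp; apply: (proj1 (r p _)) => q hq; exact: cc.
  by apply: rsum_ext => p hp; rewrite (proj2 (r p _)) // => q hq; exact: cc.
have z0 : nm W0 ^ 2 <= 0.
  apply: Rnot_lt_le => hp.
  (* At this point |[W0]|^2 (T - l) equals |K| + 1, exceeding the bound K. *)
  pose T := l + (Rabs K + 1) / nm W0 ^ 2.
  have hq : 0 < (Rabs K + 1) / nm W0 ^ 2 by apply: Rdiv_lt_0_compat => //; have := Rabs_pos K; lra.
  have hT : l <= T by rewrite /T; lra.
  have := hK T hT.
  have := RInt_Rle (fun _ => nm W0 ^ 2) (fun x => nm (W x) ^ 2) l T hT (cont_const _) ltac:(cts) (fun x hx => grow x (proj1 hx)).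
  rewrite RInt_Rcst /T.
  have ew w : 0 < w -> (l + (Rabs K + 1) / w - l) * w = Rabs K + 1 by move=> h; field; lra.
  rewrite ew //.
  have := Rle_abs K; lra.
have W00 : W0 = nul.
  by apply: nm_eq0; apply: Rsqr_0_uniq; rewrite Rsqr_pow2; apply: Rle_antisym => //; exact: pow2_ge_0.
have := ent_low m1 m2 (fun i j => phi z i j - phi' z i j)%C i j hi hj.
rewrite -/W0 W00 /blk ent_nul; [|lia|lia].
move=> e; have -> : phi z i j = ((phi z i j - phi' z i j) + phi' z i j)%C by ring.
by rewrite -e; ring.
Qed.

End Uniqueness.

(** * The equation for block matrices *)

Section Star.
Variables m1 m2 : nat.
Notation N := (m1 + m2)%nat.
Notation M := (mx_alg N).
Notation Pi := (Pi1 m1 m2).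
Notation lblk := (blk m1 m2).
Notation supp := (supp m1 m2).

Lemma blk_add (x y : M) i j : (i < m2)%nat -> (j < m1)%nat -> lblk (add x y) i j = (lblk x i j + lblk y i j)%C.
Proof. by move=> hi hj; apply: ent_add; lia. Qed.

Lemma supp_triple (x y z : M) : supp x -> supp z -> supp (mul x (mul y z)).
Proof.
move=> [x1 x2] [z1 z2]; split; first by rewrite !mulA z1.
by rewrite -mulA x2 mul_nul_l.
Qed.

(** In the sums over m1 + m2 indices only one block of each factor is nonzero, so the m x m products
    reduce to the rectangular ones of the statement. *)
Lemma blk_triple (x y z : M) i j : supp x -> supp y -> supp z -> (i < m2)%nat -> (j < m1)%nat ->
  lblk (mul x (mul (adj y) z)) i j = mmul m2 (mmul m1 (lblk x) (madj (lblk y))) (lblk z) i j.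
Proof.
move=> sx sy sz hi hj.
rewrite -mulA {1}/blk ent_mul; [|lia|lia].
rewrite /mmul csum_split (csum_ext m1 _ (fun _ => 0%C)); last first.
  by move=> k hk; rewrite (supp_up m1 m2 z k j sz) //; [ring | lia].
rewrite csum_0 Cplus_0_l; apply: csum_ext => r hr; congr (_ * _)%C.
rewrite ent_mul; [|lia|lia].
rewrite /mmul csum_split [X in (_ + X)%C](csum_ext m2 _ (fun _ => 0%C)); last first.
  by move=> k hk; rewrite (supp_right m1 m2 x _ _ sx); [ring | lia | lia].
rewrite csum_0 Cplus_0_r; apply: csum_ext => k hk; congr (_ * _)%C.
by rewrite ent_adj //; lia.
Qed.

Lemma supp_Qf (F : R -> R -> M) x l : c2 F -> (forall x l, supp (F x l)) -> supp (Qf (F 0) F x l).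
Proof.
move=> cF sF; rewrite /Qf /cv; apply: supp_RInt; first by cts.
by move=> t; apply: supp_triple.
Qed.

Lemma blk_Qf (F : R -> R -> M) x l i j : c2 F -> (forall x l, supp (F x l)) -> (i < m2)%nat -> (j < m1)%nat ->
  lblk (Qf (F 0) F x l) i j =
  CRInt (fun t => mmul m2 (mmul m1 (lblk (F (x - t) l)) (madj (lblk (F 0 l)))) (lblk (F t l)) i j) 0 x.
Proof.
move=> cF sF hi hj; rewrite {1}/blk /Qf /cv ent_RInt; [|cts|lia|lia].
apply: CRInt_ext => t _.
by rewrite -[ent _ _ _ _]/(lblk (mul (F (x - t) l) (mul (adj (F 0 l)) (F t l))) i j) blk_triple.
Qed.

Lemma star_integrand_ext (A A' : R -> R -> Mat) x l i j : 0 <= x -> 0 <= l -> (i < m2)%nat -> (j < m1)%nat ->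
  (forall x l, 0 <= x -> 0 <= l -> forall i j, (i < m2)%nat -> (j < m1)%nat -> A x l i j = A' x l i j) ->
  CRInt (fun t => mmul m2 (mmul m1 (A (x - t) l) (madj (A 0 l))) (A t l) i j) 0 x =
  CRInt (fun t => mmul m2 (mmul m1 (A' (x - t) l) (madj (A' 0 l))) (A' t l) i j) 0 x.
Proof.
move=> hx hl hi hj h; apply: CRInt_ext => t; rewrite Rmin_left // Rmax_right // => ht.
apply: csum_ext => k hk; rewrite h //; last lra.
congr (_ * _)%C; apply: csum_ext => r hr; rewrite /madj !h //; lra.
Qed.

Lemma solves_star_of_flow (a : R -> M) (F B : R -> R -> M) (A : R -> R -> Mat) : flow a F B -> (forall x l, supp (F x l)) ->
  (forall x l, 0 <= x -> 0 <= l -> forall i j, (i < m2)%nat -> (j < m1)%nat -> A x l i j = lblk (F x l) i j) ->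
  solves_star m1 m2 A.
Proof.
move=> fl sF h; have [ca cF cB F0 Fx Fl] := fl.
have ea : a = F 0 by apply: functional_extensionality => l; rewrite F0.
have cQ := c2_Qf a F ca cF.
pose Z x l := add (B x l) (Qf a F x l).
have cZ : c2 Z by rewrite /Z; cts.
have ce G i j : c2 G -> (i < m2)%nat -> (j < m1)%nat -> contC (fun p : R * R => lblk (G (fst p) (snd p)) i j).
  by move=> cG hi hj; apply: (contC_ent N (fun p : R * R => G (fst p) (snd p))) => //; lia.
exists (fun x l => lblk (B x l)), (fun x l => lblk (Z x l)); split.
  move=> i j hi hj; split; last split; last split.
  - by apply: (cont_quad_of _ (fun x l => lblk (F x l) i j)); [exact: ce | move=> x l hx hl; exact: h].
  - by apply: (cont_quad_of _ (fun x l => lblk (B x l) i j)); [exact: ce | ].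
  - by apply: (cont_quad_of _ (fun x l => lblk (Z x l) i j)); [exact: ce | ].
  move=> x l hx hl; have z0 : 0 <= 0 by lra.
  rewrite !h //; split.
    rewrite /blk -ent_RInt; [|cts|lia|lia].
    rewrite -ent_add; [|lia|lia].
    by rewrite (FTC' (fun x => F x l) (fun x => B x l) 0 x (fun x => Fx x l)); last cts.
  rewrite /blk -ent_RInt; [|cts|lia|lia].
  rewrite -ent_add; [|lia|lia].
  by rewrite (FTC' (F x) (Z x) 0 l (Fl x)); last cts.
move=> x l hx hl i j hi hj.
rewrite (star_integrand_ext A (fun x l => lblk (F x l))) // -blk_Qf // -ea.
by rewrite /Z {1}/blk ent_add //; lia.
Qed.

Lemma cont_zero_limit (f : R -> M) d : 0 < d -> cont f -> (forall e, 0 < e < d -> f e = nul) -> f 0 = nul.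
Proof.
move=> hd cf h; apply: nm_eq0; apply: Rle_antisym; last exact: nm_ge0.
apply: le_epsilon => eps he; rewrite Rplus_0_l.
have [r hr] := proj1 (contP _ _) (cf 0) _ he.
have r0 := cond_pos r.
pose e := Rmin (r / 2) (d / 2).
have e0 : 0 < e by apply: Rmin_pos; lra.
have e1 : e <= r / 2 by exact: Rmin_l.
have e2 : e <= d / 2 by exact: Rmin_r.
have q : nm (sub (f e) (f 0)) < eps.
  by apply: hr; rewrite /ball /= /AbsRing_ball /abs /minus /plus /opp /=; apply: Rabs_def1; lra.
rewrite (h e) in q; last lra.
have e3 : sub nul (f 0) = neg (f 0) by vec.
rewrite e3 nm_neg in q; lra.
Qed.

(** A solution on the quadrant is clamped to the plane and integrated along characteristics. Its
    l-derivative is two-sided only for l > 0, so the integration starts at a positive level, which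
    then tends to 0. *)
Lemma mild_of_solves_star (A : R -> R -> Mat) L : solves_star m1 m2 A ->
  let F x l : M := low m1 m2 (A (Rmax 0 x) (Rmax 0 l)) in c2 F /\ mild (fun x => F x 0) F L.
Proof.
move=> [Ax [Al [hA hS]]] F.
pose X x l : M := low m1 m2 (Ax (Rmax 0 x) (Rmax 0 l)).
pose Z x l : M := low m1 m2 (Al (Rmax 0 x) (Rmax 0 l)).
have cl (G : R -> R -> Mat) : (forall i j, (i < m2)%nat -> (j < m1)%nat -> cont_quad (fun x l => G x l i j)) ->
    c2 (fun x l => low m1 m2 (G (Rmax 0 x) (Rmax 0 l)) : M).
  move=> hG; apply: cont_mx => i j hi hj.
  case: (Nat.lt_ge_cases j m1) => hj1; last first.
    by split; apply: (cont_ext (fun _ => 0)) => [u|]; try exact: cont_const; rewrite ent_low_right.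
  case: (Nat.lt_ge_cases i m1) => hi1.
    by split; apply: (cont_ext (fun _ => 0)) => [u|]; try exact: cont_const; rewrite ent_low_up.
  have e (u : R * R) : G (Rmax 0 (fst u)) (Rmax 0 (snd u)) (i - m1)%nat j = ent N (low m1 m2 (G (Rmax 0 (fst u)) (Rmax 0 (snd u)))) i j.
    by rewrite ent_mk // if_geb // if_ltb.
  have [c1 c2'] := cont_quad_clamp _ (hG (i - m1)%nat j ltac:(lia) hj1).
  by split; [exact: (cont_ext _ _ (fun u => f_equal Re (e u)) c1) | exact: (cont_ext _ _ (fun u => f_equal Im (e u)) c2')].
have cF : c2 F by apply: cl => i j hi hj; case: (hA i j hi hj).
have cX : c2 X by apply: cl => i j hi hj; case: (hA i j hi hj) => _ [].
have cZ : c2 Z by apply: cl => i j hi hj; case: (hA i j hi hj) => _ [_ []].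
have sF x l : supp (F x l) by exact: supp_low.
have sX x l : supp (X x l) by exact: supp_low.
have sZ x l : supp (Z x l) by exact: supp_low.
have m0 x := Rmax_l 0 x.
have z0 : 0 <= 0 by lra.
have R1 x l : 0 <= x -> F x l = add (F 0 l) (RInt (fun t => X t l) 0 x).
  move=> hx; apply: supp_ext => //.
    by apply: supp_add => //; apply: supp_RInt => //; cts.
  move=> i j hi hj; rewrite [RHS]/blk ent_add; [|lia|lia].
  rewrite ent_RInt; [|cts|lia|lia].
  rewrite -[ent N (F 0 l) _ _]/(lblk (F 0 l) i j) /F !ent_low // (Rmax_right 0 0) // (Rmax_right 0 x) //.
  have [_ [_ [_ h]]] := hA i j hi hj.
  rewrite (proj1 (h x (Rmax 0 l) hx (m0 l))); congr (_ + _)%C; apply: CRInt_ext => t.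
  rewrite Rmin_left // Rmax_right // => ht.
  rewrite -[ent N _ _ _]/(lblk (X t l) i j) /X ent_low // (Rmax_right 0 t) //; lra.
have R2 x l : 0 <= l -> F x l = add (F x 0) (RInt (fun s => Z x s) 0 l).
  move=> hl; apply: supp_ext => //.
    by apply: supp_add => //; apply: supp_RInt => //; cts.
  move=> i j hi hj; rewrite [RHS]/blk ent_add; [|lia|lia].
  rewrite ent_RInt; [|cts|lia|lia].
  rewrite -[ent N (F x 0) _ _]/(lblk (F x 0) i j) /F !ent_low // (Rmax_right 0 0) // (Rmax_right 0 l) //.
  have [_ [_ [_ h]]] := hA i j hi hj.
  rewrite (proj2 (h (Rmax 0 x) l (m0 x) hl)); congr (_ + _)%C; apply: CRInt_ext => t.
  rewrite Rmin_left // Rmax_right // => ht.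
  rewrite -[ent N _ _ _]/(lblk (Z x t) i j) /Z ent_low // (Rmax_right 0 t) //; lra.
have R3 x l : 0 <= x -> 0 <= l -> Z x l = add (X x l) (Qf (F 0) F x l).
  move=> hx hl; apply: supp_ext => //.
    by apply: supp_add => //; apply: supp_Qf.
  move=> i j hi hj; rewrite blk_add // blk_Qf //.
  rewrite /X /Z !ent_low // !Rmax_right // hS //; congr (_ + _)%C.
  apply: (star_integrand_ext A (fun x l => lblk (F x l))) => // x' l' hx' hl' i' j' hi' hj'.
  by rewrite /F ent_low // !Rmax_right.
split => // x l hx hl _.
case: (Req_dec l 0) => [->|l0].
  by rewrite RInt_nul Rplus_0_r; vec.
have cQ := c2_Qf (F 0) F ltac:(cts) cF.
(* Equal to F for x >= 0, but differentiable in x on the whole line, as [chain2] demands. *)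
pose G x l := add (F 0 l) (RInt (fun t => X t l) 0 x).
(* The defect of the relation integrated over e <= s <= l. It is continuous in e and zero for 0 < e
   < l, hence zero at e = 0. *)
pose f e := sub (F (x + e) l) (add (F (x + l) e) (RInt (fun s => Qf (F 0) F (x + e + l - s) s) e l)).
have f0 : f 0 = nul.
  apply: (cont_zero_limit f l); [lra | by rewrite /f; cts |] => e he.
  have d s : e <= s <= l -> is_derive (fun s => G (x + e + l - s) s) s (Qf (F 0) F (x + e + l - s) s).
    move=> hs.
    have -> : Qf (F 0) F (x + e + l - s) s = plus (scal (-1) (X (x + e + l - s) s)) (scal 1 (Z (x + e + l - s) s)).
      rewrite -[plus _ _]/(add (rs (-1) (X (x + e + l - s) s)) (rs 1 (Z (x + e + l - s) s))) R3; [by vec | lra | lra].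
    apply: (chain2 G X _ (fun s => x + e + l - s) (fun s => s)) => //.
    - move=> y l'; have -> : X y l' = add nul (X y l') by vec.
      by apply: D_add; [exact: D_const | apply: (deriv_RInt (fun t => X t l')); cts].
    - apply: (is_derive_ext_loc (fun l' => add (F (x + e + l - s) 0) (RInt (fun r => Z (x + e + l - s) r) 0 l'))).
        have sp : 0 < s by lra.
        exists (mkposreal s sp) => y; rewrite /ball /= /AbsRing_ball /abs /minus /plus /opp /= => /Rabs_def2 hy.
        rewrite -R2; last lra.
        by rewrite R1 //; lra.
      have -> : Z (x + e + l - s) s = add nul (Z (x + e + l - s) s) by vec.
      by apply: D_add; [exact: D_const | apply: (deriv_RInt (Z (x + e + l - s))); cts].
    - by auto_derive => //; ring.
    - by auto_derive.
  have := is_RInt_derive (fun s => G (x + e + l - s) s) (fun s => Qf (F 0) F (x + e + l - s) s) e l.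
  rewrite Rmin_left ?Rmax_right; try lra.
  have cQs : cont (fun s => Qf (F 0) F (x + e + l - s) s) by cts.
  move=> /(_ d (fun s _ => cQs s)) /is_RInt_unique hI.
  have e1 : x + e + l - l = x + e by ring.
  have e2 : x + e + l - e = x + l by ring.
  rewrite e1 e2 in hI.
  rewrite /f hI -[minus _ _]/(sub (G (x + e) l) (G (x + l) e)) /G -!R1; try lra.
  by vec.
rewrite /f !Rplus_0_r in f0.
have -> : F x l = add (sub (F x l) (add (F (x + l) 0) (RInt (fun s => Qf (F 0) F (x + l - s) s) 0 l)))
   (add (F (x + l) 0) (RInt (fun s => Qf (F 0) F (x + l - s) s) 0 l)) by vec.
by rewrite f0; vec.
Qed.

End Star.

(** * Uniqueness of the A-function and the direct part *)

Lemma cexp_imag p x : cexp (2 * Ci * RtoC x * (Ci * RtoC (p / 2)))%C = RtoC (exp (- p * x)).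
Proof.
have -> : (2 * Ci * RtoC x * (Ci * RtoC (p / 2)))%C = RtoC (- p * x).
  by apply: injective_projections; rewrite /Ci /RtoC /Cmult /=; eqR; field.
by rewrite /cexp /RtoC /= cos_0 sin_0; congr pair; ring.
Qed.

Lemma Cmod_ge_Re (z : C) : Rabs (Re z) <= Cmod z.
Proof. by apply: Rle_trans (Rmax_Cmod z); exact: Rmax_l. Qed.
Lemma Cmod_ge_Im (z : C) : Rabs (Im z) <= Cmod z.
Proof. by apply: Rle_trans (Rmax_Cmod z); exact: Rmax_r. Qed.

(** Only the points z = i p / 2 on the imaginary axis are used: there the kernel is the real
    exponential exp(-p x), and real and imaginary parts fall under [lerch] separately. *)
Lemma laplace_unique (f g : R -> C) : cont_half f -> cont_half g ->
  (forall z, 0 < Im z -> exists I, is_CRInt_pinfty (fun x => cexp (2 * Ci * RtoC x * z) * f x)%C 0 I /\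
     is_CRInt_pinfty (fun x => cexp (2 * Ci * RtoC x * z) * g x)%C 0 I) ->
  forall x, 0 <= x -> f x = g x.
Proof.
move=> /cont_half_clamp [f1 f2] /cont_half_clamp [g1 g2] hfg.
pose P (k : R -> C) p X : C := (RInt (fun x => exp (- p * x) * Re (k (Rmax 0 x))) 0 X, RInt (fun x => exp (- p * x) * Im (k (Rmax 0 x))) 0 X).
have key p : 0 < p -> exists I, forall eps, 0 < eps -> exists X0, forall X, X0 <= X -> 0 <= X ->
    Cmod (P f p X - I)%C < eps /\ Cmod (P g p X - I)%C < eps.
  move=> hp; pose z := (Ci * RtoC (p / 2))%C.
  have hz : 0 < Im z by rewrite /z /Ci /RtoC /Im /=; lra.
  have [I [hI hJ]] := hfg z hz.
  exists I => eps he.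
  have [X0 h0] := is_CRInt_pinfty_lim _ _ hI eps he; have [X1 h1] := is_CRInt_pinfty_lim _ _ hJ eps he.
  have eqI (k : R -> C) X : 0 <= X -> cont (fun x => Re (k (Rmax 0 x))) -> cont (fun x => Im (k (Rmax 0 x))) ->
      CRInt (fun x => cexp (2 * Ci * RtoC x * z) * k x)%C 0 X = P k p X.
    move=> hX k1 k2.
    rewrite (CRInt_ext _ (fun x => (exp (- p * x) * Re (k (Rmax 0 x)), exp (- p * x) * Im (k (Rmax 0 x))) : C)); last first.
      move=> x; rewrite Rmin_left // Rmax_right // => hx; rewrite cexp_imag (Rmax_right 0 x); last lra.
      by case: (k x) => u w; apply: injective_projections; rewrite /RtoC /Cmult /=; eqR; ring.
    by rewrite CRInt_pair //; split => /=; cts.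
  exists (Rmax X0 X1) => X hX hX0.
  have m0 := Rmax_l X0 X1; have m1 := Rmax_r X0 X1.
  by rewrite -!eqI //; split; [apply: h0; lra | apply: h1; lra].
have van (h1 h2 : R -> R) : cont h1 -> cont h2 ->
    (forall p, 0 < p -> exists I, forall eps, 0 < eps -> exists X0, forall X, X0 <= X -> 0 <= X ->
      Rabs (RInt (fun x => exp (- p * x) * h1 x) 0 X - I) < eps /\ Rabs (RInt (fun x => exp (- p * x) * h2 x) 0 X - I) < eps) ->
    forall x, 0 <= x -> h1 x = h2 x.
  move=> c1 c2 hv x hx.
  suff : h1 x - h2 x = 0 by lra.
  apply: (lerch (fun x => h1 x - h2 x)) => //; first by cts.
  move=> p hp eps he; have [I hI] := hv p hp.
  have [X0 h0] := hI (eps / 2) ltac:(lra).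
  exists (Rmax 0 X0) => X hX; have m0 := Rmax_l 0 X0; have m1 := Rmax_r 0 X0.
  have [q1 q2] := h0 X ltac:(lra) ltac:(lra).
  have -> : RInt (fun x => exp (- p * x) * (h1 x - h2 x)) 0 X =
    RInt (fun x => exp (- p * x) * h1 x) 0 X - RInt (fun x => exp (- p * x) * h2 x) 0 X.
    by rewrite -RInt_Rminus; [apply: RInt_ext => t _; eqR; ring | cts | cts].
  move/Rabs_def2: q1 => q1; move/Rabs_def2: q2 => q2; apply: Rabs_def1; lra.
move=> x hx.
have e1 : Re (f (Rmax 0 x)) = Re (g (Rmax 0 x)).
  apply: (van (fun x => Re (f (Rmax 0 x))) (fun x => Re (g (Rmax 0 x)))) => // p hp.
  have [I hI] := key p hp; exists (Re I) => eps he; have [X0 h0] := hI eps he; exists X0 => X hX hX0.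
  have [q1 q2] := h0 X hX hX0.
  by split; [exact: Rle_lt_trans (Cmod_ge_Re (P f p X - I)%C) q1 | exact: Rle_lt_trans (Cmod_ge_Re (P g p X - I)%C) q2].
have e2 : Im (f (Rmax 0 x)) = Im (g (Rmax 0 x)).
  apply: (van (fun x => Im (f (Rmax 0 x))) (fun x => Im (g (Rmax 0 x)))) => // p hp.
  have [I hI] := key p hp; exists (Im I) => eps he; have [X0 h0] := hI eps he; exists X0 => X hX hX0.
  have [q1 q2] := h0 X hX hX0.
  by split; [exact: Rle_lt_trans (Cmod_ge_Im (P f p X - I)%C) q1 | exact: Rle_lt_trans (Cmod_ge_Im (P g p X - I)%C) q2].
rewrite Rmax_right // in e1 e2.
by apply: injective_projections.
Qed.

Lemma half_deriv_unique (f f1 f2 : R -> C) (g : R -> C) : has_C1_deriv_half f f1 -> has_C1_deriv_half g f2 ->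
  (forall x, 0 <= x -> f x = g x) -> forall x, 0 <= x -> f1 x = f2 x.
Proof.
move=> [/cont_half_clamp [a1 a2] hf] [/cont_half_clamp [b1 b2] hg] e x hx.
have z0 : 0 <= 0 by lra.
have eI y : 0 <= y -> (RInt (fun t => Re (f1 (Rmax 0 t))) 0 y, RInt (fun t => Im (f1 (Rmax 0 t))) 0 y) =
    (RInt (fun t => Re (f2 (Rmax 0 t))) 0 y, RInt (fun t => Im (f2 (Rmax 0 t))) 0 y) :> C.
  move=> hy.
  have cl (k : R -> C) : CRInt k 0 y = CRInt (fun t => k (Rmax 0 t)) 0 y.
    by apply: CRInt_ext => t; rewrite Rmin_left // Rmax_right // => ht; rewrite Rmax_right //; lra.
  rewrite -(CRInt_pair (fun t => f1 (Rmax 0 t))) // -(CRInt_pair (fun t => f2 (Rmax 0 t))) // -!cl.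
  have := e y hy; rewrite (hf y hy) (hg y hy) (e 0 z0) => h.
  have -> : CRInt f1 0 y = ((g 0 + CRInt f1 0 y) - g 0)%C by ring.
  by rewrite h; ring.
have zr (h1 h2 : R -> R) : cont h1 -> cont h2 -> (forall y, 0 <= y -> RInt h1 0 y = RInt h2 0 y) -> h1 x = h2 x.
  move=> c1 c2 h; suff : h1 x - h2 x = 0 by lra.
  apply: (zero_of_RInt (fun x => h1 x - h2 x)) => //; first by cts.
  by move=> y hy; rewrite RInt_Rminus // h //; eqR; ring.
have := zr _ _ a1 b1 (fun y hy => f_equal fst (eI y hy)).
have := zr _ _ a2 b2 (fun y hy => f_equal snd (eI y hy)).
by rewrite Rmax_right // => q1 q2; apply: injective_projections.
Qed.

Section Direct.
Variables m1 m2 : nat.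
Notation N := (m1 + m2)%nat.
Notation M := (mx_alg N).

(** The Weyl functions coincide, hence so do the Laplace integrals after division by 2 i z, hence
    the functions Phi and finally their derivatives. The flow supplies the extended potential
    [a]. *)
Lemma A_function_unique (v : R -> Mat) (a : R -> M) (F B : R -> R -> M) : flow a F B -> (forall x l, supp m1 m2 (F x l)) ->
  (forall x i j, 0 <= x -> (i < m2)%nat -> (j < m1)%nat -> blk m1 m2 (a x) i j = (- Ci * Cconj (v x j i))%C) ->
  forall A A' : R -> R -> Mat, is_A_function m1 m2 v A -> is_A_function m1 m2 v A' ->
  forall x l, 0 <= x -> 0 <= l -> forall i j, (i < m2)%nat -> (j < m1)%nat -> A x l i j = A' x l i j.
Proof.
move=> fl sF av A A' hA hA' x l hx hl i j hi hj.
have [Ph [ph [w [d L]]]] := hA l hl; have [Ph' [ph' [w' [d' L']]]] := hA' l hl.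
have [D _] := d i j hi hj; have [D' _] := d' i j hi hj.
have wu := weyl_unique m1 m2 v a F B fl sF av l ph ph' hl w w'.
have hc (f f' : R -> C) : has_C1_deriv_half f f' -> cont_half f.
  move=> [/cont_half_clamp [c1 c2] h].
  have cI (k : R -> R) : cont k -> cont (fun y => RInt k 0 y) by move=> ck; cts.
  pose g y := (f 0 + (RInt (fun t => Re (f' (Rmax 0 t))) 0 y, RInt (fun t => Im (f' (Rmax 0 t))) 0 y))%C.
  apply: (cont_half_of _ g).
    split; rewrite /g.
      apply: (cont_ext (fun y => Re (f 0) + RInt (fun t => Re (f' (Rmax 0 t))) 0 y)) => //.
      by apply: cont_Rplus; [exact: cont_const | exact: cI c1].
    apply: (cont_ext (fun y => Im (f 0) + RInt (fun t => Im (f' (Rmax 0 t))) 0 y)) => //.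
    by apply: cont_Rplus; [exact: cont_const | exact: cI c2].
  move=> y hy; rewrite /g h //; congr (_ + _)%C.
  rewrite -(CRInt_pair (fun t => f' (Rmax 0 t))) //.
  by apply: CRInt_ext => t; rewrite Rmin_left // Rmax_right // => ht; rewrite Rmax_right //; lra.
apply: (half_deriv_unique (fun x => Ph x i j) (fun x => A x l i j) (fun x => A' x l i j) (fun x => Ph' x i j)) => //.
have dn (f f' : R -> C) : has_C1_deriv_half f f' -> C1_half f by exists f'.
apply: laplace_unique; [exact: hc D | exact: hc D' |] => z hz.
have [I [hI eI]] := L z hz i j hi hj; have [J [hJ eJ]] := L' z hz i j hi hj.
exists I; split => //; have -> : I = J; last by [].
have z0 : (2 * Ci * z)%C <> 0%C.
  move=> h; have := f_equal Re h; move: hz; case: (z) => p q /=; lra.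
have e : (2 * Ci * z * I)%C = (2 * Ci * z * J)%C by rewrite -eI -eJ; exact: wu.
move: (2 * Ci * z)%C z0 e => c z0 e.
have -> : I = (c * I / c)%C by field.
by rewrite e; field.
Qed.

Theorem direct_part (v : R -> Mat) : C1_half_mat m1 m2 v ->
  forall A, is_A_function m1 m2 v A -> solves_star m1 m2 A.
Proof.
move=> hv A hA.
have hF : C1_half_mat m2 m1 (fun x i j => - Ci * Cconj (v x j i))%C.
  by move=> i j hi hj; apply: C1_nconj; exact: hv.
have [a [a' [ca [ca' [da [sa ha]]]]]] := C1_lift m1 m2 _ hF.
have [A1 [B1 fl1]] := goursat a a' ca ca' da.
have [F [B [fl sF]]] := flow_compress (Pi1 m1 m2) a A1 B1 fl1 (Pi1_Pi1 m1 m2) (adj_Pi1 m1 m2) (fun x => proj1 (sa x)) (fun x => proj2 (sa x)).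
have av x i j : 0 <= x -> (i < m2)%nat -> (j < m1)%nat -> blk m1 m2 (a x) i j = (- Ci * Cconj (v x j i))%C.
  by move=> hx hi hj; rewrite ha // ent_low.
have hA1 := A_function_of_flow m1 m2 v a F B fl sF av.
apply: (solves_star_of_flow m1 m2 a F B A fl sF).
exact: (A_function_unique v a F B fl sF av A _ hA hA1).
Qed.

End Direct.

(** * The operators S_T *)

Lemma cont_Rmin {U : UniformSpace} (f g : U -> R) : cont f -> cont g -> cont (fun u => Rmin (f u) (g u)).
Proof.
move=> cf cg.
apply: (cont_ext (fun u => f u - Rmax 0 (f u - g u))); last by cts.
by move=> u; rewrite /Rmin /Rmax; repeat case: Rle_dec => ?; lra.
Qed.

Lemma RInt_Rrev (f : R -> R) T : cont f -> RInt (fun t => f (T - t)) 0 T = RInt f 0 T.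
Proof.
move=> cf.
have e : RInt (fun y => scal (-1) (f (-1 * y + T))) 0 T = RInt f (-1 * 0 + T) (-1 * T + T).
  by apply: (RInt_comp_lin f (-1) T 0 T); exact: exR.
have e1 : -1 * 0 + T = T by ring.
have e2 : -1 * T + T = 0 by ring.
rewrite e1 e2 in e.
have e3 : RInt (fun y => scal (-1) (f (-1 * y + T))) 0 T = -1 * RInt (fun t => f (T - t)) 0 T.
  rewrite -RInt_Rmult; last by cts.
  by apply: RInt_ext => t _; rewrite /scal /= /mult /=; congr (_ * f _); ring.
rewrite e3 in e.
have := RInt_Rcat f 0 T 0 cf; rewrite -e.
have -> : RInt f 0 0 = 0 by exact: (RInt_point (V := R_CompleteNormedModule)).
lra.
Qed.

Section Gram.
Context {M : star_alg}.
Variables (c G : R -> M) (T : R).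
Hypothesis cc : cont c.
Hypothesis cG : cont G.
Hypothesis hT : 0 <= T.

(** The kernel of K K^*, with K the convolution with c on L^2(0, T). *)
Definition gram (x t : R) : M := RInt (fun xi => mul (c (x - xi)) (adj (c (t - xi)))) 0 (Rmin x t).

Lemma cont_gram x : cont (gram x).
Proof.
rewrite /gram; apply: (cont_RInt (fun t xi => mul (c (x - xi)) (adj (c (t - xi)))) (fun _ => 0) (Rmin x)); cbv beta; try by cts.
by apply: cont_Rmin; cts.
Qed.

(** The operator K^* applied to [G]. *)
Definition corr (xi : R) : M := RInt (fun t => mul (adj (c (t - xi))) (G t)) xi T.

Lemma cont_corr : cont corr.
Proof. by rewrite /corr; cts. Qed.

Lemma gram_int x : 0 <= x <= T ->
  RInt (fun t => mul (gram x t) (G t)) 0 T = RInt (fun xi => mul (c (x - xi)) (corr xi)) 0 x.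
Proof.
move=> hx; have cg := cont_gram x.
pose H xi t := mul (c (x - xi)) (mul (adj (c (t - xi))) (G t)).
have cH : c2 H by rewrite /H; cts.
have cH' : c2 (fun t xi => H xi t) by rewrite /H; cts.
rewrite -(RInt_cat _ 0 x T); last by cts.
have -> : RInt (fun t => mul (gram x t) (G t)) 0 x = RInt (fun xi => RInt (H xi) xi x) 0 x.
  rewrite -(Fubini_tri (fun t xi => H xi t)) //; apply: RInt_ext => t; rewrite Rmin_left ?Rmax_right; try lra; move=> ht.
  rewrite /gram Rmin_right; last lra.
  by rewrite -RInt_cmul; [apply: RInt_ext => s _; exact: mulA | cts].
have -> : RInt (fun t => mul (gram x t) (G t)) x T = RInt (fun xi => RInt (H xi) x T) 0 x.
  rewrite -(Fubini_rect (fun t xi => H xi t) x T 0 x) //; apply: RInt_ext => t; rewrite Rmin_left ?Rmax_right; try lra; move=> ht.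
  rewrite /gram Rmin_left; last lra.
  by rewrite -RInt_cmul; [apply: RInt_ext => s _; exact: mulA | cts].
rewrite -RInt_add; try by cts.
apply: RInt_ext => xi _; rewrite RInt_cat; last by cts.
by rewrite /corr -RInt_mulc; last cts.
Qed.

(* S_T = I - K K^* with K the convolution with c; after time reversal K^* is the convolution with c^*. *)
Lemma gram_form : RInt (fun x => inner (G x) (RInt (fun t => mul (gram x t) (G t)) 0 T)) 0 T =
  RInt (fun xi => nm (cv (fun t => adj (c t)) (fun t => G (T - t)) xi) ^ 2) 0 T.
Proof.
have ck := cont_corr.
pose F x xi := inner (G x) (mul (c (x - xi)) (corr xi)).
have cF : c2 F by rewrite /F; cts.
have -> : RInt (fun x => inner (G x) (RInt (fun t => mul (gram x t) (G t)) 0 T)) 0 T = RInt (fun x => RInt (F x) 0 x) 0 T.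
  apply: RInt_ext => x; rewrite Rmin_left ?Rmax_right; try lra; move=> hx.
  by rewrite gram_int -?RInt_inner //; [cts | lra].
rewrite (Fubini_tri (V := R_CompleteNormedModule) F) //.
rewrite -(RInt_Rrev (fun xi => RInt (fun x => F x xi) xi T)); last by cts.
apply: RInt_ext => xi; rewrite Rmin_left ?Rmax_right; try lra; move=> hxi.
have e : corr (T - xi) = cv (fun t => adj (c t)) (fun t => G (T - t)) xi.
  pose f t := mul (adj (c (t - (T - xi)))) (G t).
  have cf : cont f by rewrite /f; cts.
  rewrite /corr -(RInt_sum_minus f T xi cf) /cv; apply: RInt_ext => t _; rewrite /f.
  by congr (mul (adj (c _)) _); ring.
rewrite -e -inner_nm /corr -RInt_inner; last by cts.
by apply: RInt_ext => x _; rewrite /F -/(corr (T - xi)) inner_sym inner_mul.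
Qed.

End Gram.

Section FromS.
Variables m1 m2 : nat.
Notation N := (m1 + m2)%nat.
Notation M := (mx_alg N).
Notation Pi := (Pi1 m1 m2).

Lemma inner_one (Z : M) : inner one Z = rsum N (fun q => Re (ent N Z q q)).
Proof.
rewrite -[inner one Z]/(Re (mxcinner N (one : M) Z)) /mxcinner Re_csum; apply: rsum_ext => i hi; congr Re.
rewrite (csum_ext _ _ (fun j => if Nat.eqb i j then ent N Z i j else 0%C)); first exact: (csum_delta N i (fun j => ent N Z i j) hi).
move=> j hj; rewrite ent_one // /idm; case: Nat.eqb.
  have -> : Cconj 1%C = 1%C by rewrite /Cconj /= Ropp_0.
  ring.
have -> : Cconj 0%C = 0%C by rewrite /Cconj /= Ropp_0.
ring.
Qed.

Lemma rsum_Re_ineq n (f g : nat -> C) eps : (forall q, (q < n)%nat -> Re (f q) >= eps * Re (g q)) ->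
  eps * rsum n (fun q => Re (g q)) <= rsum n (fun q => Re (f q)).
Proof. by move=> h; rewrite -rsum_mul_l; apply: rsum_le => q hq; apply: Rge_le; exact: h. Qed.

(** The form inequality is applied to each column of a matrix function and summed by a trace, which
    turns it into an inequality for Frobenius norms; [gram_form] then rewrites the quadratic form of
    K K^* as the squared norm of a convolution. *)
Lemma S_contracts (A0 : R -> Mat) (c : R -> M) : cont c -> (forall x, supp m1 m2 (c x)) ->
  (forall x i j, 0 <= x -> (i < m2)%nat -> (j < m1)%nat -> blk m1 m2 (c x) i j = A0 x i j) ->
  S_strictly_pos m1 m2 A0 ->
  forall L, 0 < L -> exists eps, 0 < eps <= 1 /\ contracts (fun t => adj (c t)) eps L.
Proof.
move=> cc sc hc hS T hT; have [eps0 [he0 H]] := hS T hT.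
pose eps := Rmin eps0 1.
have ea : eps <= eps0 by exact: Rmin_l.
have eb : eps <= 1 by exact: Rmin_r.
have ep : 0 < eps by apply: Rmin_pos; lra.
exists eps; split => // g cg.
(* Time reversal is what turns K^* into a causal convolution. Only the lower rows are kept, since
   the test vectors have m2 components; the adjoint of c annihilates the upper rows anyway. *)
pose G x := lowpart Pi (g (T - x)).
have cG : cont G by rewrite /G /lowpart; cts.
have upG x r q : (r < m1)%nat -> (q < N)%nat -> ent N (G x) r q = 0%C.
  move=> hr hq; have hr' : (r < N)%nat by lia.
  by rewrite /G /lowpart ent_sub // ent_Pi_mul // if_ltb //; ring.
pose SG x := sub (G x) (RInt (fun t => mul (gram c x t) (G t)) 0 T).
have cSG : cont SG.
  rewrite /SG; apply: cont_sub => //.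
  apply: (cont_RInt (fun x t => mul (gram c x t) (G t)) (fun _ => 0) (fun _ => T)); try by cts.
  apply: cont_mul; last by cts.
  rewrite /gram; apply: (cont_RInt (fun (p : R * R) xi => mul (c (fst p - xi)) (adj (c (snd p - xi)))) (fun _ => 0) (fun p => Rmin (fst p) (snd p))); try by cts.
  by apply: (cont_Rmin (fun p : R * R => fst p) (fun p => snd p)); cts.
pose f q : R -> nat -> C := fun x k => ent N (G x) (m1 + k)%nat q.
have eK x t i k : 0 <= x -> 0 <= t -> (i < m2)%nat -> (k < m2)%nat ->
    s_kernel m1 A0 x t i k = ent N (gram c x t) (m1 + i)%nat (m1 + k)%nat.
  move=> hx ht hi hk; rewrite /gram ent_RInt; [|cts|lia|lia].
  have hm := Rmin_glb x t 0 hx ht.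
  apply: CRInt_ext => xi; rewrite Rmin_left // Rmax_right // => hxi.
  have q1 := Rmin_l x t; have q2 := Rmin_r x t.
  rewrite ent_mul; [|lia|lia].
  rewrite /mmul csum_split [X in (_ + X)%C](csum_ext m2 _ (fun _ => 0%C)); last first.
    by move=> r hr; rewrite (supp_right m1 m2 _ _ _ (sc (x - xi))); [ring | lia | lia].
  rewrite csum_0 Cplus_0_r; apply: csum_ext => r hr; rewrite ent_adj; [|lia|lia].
  rewrite -[ent N (c (x - xi)) _ _]/(blk m1 m2 (c (x - xi)) i r) -[ent N (c (t - xi)) _ _]/(blk m1 m2 (c (t - xi)) k r) /madj !hc //; lra.
have eS x i q : 0 <= x <= T -> (i < m2)%nat -> (q < N)%nat -> S_op m1 m2 A0 T (f q) x i = ent N (SG x) (m1 + i)%nat q.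
  move=> hx hi hq; have cgr := cont_gram c cc x.
  rewrite /SG ent_sub; [|lia|lia]. rewrite ent_RInt; [|cts|lia|lia].
  rewrite /S_op; congr (_ - _)%C; apply: CRInt_ext => t; rewrite Rmin_left ?Rmax_right; try lra; move=> ht.
  rewrite ent_mul; [|lia|lia].
  rewrite /mmul csum_split (csum_ext m1 _ (fun _ => 0%C)); last first.
    by move=> r hr; rewrite upG //; ring.
  rewrite csum_0 Cplus_0_l; apply: csum_ext => k hk; rewrite eK //; lra.
have eI (Y : R -> M) (y : R -> nat -> C) q : cont Y -> (q < N)%nat ->
    (forall x k, 0 <= x <= T -> (k < m2)%nat -> y x k = ent N (Y x) (m1 + k)%nat q) ->
    Defs.inner m2 T y (f q) = ent N (RInt (fun x => mul (adj (G x)) (Y x)) 0 T) q q.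
  move=> cY hq hy; rewrite ent_RInt; [|cts|lia|lia].
  apply: CRInt_ext => x; rewrite Rmin_left ?Rmax_right; try lra; move=> hx.
  rewrite ent_mul // /mmul csum_split (csum_ext m1 _ (fun _ => 0%C)); last first.
    move=> r hr; rewrite ent_adj ?upG //; try lia.
    have -> : Cconj 0%C = 0%C by rewrite /Cconj /= Ropp_0.
    ring.
  rewrite csum_0 Cplus_0_l; apply: csum_ext => k hk; rewrite ent_adj; [|lia|lia].
  rewrite hy //; [by rewrite /f; ring | lra].
have tr (Y : R -> M) : cont Y -> inner one (RInt (fun x => mul (adj (G x)) (Y x)) 0 T) = RInt (fun x => inner (G x) (Y x)) 0 T.
  move=> cY; rewrite -RInt_inner; last by cts.
  by apply: RInt_ext => x _; rewrite -inner_mul mul1r.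
have ineq : eps0 * RInt (fun x => inner (G x) (G x)) 0 T <= RInt (fun x => inner (G x) (SG x)) 0 T.
  rewrite -!tr // !inner_one; apply: rsum_Re_ineq => q hq.
  rewrite -(eI SG (S_op m1 m2 A0 T (f q)) q) //; last by move=> x k hx hk; exact: eS.
  rewrite -(eI G (f q) q) //.
  apply: H => k hk x hx; have [c1 c2'] := contC_ent N G (m1 + k)%nat q cG ltac:(lia) hq.
  by split; apply/continuity_pt_filterlim; [exact: c1 | exact: c2'].
have hG := gram_form c G T cc cG ltac:(lra).
have e1 : RInt (fun x => inner (G x) (SG x)) 0 T = RInt (fun x => nm (G x) ^ 2) 0 T -
  RInt (fun x => inner (G x) (RInt (fun t => mul (gram c x t) (G t)) 0 T)) 0 T.
  have cR : cont (fun x => RInt (fun t => mul (gram c x t) (G t)) 0 T).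
    apply: (cont_ext (fun x => sub (G x) (SG x))) => [u|]; [by rewrite /SG; vec | cts].
  rewrite -RInt_Rminus; [|by cts|exact: (cont_inner _ _ cG cR)].
  by apply: RInt_ext => x _; rewrite /SG inner_sub inner_nm.
have e2 : RInt (fun x => inner (G x) (G x)) 0 T = RInt (fun x => nm (G x) ^ 2) 0 T.
  by apply: RInt_ext => x _; exact: inner_nm.
have e3 : RInt (fun xi => nm (cv (fun t => adj (c t)) (fun t => G (T - t)) xi) ^ 2) 0 T = RInt (fun t => nm (cv (fun t => adj (c t)) g t) ^ 2) 0 T.
  apply: RInt_ext => xi _; congr (nm _ ^ 2); rewrite /cv; apply: RInt_ext => t _.
  rewrite /G; have -> : T - (T - t) = t by ring.
  rewrite /lowpart mul_sub_r -(mulA _ (adj (c (xi - t))) Pi) -{1}(adj_Pi1 m1 m2) -adj_mul (proj2 (sc (xi - t))) adj_nul mul_nul_l; by vec.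
have e4 : RInt (fun x => nm (G x) ^ 2) 0 T <= RInt (fun t => nm (g t) ^ 2) 0 T.
  rewrite -(RInt_Rrev (fun t => nm (g t) ^ 2)); last by cts.
  apply: RInt_Rle; [lra | by cts | by cts |] => x _.
  have := pyth Pi (Pi1_Pi1 m1 m2) (adj_Pi1 m1 m2) (g (T - x)); have := pow2_ge_0 (nm (uppart Pi (g (T - x)))); rewrite /G; lra.
have G0 : 0 <= RInt (fun x => nm (G x) ^ 2) 0 T.
  by apply: RInt_Rge0; [lra | cts | move=> x _; exact: pow2_ge_0].
rewrite -e3 -hG.
have : eps * RInt (fun x => nm (G x) ^ 2) 0 T <= eps0 * RInt (fun x => nm (G x) ^ 2) 0 T by apply: Rmult_le_compat_r.
have : (1 - eps) * RInt (fun x => nm (G x) ^ 2) 0 T <= (1 - eps) * RInt (fun t => nm (g t) ^ 2) 0 T by apply: Rmult_le_compat_l; lra.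
rewrite e1 e2 in ineq; lra.
Qed.

End FromS.

(** * The inverse part *)

Section Symmetries.
Context {M : star_alg}.

(** Adjoints reverse the triple product, and substituting x - t for t in the convolution restores
    the order. *)
Lemma flow_adj (a : R -> M) A B : flow a A B ->
  flow (fun l => adj (a l)) (fun x l => adj (A x l)) (fun x l => adj (B x l)).
Proof.
move=> [ca cA cB A0 Ax Al]; split; try by cts.
- by move=> l; rewrite A0.
- by move=> x l; apply: D_adj.
move=> x l.
have -> : Qf (fun l => adj (a l)) (fun x l => adj (A x l)) x l = adj (Qf a A x l).
  rewrite /Qf cv_flip; [|by cts|by cts].
  rewrite /cv -RInt_adj; last by cts.
  by apply: RInt_ext => t _; rewrite !adj_mul !adjK mulA.
by rewrite -adj_add; apply: D_adj.
Qed.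

Lemma flow_unitary (U V : M) (a : R -> M) A B : mul (adj U) U = one -> mul V (adj V) = one -> flow a A B ->
  flow (fun l => mul U (mul (a l) V)) (fun x l => mul U (mul (A x l) V)) (fun x l => mul U (mul (B x l) V)).
Proof.
move=> hU hV [ca cA cB A0 Ax Al]; split; try by cts.
- by move=> l; rewrite A0.
- by move=> x l; apply: D_mulc; apply: D_cmul.
move=> x l.
have -> : Qf (fun l => mul U (mul (a l) V)) (fun x l => mul U (mul (A x l) V)) x l = mul U (mul (Qf a A x l) V).
  rewrite /Qf /cv -RInt_cmul; last by cts.
  rewrite -RInt_mulc; last by cts.
  apply: RInt_ext => t _; rewrite !adj_mul !mulA; congr (mul U (mul _ _)).
  by rewrite -(mulA _ V (adj V)) hV mul1l -(mulA _ (adj U) U) hU mul1l.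
have -> : add (mul U (mul (B x l) V)) (mul U (mul (Qf a A x l) V)) = mul U (mul (add (B x l) (Qf a A x l)) V) by dist.
by apply: D_mulc; apply: D_cmul.
Qed.

(** The transformed function solves the same equation from the same initial values, so uniqueness
    carries the symmetry over to the boundary values. *)
Lemma unitary_invariant (U V : M) (a : R -> M) A B : mul (adj U) U = one -> mul V (adj V) = one -> flow a A B ->
  (forall x, 0 <= x -> mul U (mul (A x 0) V) = A x 0) -> forall l, 0 <= l -> mul U (mul (a l) V) = a l.
Proof.
move=> hU hV fl h l hl; have fl' := flow_unitary U V a A B hU hV fl.
rewrite -(fl_0 _ _ _ fl).
apply: (mild_unique (fun x => mul U (mul (A x 0) V)) (fun x => A x 0) (fun x l => mul U (mul (A x l) V)) A l) => //.
- exact: fl_A fl'.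
- exact: fl_A fl.
- by move=> x [hx _]; exact: h.
- by move=> x l' _ _ _; exact: (flow_mild _ _ _ _ _ fl').
- by move=> x l' _ _ _; exact: (flow_mild _ _ _ _ _ fl).
- lra.
- lra.
Qed.

(* A, A (2 Pi - 1) and (1 - 2 Pi) A solve equations of the same form with the same initial values. *)
Lemma flow_support (Pi : M) (a : R -> M) A B : mul Pi Pi = Pi -> adj Pi = Pi -> flow a A B ->
  (forall x, 0 <= x -> mul (A x 0) Pi = A x 0 /\ mul Pi (A x 0) = nul) ->
  forall l, 0 <= l -> mul (a l) Pi = a l /\ mul Pi (a l) = nul.
Proof.
move=> PP Pa fl h l hl.
pose J := sub (rs 2 Pi) one.
have Ja : adj J = J by rewrite /J adj_sub adj_rs Pa -{1}(mul1l _ (adj one)) -{1}(adjK _ one) -adj_mul mul1l adjK.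
have JJ : mul J J = one.
  by rewrite /J; dist; rewrite PP mul1l mul1r mul1l; vec.
have a1 : adj (one : M) = one.
  by rewrite -{1}(mul1l _ (adj one)) -{1}(adjK _ one) -adj_mul mul1l adjK.
have nJ : mul (adj (neg J)) (neg J) = one.
  have -> : neg J = rs (-1) J by exact: neg_rs.
  by rewrite adj_rs Ja mul_rs_l mul_rs_r JJ; vec.
have one1 : mul (one : M) (adj one) = one by rewrite a1 mul1l.
have one2 : mul (adj (one : M)) one = one by rewrite a1 mul1l.
have e1 : mul one (mul (a l) J) = a l.
  apply: (unitary_invariant one J a A B) => //; first by rewrite Ja.
  by move=> x hx; have [h1 h2] := h x hx; rewrite mul1l /J; dist; rewrite h1 mul1r; vec.
have e2 : mul (neg J) (mul (a l) one) = a l.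
  apply: (unitary_invariant (neg J) one a A B) => //.
  by move=> x hx; have [h1 h2] := h x hx; rewrite mul1r /J; dist; rewrite h2 mul1l; vec.
rewrite mul1l /J mul_sub_r mul_rs_r mul1r in e1.
rewrite mul1r /J mul_neg_l mul_sub_l mul_rs_l mul1l in e2.
split.
  have -> : mul (a l) Pi = rs (/ 2) (add (sub (rs 2 (mul (a l) Pi)) (a l)) (a l)) by vec.
  by rewrite e1; vec.
have -> : mul Pi (a l) = rs (/ 2) (sub (a l) (neg (sub (rs 2 (mul Pi (a l))) (a l)))) by vec.
by rewrite e2; vec.
Qed.

End Symmetries.

Section InversePart.
Variables m1 m2 : nat.
Notation N := (m1 + m2)%nat.
Notation M := (mx_alg N).
Notation Pi := (Pi1 m1 m2).

Lemma inverse_flow (A0 : R -> Mat) : C1_half_mat m2 m1 A0 -> S_strictly_pos m1 m2 A0 ->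
  exists (a a' : R -> M) (F B : R -> R -> M), cont a' /\ (forall x, is_derive a x (a' x)) /\ flow a F B /\
    (forall x l, supp m1 m2 (F x l)) /\ forall x, 0 <= x -> F x 0 = low m1 m2 (A0 x).
Proof.
move=> h0 hS.
have [c [c' [cc [cc' [dc [sc hc]]]]]] := C1_lift m1 m2 A0 h0.
have bc x i j : 0 <= x -> (i < m2)%nat -> (j < m1)%nat -> blk m1 m2 (c x) i j = A0 x i j.
  by move=> hx hi hj; rewrite hc // ent_low.
have con := S_contracts m1 m2 A0 c cc sc bc hS.
(* The strict contraction is available for the adjoint of c, so the potential is reconstructed from
   adjoint initial data and transferred back by [flow_adj]. *)
have [a1 [a1' [ca1 [ca1' [da1 P1]]]]] := inverse_global (fun x => adj (c x)) (fun x => adj (c' x))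
  ltac:(cts) ltac:(cts) (fun x => D_adj c x (c' x) (dc x)) con.
have [A1 [B1 fl1]] := goursat a1 a1' ca1 ca1' da1.
have i1 := P1 a1 A1 B1 fl1 (fun s _ => erefl _).
have fl2 := flow_adj _ _ _ fl1.
have sup2 : forall l, 0 <= l -> mul (adj (a1 l)) Pi = adj (a1 l) /\ mul Pi (adj (a1 l)) = nul.
  apply: (flow_support Pi (fun l => adj (a1 l)) _ _ (Pi1_Pi1 m1 m2) (adj_Pi1 m1 m2) fl2) => x hx.
  by rewrite i1 // adjK; exact: sc.
(* The block structure of the adjoint of [a1] is known for l >= 0 only. Compression enforces it for
   all l, as [flow_compress] requires, and changes nothing for l >= 0. *)
pose cp y : M := mul (sub one Pi) (mul y Pi).
pose a l := cp (adj (a1 l)).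
pose a' l := cp (adj (a1' l)).
have ca : cont a by rewrite /a /cp; cts.
have ca' : cont a' by rewrite /a' /cp; cts.
have da x : is_derive a x (a' x) by apply: D_mulc; apply: D_cmul; apply: D_adj.
have ea l : 0 <= l -> a l = adj (a1 l).
  by move=> hl; have [q1 q2] := sup2 l hl; rewrite /a /cp q1 mul_sub_l mul1l q2; vec.
have aP x : mul (a x) Pi = a x by rewrite /a /cp !mulA (Pi1_Pi1 m1 m2).
have Pa x : mul Pi (a x) = nul.
  rewrite /a /cp -mulA mul_sub_r (Pi1_Pi1 m1 m2) mul1r.
  have -> : sub Pi Pi = nul by vec.
  exact: mul_nul_l.
have [A2 [B2 fl3]] := goursat a a' ca ca' da.
have [F [B [fl sF]]] := flow_compress Pi a A2 B2 fl3 (Pi1_Pi1 m1 m2) (adj_Pi1 m1 m2) aP Pa.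
exists a, a', F, B; do 4 (split => //).
(* [P1] holds for every flow whose boundary values agree with [a1] for s >= 0, and the adjoint of
   the compressed flow is one of these. *)
move=> x hx; rewrite -hc // -[LHS](adjK _) -[RHS](adjK _); congr adj.
apply: (P1 _ _ _ (flow_adj _ _ _ fl)) => // s hs.
by rewrite ea // adjK.
Qed.

Lemma star_unique (a : R -> M) (F B : R -> R -> M) (A : R -> R -> Mat) : flow a F B ->
  solves_star m1 m2 A -> (forall x, 0 <= x -> F x 0 = low m1 m2 (A x 0)) ->
  forall x l, 0 <= x -> 0 <= l -> forall i j, (i < m2)%nat -> (j < m1)%nat -> A x l i j = blk m1 m2 (F x l) i j.
Proof.
move=> fl hA h x l hx hl i j hi hj.
have [cE mE] := mild_of_solves_star m1 m2 A (x + l) hA.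
have z0 : Rmax 0 0 = 0 by apply: Rmax_left; lra.
have e := mild_unique _ (fun x => F x 0) _ F (x + l) ltac:(lra) cE (fl_A _ _ _ fl) _ mE
  (fun x l _ _ _ => flow_mild _ _ _ x l fl) x l hx hl (Rle_refl _).
rewrite -e.
  by rewrite ent_low // !Rmax_right.
by move=> y [hy _]; rewrite z0 (Rmax_right 0 y hy) h.
Qed.

Lemma low_ext (f g : Mat) : (forall i j, (i < m2)%nat -> (j < m1)%nat -> f i j = g i j) -> low m1 m2 f = low m1 m2 g.
Proof.
move=> h; apply: supp_ext; try exact: supp_low.
by move=> i j hi hj; rewrite !ent_low //; exact: h.
Qed.

Theorem inverse_part (A0 : R -> Mat) : C1_half_mat m2 m1 A0 -> S_strictly_pos m1 m2 A0 ->
  exists A : R -> R -> Mat,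
    (solves_star m1 m2 A /\
     (forall x, 0 <= x -> forall i j, (i < m2)%nat -> (j < m1)%nat -> A x 0 i j = A0 x i j)) /\
    (forall A' : R -> R -> Mat, solves_star m1 m2 A' ->
       (forall x, 0 <= x -> forall i j, (i < m2)%nat -> (j < m1)%nat -> A' x 0 i j = A0 x i j) ->
       forall x l, 0 <= x -> 0 <= l ->
         forall i j, (i < m2)%nat -> (j < m1)%nat -> A' x l i j = A x l i j) /\
    (exists v : R -> Mat, C1_half_mat m1 m2 v /\ is_A_function m1 m2 v A /\
       forall l, 0 <= l -> forall i j, (i < m1)%nat -> (j < m2)%nat -> v l i j = (- Ci * Cconj (A 0%R l j i))%C).
Proof.
move=> h0 hS; have [a [a' [F [B [ca' [da [fl [sF F0]]]]]]]] := inverse_flow A0 h0 hS.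
exists (fun x l => blk m1 m2 (F x l)); split; last split.
- split; first by apply: (solves_star_of_flow m1 m2 a F B).
  by move=> x hx i j hi hj; rewrite F0 // ent_low.
- move=> A' hA' h'; apply: (star_unique a F B A' fl hA') => x hx.
  by rewrite F0 //; apply: low_ext => i j hi hj; rewrite h'.
exists (fun l i j => - Ci * Cconj (blk m1 m2 (F 0%R l) j i))%C; split; last split => //.
  move=> i j hi hj; apply: C1_nconj.
  have -> : (fun x => blk m1 m2 (F 0 x) j i) = (fun x => ent N (a x) (m1 + j)%nat i).
    by apply: functional_extensionality => x; rewrite (fl_0 _ _ _ fl).
  by exists (fun x => ent N (a' x) (m1 + j)%nat i); apply: (has_C1_ent m1 m2 a a') => //; lia.
apply: (A_function_of_flow m1 m2 _ a F B fl sF) => x i j hx hi hj.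
rewrite (fl_0 _ _ _ fl); case: (blk m1 m2 (a x) i j) => p q.
by apply: injective_projections; rewrite /Ci /Cconj /Cmult /Copp /=; eqR; ring.
Qed.

End InversePart.

Theorem theorem1p6 :
  forall m1 m2 : nat, (0 < m1)%nat -> (0 < m2)%nat ->
  (* direct part *)
  (forall v : R -> Mat,
     C1_half_mat m1 m2 v ->
     forall A : R -> R -> Mat,
       is_A_function m1 m2 v A ->
       solves_star m1 m2 A)
  /\
  (* inverse part *)
  (forall A0 : R -> Mat,
     C1_half_mat m2 m1 A0 ->
     S_strictly_pos m1 m2 A0 ->
     exists A : R -> R -> Mat,
       (solves_star m1 m2 A /\
        (forall x, 0 <= x -> forall i j, (i < m2)%nat -> (j < m1)%nat ->
           A x 0 i j = A0 x i j)) /\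
       (forall A' : R -> R -> Mat,
          solves_star m1 m2 A' ->
          (forall x, 0 <= x -> forall i j, (i < m2)%nat -> (j < m1)%nat ->
             A' x 0 i j = A0 x i j) ->
          forall x l, 0 <= x -> 0 <= l ->
            forall i j, (i < m2)%nat -> (j < m1)%nat -> A' x l i j = A x l i j) /\
       (exists v : R -> Mat,
          C1_half_mat m1 m2 v /\
          is_A_function m1 m2 v A /\
          forall l, 0 <= l -> forall i j, (i < m1)%nat -> (j < m2)%nat ->
            v l i j = (- Ci * Cconj (A 0 l j i))%C)).
Proof.
move=> m1 m2 _ _; split; [exact: direct_part | exact: inverse_part].
Qed.
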